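(* Let $\Gamma\le \mathrm{PSL}_2(\mathbb R)$ be a geometrically finite Fuchsian group having $\infty$ as cuspidal point, with $\Gamma\neq\Gamma_\infty$, satisfying condition (A): for each relevant isometric sphere of $\Gamma$, its summit is contained in $\partial\mathcal K$ but is not a vertex of $\mathcal K$. Let $Y=\Gamma\backslash\mathbb H$, let $\mathbb A$ be a basal family of precells, $\mathbb S$ a set of choices associated to $\mathbb A$ and $\mathbb T$ a shift map. Let $R$ be the first return map of $\widehat{\mathrm{CS}}_{\mathrm{st}}$, $\Lambda_{\mathrm{st}}$ the set of two-sided infinite geometric coding sequences, $\sigma$ the left shift, and $\mathrm{Cod}\colon\Lambda_{\mathrm{st}}\to\widehat{\mathrm{CS}}_{\mathrm{st}}$ the inverse of the bijection $\widehat{\mathrm{CS}}_{\mathrm{st}}\to\Lambda_{\mathrm{st}}$ assigning to each vector its geometric coding sequence. Then $R\circ\mathrm{Cod}=\mathrm{Cod}\circ\sigma$ on $\Lambda_{\mathrm{st}}$, and $(\Lambda_{\mathrm{st}},\sigma)$ is a symbolic dynamics for the geodesic flow on $Y$.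
   Context: **Setting.** $\mathbb H=\{z\in\mathbb C:\operatorname{Im}z>0\}$ is the hyperbolic plane with the Möbius action $g.z$ of $\mathrm{PSL}_2(\mathbb R)$; $\overline{\mathbb H}^g=\{\operatorname{Im}z\ge0\}\cup\{\infty\}$, $\partial_g\mathbb H=\mathbb R\cup\{\infty\}$. For $V\subseteq \mathbb H$, $\partial_gV$ is the intersection of the closure of $V$ in $\overline{\mathbb H}^g$ with $\partial_g\mathbb H$; other closures, boundaries and interiors are taken in $\mathbb H$. Geodesic segments with endpoints in $\partial_g\mathbb H$ are considered as subsets of $\mathbb H$; they are complete if both endpoints are in $\partial_g\mathbb H$. For a Fuchsian group $\Gamma$, a fundamental region is an open $F\subseteq\mathbb H$ whose translates $g.F$ ($g\in\Gamma$) are pairwise disjoint and with $\bigcup_g g.\overline F=\mathbb H$; a closed fundamental region is a closed set whose interior is a fundamental region. $\Gamma$ is geometrically finite if it has a convex fundamental region with finitely many sides. $\infty$ is cuspidal if $\Gamma$ contains a parabolic element fixing $\infty$. $\Gamma_\infty$ is the stabilizer of $\infty$ in $\Gamma$. **Isometric spheres.** For $g=\begin{bmatrix}a&b\\c&d\end{bmatrix}\in\Gamma\setminus\Gamma_\infty$: $I(g)=\{z\in\mathbb H:|cz+d|=1\}$, $\mathrm{ext}\,I(g)=\{|cz+d|>1\}$; the summit of $I(g)$ is its point of maximal imaginary part; $\mathcal K=\bigcap_{g\in\Gamma\setminus\Gamma_\infty}\mathrm{ext}\,I(g)$. An isometric sphere $I$ is relevant if $I\cap\partial\mathcal K$ contains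 a one-dimensional submanifold; then $I\cap\partial\mathcal K$ is its relevant part. A vertex of $\mathcal K$ is an endpoint (in $\overline{\mathbb H}^g$) of a relevant part; it is inner if it lies in $\mathbb H$, otherwise infinite. An infinite vertex is two-sided if it is an endpoint of the relevant parts of two distinct relevant isometric spheres, otherwise one-sided. For a one-sided infinite vertex $v$ there is a unique one-sided infinite vertex $w\ne v$ such that the closed vertical strip of $\mathbb H$ between $v$ and $w$ lies in $\mathcal K$. **Precells.** An inner vertex $v$ is an endpoint of exactly two relevant parts, of spheres with summits $s_1,s_2$; the non-cuspidal precell attached to $v$ is the hyperbolic quadrilateral with vertices $s_1,v,s_2,\infty$ (including its boundary in $\mathbb H$), with vertical sides $[s_i,\infty]$ and non-vertical sides $[s_i,v]$. For an infinite vertex $v$ and each relevant isometric sphere whose relevant part has endpoint $v$, with summit $s$, the hyperbolic triangle with vertices $v,s,\infty$ is a cuspidal precell attached to $v$ (vertical sides $[v,\infty],[s,\infty]$, non-vertical side $[v,s]$). For a one-sided infinite vertex $v$, with $w\ne v$ the unique one-sided infinite vertex such that the closed vertical strip of $\mathbb H$ between $v$ and $w$ lies in $\mathcal K$, this closed vertical strip is a strip precell (attached to $v$ and $w$). A basal family is a set $\mathbb A$ of precells whose union is a closed fundamental region for $\Gamma$. **Cycles and cells.** For $\mathcal A\in\mathbb A$ and a non-vertical side $b$ of $\mathcal A$ there is a unique $g\in\Gamma\setminus\Gamma_\infty$ with $b\subseteq I(g)$ such that $g.b$ is a non-vertical side of some $\mathcal A'\in\mathbb A$; $g$ is called assigned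 to $\mathcal A$. Strip precell $\mathcal A$: $h_{\mathcal A}=\mathrm{id}$, the cycle of $(\mathcal A,\mathrm{id})$ is $((\mathcal A,\mathrm{id}))$, $\mathcal B(\mathcal A)=\mathcal A$, $\mathrm{cyl}(\mathcal A)=2$. Cuspidal $\mathcal A$ with assigned $g$, $\mathcal A'\in\mathbb A$ having non-vertical side $g.b$: the cycle of $(\mathcal A,g)$ is $((\mathcal A,g),(\mathcal A',g^{-1}))$, $\mathcal B(\mathcal A)=\mathcal A\cup g^{-1}.\mathcal A'$, $\mathrm{cyl}(\mathcal A)=3$. Non-cuspidal $\mathcal A$ attached to $v$, with $h_{\mathcal A}$ one of its two assigned elements: let $h_1=h_{\mathcal A}$, $g_1=\mathrm{id}$, $g_{j+1}=h_jg_j$, $\mathcal A_j\in\mathbb A$ the precell attached to $g_j.v$, and for $j\ge2$ let $h_j$ be such that $\{h_j,h_{j-1}^{-1}\}$ is the set of the two elements assigned to $\mathcal A_j$; $k$ is the least index with $g_{k+1}=\mathrm{id}$; the cycle of $(\mathcal A,h_{\mathcal A})$ is $((\mathcal A_j,h_j))_{j=1,\dots,k}$, $\mathcal B(\mathcal A)=\bigcup_{j=1}^kg_j^{-1}.\mathcal A_j$ (independent of the choice of $h_{\mathcal A}$), and $\mathrm{cyl}(\mathcal A)$ is the least $l\in\{1,\dots,k-1\}$ with $\mathcal A_{l+1}=\mathcal A$ if it exists, and $k$ otherwise. The sets $\mathcal B(\mathcal A)$ are the cells; they are convex polyhedra all of whose sides are complete geodesic segments. Two cycles are equivalent if some precell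 occurs in both. A set of choices $\mathbb S$ contains exactly one pair $(\mathcal A,h_{\mathcal A})$ out of each equivalence class of cycles. **Base set and cross section.** $\mathrm{BS}\subseteq\mathbb H$ is the union of all $\Gamma$-translates of all sides of all cells, $\mathrm{bd}=\bigcup_{g\in\Gamma}\bigcup_{\mathcal A\in\mathbb A}g.\partial_g\mathcal B(\mathcal A)$, $\mathrm{CS}\subseteq S\mathbb H$ is the set of unit tangent vectors based on $\mathrm{BS}$ but not tangent to $\mathrm{BS}$. $\pi$ denotes the projections $\mathbb H\to Y$, $S\mathbb H\to SY=\Gamma\backslash S\mathbb H$, $\overline{\mathbb H}^g\to\Gamma\backslash\overline{\mathbb H}^g$; $\widehat{\mathrm{CS}}=\pi(\mathrm{CS})$. Geodesics (arc length parametrized) on $Y$ are images of geodesics on $\mathbb H$. $\mathrm{NIC}$ is the set of geodesics on $Y$ at least one endpoint of which lies in $\pi(\mathrm{bd})$; $\widehat{\mathrm{CS}}_{\mathrm{st}}$ is $\widehat{\mathrm{CS}}$ minus all unit tangent vectors to geodesics in $\mathrm{NIC}$. It is a strong cross section for the geodesic flow with respect to every measure $\mu$ on the space of geodesics on $Y$ with $\mu(\mathrm{NIC})=0$, i.e. almost every geodesic intersects it infinitely often in past and future, intersections are discrete in time, and each geodesic intersecting it at all does so infinitely often in past and future. $R(\widehat v)=\widehat\gamma'(t_0)$, where $\widehat\gamma$ is the geodesic on $Y$ with $\widehat\gamma'(0)=\widehat v$ and $t_0>0$ is the first positive time with $\widehat\gamma'(t_0)\in\widehat{\mathrm{CS}}$.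 **Representatives.** Let $\mathcal I$ be the finite set of $\alpha=((\mathcal A,h_{\mathcal A}),m)$ with $(\mathcal A,h_{\mathcal A})\in\mathbb S$, $1\le m\le\mathrm{cyl}(\mathcal A)$. To $\alpha$ attach a cell $B_\alpha$ and a vertical side $b_\alpha$ of it: non-cuspidal case: $B_\alpha=\mathcal B(\mathcal A_m)$, $b_\alpha=(h_m^{-1}.\infty,\infty)$; cuspidal case ($\mathcal A$ attached to $v$, cycle $((\mathcal A,g),(\mathcal A',g^{-1}))$): $(B_\alpha,b_\alpha)=(\mathcal B(\mathcal A),(v,\infty))$, $(\mathcal B(\mathcal A'),(g.v,\infty))$, $(\mathcal B(\mathcal A),(g^{-1}.\infty,\infty))$ for $m=1,2,3$; strip case (attached to $v_1<v_2$): $B_\alpha=\mathcal A$, $b_\alpha=(v_m,\infty)$. A shift map is any map $\mathbb T\colon\mathcal I\to\Gamma_\infty$. $\mathrm{CS}'_\alpha$ is the set of unit tangent vectors based on $\mathbb T(\alpha).b_\alpha$ that point into the interior of $\mathbb T(\alpha).B_\alpha$. $\mathrm{CS}'=\bigcup_\alpha\mathrm{CS}'_\alpha$ is a disjoint union and $\pi$ maps it bijectively onto $\widehat{\mathrm{CS}}$. **Coding.** $v\in\mathrm{CS}'$, with geodesic $\gamma_v$ ($\gamma_v'(0)=v$), gets the label $(\alpha,g)\in\mathcal I\times\Gamma$ if there is a first time $t>0$ with $\gamma_v'(t)\in\mathrm{CS}$ and then $\gamma_v'(t)\in g.\mathrm{CS}'_\alpha$ (this pair is unique); it gets the label $\varepsilon$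 if there is no such time. $\pi(v)$ gets the label of $v$. Let $\Sigma$ be the set of labels. For $\widehat v\in\widehat{\mathrm{CS}}$ with geodesic $\widehat\gamma$, let $(t_n)_{n\in J}$ ($J\ni0$ an interval in $\mathbb Z$) be the increasing sequence of all times $t$ with $\widehat\gamma'(t)\in\widehat{\mathrm{CS}}$, normalized by $t_0=0$; the geometric coding sequence of $\widehat v$ is $(a_n)_{n\in J}$ with $a_n$ the label of $\widehat\gamma'(t_n)$. $(\sigma(a))_n=a_{n+1}$. The map $\widehat v\mapsto$ geometric coding sequence is a bijection $\widehat{\mathrm{CS}}_{\mathrm{st}}\to\Lambda_{\mathrm{st}}$. **Symbolic dynamics.** Given a strong cross section $\widehat C$ with first return map $R$ and a decomposition into disjoint pieces $\widehat C_s$, $s\in\Sigma$ ($\Sigma$ at most countable), the coding sequence of $\widehat v$ is $(a_n)_{n\in\mathbb Z}$ with $a_n=s$ iff $R^n(\widehat v)\in\widehat C_s$; if the coding map is injective, the shift-invariant set of all arising sequences together with $\sigma$ is called a symbolic dynamics for the geodesic flow (with alphabet $\Sigma$). *)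

(* Defs.v *)
From HB Require Import structures.
From mathcomp Require Import all_boot all_order all_algebra generic_quotient.
From mathcomp Require Import all_classical all_reals all_analysis.
From mathcomp Require Import complex.

Set Implicit Arguments.
Unset Strict Implicit.
Unset Printing Implicit Defensive.

Import Order.TTheory GRing.Theory Num.Theory.
Import numFieldNormedType.Exports.

Local Open Scope quotient_scope.
Local Open Scope classical_set_scope.
Local Open Scope ring_scope.
Local Open Scope complex_scope.

Record SL2 (R : realType) : Type :=
  MkSL2 { SL2mx : 'M[R]_2; SL2_det : \det SL2mx == 1 }.

HB.instance Definition _ (R : realType) := [isSub for @SL2mx R].
HB.instance Definition _ (R : realType) := [Choice of SL2 R by <:].

Section SpecialLinear.
Variable R : realType.
Implicit Types A B : SL2 R.

Fact SL2_one_subproof : \det (1%:M : 'M[R]_2) == 1.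
Proof. by rewrite det1. Qed.
Definition SL2_one : SL2 R := MkSL2 SL2_one_subproof.

Fact SL2_mul_subproof A B : \det (SL2mx A *m SL2mx B) == 1.
Proof. by rewrite det_mulmx (eqP (SL2_det A)) (eqP (SL2_det B)) mulr1. Qed.
Definition SL2_mul A B : SL2 R := MkSL2 (SL2_mul_subproof A B).

Fact SL2_inv_subproof A : \det (invmx (SL2mx A)) == 1.
Proof. by rewrite det_inv (eqP (SL2_det A)) invr1. Qed.
Definition SL2_inv A : SL2 R := MkSL2 (SL2_inv_subproof A).

Fact SL2_opp_subproof A : \det (- SL2mx A) == 1.
Proof. by rewrite -scaleN1r detZ (eqP (SL2_det A)) mulr1 sqrrN expr1n. Qed.
Definition SL2_opp A : SL2 R := MkSL2 (SL2_opp_subproof A).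

Let unitSL2 A : SL2mx A \in unitmx.
Proof. by rewrite unitmxE (eqP (SL2_det A)) unitr1. Qed.

Fact SL2_mulA : associative SL2_mul.
Proof. by move=> A B D; apply: val_inj; rewrite /= mulmxA. Qed.
Fact SL2_mul1 : left_id SL2_one SL2_mul.
Proof. by move=> A; apply: val_inj; rewrite /= mul1mx. Qed.
Fact SL2_mulr1 : right_id SL2_one SL2_mul.
Proof. by move=> A; apply: val_inj; rewrite /= mulmx1. Qed.
Fact SL2_mulV : left_inverse SL2_one SL2_inv SL2_mul.
Proof. by move=> A; apply: val_inj; rewrite /= mulVmx. Qed.
Fact SL2_mulrV : right_inverse SL2_one SL2_inv SL2_mul.
Proof. by move=> A; apply: val_inj; rewrite /= mulmxV. Qed.

HB.instance Definition _ := isGroup.Build (SL2 R)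
  SL2_mulA SL2_mul1 SL2_mulr1 SL2_mulV SL2_mulrV.

(* PSL2 is SL2 modulo sign. *)
Definition pmeq A B := (A == B) || (A == SL2_opp B).

Fact SL2_oppK : involutive SL2_opp.
Proof. by move=> A; apply: val_inj; rewrite /= opprK. Qed.

Fact pmeq_equiv : equiv_class_of pmeq.
Proof.
split=> [A|A B|B A D]; rewrite /pmeq ?eqxx //.
  by rewrite eq_sym; congr (_ || _); rewrite eq_sym (can2_eq SL2_oppK SL2_oppK).
case/orP=> /eqP-> //; case/orP=> /eqP->; rewrite ?SL2_oppK eqxx ?orbT //.
Qed.
Canonical pmeq_equivRel := EquivRelPack pmeq_equiv.

Definition PSL2 := {eq_quot pmeq}.
HB.instance Definition _ := Choice.on PSL2.
HB.instance Definition _ := EqQuotient.on PSL2.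

Definition PSL2_one : PSL2 := \pi_PSL2 (1%g : SL2 R).
Definition PSL2_mul (g h : PSL2) : PSL2 := \pi_PSL2 (repr g * repr h)%g.
Definition PSL2_inv (g : PSL2) : PSL2 := \pi_PSL2 ((repr g)^-1)%g.

Let reprpi A : repr (\pi_PSL2 A) = A \/ repr (\pi_PSL2 A) = SL2_opp A.
Proof.
have /eqP : repr (\pi_PSL2 A) = A %[mod PSL2] by rewrite reprK.
by rewrite eqmodE => /orP[]/eqP; [left|right].
Qed.

Let piN A : \pi_PSL2 (SL2_opp A) = \pi_PSL2 A.
Proof. by apply/eqP; rewrite eqmodE /= /pmeq eqxx orbT. Qed.

Let mulN A B : (SL2_opp A * B)%g = SL2_opp (A * B)%g.
Proof. by apply: val_inj; rewrite /= mulNmx. Qed.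
Let mulrN' A B : (A * SL2_opp B)%g = SL2_opp (A * B)%g.
Proof. by apply: val_inj; rewrite /= mulmxN. Qed.

Let pi_mul A B : PSL2_mul (\pi A) (\pi B) = \pi_PSL2 (A * B)%g.
Proof.
rewrite /PSL2_mul; have [->|->] := reprpi A; have [->|->] := reprpi B;
  by rewrite ?mulN ?mulrN' ?mulN ?piN.
Qed.

Let pi_inv A : PSL2_inv (\pi A) = \pi_PSL2 (A^-1)%g.
Proof.
rewrite /PSL2_inv; have [->//|->] := reprpi A.
have -> : ((SL2_opp A)^-1 = SL2_opp A^-1)%g; last exact: piN.
by apply: (mulgI (SL2_opp A)); rewrite mulgV mulN mulrN' mulgV SL2_oppK.
Qed.

Fact PSL2_mulA : associative PSL2_mul.
Proof.
by move=> g h k; rewrite -[g]reprK -[h]reprK -[k]reprK !pi_mul mulgA.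
Qed.
Fact PSL2_mul1 : left_id PSL2_one PSL2_mul.
Proof. by move=> g; rewrite -[g]reprK pi_mul mul1g. Qed.
Fact PSL2_mulr1 : right_id PSL2_one PSL2_mul.
Proof. by move=> g; rewrite -[g]reprK pi_mul mulg1. Qed.
Fact PSL2_mulV : left_inverse PSL2_one PSL2_inv PSL2_mul.
Proof. by move=> g; rewrite -[g]reprK pi_inv pi_mul mulVg. Qed.
Fact PSL2_mulrV : right_inverse PSL2_one PSL2_inv PSL2_mul.
Proof. by move=> g; rewrite -[g]reprK pi_inv pi_mul mulgV. Qed.

HB.instance Definition _ := isGroup.Build PSL2
  PSL2_mulA PSL2_mul1 PSL2_mulr1 PSL2_mulV PSL2_mulrV.

End SpecialLinear.

Section HyperbolicPlane.
Variable R : realType.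

(* R[i] itself carries no topology; numClosedFieldType puts the norm topology
   on this alias. *)
Definition Cplx : numClosedFieldType := R[i].
Local Notation C := Cplx.

(* The Riemann sphere, None being the point at infinity. *)
Definition sphere := one_point_compactification C.

Definition uhp : set C := [set z | 0 < complex.Im z].

Definition bdry_pt : set sphere :=
  [set p | p = None \/ exists x : R, p = Some (x%:C : C)].

Definition entry (g : PSL2 R) (i j : 'I_2) : C := (SL2mx (repr g) i j)%:C.

(* cz + d; its sign, like that of the entries, depends on repr. *)
Definition jfac (g : PSL2 R) (z : C) : C := entry g 1 0 * z + entry g 1 1.

Definition mobC (g : PSL2 R) (z : C) : C :=
  (entry g 0 0 * z + entry g 0 1) / jfac g z.

Definition mob (g : PSL2 R) (p : sphere) : sphere :=
  match p with
  | None => if entry g 1 0 == 0 then None else Some (entry g 0 0 / entry g 1 0)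
  | Some z => if jfac g z == 0 then None else Some (mobC g z)
  end.

(* A tangent vector is a pair (base point, direction in the complex plane);
   the hyperbolic norm of (z, u) is |u| / Im z. *)
Definition SH : set (C * C) :=
  [set v | uhp v.1 /\ `|v.2| = ((complex.Im v.1)%:C : C)].

Definition mobT (g : PSL2 R) (v : C * C) : C * C :=
  (mobC g v.1, v.2 / (jfac g v.1) ^+ 2).

(* The unit speed geodesics are exactly t |-> g.(i e^t), g in PSL2(R), each of
   them coming from a single g. *)
Definition axis (r : \bar R) : sphere :=
  match r with
  | r'%:E => Some (0 +i* expR r' : C)
  | +oo%E => None
  | -oo%E => Some (0 : C)
  end.

Definition geod (g : PSL2 R) (r : \bar R) : sphere := mob g (axis r).

Definition velocity (g : PSL2 R) (t : R) : C * C :=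
  mobT g (0 +i* expR t, 0 +i* expR t).

(* The geodesic segment from p to q, as a subset of the plane: endpoints on
   the ideal boundary are left out. *)
Definition seg (p q : sphere) : set C :=
  [set z | exists (g : PSL2 R) (s t : \bar R) (r : R),
     [/\ geod g s = p, geod g t = q, (s <= r%:E <= t)%E &
         geod g r%:E = Some z]].

Definition closureH (V : set C) : set C := closure V `&` uhp.
Definition boundaryH (V : set C) : set C := closureH V `\` V^°.
Definition ideal_boundary (V : set C) : set sphere :=
  closure ((fun z => Some z : sphere) @` V) `&` bdry_pt.

Definition hconvex (V : set C) : Prop :=
  V `<=` uhp /\ forall z w, V z -> V w -> seg (Some z) (Some w) `<=` V.

(* The convex polygon with vertices P, with its boundary in the plane but
   without its ideal vertices. *)
Definition polygon (P : set sphere) : set C :=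
  [set z | forall V : set C, hconvex V ->
     (forall p q, P p -> P q -> seg p q `<=` V) -> V z].

Definition side (V b : set C) : Prop :=
  [/\ b !=set0, b `<=` boundaryH V, hconvex b &
      forall b', hconvex b' -> b `<=` b' -> b' `<=` boundaryH V -> b' = b].

(* (z, u) is the velocity of a curve in M differentiable at z. *)
Definition tangent_to (M : set C) (v : C * C) : Prop :=
  exists c : R -> C,
    [/\ c 0 = v.1, \forall t \near (0 : R), M (c t),
        is_derive (0 : R) (1 : R) (fun t => complex.Re (c t)) (complex.Re v.2) &
        is_derive (0 : R) (1 : R) (fun t => complex.Im (c t)) (complex.Im v.2)].

Definition points_into (V : set C) (v : C * C) : Prop :=
  exists g : PSL2 R, velocity g 0 = v /\
    \forall t \near (0 : R)^'+, V^° (velocity g t).1.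

Definition first_time (P : set R) (t : R) : Prop :=
  [/\ 0 < t, P t & forall s, 0 < s < t -> ~ P s].

End HyperbolicPlane.

Arguments uhp {R}.
Arguments bdry_pt {R}.
Arguments SH {R}.

Section FuchsianGroups.
Variables (R : realType) (Gam : set (PSL2 R)).
Local Notation C := (Cplx R).

(* Discreteness: the preimage of Gam in SL2(R) meets some neighbourhood of the
   identity matrix only in the identity. *)
Definition fuchsian : Prop :=
  [/\ Gam 1%g, forall g h, Gam g -> Gam h -> Gam (g * h^-1)%g &
      \forall M \near (1%:M : 'M[R]_2), forall A : SL2 R,
        SL2mx A = M -> Gam (\pi_(PSL2 R) A) -> A = 1%g].

Definition fundamental_region (F : set C) : Prop :=
  [/\ open F, F `<=` uhp,
      forall g h, Gam g -> Gam h -> g <> h ->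
        (mobC g @` F) `&` (mobC h @` F) = set0 &
      \bigcup_(g in Gam) (mobC g @` closureH F) = uhp].

Definition closed_fundamental_region (K : set C) : Prop :=
  closureH K = K /\ fundamental_region K^°.

Definition geometrically_finite : Prop :=
  exists F, [/\ fundamental_region F, hconvex F & finite_set (side F)].

Definition parabolic (g : PSL2 R) : Prop :=
  g <> 1%g /\ `|\tr (SL2mx (repr g))| = 2.

Definition cuspidal_at_infinity : Prop :=
  exists g, [/\ Gam g, parabolic g & mob g None = None].

Definition stab_inf : set (PSL2 R) := [set g | Gam g /\ mob g None = None].
Local Notation moving := (Gam `\` stab_inf).

Definition isom_sphere (g : PSL2 R) : set C :=
  [set z | uhp z /\ `|jfac g z| = 1].
Definition isom_ext (g : PSL2 R) : set C :=
  [set z | uhp z /\ 1 < `|jfac g z|].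

Definition summit (I : set C) (s : C) : Prop :=
  I s /\ forall z, I z -> complex.Im z <= complex.Im s.

Definition common_ext : set C :=
  [set z | uhp z /\ forall g, moving g -> isom_ext g z].

(* A set contains a one-dimensional submanifold iff it contains an embedded
   compact arc. *)
Definition contains_arc (M : set C) : Prop :=
  exists f : R -> C, [/\ {within `[0, 1], continuous f},
    {in `[0, 1] &, injective f} & f @` `[0, 1] `<=` M].

Definition relevant_part (I : set C) : set C := I `&` boundaryH common_ext.

Definition relevant (I : set C) : Prop :=
  (exists2 g, moving g & I = isom_sphere g) /\ contains_arc (relevant_part I).

Definition endpoint (b : set C) (p : sphere R) : Prop :=
  exists2 q, p <> q & b = seg p q.

Definition part_endpoint (I : set C) (p : sphere R) : Prop :=
  relevant I /\ endpoint (relevant_part I) p.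

Definition vertex (p : sphere R) : Prop := exists I, part_endpoint I p.

Definition inner_vertex (v : C) : Prop := uhp v /\ vertex (Some v).
Definition infinite_vertex (p : sphere R) : Prop := bdry_pt p /\ vertex p.
Definition two_sided (p : sphere R) : Prop :=
  exists I1 I2, [/\ I1 <> I2, part_endpoint I1 p & part_endpoint I2 p].
Definition one_sided_vertex (p : sphere R) : Prop :=
  infinite_vertex p /\ ~ two_sided p.

Definition condition_A : Prop :=
  forall I s, relevant I -> summit I s ->
    boundaryH common_ext s /\ ~ vertex (Some s).

Definition noncuspidal_precell (A : set C) (v s1 s2 : C) : Prop :=
  inner_vertex v /\ exists I1 I2,
    [/\ I1 <> I2, part_endpoint I1 (Some v) /\ part_endpoint I2 (Some v),
        summit I1 s1, summit I2 s2 &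
        A = polygon [set Some s1; Some v; Some s2; None]].

Definition cuspidal_precell (A : set C) (v : sphere R) (s : C) : Prop :=
  infinite_vertex v /\ exists I,
    [/\ part_endpoint I v, summit I s & A = polygon [set v; Some s; None]].

Definition strip_precell (A : set C) (x y : R) : Prop :=
  [/\ x < y, one_sided_vertex (Some (x%:C : C)),
      one_sided_vertex (Some (y%:C : C)),
      A = [set z | uhp z /\ x <= complex.Re z <= y] & A `<=` common_ext].

Definition precell (A : set C) : Prop :=
  [\/ exists v s1 s2, noncuspidal_precell A v s1 s2,
      exists v s, cuspidal_precell A v s |
      exists x y, strip_precell A x y].

Definition attached (A : set C) (v : C) : Prop :=
  exists s1 s2, noncuspidal_precell A v s1 s2.

Definition nonvertical_side (A b : set C) : Prop :=
  (exists v s1 s2, noncuspidal_precell A v s1 s2 /\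
     (b = seg (Some s1) (Some v) \/ b = seg (Some s2) (Some v))) \/
  (exists v s, cuspidal_precell A v s /\ b = seg (Some s) v).

Definition basal_family (AA : set (set C)) : Prop :=
  (forall A, AA A -> precell A) /\
  closed_fundamental_region (\bigcup_(A in AA) A).

End FuchsianGroups.

Section Cells.
Variables (R : realType) (Gam : set (PSL2 R)) (AA : set (set (Cplx R))).
Local Notation C := (Cplx R).
Local Notation moving := (Gam `\` stab_inf Gam).
Local Notation pairs := (seq (set C * PSL2 R)).

Definition paired_side (b : set C) (g : PSL2 R) (A' : set C) : Prop :=
  [/\ moving g, b `<=` isom_sphere g, AA A' &
      nonvertical_side Gam A' (mobC g @` b)].

Definition assigned (A : set C) : set (PSL2 R) :=
  [set g | exists b A', nonvertical_side Gam A b /\ paired_side b g A'].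

(* Cycles are lists indexed from 0, so that term j of a list c is the pair
   (A_(j+1), h_(j+1)) and cycle_elt c j is g_(j+1) = h_j ... h_1. *)
Definition cycle_term (c : pairs) (j : nat) : set C * PSL2 R :=
  nth (set0, 1%g) c j.
Definition cycle_elt (c : pairs) (j : nat) : PSL2 R :=
  foldl (fun g p => p.2 * g)%g 1%g (take j c).

Definition strip_cycle (A : set C) (h : PSL2 R) (x y : R) (c : pairs) : Prop :=
  [/\ AA A, strip_precell Gam A x y, h = 1%g & c = [:: (A, h)]].

Definition cuspidal_cycle (A : set C) (h : PSL2 R) (v : sphere R)
    (A' : set C) (c : pairs) : Prop :=
  [/\ AA A, exists2 s, cuspidal_precell Gam A v s &
                       paired_side (seg (Some s) v) h A' &
      c = [:: (A, h); (A', h^-1%g)]].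

Definition noncuspidal_cycle (A : set C) (h : PSL2 R) (c : pairs) : Prop :=
  [/\ AA A /\ assigned A h, (0 < size c)%N /\ cycle_term c 0%N = (A, h),
      exists2 v, attached Gam A v &
        forall j, (j < size c)%N ->
          AA (cycle_term c j).1 /\
          attached Gam (cycle_term c j).1 (mobC (cycle_elt c j) v),
      forall j, (j.+1 < size c)%N ->
        assigned (cycle_term c j.+1).1 =
        [set (cycle_term c j.+1).2; ((cycle_term c j).2)^-1%g] &
      cycle_elt c (size c) = 1%g /\
      forall j, (0 < j < size c)%N -> cycle_elt c j <> 1%g].

Definition cycle_of (A : set C) (h : PSL2 R) (c : pairs) : Prop :=
  [\/ exists x y, strip_cycle A h x y c,
      exists v A', cuspidal_cycle A h v A' c |
      noncuspidal_cycle A h c].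

(* The cell of A; the three cases of its definition are one formula in terms
   of the cycle. *)
Definition is_cell (A B : set C) : Prop :=
  exists h c, cycle_of A h c /\
    B = \bigcup_(j < size c) (mobC (cycle_elt c j)^-1%g @` (cycle_term c j).1).

Definition is_cyl (A : set C) (h : PSL2 R) (n : nat) : Prop :=
  [\/ (exists x y c, strip_cycle A h x y c) /\ n = 2%N,
      (exists v A' c, cuspidal_cycle A h v A' c) /\ n = 3%N |
      exists2 c, noncuspidal_cycle A h c &
        n = (find (fun p => `[< p.1 = A >]) (behead c)).+1].

Definition cycle_equiv (c c' : pairs) : Prop :=
  exists A, A \in map fst c /\ A \in map fst c'.

Definition set_of_choices (S : set (set C * PSL2 R)) : Prop :=
  (forall p, S p -> exists c, cycle_of p.1 p.2 c) /\
  (forall A h c, cycle_of A h c ->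
     exists! p, S p /\ exists2 c', cycle_of p.1 p.2 c' & cycle_equiv c c').

Definition base_set : set C :=
  [set z | exists g A B b, [/\ Gam g, AA A, is_cell A B, side B b &
                               (mobC g @` b) z]].

Definition ideal_cells : set (sphere R) :=
  [set p | exists g A B, [/\ Gam g, AA A, is_cell A B &
                             (mob g @` ideal_boundary B) p]].

Definition cross_section : set (C * C) :=
  [set v | [/\ SH v, base_set v.1 & ~ tangent_to base_set v]].

(* (A, h, m) stands for the index ((A, h), m). *)
Definition CS_index := (set C * PSL2 R * nat)%type.

Definition index_set (S : set (set C * PSL2 R)) : set CS_index :=
  [set i | S i.1 /\ exists2 n, is_cyl i.1.1 i.1.2 n & (1 <= i.2 <= n)%N].

Definition shift_map (S : set (set C * PSL2 R)) (T : CS_index -> PSL2 R) :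
    Prop :=
  forall i, index_set S i -> stab_inf Gam (T i).

Definition index_side (i : CS_index) (B b : set C) : Prop :=
  let: (A, h, m) := i in
  [\/ exists c, [/\ noncuspidal_cycle A h c,
        is_cell (cycle_term c m.-1).1 B &
        b = seg (mob ((cycle_term c m.-1).2)^-1%g None) None],
      exists v A' c, cuspidal_cycle A h v A' c /\
        [\/ [/\ m = 1%N, is_cell A B & b = seg v None],
            [/\ m = 2%N, is_cell A' B & b = seg (mob h v) None] |
            [/\ m = 3%N, is_cell A B & b = seg (mob h^-1%g None) None]] |
      exists x y c, strip_cycle A h x y c /\ B = A /\
        (m = 1%N /\ b = seg (Some (x%:C : C)) None \/
         m = 2%N /\ b = seg (Some (y%:C : C)) None)].

Definition section_piece (T : CS_index -> PSL2 R) (i : CS_index) :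
    set (C * C) :=
  [set v | SH v /\ exists B b, [/\ index_side i B b,
     (mobC (T i) @` b) v.1 & points_into (mobC (T i) @` B) v]].

Definition section_reps (S : set (set C * PSL2 R)) (T : CS_index -> PSL2 R) :
    set (C * C) :=
  \bigcup_(i in index_set S) section_piece T i.

(* None is the label epsilon. *)
Definition label := option (CS_index * PSL2 R).

Definition has_label (S : set (set C * PSL2 R)) (T : CS_index -> PSL2 R)
    (v : C * C) (l : label) : Prop :=
  exists2 g, velocity g 0 = v &
    match l with
    | None => ~ exists t, first_time [set t | cross_section (velocity g t)] t
    | Some (i, h) => [/\ index_set S i, Gam h & exists2 t,
        first_time [set t | cross_section (velocity g t)] t &
        (mobT h @` section_piece T i) (velocity g t)]
    end.

Definition alphabet (S : set (set C * PSL2 R)) (T : CS_index -> PSL2 R) :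
    set label :=
  [set l | exists2 v, section_reps S T v & has_label S T v l].

End Cells.

Section Quotient.
Variables (R : realType) (Gam : set (PSL2 R)).
Local Notation C := (Cplx R).

(* Points of the quotients of SH and of the closed half plane are orbits. *)
Definition piT (v : C * C) : set (C * C) := [set mobT g v | g in Gam].
Definition piS (p : sphere R) : set (sphere R) := [set mob g p | g in Gam].

Definition SY : set (set (C * C)) := piT @` SH.

(* A geodesic on Y is represented by its velocity curve, a function with
   values in SY. *)
Definition velocityY (g : PSL2 R) : R -> set (C * C) :=
  fun t => piT (velocity g t).
Definition geodY : Type := set_type (range velocityY).

HB.instance Definition _ := Choice.on geodY.

Fact geodY_point_subproof : velocityY 1%g \in range velocityY.
Proof. by apply/mem_set; exists 1%g. Qed.
HB.instance Definition _ := isPointed.Build geodY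
  (exist _ (velocityY 1%g) geodY_point_subproof : geodY).

(* Junk value v when the geodesic never comes back to D. *)
Definition first_return_map (D : set (set (C * C))) (v : set (C * C)) :
    set (C * C) :=
  xget v [set w | exists (c : geodY) t, [/\ val c 0 = v,
    first_time [set s | D (val c s)] t & val c t = w]].

Definition infinitely_often (D : set (set (C * C))) (c : geodY) : Prop :=
  forall t0 : R, (exists2 t, t0 < t & D (val c t)) /\
                 (exists2 t, t < t0 & D (val c t)).

Definition strong_cross_section (G : set (set geodY))
    (mu : {measure set (g_sigma_algebraType G) -> \bar R})
    (D : set (set (C * C))) : Prop :=
  [/\ D `<=` SY,
      {ae mu, forall c, infinitely_often D c},
      forall (c : geodY) t, D (val c t) -> exists2 e : R, 0 < e &
        forall s, `|s - t| < e -> s <> t -> ~ D (val c s) &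
      forall c : geodY, (exists t, D (val c t)) -> infinitely_often D c].

(* a is the coding sequence of v: w n is the n-th iterate of the first return
   map at v, for n of either sign. *)
Definition return_coding (L : Type) (D : set (set (C * C))) (Sig : set L)
    (piece : L -> set (set (C * C))) (v : set (C * C)) (a : int -> L) : Prop :=
  exists w : int -> set (C * C),
    [/\ w 0 = v, forall n, D (w n),
        forall n, w (n + 1) = first_return_map D (w n) &
        forall n, Sig (a n) /\
          forall s, Sig s -> (a n = s <-> piece s (w n))].

Definition left_shift (L : Type) (a : int -> L) : int -> L :=
  fun n => a (n + 1).

(* (Lam, left_shift) is the symbolic dynamics with alphabet Sig given by the
   cross section D and its decomposition into the pieces. *)
Definition symbolic_dynamics (G : set (set geodY))
    (mu : {measure set (g_sigma_algebraType G) -> \bar R})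
    (L : Type) (D : set (set (C * C))) (Sig : set L)
    (piece : L -> set (set (C * C))) (Lam : set (int -> L)) : Prop :=
  [/\ strong_cross_section mu D,
      countable Sig,
      trivIset Sig piece /\ \bigcup_(s in Sig) piece s = D,
      forall v w a, D v -> D w ->
        return_coding D Sig piece v a -> return_coding D Sig piece w a ->
        v = w &
      Lam = [set a | exists2 v, D v & return_coding D Sig piece v a] /\
      (@left_shift L) @` Lam = Lam].

End Quotient.

Section GeometricCoding.
Variables (R : realType) (Gam : set (PSL2 R)) (AA : set (set (Cplx R))).
Variables (S : set (set (Cplx R) * PSL2 R)) (T : CS_index R -> PSL2 R).
Local Notation C := (Cplx R).

Definition CSY : set (set (C * C)) := piT Gam @` cross_section Gam AA.

Definition NIC : set (geodY Gam) :=
  [set c | exists g, val c = velocityY Gam g /\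
     ((piS Gam @` ideal_cells Gam AA) (piS Gam (geod g +oo%E)) \/
      (piS Gam @` ideal_cells Gam AA) (piS Gam (geod g -oo%E)))].

Definition CSst : set (set (C * C)) :=
  CSY `\` [set v | exists2 c, NIC c & exists t, val c t = v].

Definition has_labelY (v : set (C * C)) (l : label R) : Prop :=
  exists u, [/\ section_reps Gam AA S T u, piT Gam u = v &
                has_label Gam AA S T u l].

(* a restricted to the interval J is the geometric coding sequence of v. *)
Definition geometric_coding (v : set (C * C)) (J : set int)
    (a : int -> label R) : Prop :=
  [/\ J 0, forall m n p, J m -> J p -> m <= n <= p -> J n &
   exists (c : geodY Gam) (t : int -> R),
   [/\ val c 0 = v, t 0 = 0,
       forall m n, J m -> J n -> m < n -> t m < t n,
       t @` J = [set s | CSY (val c s)] &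
       forall n, J n -> has_labelY (val c (t n)) (a n)]].

Definition Lst : set (int -> label R) :=
  [set a | exists2 v, CSY v & geometric_coding v setT a].

Definition coding_map (v : set (C * C)) : int -> label R :=
  xget (fun=> None) [set a | geometric_coding v setT a].

(* The inverse of coding_map on CSst, meaningful once coding_map is injective
   there. *)
Definition Cod : (int -> label R) -> set (C * C) :=
  'pinv_(fun=> set0) CSst coding_map.

Definition CSst_piece (l : label R) : set (set (C * C)) :=
  [set v | CSst v /\ has_labelY v l].

End GeometricCoding.

Arguments NIC {R} Gam AA _.

(* Main.v *)
(** The translates of the cells tessellate the plane by ideal polygons whose sides are
complete geodesics, locally finitely: geometric finiteness makes the basal family finite,
because infinitely many precells would give infinitely many disjoint isometric rectangles,
which finitely many cusp neighbourhoods of finite area would have to contain. A geodesic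
therefore crosses BS at isolated times, each time entering a unique translate of a unique
piece CS'_alpha, and it has only finitely many crossings in one direction exactly when its
end there is a boundary point of a translate of a cell. So CSst consists of the vectors with
a bi-infinite sequence of crossings, and the first return map moves along that sequence. The
labels determine, up to Gamma, the sequence of polygons entered and of sides crossed. Two
geodesics with the same sequence have the same end points: the geodesic joining two
different forward end points would have a point on the inner side of all the crossed lines,
but along a geodesic only finitely many crossed lines have a given point on their inner
side. *)

Require Import Defs.
From HB Require Import structures.
From mathcomp Require Import all_boot all_order all_algebra generic_quotient.
From mathcomp Require Import all_classical all_reals all_analysis.
From mathcomp Require Import complex.
From mathcomp Require Import zify ring lra.
Set Implicit Arguments.
Unset Strict Implicit.
Unset Printing Implicit Defensive.
Import Order.TTheory GRing.Theory Num.Theory.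
Import numFieldNormedType.Exports.
Local Open Scope quotient_scope.
Local Open Scope classical_set_scope.
Local Open Scope ring_scope.

(** A half plane is named by a group element: [k] stands for the image under [k] of the part of the
    plane to the right of the imaginary axis. Whether a point of the geodesic [h] lies in it is
    decided by the sign of [al (k^-1 * h) * e^(2t) + be (k^-1 * h)], a function affine in [e^(2t)];
    convexity, crossings, tangency and ideal end points all reduce to the two numbers [al] and [be].
    No angle enters: that the precells around an inner vertex fill a polygon with complete sides is
    shown by connectedness, along segments avoiding the vertex. The main obstacle is finiteness of
    the basal family, because geometric finiteness speaks of some convex region with no given
    relation to the isometric spheres, which may even contain whole half planes. Outside the half
    planes avoiding the lines of its sides, finitely many standard cusp regions cover the plane. The
    isometric rectangles lie in ideal triangles spanned by translates of the cusp, and half planes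
    inside a fundamental region cannot meet those. *)

(** * Matrix entries of elements of PSL2, up to sign *)

Section Coordinates.
Variable R : realType.
Local Notation C := (Cplx R).
Local Notation G := (PSL2 R).
Implicit Types (g h : G) (z w : C) (x y : R).

Definition re z : R := complex.Re z.

Definition im z : R := complex.Im z.

Definition pt x y : C := Complex x y.

Lemma ptK z : pt (re z) (im z) = z. Proof. by case: z. Qed.

Lemma re_pt x y : re (pt x y) = x. Proof. by []. Qed.

Lemma im_pt x y : im (pt x y) = y. Proof. by []. Qed.

Lemma Cext z w : re z = re w -> im z = im w -> z = w.
Proof. by case: z w => [a b] [c d] /= -> ->. Qed.

Definition ea g : R := SL2mx (repr g) 0 0.

Definition eb g : R := SL2mx (repr g) 0 1.

Definition ec g : R := SL2mx (repr g) 1 0.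

Definition ed g : R := SL2mx (repr g) 1 1.

Lemma det2 (M : 'M[R]_2) : \det M = M 0 0 * M 1 1 - M 0 1 * M 1 0.
Proof.
rewrite (expand_det_row _ 0) !big_ord_recl big_ord0 addr0 /cofactor /=.
rewrite !det_mx11 !mxE /= /bump /=.
have -> : lift 0 0 = 1 :> 'I_2 by apply: val_inj.
have -> : lift 1 0 = 0 :> 'I_2 by apply: val_inj.
lra.
Qed.

Lemma edet g : ea g * ed g - eb g * ec g = 1.
Proof. by rewrite /ea /eb /ec /ed -det2 (eqP (SL2_det _)). Qed.

Definition mx4 (a b c d : R) : 'M[R]_2 :=
 \matrix_(i, j) if i == 0 then (if j == 0 then a else b)
         else (if j == 0 then c else d).

(** Junk value: the identity when [a d - b c] is not 1. The determinant condition is thus postponed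
    to [mk4E], and explicit matrices can be written without a proof term. *)
Definition mk4 (a b c d : R) : G :=
 if @idP (\det (mx4 a b c d) == 1) is ReflectT H then \pi_G (MkSL2 H) else 1%g.

(** The choice of [repr] leaves a common sign of the entries undetermined. Entry formulas carry it
    as an explicit [s] with [s * s = 1], which cancels in every expression of even degree. *)
Definition eqs (a b c d a' b' c' d' : R) : Prop :=
 exists s : R, [/\ s * s = 1, a = s * a', b = s * b', c = s * c' & d = s * d'].

Lemma repr_pi (A : SL2 R) : repr (\pi_G A) = A \/ repr (\pi_G A) = SL2_opp A.
Proof.
have /eqP : repr (\pi_G A) = A %[mod G] by rewrite reprK.
by rewrite eqmodE => /orP[]/eqP; [left|right].
Qed.

Lemma pi_entries (A : SL2 R) (g := \pi_G A) :
 eqs (ea g) (eb g) (ec g) (ed g)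
   (SL2mx A 0 0) (SL2mx A 0 1) (SL2mx A 1 0) (SL2mx A 1 1).
Proof.
rewrite /ea /eb /ec /ed; have [->|->] := repr_pi A.
 by exists 1; rewrite !mul1r.
by exists (-1); rewrite !mxE !mulN1r opprK.
Qed.

Lemma mk4E (a b c d : R) (g := mk4 a b c d) : a * d - b * c = 1 ->
 eqs (ea g) (eb g) (ec g) (ed g) a b c d.
Proof.
move=> H; rewrite /g /mk4; case: {-}_ / idP => [K|[]]; last first.
 by rewrite det2 !mxE /= H.
by have := pi_entries (MkSL2 K); rewrite !mxE /=.
Qed.

Lemma mx2P (M N : 'M[R]_2) : M 0 0 = N 0 0 -> M 0 1 = N 0 1 ->
 M 1 0 = N 1 0 -> M 1 1 = N 1 1 -> M = N.
Proof.
move=> ? ? ? ?; apply/matrixP => i j.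
by case: i => [[|[|i]] Hi] //; case: j => [[|[|j]] Hj] //;
 [have -> : Ordinal Hi = 0 by apply: val_inj| have -> : Ordinal Hi = 0 by apply: val_inj| have -> : Ordinal Hi = 1 by apply: val_inj| have -> : Ordinal Hi = 1 by apply: val_inj];
 [have -> : Ordinal Hj = 0 by apply: val_inj| have -> : Ordinal Hj = 1 by apply: val_inj| have -> : Ordinal Hj = 0 by apply: val_inj| have -> : Ordinal Hj = 1 by apply: val_inj].
Qed.

Lemma eqsP g h : eqs (ea g) (eb g) (ec g) (ed g) (ea h) (eb h) (ec h) (ed h) ->
 g = h.
Proof.
case=> s [s2 Ha Hb Hc Hd].
have /orP[/eqP s1|/eqP s1] : (s == 1) || (s == -1).
 nra.
- rewrite -[g]reprK -[h]reprK; congr (\pi_G _); apply: val_inj => /=.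
 by apply: mx2P; rewrite -/(ea g) -/(eb g) -/(ec g) -/(ed g)
   -/(ea h) -/(eb h) -/(ec h) -/(ed h) ?Ha ?Hb ?Hc ?Hd s1 mul1r.
- rewrite -[g]reprK -[h]reprK; apply/eqP; rewrite eqmodE; apply/orP; right.
 apply/eqP; apply: val_inj => /=.
 by apply: mx2P; rewrite !mxE -/(ea g) -/(eb g) -/(ec g) -/(ed g)
   -/(ea h) -/(eb h) -/(ec h) -/(ed h) ?Ha ?Hb ?Hc ?Hd s1 mulN1r.
Qed.

Lemma sum2 (F : 'I_2 -> R) : \sum_i F i = F 0 + F 1.
Proof.
rewrite !big_ord_recl big_ord0 addr0; congr (_ + F _); exact: val_inj.
Qed.

Lemma mul_entries g h (k := (g * h)%g) :
 eqs (ea k) (eb k) (ec k) (ed k)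
  (ea g * ea h + eb g * ec h) (ea g * eb h + eb g * ed h)
  (ec g * ea h + ed g * ec h) (ec g * eb h + ed g * ed h).
Proof.
have := pi_entries (repr g * repr h)%g; rewrite -/(PSL2_mul g h) /= !mxE !sum2.
exact.
Qed.

Lemma inv_entries g (k := (g^-1)%g) :
 eqs (ea k) (eb k) (ec k) (ed k) (ed g) (- eb g) (- ec g) (ea g).
Proof.
(* The rows of the inverse solve the linear equations [g^-1 * g = 1], with the determinant of [g] as
   Cramer's denominator. *)
have [s [s2]] := mul_entries g^-1%g g; rewrite mulVg -/k => A B D E.
have [s' [s2' A' B' D' E']] := pi_entries (1%g : SL2 R).
move: A' B' D' E'; rewrite -[\pi_G _]/(1%g : G) /= !mxE /= => A' B' D' E'.
have dt := edet g; have K u v : s * u = v -> u = s * v.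
 nra.
rewrite A' mulr1 in A; rewrite B' mulr0 in B.
rewrite D' mulr0 in D; rewrite E' mulr1 in E.
have {}A := K _ _ (esym A); have {}B := K _ _ (esym B).
have {}D := K _ _ (esym D); have {}E := K _ _ (esym E).
rewrite mulr0 in B D.
exists (s * s'); split; first by rewrite mulrACA s2 s2' mulr1.
- by rewrite -[LHS]mulr1 -dt -A -[RHS]subr0 -(mul0r (ec g)) -B; ring.
- rewrite -[LHS]mulr1 -dt mulrN -A.
 by rewrite -[RHS]addr0 -(mul0r (ea g)) -B; ring.
- rewrite -[LHS]mulr1 -dt mulrN -E.
 by rewrite -[RHS]addr0 -(mul0r (ed g)) -D; ring.
- by rewrite -[LHS]mulr1 -dt -E -[RHS]subr0 -(mul0r (eb g)) -D; ring.
Qed.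

Lemma one_entries (k := 1%g : G) : eqs (ea k) (eb k) (ec k) (ed k) 1 0 0 1.
Proof. by have := pi_entries (1%g : SL2 R); rewrite /= !mxE. Qed.

End Coordinates.

Lemma mulRI (R : realType) (a b c : R) : c != 0 -> a * c = b * c -> a = b.
Proof. by move=> c0; apply: mulIf. Qed.

(** * The action on the plane and on unit tangent vectors, in real coordinates *)

Section Action.
Variable R : realType.
Local Notation C := (Cplx R).
Local Notation G := (PSL2 R).
Implicit Types (g h : G) (z w : C) (x y t : R).

(** The squared modulus of [cz + d], free of the sign ambiguity. *)
Definition den g z : R :=
 (ec g * re z + ed g) ^+ 2 + (ec g * im z) ^+ 2.

(** The real part of [az + b] times the conjugate of [cz + d], that is, the numerator of [Re (g z)].
    Being a polynomial in the coordinates, it will serve as the equation of a geodesic. *)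
Definition qf g z : R :=
 ea g * ec g * (re z ^+ 2 + im z ^+ 2)
 + (ea g * ed g + eb g * ec g) * re z + eb g * ed g.

Lemma uhpE z : uhp z = (0 < im z) :> Prop. Proof. by []. Qed.

Lemma mobC_re g z : re (mobC g z) = qf g z / den g z.
Proof.
case: z => x y; rewrite /mobC /jfac /entry -/(ea g) -/(eb g) -/(ec g) -/(ed g).
rewrite /re /qf /den /= /re /im /=.
rewrite !(mul0r, subr0, addr0, add0r); ring.
Qed.

Lemma mobC_im g z : im (mobC g z) = im z / den g z.
Proof.
case: z => x y; rewrite /mobC /jfac /entry -/(ea g) -/(eb g) -/(ec g) -/(ed g).
rewrite /im /den /= /re /im /= !(mul0r, subr0, addr0, add0r).
transitivity (y * (ea g * ed g - eb g * ec g)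
 / ((ec g * x + ed g) ^+ 2 + (ec g * y) ^+ 2)); first ring.
by rewrite edet mulr1.
Qed.

Lemma den_gt0 g z : uhp z -> 0 < den g z.
Proof.
rewrite uhpE /den => y0; have [c0|c0] := eqVneq (ec g) 0.
 rewrite c0 !mul0r add0r expr0n addr0 exprn_even_gt0 //=.
 by apply: contra_eq_neq (edet g) => ->; rewrite c0 !mulr0 subr0 eq_sym oner_neq0.
by rewrite ltr_wpDl ?sqr_ge0// exprn_even_gt0 //= mulf_neq0 // gt_eqF.
Qed.

Lemma den_neq0 g z : uhp z -> den g z != 0.
Proof. by move/den_gt0 => /(_ g)/gt_eqF ->. Qed.

Lemma mobC_uhp g z : uhp z -> uhp (mobC g z).
Proof. by move=> Hz; rewrite uhpE mobC_im divr_gt0 // den_gt0. Qed.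

Lemma denM g h z : uhp z -> den (g * h)%g z = den g (mobC h z) * den h z.
Proof.
move=> Hz; have [s [s2 Ha Hb Hc Hd]] := mul_entries g h.
rewrite {1 2}/den mobC_re mobC_im Hc Hd; have := den_neq0 h Hz.
move=> D0; rewrite -[LHS]mul1r -s2; have dh := edet h.
have -> : (ec g * (qf h z / den h z) + ed g) ^+ 2
  + (ec g * (im z / den h z)) ^+ 2
  = ((ec g * qf h z + ed g * den h z) ^+ 2 + (ec g * im z) ^+ 2)
   / (den h z) ^+ 2 by field.
apply: (mulRI D0); rewrite -[RHS]mulrA -expr2 divfK ?expf_neq0 //.
have -> : (ec g * im z) ^+ 2 = (ec g * im z * (ea h * ed h - eb h * ec h)) ^+ 2.
 by rewrite dh mulr1.
have s4 : s * s * (s * s) = 1 by nra.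
rewrite -[RHS]mul1r -s4 /qf /den; ring.
Qed.

(** Under the action [qf] changes only by the positive factor [den h z], so its sign is equivariant.
    This makes half planes compatible with the group. *)
Lemma qfM g h z : uhp z -> qf (g * h)%g z = qf g (mobC h z) * den h z.
Proof.
move=> Hz; have [s [s2 Ha Hb Hc Hd]] := mul_entries g h.
rewrite {1 2}/qf mobC_re mobC_im Ha Hb Hc Hd; have D0 := den_neq0 h Hz.
have dh := edet h.
have -> : (ea g * ec g * ((qf h z / den h z) ^+ 2 + (im z / den h z) ^+ 2)
  + (ea g * ed g + eb g * ec g) * (qf h z / den h z) + eb g * ed g)
  = (ea g * ec g * (qf h z ^+ 2 + im z ^+ 2)
  + (ea g * ed g + eb g * ec g) * (qf h z * den h z)
  + eb g * ed g * (den h z) ^+ 2) / (den h z) ^+ 2 by field.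
apply: (mulRI D0); rewrite -[RHS]mulrA -expr2 divfK ?expf_neq0 //.
have -> : qf h z ^+ 2 + im z ^+ 2
  = qf h z ^+ 2 + (im z * (ea h * ed h - eb h * ec h)) ^+ 2.
 by rewrite dh mulr1.
rewrite -[RHS]mul1r -s2 /qf /den; ring.
Qed.

Lemma mobCM g h z : uhp z -> mobC (g * h)%g z = mobC g (mobC h z).
Proof.
move=> Hz; have D0 := den_neq0 h Hz; have D1 := den_neq0 g (mobC_uhp h Hz).
apply: Cext; rewrite ?mobC_re ?mobC_im ?qfM ?denM // ?mobC_im.
 by rewrite -mulf_div divff ?mulr1.
lra.
Qed.

Lemma den1 z : den 1%g z = 1.
Proof.
have [s [s2 Ha Hb Hc Hd]] := one_entries R.
by rewrite /den Hc Hd mulr0 !mul0r add0r expr0n addr0 mulr1 expr2.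
Qed.

Lemma qf1 z : qf 1%g z = re z.
Proof.
have [s [s2 Ha Hb Hc Hd]] := one_entries R.
by rewrite /qf Ha Hb Hc Hd !(mulr0, mul0r, addr0, add0r) !mulr1 s2 mul1r.
Qed.

Lemma mobC1 z : mobC 1%g z = z.
Proof. by apply: Cext; rewrite ?mobC_re ?mobC_im den1 divr1 ?qf1. Qed.

Lemma mobCK g z : uhp z -> mobC g^-1%g (mobC g z) = z.
Proof. by move=> Hz; rewrite -mobCM // mulVg mobC1. Qed.

Lemma mobCKV g z : uhp z -> mobC g (mobC g^-1%g z) = z.
Proof. by move=> Hz; rewrite -mobCM // mulgV mobC1. Qed.

Lemma denV g z : uhp z -> den g^-1%g (mobC g z) = (den g z)^-1.
Proof.
move=> Hz; have := denM g^-1%g g Hz; rewrite mulVg den1 => H.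
by apply: (mulRI (den_neq0 g Hz)); rewrite -H mulVf ?den_neq0.
Qed.

Lemma norm_Cplx z : `|z| = (Num.sqrt (re z ^+ 2 + im z ^+ 2))%:C%C :> C.
Proof. by case: z => x y. Qed.

Lemma jfac_re g z : re (jfac g z) = ec g * re z + ed g.
Proof.
by case: z => x y; rewrite /jfac /entry /re /= mul0r subr0.
Qed.

Lemma jfac_im g z : im (jfac g z) = ec g * im z.
Proof.
by case: z => x y; rewrite /jfac /entry /im /= mul0r !addr0.
Qed.

Lemma jfac_norm g z : `|jfac g z| = (Num.sqrt (den g z))%:C%C.
Proof. by rewrite norm_Cplx jfac_re jfac_im. Qed.

Lemma jfac_neq0 g z : uhp z -> jfac g z != 0.
Proof.
move=> Hz; apply: contra_neq (den_neq0 g Hz) => H.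
by rewrite /den -jfac_re -jfac_im H /re /im /= expr0n addr0.
Qed.

Lemma isom_sphereE g z : isom_sphere g z <-> uhp z /\ den g z = 1.
Proof.
rewrite /isom_sphere /= jfac_norm; split=> -[Hz H]; split => //; last first.
 by rewrite H sqrtr1.
move: H => /(congr1 (@complex.Re R)) /= H.
by rewrite -[LHS]sqr_sqrtr ?H ?expr1n // ltW // den_gt0.
Qed.

Lemma isom_extE g z : isom_ext g z <-> uhp z /\ 1 < den g z.
Proof.
rewrite /isom_ext /= jfac_norm; split=> -[Hz]; rewrite ltcR => H; split => //.
 by rewrite -(sqr_sqrtr (ltW (den_gt0 g Hz))) exprn_egt1.
by rewrite -sqrtr1 ltr_sqrt // den_gt0.
Qed.

Lemma jfacM g h z : uhp z ->
 (jfac (g * h)%g z) ^+ 2 = (jfac g (mobC h z) * jfac h z) ^+ 2.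
Proof.
move=> Hz; have [s [s2 _ _ Hc Hd]] := mul_entries g h.
have j0 := jfac_neq0 h Hz.
have -> : jfac (g * h)%g z = s%:C%C * (jfac g (mobC h z) * jfac h z).
 rewrite {2}/jfac mulrDl /mobC mulrA divfK //.
 rewrite /jfac /entry -!/(ea _) -!/(eb _) -!/(ec _) -!/(ed _) Hc Hd.
 by rewrite !(rmorphM, rmorphD) /=; ring.
by rewrite exprMn expr2 -rmorphM s2 mul1r.
Qed.

Lemma mobTM g h (v : C * C) : uhp v.1 ->
 mobT (g * h)%g v = mobT g (mobT h v).
Proof.
move=> Hv; rewrite /mobT /= mobCM // jfacM //; congr (_, _).
by rewrite exprMn invfM mulrA mulrAC.
Qed.

Lemma mobT1 v : mobT (1%g : G) v = v.
Proof.
case: v => z u; rewrite /mobT /= mobC1; congr (_, _).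
have [s [s2 _ _ Hc Hd]] := one_entries R.
rewrite /jfac /entry -!/(ec _) -!/(ed _) Hc Hd mulr0 mulr1 mul0r add0r.
by rewrite expr2 -rmorphM s2 divr1.
Qed.

Lemma velocity1 g t : (velocity g t).1 = mobC g (pt 0 (expR t)).
Proof. by []. Qed.

Definition gp g t : C := mobC g (pt 0 (expR t)).

Lemma gp_uhp g t : uhp (gp g t).
Proof. by apply: mobC_uhp; rewrite uhpE /= expR_gt0. Qed.

Lemma mobC_gp g h t : mobC g (gp h t) = gp (g * h)%g t.
Proof. by rewrite /gp mobCM // uhpE /= expR_gt0. Qed.

Lemma mobT_velocity g h t : mobT g (velocity h t) = velocity (g * h)%g t.
Proof. by rewrite /velocity mobTM //= ?uhpE /= expR_gt0. Qed.

(** Right multiplication by this diagonal element is the geodesic flow: it shifts the time parameter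
    by [t]. *)
Definition at_ t : G := mk4 (expR (t / 2)) 0 0 (expR (- (t / 2))).

Lemma at_entries t : eqs (ea (at_ t)) (eb (at_ t)) (ec (at_ t)) (ed (at_ t))
  (expR (t / 2)) 0 0 (expR (- (t / 2))).
Proof. by apply: mk4E; rewrite mulr0 subr0 -expRD subrr expR0. Qed.

Lemma expR_half t : expR (t / 2) * expR (t / 2) = expR t.
Proof. by rewrite -expRD -splitr. Qed.

Lemma velocity_at g s t : velocity (g * at_ t)%g s = velocity g (s + t).
Proof.
rewrite -mobT_velocity /velocity; congr (mobT g _).
have [u [u2 Ha Hb Hc Hd]] := at_entries t.
have Hs : expR (s + t) = expR s * (expR (t / 2) / expR (- (t / 2))).
 by rewrite expRN invrK expR_half expRD.
have e0 : expR (- (t / 2)) != 0 by rewrite gt_eqF ?expR_gt0.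
have u2n : u != 0 by nra; rewrite mulr0 eq_sym oner_neq0.
rewrite /mobT /= /mobC /jfac /entry -!/(ea _) -!/(eb _) -!/(ec _) -!/(ed _).
rewrite Ha Hb Hc Hd !mulr0 !mul0r !add0r addr0 -rmorphXn /=.
have -> : (u * expR (- (t / 2))) ^+ 2 = expR (- (t / 2)) ^+ 2.
 nra.
have E : forall x : R, (0 +i* x)%C = x%:C%C * (0 +i* 1)%C :> C.
 by move=> x; apply: Cext; rewrite /re /im /= !(mul0r, mulr0, mulr1) ?subr0 ?addr0.
congr (_, _); rewrite !(E (expR _)) Hs !rmorphM /=.
 rewrite !fmorphV /=; field.
 by rewrite !fmorph_eq0 u2n e0.
have -> : (expR (t / 2))%:C%C = ((expR (- (t / 2)))%:C%C)^-1 :> C.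
 by rewrite -fmorphV expRN invrK.
by field; rewrite fmorph_eq0.
Qed.

Lemma velocity_at0 g t : velocity (g * at_ t)%g 0 = velocity g t.
Proof. by rewrite velocity_at add0r. Qed.

Lemma gp_at g s t : gp (g * at_ t)%g s = gp g (s + t).
Proof. by rewrite /gp -!velocity1 velocity_at. Qed.

End Action.

Arguments mobC {R} g z : simpl never.

Arguments jfac {R} g z : simpl never.

Arguments entry {R} g i j : simpl never.

(** * Neighbourhoods, continuity and interiors in the plane *)

Section PlaneTopology.
Variable R : realType.
Local Notation C := (Cplx R).
Local Notation G := (PSL2 R).
Implicit Types (g h k : G) (z w : C) (x y t e : R) (U V : set C).

(** Squares instead of the disks of the norm, so that real and imaginary parts can be estimated
    separately. *)
Definition box z e : set C :=
 [set w | `|re w - re z| < e /\ `|im w - im z| < e].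

Lemma nbhs_box z U : nbhs z U <-> exists2 e, 0 < e & box z e `<=` U.
Proof.
have reE (u v : C) : complex.Re (u - v) = re u - re v by case: u v => [? ?] [].
have imE (u v : C) : complex.Im (u - v) = im u - im v by case: u v => [? ?] [].
split.
 move/(@nbhs_ballP C C z U) => [[e e'] /=]; rewrite ltcE /= => /andP[/eqP -> e0] H.
 exists (e / 2); first by rewrite divr_gt0.
 move=> w [H1 H2]; apply: H; rewrite -ball_normE /= norm_Cplx ltcR.
 rewrite /re /im reE imE -(ger0_norm (ltW e0)) -sqrtr_sqr ltr_sqrt; last first.
  by rewrite exprn_gt0.
 move: H1 H2; rewrite !ltr_norml => /andP[? ?] /andP[? ?]; nra.
case=> e e0 H; apply/(@nbhs_ballP C C z U); exists (e%:C%C); first by rewrite /= ltcR.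
move=> w; rewrite -ball_normE /= norm_Cplx ltcR => K; apply: H.
rewrite /re /im reE imE -/(re z) -/(im z) -/(re w) -/(im w) in K.
have K2 : (re z - re w) ^+ 2 + (im z - im w) ^+ 2 < e ^+ 2.
 rewrite -(sqr_sqrtr (addr_ge0 (sqr_ge0 (re z - re w)) (sqr_ge0 (im z - im w)))).
 by rewrite ltr_sqr ?nnegrE ?sqrtr_ge0 ?(ltW e0).
split; rewrite distrC -[X in _ < X]ger0_norm ?(ltW e0) // -ltr_sqr ?nnegrE //=;
 rewrite !real_normK ?num_real //; apply: le_lt_trans K2;
 by rewrite ?lerDl ?lerDr sqr_ge0.
Qed.

Lemma box_nbhs z e : 0 < e -> nbhs z (box z e).
Proof. by move=> e0; apply/nbhs_box; exists e. Qed.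

Lemma cts_re : continuous (@re R : C -> R).
Proof.
move=> z; apply/(@cvgrPdist_lt R R C (nbhs z) _ _ _) => e e0; apply: filterS (box_nbhs z e0) => w [+ _].
by rewrite distrC.
Qed.

Lemma cts_im : continuous (@im R : C -> R).
Proof.
move=> z; apply/(@cvgrPdist_lt R R C (nbhs z) _ _ _) => e e0; apply: filterS (box_nbhs z e0) => w [_ +].
by rewrite distrC.
Qed.

Lemma cvg_sqr (T : Type) (F : set_system T) (FF : Filter F) (f : T -> R) x :
 f @ F --> x -> (fun u : T => f u ^+ 2) @ F --> x ^+ 2.
Proof. by move=> fx; under eq_cvg do rewrite expr2; rewrite expr2; apply: cvgM. Qed.

Ltac cts := repeat lazymatch goal with
 | |- cvg_to _ (nbhs (_ + _)) => apply: cvgD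
 | |- cvg_to _ (nbhs (- _)) => apply: cvgN
 | |- cvg_to _ (nbhs (_ * _)) => apply: cvgM
 | |- cvg_to _ (nbhs (_ ^+ 2)) => apply: cvg_sqr
 | |- _ => first [assumption | exact: cvg_cst]
 end.

Lemma cvg_pt (T : Type) (F : set_system T) (FF : Filter F) (f g : T -> R) x y :
 f @ F --> x -> g @ F --> y -> (fun u : T => pt (f u) (g u)) @ F --> pt x y.
Proof.
move=> fx gy U /nbhs_box[e e0 eU].
have := (proj1 (@cvgrPdist_lt R R _ F FF f x) fx e e0) => Hf; have := (proj1 (@cvgrPdist_lt R R _ F FF g y) gy e e0) => Hg.
change (F [set u | U (pt (f u) (g u))]); apply: filterS2 Hf Hg => t Ht Ht'; apply: eU; rewrite /box /= distrC.
by split=> //; rewrite distrC.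
Qed.

Lemma open_gt0 (f : C -> R) : continuous f -> open [set z | 0 < f z].
Proof.
move=> cf; rewrite -[X in open X]/(f @^-1` [set r | 0 < r]).
by apply: open_comp; [move=> z _; exact: cf|exact: open_gt].
Qed.

Lemma closed_ge0 (f : C -> R) : continuous f -> closed [set z | 0 <= f z].
Proof.
move=> cf; rewrite -[X in closed X]/(f @^-1` [set r | 0 <= r]).
by apply: preimage_closed; [move=> z _; exact: cf|exact: closed_ge].
Qed.

Lemma open_uhp : open (@uhp R).
Proof. exact: open_gt0 cts_im. Qed.

Lemma nbhs_uhp z : uhp z -> nbhs z (@uhp R).
Proof. by move=> Hz; apply: open_nbhs_nbhs; split=> //; exact: open_uhp. Qed.

(* Going through an abstract filter keeps the structure on C out of the
  unification problems. *)
Lemma cts_reim (f : R -> R -> R) :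
 (forall (T : Type) (F : set_system T) (FF : Filter F) (u v : T -> R) x y,
   u @ F --> x -> v @ F --> y -> (fun a : T => f (u a) (v a)) @ F --> f x y) ->
 continuous (fun z : C => f (re z) (im z)).
Proof.
move=> H z; have Hr : (@re R) @ nbhs z --> re z by exact: cts_re.
have Hi : (@im R) @ nbhs z --> im z by exact: cts_im.
exact: (H C (nbhs z) (@nbhs_filter C z) (@re R) (@im R) (re z) (im z) Hr Hi).
Qed.

Lemma cts_qf g : continuous (qf g : C -> R).
Proof.
apply: (@cts_reim (fun x y => ea g * ec g * (x ^+ 2 + y ^+ 2)
 + (ea g * ed g + eb g * ec g) * x + eb g * ed g)) => *; cts.
Qed.

Lemma cts_den g : continuous (den g : C -> R).
Proof.
by apply: (@cts_reim (fun x y => (ec g * x + ed g) ^+ 2 + (ec g * y) ^+ 2)) => *; cts.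
Qed.

Lemma cvg_mobC g (F : set_system C) (FF : Filter F) x y t : t != 0 ->
 qf g @ F --> x -> (@im R) @ F --> y -> den g @ F --> t ->
 mobC g @ F --> pt (x / t) (y / t).
Proof.
move=> t0 Fq Fi Fd.
have -> : mobC g = (fun w => pt (qf g w / den g w) (im w / den g w)).
 by apply/funext => w; apply: Cext; rewrite /= ?mobC_re ?mobC_im.
by apply: cvg_pt; apply: cvgM => //; apply: cvgV.
Qed.

Lemma cts_mobC g z : uhp z -> mobC g x @[x --> z] --> mobC g z.
Proof.
move=> Hz; have -> : mobC g z = pt (qf g z / den g z) (im z / den g z).
 by apply: Cext; rewrite /= ?mobC_re ?mobC_im.
apply: (@cvg_mobC g (nbhs z) (@nbhs_filter C z)); first exact: den_neq0.
- exact: cts_qf.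
- exact: cts_im.
- exact: cts_den.
Qed.

Lemma cts_gp g : continuous (gp g : R -> C).
Proof.
move=> t; rewrite /gp; apply: (@cvg_comp _ _ _ (fun t => pt 0 (expR t)) (mobC g));
 last by apply: cts_mobC; rewrite uhpE expR_gt0.
by apply: cvg_pt; [exact: cvg_cst|exact: continuous_expR].
Qed.

(** The formula for [mobC] is a homeomorphism only on the half plane, hence the restriction on [V].
    One inclusion, proved for all elements, is applied to [g] and to its inverse. *)
Lemma interior_mobC g V : V `<=` uhp -> (mobC g @` V)^° = mobC g @` (V^°).
Proof.
have sub h U : U `<=` uhp -> mobC h @` (U^°) `<=` (mobC h @` U)^°.
 move=> HU _ [z Hz <-]; have Uz : uhp z by apply: HU; exact: interior_subset Hz.
 have := @cts_mobC h^-1%g (mobC h z) (mobC_uhp h Uz); rewrite mobCK // => /(_ _ Hz).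
 move=> K; rewrite /interior; near=> w.
 have Hw : uhp w by near: w; apply: nbhs_uhp; exact: mobC_uhp.
 exists (mobC h^-1%g w); last by rewrite mobCKV.
 by near: w; exact: K.
move=> HV; apply/seteqP; split; last exact: sub.
move=> z Hz; have Uz : uhp z.
 by have [w Vw <-] := interior_subset Hz; apply: mobC_uhp; exact: HV.
exists (mobC g^-1%g z); last by rewrite mobCKV.
have H : mobC g @` V `<=` uhp by move=> _ [w /HV Hw <-]; exact: mobC_uhp.
have := sub g^-1%g _ H (mobC g^-1%g z) (ex_intro2 _ _ z Hz erefl).
apply: interiorS => _ [_ [w Vw <-] <-]; rewrite mobCK //; exact: HV.
Unshelve. all: by end_near. Qed.

Lemma closureHP V z : closureH V z <->
 uhp z /\ forall e, 0 < e -> exists2 w, V w & box z e w.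
Proof.
split.
 case=> clV Hz; split=> // e e0.
 by have [w [Vw zw]] := clV _ (box_nbhs z e0); exists w.
case=> Hz H; split=> // U /nbhs_box[e e0 eU].
by have [w Vw zw] := H e e0; exists w; split=> //; exact: eU.
Qed.

End PlaneTopology.

(** * Geodesics as oriented lines with two half planes *)

Section Lines.
Variable R : realType.
Local Notation C := (Cplx R).
Local Notation G := (PSL2 R).
Implicit Types (g h k m : G) (z w : C) (x y s t e : R) (U V : set C).

Lemma velocity_1 : velocity (1%g : G) 0 = (pt 0 1, pt 0 1).
Proof. by rewrite /velocity mobT1 expR0. Qed.

Lemma sqr1_re (u : C) : u ^+ 2 = 1 ->
 re u ^+ 2 - im u ^+ 2 = 1 /\ re u * im u = 0.
Proof.
case: u => a b /(congr1 (fun z : C => (re z, im z))).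
rewrite expr2 /re /im /= => -[H1 H2]; split; first by rewrite -H1; ring.
by lra.
Qed.

(** Fixing the upward unit vector at [i] gives [(ci + d)^2 = 1], so [c = 0] and [d] is a sign;
    fixing the point [i] then forces [b = 0]. *)
Lemma velocity_eq1 k : velocity k 0 = velocity 1%g 0 -> k = 1%g.
Proof.
rewrite velocity_1 /velocity expR0 => H.
have H1 : mobC k (pt 0 1) = pt 0 1 := congr1 fst H.
have H2 : pt 0 1 / jfac k (pt 0 1) ^+ 2 = pt 0 1 := congr1 snd H.
have i0 : pt 0 1 != 0 :> C.
 by apply/eqP => /(congr1 (@im R)) /eqP; rewrite /= oner_eq0.
have J : jfac k (pt 0 1) ^+ 2 = 1.
 apply: invr_inj; rewrite invr1; apply: (mulfI i0); rewrite mulr1; exact: H2.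
have [] := sqr1_re J; rewrite jfac_re jfac_im /= mulr0 add0r mulr1 => J1 J2.
have c0 : ec k = 0.
 apply/eqP; move/eqP: J2; rewrite mulf_eq0 => /orP[/eqP d0|//].
 by move: J1; rewrite d0; nra.
have d1 : ed k * ed k = 1 by move: J1; rewrite c0; lra.
have dt := edet k; rewrite c0 mulr0 subr0 in dt.
have := congr1 (@re R) H1; rewrite mobC_re /den /qf /= c0.
rewrite !(mul0r, mulr0, add0r, addr0) expr0n addr0 /= => /eqP.
rewrite mulf_eq0 invr_eq0 expf_eq0 /= mulf_eq0.
have d0 : ed k != 0 by apply/eqP => d0; move: d1; rewrite d0; lra.
rewrite (negPf d0) !orbF => /eqP b0.
have [s [s2 Ha Hb Hc Hd]] := one_entries R.
apply: eqsP; rewrite Ha Hb Hc Hd; exists (ed k * s); split.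
- nra.
- nra.
- by rewrite !mulr0.
- by rewrite !mulr0.
- nra.
Qed.

Lemma velocity_inj g h : velocity g 0 = velocity h 0 -> g = h.
Proof.
move=> H; suff : (h^-1 * g = 1)%g.
 by move=> /(congr1 (fun k => h * k)%g); rewrite mulVKg mulg1.
by apply: velocity_eq1; rewrite -mobT_velocity H mobT_velocity mulVg.
Qed.

Lemma SH_velocity g t : SH (velocity g t).
Proof.
have iu : uhp (pt 0 (expR t) : C) by rewrite uhpE /= expR_gt0.
split; first exact: gp_uhp.
have -> : complex.Im (velocity g t).1 = expR t / den g (pt 0 (expR t)).
 exact: (mobC_im g (pt 0 (expR t))).
rewrite normrM normfV normrX jfac_norm norm_Cplx re_pt im_pt.
rewrite -rmorphXn -fmorphV -rmorphM sqr_sqrtr ?(ltW (den_gt0 _ _)) //.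
by rewrite expr0n add0r sqrtr_sqr ger0_norm // expR_ge0.
Qed.

Lemma SH_exists (v : C * C) : SH v -> exists g, velocity g 0 = v.
Proof.
case: v => z u [/= Hz Hu]; set y := im z.
have u0 : u != 0.
 by rewrite -normr_eq0 Hu; apply/eqP => /(congr1 (@re R)); apply/eqP; rewrite gt_eqF.
(* Iwasawa decomposition. The automorphy factor is squared in [mobT], so a rotation about [i] built
   from a square root turns the upward vector into the direction of [u]; a triangular element then
   moves [i] to [z]. *)
pose q : C := sqrtC (pt 0 y / u).
have q2 : q ^+ 2 = pt 0 y / u by rewrite sqrtCK.
have nq : re q ^+ 2 + im q ^+ 2 = 1.
 have : `|q| ^+ 2 = 1.
  rewrite -normrX q2 normrM normfV Hu norm_Cplx /= expr0n add0r.
  rewrite sqrtr_sqr gtr0_norm // -/(im z) -/y divff //.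
  by apply/eqP => /(congr1 (@re R)); apply/eqP; rewrite gt_eqF.
 rewrite norm_Cplx -rmorphXn /= sqr_sqrtr ?addr_ge0 ?sqr_ge0 //.
 by move=> /(congr1 (@re R)).
pose k := mk4 (re q) (- im q) (im q) (re q).
have [s [s2 ka kb kc kd]] : eqs (ea k) (eb k) (ec k) (ed k)
  (re q) (- im q) (im q) (re q) by apply: mk4E; rewrite -nq; ring.
pose r := Num.sqrt y; have r2 : r * r = y by rewrite -expr2 sqr_sqrtr // ltW.
have r0 : r != 0 by rewrite gt_eqF // sqrtr_gt0.
pose n := mk4 r (re z / r) 0 r^-1.
have [s' [s2' na nb nc nd]] : eqs (ea n) (eb n) (ec n) (ed n) r (re z / r) 0 r^-1.
 by apply: mk4E; rewrite mulr0 subr0 divff.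
have s0 : s' != 0 by apply/eqP => u1; move: s2'; rewrite u1; lra.
exists (n * k)%g; rewrite -mobT_velocity /velocity expR0.
have -> : mobT k (pt 0 1, pt 0 1) = (pt 0 1, pt 0 1 / q ^+ 2).
 rewrite /mobT /=; congr (_, _ / _).
  apply: Cext; rewrite ?mobC_re ?mobC_im /den /qf ?ka ?kb ?kc ?kd /=.
   apply/eqP; rewrite mulf_eq0; apply/orP; left; apply/eqP; ring.
  rewrite (_ : _ + _ = s * s * (re q ^+ 2 + im q ^+ 2)); last by ring.
  by rewrite s2 nq mulr1 divr1.
 have -> : jfac k (pt 0 1) = s%:C%C * q.
  by apply: Cext; rewrite ?jfac_re ?jfac_im ?kc ?kd; case: (q) => a b; rewrite /re /im /=; ring.
 by rewrite exprMn expr2 -rmorphM s2 mul1r.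
rewrite /mobT /=; congr (_, _).
 apply: Cext; rewrite ?mobC_re ?mobC_im /den /qf ?na ?nb ?nc ?nd /=.
  rewrite !(mulr0, mul0r, add0r, addr0) expr0n addr0 /=; field.
  by rewrite r0 s0.
 rewrite !(mulr0, mul0r, add0r, addr0) expr0n addr0 /= exprMn [s' ^+ 2]expr2 s2'.
 lra.
have -> : jfac n (pt 0 1) ^+ 2 = (y^-1)%:C%C.
 have -> : jfac n (pt 0 1) = (s' / r)%:C%C.
  by apply: Cext; rewrite ?jfac_re ?jfac_im ?nc ?nd /= /re /im /=; ring.
 by rewrite -rmorphXn /= expr2 mulrACA s2' mul1r -invfM r2.
have q0 : q ^+ 2 != 0.
 rewrite q2 mulf_neq0 ?invr_eq0 //.
 by apply/eqP => /(congr1 (@im R)); apply/eqP; rewrite gt_eqF.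
have yE : (y^-1)%:C%C = (y%:C%C)^-1 :> C by exact: fmorphV.
have iE : pt 0 y = pt 0 1 * y%:C%C :> C.
 by apply: Cext; rewrite /re /im /=; ring.
rewrite yE invrK q2 iE; field; rewrite u0 fmorph_eq0 gt_eqF //=.
by apply/eqP => /(congr1 (@im R)); apply/eqP; rewrite oner_neq0.
Qed.

(** On the imaginary axis [qf m] is [al m * y^2 + be m]. The signs of [al m] and [be m] tell on
    which side of the axis the images of infinity and of 0 under [m] lie. *)
Definition al m : R := ea m * ec m.

Definition be m : R := eb m * ed m.

Lemma qf_axis m y : qf m (pt 0 y) = al m * y ^+ 2 + be m.
Proof. by rewrite /qf /al /be /= expr0n mulr0 add0r addr0. Qed.

(** The equation of the oriented geodesic [k]: it has the sign of [Re (k^-1 z)]. Keeping the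
    numerator only makes it a polynomial that can also be evaluated at real points, hence at ideal
    end points. *)
Definition side_ k z : R := qf k^-1%g z.

Definition line k : set C := [set z | uhp z /\ side_ k z = 0].

Definition hpl k : set C := [set z | uhp z /\ 0 < side_ k z].

Definition chpl k : set C := [set z | uhp z /\ 0 <= side_ k z].

(** The half turn about [i]. Multiplied on the right it reverses a geodesic and exchanges its
    sides. *)
Definition Sop : G := mk4 0 (-1) 1 0.

Lemma Sop_entries : eqs (ea Sop) (eb Sop) (ec Sop) (ed Sop) 0 (-1) 1 0.
Proof. by apply: mk4E; ring. Qed.

(** The source of all sign arguments: up to a positive factor the equation of a line is affine in
    [e^(2t)] along any geodesic, so it has at most one zero unless it vanishes identically. *)
Lemma side_gp k h t :
 side_ k (gp h t) * den h (pt 0 (expR t))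
 = al (k^-1 * h)%g * expR t ^+ 2 + be (k^-1 * h)%g.
Proof. by rewrite -qf_axis qfM // uhpE /= expR_gt0. Qed.

Lemma den_axis_gt0 h t : 0 < den h (pt 0 (expR t)).
Proof. by apply: den_gt0; rewrite uhpE /= expR_gt0. Qed.

Lemma side_gp_gt0 k h t : (0 < side_ k (gp h t)) =
 (0 < al (k^-1 * h)%g * expR t ^+ 2 + be (k^-1 * h)%g).
Proof. by rewrite -side_gp pmulr_lgt0 // den_axis_gt0. Qed.

Lemma side_gp_ge0 k h t : (0 <= side_ k (gp h t)) =
 (0 <= al (k^-1 * h)%g * expR t ^+ 2 + be (k^-1 * h)%g).
Proof. by rewrite -side_gp pmulr_lge0 // den_axis_gt0. Qed.

Lemma side_gp_eq0 k h t : (side_ k (gp h t) == 0) =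
 (al (k^-1 * h)%g * expR t ^+ 2 + be (k^-1 * h)%g == 0).
Proof. by rewrite -side_gp mulf_eq0 [X in _ || X]gt_eqF ?orbF // den_axis_gt0. Qed.

Lemma side_mobC g k z : uhp z ->
 side_ (g * k)%g (mobC g z) = side_ k z / den g z.
Proof.
move=> Hz; rewrite /side_ invgM qfM ?mobCK ?denV //; exact: mobC_uhp.
Qed.

Lemma side_gt0_mobC g k z : uhp z ->
 (0 < side_ (g * k)%g (mobC g z)) = (0 < side_ k z).
Proof. by move=> Hz; rewrite side_mobC // pmulr_lgt0 // invr_gt0 den_gt0. Qed.

Lemma side_ge0_mobC g k z : uhp z ->
 (0 <= side_ (g * k)%g (mobC g z)) = (0 <= side_ k z).
Proof. by move=> Hz; rewrite side_mobC // pmulr_lge0 // invr_gt0 den_gt0. Qed.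

Lemma side_eq0_mobC g k z : uhp z ->
 (side_ (g * k)%g (mobC g z) == 0) = (side_ k z == 0).
Proof.
by move=> Hz; rewrite side_mobC // mulf_eq0 invr_eq0 [X in _ || X]gt_eqF ?orbF // den_gt0.
Qed.

Let mob_set g (P Q : set C) : (forall z, P z -> uhp z) ->
 (forall z, Q z -> uhp z) ->
 (forall z, uhp z -> (Q (mobC g z) <-> P z)) -> mobC g @` P = Q.
Proof.
move=> HP HQ H; apply/seteqP; split=> [_ [z Pz <-]|z Qz]; first by apply/H; auto.
have uz := HQ _ Qz; exists (mobC g^-1%g z); last by rewrite mobCKV.
by apply/H; [exact: mobC_uhp|rewrite mobCKV].
Qed.

Lemma line_mobC g k : mobC g @` line k = line (g * k)%g.
Proof.
apply: mob_set => [z []|z []|z Hz] //; rewrite /line /=.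
have E := side_eq0_mobC g k Hz.
split=> -[_ /eqP H]; split; [exact: Hz| |exact: mobC_uhp|]; apply/eqP.
 by rewrite -E.
by rewrite E.
Qed.

Lemma hpl_mobC g k : mobC g @` hpl k = hpl (g * k)%g.
Proof.
apply: mob_set => [z []|z []|z Hz] //; rewrite /hpl /=.
by split=> -[_]; rewrite side_gt0_mobC // => ?; split=> //; exact: mobC_uhp.
Qed.

Lemma side_Sop k z : uhp z -> side_ (k * Sop)%g z = - side_ k z.
Proof.
move=> Hz; rewrite /side_ invgM qfM //.
have [s [s2 Ha Hb Hc Hd]] := Sop_entries.
have [s' [s2' Ha' Hb' Hc' Hd']] := inv_entries Sop.
have -> : forall w, qf Sop^-1%g w = - re w.
 move=> w; rewrite /qf Ha' Hb' Hc' Hd' Ha Hb Hc Hd.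
 transitivity (- (s * s) * (s' * s') * re w); first by ring.
 by rewrite s2 s2'; ring.
by rewrite mobC_re mulNr divfK // den_neq0.
Qed.

Lemma line_Sop k : line (k * Sop)%g = line k.
Proof.
apply/seteqP; split=> z [Hz]; rewrite /line /= side_Sop // => H; split=> //.
 by rewrite -[LHS]opprK H oppr0.
by rewrite H oppr0.
Qed.

Lemma gp_line k t : line k (gp k t).
Proof.
split; first exact: gp_uhp.
apply/eqP; rewrite side_gp_eq0 mulVg /al /be.
by have [s [s2 -> -> -> ->]] := one_entries R; rewrite !(mulr0, mul0r, addr0).
Qed.

Lemma lineP k z : line k z -> exists t, gp k t = z.
Proof.
case=> Hz Hs; exists (ln (im (mobC k^-1%g z))).
have Hu := mobC_uhp k^-1%g Hz; rewrite uhpE in Hu.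
rewrite /gp lnK ?posrE // -[RHS](mobCKV k Hz); congr (mobC k _).
by apply: Cext => //=; rewrite mobC_re -/(side_ k z) Hs mul0r.
Qed.

Lemma geod_fin g t : geod g t%:E = Some (gp g t).
Proof.
rewrite /geod /= /gp -/(pt 0 (expR t)) ifN //.
by apply: jfac_neq0; rewrite uhpE /= expR_gt0.
Qed.

Lemma re_real_uhp (u : C) : im u = 0 -> ~ uhp u.
Proof. by rewrite uhpE => ->; rewrite ltxx. Qed.

Lemma geod_pinf g : geod g +oo = if ec g == 0 then None else Some (pt (ea g / ec g) 0).
Proof.
rewrite /geod /=; have -> : (entry g 1 0 == 0) = (ec g == 0).
 by rewrite /entry -/(ec g) fmorph_eq0.
case: ifP => // c0; congr Some; rewrite /entry -/(ec g) -/(ea g) -fmorph_div.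
by [].
Qed.

Lemma geod_ninf g : geod g -oo = if ed g == 0 then None else Some (pt (eb g / ed g) 0).
Proof.
rewrite /geod /= /mobC; have E : jfac g 0 = (ed g)%:C%C by rewrite /jfac mulr0 add0r.
rewrite E fmorph_eq0; case: ifP => // d0; congr Some.
by rewrite mulr0 add0r /entry -/(eb g) -fmorph_div.
Qed.

Lemma geod_uhp g r z : uhp z -> geod g r = Some z -> exists2 t, r = t%:E & gp g t = z.
Proof.
case: r => [t||] Hz.
- by rewrite geod_fin => -[<-]; exists t.
- by rewrite geod_pinf; case: ifP => // _ [E]; move: Hz; rewrite -E => /re_real_uhp; case.
- by rewrite geod_ninf; case: ifP => // _ [E]; move: Hz; rewrite -E => /re_real_uhp; case.
Qed.

Lemma segP z w u : uhp z -> uhp w -> seg (Some z) (Some w) u <->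
 exists g s t r, [/\ gp g s = z, gp g t = w, s <= r <= t & gp g r = u].
Proof.
move=> Hz Hw; split.
 case=> g [s [t [r [/(geod_uhp Hz)[s' -> E1] /(geod_uhp Hw)[t' -> E2]]]]].
 by rewrite !lee_fin geod_fin => H -[E3]; exists g, s', t', r.
case=> g [s [t [r [E1 E2 H E3]]]]; exists g, s%:E, t%:E, r.
by rewrite !geod_fin E1 E2 E3 !lee_fin.
Qed.

Lemma affine_between (a b X Y Z : R) : X <= Y <= Z ->
 0 <= a * X + b -> 0 <= a * Z + b -> 0 <= a * Y + b.
Proof. by move=> /andP[]; have [?|?] := leP 0 a; nra. Qed.

Lemma affine_between_gt (a b X Y Z : R) : X <= Y <= Z ->
 0 < a * X + b -> 0 < a * Z + b -> 0 < a * Y + b.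
Proof. by move=> /andP[]; have [?|?] := leP 0 a; nra. Qed.

Lemma expR2_mono s t : (expR s ^+ 2 <= expR t ^+ 2) = (s <= t).
Proof. by rewrite ler_sqr ?nnegrE ?expR_ge0 // ler_expR. Qed.

Lemma expR2_lt s t : (expR s ^+ 2 < expR t ^+ 2) = (s < t).
Proof. by rewrite ltr_sqr ?nnegrE ?expR_ge0 // ltr_expR. Qed.

Lemma hconvex_chpl k : hconvex (chpl k).
Proof.
split=> [z []//|z w [Hz Sz] [Hw Sw] u /(segP _ Hz Hw)[g [s [t [r [E1 E2 /andP[H1 H2] E3]]]]]].
rewrite -E1 side_gp_ge0 in Sz; rewrite -E2 side_gp_ge0 in Sw.
split; first by rewrite -E3; exact: gp_uhp.
rewrite -E3 side_gp_ge0; apply: affine_between Sz Sw.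
by rewrite !expR2_mono H1 H2.
Qed.

Lemma hconvex_hpl k : hconvex (hpl k).
Proof.
split=> [z []//|z w [Hz Sz] [Hw Sw] u /(segP _ Hz Hw)[g [s [t [r [E1 E2 /andP[H1 H2] E3]]]]]].
rewrite -E1 side_gp_gt0 in Sz; rewrite -E2 side_gp_gt0 in Sw.
split; first by rewrite -E3; exact: gp_uhp.
rewrite -E3 side_gp_gt0; apply: affine_between_gt Sz Sw.
by rewrite !expR2_mono H1 H2.
Qed.

Lemma hconvexI U V : hconvex U -> hconvex V -> hconvex (U `&` V).
Proof.
move=> [HU cU] [HV cV]; split=> [z [/HU]//|z w [Uz Vz] [Uw Vw] u su].
by split; [exact: cU su|exact: cV su].
Qed.

Lemma hconvex_line k : hconvex (line k).
Proof.
have -> : line k = chpl k `&` chpl (k * Sop)%g.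
 apply/seteqP; split=> z.
  by case=> Hz H; split; split=> //; rewrite ?side_Sop // H ?oppr0.
 case=> -[Hz H1] [_]; rewrite side_Sop // oppr_ge0 => H2; split=> //.
 by apply/le_anti; rewrite H1 H2.
by apply: hconvexI; exact: hconvex_chpl.
Qed.

End Lines.

Arguments Sop {R}.

Lemma pigeonhole (T : eqType) (s : seq T) (f : nat -> T) :
 (forall n, f n \in s) -> exists m n, (m < n)%N /\ f m = f n.
Proof.
move=> H; apply: contrapT => K.
have U : uniq (map f (iota 0 (size s).+1)).
 rewrite map_inj_in_uniq ?iota_uniq // => m n _ _ E; apply: contrapT => /eqP.
 by rewrite neq_ltn => /orP[?|?]; apply: K; [exists m, n|exists n, m].
have := uniq_leq_size U; rewrite size_map size_iota => /(_ s) F.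
suff : (size s < size s)%N by rewrite ltnn.
by apply: F => _ /mapP[n _ ->].
Qed.

Lemma pigeonhole_ex (T : eqType) (s : seq T) (P : nat -> T -> Prop) :
 (forall n, exists2 x, x \in s & P n x) ->
 exists m n x, [/\ (m < n)%N, x \in s, P m x & P n x].
Proof.
move=> H; have [f Hf] := choice (fun n => let: ex_intro2 x a b := H n in
 ex_intro (fun x => x \in s /\ P n x) x (conj a b)).
have [m [n [mn E]]] := pigeonhole (fun n => proj1 (Hf n)).
by exists m, n, (f m); split=> //; [case: (Hf m)|case: (Hf m)|rewrite E; case: (Hf n)].
Qed.

(** * Finite intersections of half planes and their sides *)

Section Polygons.
Variable R : realType.
Local Notation C := (Cplx R).
Local Notation G := (PSL2 R).
Implicit Types (g h k m : G) (z w u v : C) (x y s t e r : R) (U V D b : set C).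

Definition vert x : G := mk4 1 x 0 1.

Lemma vert_entries x : eqs (ea (vert x)) (eb (vert x)) (ec (vert x)) (ed (vert x))
 1 x 0 1.
Proof. by apply: mk4E; ring. Qed.

Lemma side_vert x z : side_ (vert x) z = re z - x.
Proof.
have [s [s2 Ha Hb Hc Hd]] := vert_entries x.
have [s' [s2' Ha' Hb' Hc' Hd']] := inv_entries (vert x).
rewrite /side_ /qf Ha' Hb' Hc' Hd' Ha Hb Hc Hd.
transitivity ((s * s) * (s' * s') * (re z - x)); first by ring.
by rewrite s2 s2'; ring.
Qed.

(** The semicircle of centre [c] and radius [r], with the inside as its positive side; infinity goes
    to [c + r] and 0 to [c - r]. *)
Definition circ c r : G :=
 mk4 ((c + r) / Num.sqrt (2 * r)) ((c - r) / Num.sqrt (2 * r))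
   (Num.sqrt (2 * r))^-1 (Num.sqrt (2 * r))^-1.

Lemma side_circ c r z : 0 < r ->
 side_ (circ c r) z = (r ^+ 2 - ((re z - c) ^+ 2 + im z ^+ 2)) / (2 * r).
Proof.
move=> r0; set n := Num.sqrt (2 * r).
have n2 : n * n = 2 * r by rewrite -expr2 sqr_sqrtr // mulr_ge0 // ltW.
have n0 : n != 0 by nra.
have [s [s2 Ha Hb Hc Hd]] : eqs (ea (circ c r)) (eb (circ c r)) (ec (circ c r))
  (ed (circ c r)) ((c + r) / n) ((c - r) / n) n^-1 n^-1.
 apply: mk4E; transitivity (2 * r / (n * n)); first by rewrite -/n; field.
 by rewrite n2 divff // mulf_neq0 ?gt_eqF.
have [s' [s2' Ha' Hb' Hc' Hd']] := inv_entries (circ c r).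
rewrite /side_ /qf Ha' Hb' Hc' Hd' Ha Hb Hc Hd -n2.
transitivity ((s * s) * (s' * s') * ((r ^+ 2 - ((re z - c) ^+ 2 + im z ^+ 2)) / (n * n))).
 by field.
by rewrite s2 s2'; ring.
Qed.

Lemma gp_Sop k t : gp (k * Sop)%g t = gp k (- t).
Proof.
rewrite -mobC_gp; congr (mobC k _).
have [s [s2 Ha Hb Hc Hd]] := Sop_entries R.
rewrite /gp; apply: Cext; rewrite ?mobC_re ?mobC_im /qf /den ?Ha ?Hb ?Hc ?Hd /=.
 lra.
rewrite !(mulr0, mul0r, addr0, add0r, mulr1) expr0n add0r expRN exprMn.
by rewrite [s ^+ 2]expr2 s2 mul1r expr2 invfM mulrA divff ?mul1r // gt_eqF ?expR_gt0.
Qed.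

Lemma join_ex z w : uhp z -> uhp w ->
 exists k s t, [/\ gp k s = z, gp k t = w & s <= t].
Proof.
move=> Hz Hw; have [k [Lz Lw]] : exists k, line k z /\ line k w.
 have [E|N] := eqVneq (re z) (re w).
  exists (vert (re z)).
  by split; split=> //; rewrite side_vert ?subrr // -E subrr.
 (* The real point at equal Euclidean distance from [z] and [w]. *)
 pose c := ((re w ^+ 2 + im w ^+ 2) - (re z ^+ 2 + im z ^+ 2))
   / (2 * (re w - re z)).
 pose r := Num.sqrt ((re z - c) ^+ 2 + im z ^+ 2).
 have z2 : 0 < (re z - c) ^+ 2 + im z ^+ 2.
  by rewrite ltr_wpDl ?sqr_ge0 // exprn_gt0.
 have r0 : 0 < r by rewrite sqrtr_gt0.
 have r2 : r ^+ 2 = (re z - c) ^+ 2 + im z ^+ 2 by rewrite sqr_sqrtr // ltW.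
 exists (circ c r); split; split=> //; rewrite side_circ // r2 ?subrr ?mul0r //.
 apply/eqP; rewrite mulf_eq0; apply/orP; left; apply/eqP.
 by rewrite /c; field; rewrite subr_eq0 eq_sym.
have [s Es] := lineP Lz; have [t Et] := lineP Lw.
have [st|ts] := leP s t; first by exists k, s, t.
exists (k * Sop)%g, (- s), (- t); rewrite !gp_Sop !opprK.
by split=> //; rewrite lerN2 ltW.
Qed.

Lemma gp_inj k : injective (gp k).
Proof.
move=> s t E; have : mobC k^-1%g (gp k s) = mobC k^-1%g (gp k t) by rewrite E.
rewrite /gp !mobCK ?uhpE /= ?expR_gt0 // => /(congr1 (@im R)) /=.
exact: expR_inj.
Qed.

Lemma hconvex_gp V k s t r : hconvex V -> V (gp k s) -> V (gp k t) ->
 s <= r <= t -> V (gp k r).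
Proof.
move=> [HV cV] Vs Vt H; apply: (cV _ _ Vs Vt).
by apply/segP; try exact: gp_uhp; exists k, s, t, r.
Qed.

(** [ac = 0] and [bd = 0] with determinant 1 leave a diagonal or an antidiagonal matrix: the
    stabilizer of the imaginary axis. Hence two elements with the same line differ by the flow and
    possibly the half turn. *)
Lemma diag_or_anti m : al m = 0 -> be m = 0 ->
 (exists t, m = at_ t) \/ (exists t, m = (Sop * at_ t)%g).
Proof.
rewrite /al /be => H1 H2; have dt := edet m.
have L (x : R) : x != 0 -> expR (ln (x ^+ 2) / 2) = `|x|.
 move=> x0; rewrite -[RHS]lnK ?posrE ?normr_gt0 //; congr expR.
 by rewrite -real_normK ?num_real // expr2 lnM ?posrE ?normr_gt0 //; field.
have sg (x : R) : x != 0 -> exists s, [/\ s * s = 1, x = s * `|x| & x^-1 = s * `|x|^-1].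
 move=> x0; exists (Num.sg x).
 split; [by rewrite -expr2 sqr_sg x0|by rewrite -numEsg|].
 by rewrite normrEsg invfM mulrA divff ?mul1r // sgr_eq0.
have [c0|c0] := eqVneq (ec m) 0.
 rewrite c0 mulr0 subr0 in dt.
 have a0 : ea m != 0 by apply: contra_eq_neq dt => ->; rewrite mul0r eq_sym oner_neq0.
 have d0 : ed m = (ea m)^-1 by apply: (mulfI a0); rewrite dt divff.
 have b0 : eb m = 0.
  by apply/eqP; move/eqP: H2; rewrite mulf_eq0 d0 invr_eq0 (negPf a0) orbF.
 left; exists (ln (ea m ^+ 2)); apply: eqsP.
 have [s [s2 -> -> -> ->]] := at_entries (ln (ea m ^+ 2)).
 have [s' [s2' E1 E2]] := sg _ a0.
 have S0 (u : R) : s' * u = s' * s * (s * u) by rewrite mulrA -[s' * s * s]mulrA s2 mulr1.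
 exists (s' * s); rewrite c0 b0 !mulr0 d0 expRN L // -!S0; split=> //.
 by rewrite mulrACA s2 s2' mulr1.
have a0 : ea m = 0 by apply/eqP; move/eqP: H1; rewrite mulf_eq0 (negPf c0) orbF.
rewrite a0 mul0r sub0r in dt.
have b0 : eb m = - (ec m)^-1 by apply: (mulIf c0); rewrite mulNr mulVf // -dt opprK.
have d0 : ed m = 0.
 apply/eqP; move/eqP: H2; rewrite mulf_eq0 b0 oppr_eq0 invr_eq0 (negPf c0).
 by [].
right; exists (ln (ec m ^+ 2)); apply: eqsP.
have [s0 [s02 -> -> -> ->]] := mul_entries Sop (at_ (ln (ec m ^+ 2))).
have [s [s2 -> -> -> ->]] := at_entries (ln (ec m ^+ 2)).
have [s1 [s12 -> -> -> ->]] := Sop_entries R.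
have [s' [s2' E1 E2]] := sg _ c0.
exists (s' * s * s0 * s1); rewrite a0 b0 d0 expRN L // E2.
have K : s' * s * s0 * s1 * (s0 * (s1 * s)) = s'.
 transitivity (s' * (s * s) * (s0 * s0) * (s1 * s1)); first by ring.
 by rewrite s2 s02 s12 !mulr1.
split; [|by ring| |rewrite [LHS]E1 -{1}K; ring|by ring].
 transitivity ((s' * s') * (s * s) * (s0 * s0) * (s1 * s1)); first by ring.
 by rewrite s2 s02 s12 s2' !mulr1.
by rewrite -{1}K; ring.
Qed.

Lemma line_two k k' z w : z <> w -> line k z -> line k w -> line k' z ->
 line k' w -> al (k'^-1 * k)%g = 0 /\ be (k'^-1 * k)%g = 0.
Proof.
move=> zw /lineP[s Es] /lineP[t Et] [_ /eqP] + [_ /eqP].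
rewrite -Es -Et !side_gp_eq0 => /eqP H1 /eqP H2.
have st : expR s ^+ 2 - expR t ^+ 2 != 0.
 rewrite subr_eq0 eqrXn2 ?expR_ge0 //; apply/eqP => /expR_inj E; apply: zw.
 by rewrite -Es -Et E.
have : al (k'^-1 * k)%g * (expR s ^+ 2 - expR t ^+ 2) = 0 by move: H1 H2; lra.
move/eqP; rewrite mulf_eq0 (negPf st) orbF => /eqP a0; split=> //.
by move: H1; rewrite a0 mul0r add0r.
Qed.

Lemma same_line k k' : al (k'^-1 * k)%g = 0 -> be (k'^-1 * k)%g = 0 ->
 (exists t, k = (k' * at_ t)%g) \/ (exists t, k = (k' * Sop * at_ t)%g).
Proof.
move=> a0 b0; have [[t E]|[t E]] := diag_or_anti a0 b0; [left|right]; exists t.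
 by rewrite -E mulVKg.
by rewrite -mulgA -E mulVKg.
Qed.

Lemma side_at k t z : uhp z -> side_ (k * at_ t)%g z = side_ k z.
Proof.
move=> Hz; rewrite /side_ invgM qfM //.
have [s [s2 Ha Hb Hc Hd]] := at_entries t.
have [s' [s2' Ha' Hb' Hc' Hd']] := inv_entries (at_ t).
have E : forall w, qf (at_ t)^-1%g w = re w.
 move=> w; rewrite /qf Ha' Hb' Hc' Hd' Ha Hb Hc Hd.
 transitivity ((s * s) * (s' * s') * (expR (- (t / 2)) * expR (t / 2)) * re w).
  by ring.
 by rewrite s2 s2' -expRD addNr expR0; ring.
by rewrite E mobC_re divfK // den_neq0.
Qed.

Lemma line_at k t : line (k * at_ t)%g = line k.
Proof. by apply/seteqP; split=> z [Hz H]; split=> //; move: H; rewrite side_at. Qed.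

Lemma hpl_at k t : hpl (k * at_ t)%g = hpl k.
Proof. by apply/seteqP; split=> z [Hz H]; split=> //; move: H; rewrite side_at. Qed.

Lemma line_eq2 k k' z w : z <> w -> line k z -> line k w -> line k' z ->
 line k' w -> line k = line k'.
Proof.
move=> zw a b c d; have [a0 b0] := line_two zw a b c d.
have [[t ->]|[t ->]] := same_line a0 b0; first by rewrite line_at.
by rewrite line_at line_Sop.
Qed.

Lemma near_pos k z U : line k z -> nbhs z U ->
 exists w, [/\ U w, uhp w & 0 < side_ k w].
Proof.
move=> [Hz Sz] HU; have Hu := mobC_uhp k^-1%g Hz.
have := @cts_mobC R k _ Hu; rewrite mobCKV // => /(_ _ HU) /nbhs_box[e e0 eU].
pose p := mobC k^-1%g z; have p0 : re p = 0 by rewrite mobC_re -/(side_ k z) Sz mul0r.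
have Hv : uhp (pt (e / 2) (im p)) by [].
exists (mobC k (pt (e / 2) (im p))); split.
- apply: eU; rewrite /box /= -/p p0 !subr0 subrr normr0; split=> //.
 by rewrite gtr0_norm ?divr_gt0 // ltr_pdivrMr // ltr_pMr // ltr1n.
- exact: mobC_uhp.
have := side_gt0_mobC k 1%g Hv; rewrite mulg1 => ->.
rewrite /side_ (_ : 1^-1 = 1)%g; last by rewrite invg1.
by rewrite qf1 divr_gt0.
Qed.

Lemma near_neg k z U : line k z -> nbhs z U ->
 exists w, [/\ U w, uhp w & side_ k w < 0].
Proof.
rewrite -line_Sop => L HU; have [w [Uw Hw]] := near_pos L HU.
by rewrite side_Sop // oppr_gt0; exists w.
Qed.

Lemma cts_side k : continuous (side_ k : C -> R).
Proof. exact: cts_qf. Qed.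

Lemma open_hpl k : open (hpl k).
Proof. by apply: openI; [exact: open_uhp|exact: open_gt0 (@cts_side k)]. Qed.

(** Different elements may name the same half plane, so [K] is not a list of sides without
    repetition; sides are compared through [line]. *)
Definition poly (K : seq G) : set C :=
 [set z | uhp z /\ forall k, k \in K -> 0 <= side_ k z].

Definition ipoly (K : seq G) : set C :=
 [set z | uhp z /\ forall k, k \in K -> 0 < side_ k z].

Lemma poly_cons k K : poly (k :: K) = chpl k `&` poly K.
Proof.
apply/seteqP; split=> z.
 case=> Hz H; split; [split=> //|split=> // k' k'K]; apply: H; rewrite !inE ?eqxx //.
 by rewrite k'K orbT.
by case=> -[Hz Hk] [_ H]; split=> // k'; rewrite inE => /orP[/eqP->//|/H].
Qed.

Lemma ipoly_cons k K : ipoly (k :: K) = hpl k `&` ipoly K.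
Proof.
apply/seteqP; split=> z.
 case=> Hz H; split; [split=> //|split=> // k' k'K]; apply: H; rewrite !inE ?eqxx //.
 by rewrite k'K orbT.
by case=> -[Hz Hk] [_ H]; split=> // k'; rewrite inE => /orP[/eqP->//|/H].
Qed.

Lemma poly_nil : poly [::] = @uhp R.
Proof. by apply/seteqP; split=> z; [case|]. Qed.

Lemma ipoly_nil : ipoly [::] = @uhp R.
Proof. by apply/seteqP; split=> z; [case|]. Qed.

Lemma hconvex_uhp : hconvex (@uhp R).
Proof.
split=> // z w Hz Hw u /(segP _ Hz Hw)[g [s [t [r [_ _ _ <-]]]]]; exact: gp_uhp.
Qed.

Lemma hconvex_poly K : hconvex (poly K).
Proof.
elim: K => [|k K IH]; first by rewrite poly_nil; exact: hconvex_uhp.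
by rewrite poly_cons; apply: hconvexI => //; exact: hconvex_chpl.
Qed.

Lemma hconvex_ipoly K : hconvex (ipoly K).
Proof.
elim: K => [|k K IH]; first by rewrite ipoly_nil; exact: hconvex_uhp.
by rewrite ipoly_cons; apply: hconvexI => //; exact: hconvex_hpl.
Qed.

Lemma open_ipoly K : open (ipoly K).
Proof.
elim: K => [|k K IH]; first by rewrite ipoly_nil; exact: open_uhp.
by rewrite ipoly_cons; apply: openI => //; exact: open_hpl.
Qed.

Lemma ipoly_sub K : ipoly K `<=` poly K.
Proof. by move=> z [Hz H]; split=> // k /H /ltW. Qed.

Lemma poly_sub K : poly K `<=` uhp. Proof. by move=> z []. Qed.

Lemma interior_poly K : (poly K)^° = ipoly K.
Proof.
apply/seteqP; split; last first.
 by rewrite -open_subsetE; [exact: ipoly_sub|exact: open_ipoly].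
move=> z zi; have [Hz Hp] := interior_subset zi; split=> // k kK.
rewrite lt_neqAle Hp // andbT eq_sym; apply/eqP => S0.
have [//|w [[_ /(_ k kK)]]] := @near_neg k z _ _ zi.
by move=> + _; rewrite leNgt => /negP.
Qed.

Lemma closureH_poly K : closureH (poly K) = poly K.
Proof.
apply/seteqP; split=> z; last by case=> Hz H; split=> //; exact: subset_closure.
case=> cl Hz; split=> // k kK.
have : closure [set z | 0 <= side_ k z] z.
 by apply: closure_subset cl => w [_]; exact.
by rewrite -(proj1 (closure_id _) (closed_ge0 (@cts_side k))).
Qed.

(** On the segment from an interior point to a point of the closed polygon all points but the last
    are interior: an affine function of [e^(2t)] that is positive at the start and nonnegative at
    the end is positive in between. *)
Lemma closure_ipoly K z0 : ipoly K z0 -> poly K `<=` closure (ipoly K).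
Proof.
move=> z0K z zK U HU; have [k [s [t [Es Et st]]]] := join_ex (proj1 z0K) (proj1 zK).
have [E|N] := eqVneq s t.
 by exists z; split; [rewrite -Et -E Es|exact: nbhs_singleton].
have {}st : s < t by rewrite lt_neqAle N.
rewrite -Et in HU; have := @cts_gp R k t _ HU => /nbhs_ballP[e /= e0 eU].
pose r := Num.max s (t - e / 2); exists (gp k r).
have rt : r < t by rewrite gt_max st ltrBlDr ltrDl divr_gt0.
have sr : s <= r by rewrite le_max lexx.
split; last first.
 apply: eU; rewrite /ball /= gtr0_norm ?subr_gt0 // ltrBlDr -ltrBlDl.
 by rewrite lt_max; apply/orP; right; rewrite ltrD2l ltrN2 ltr_pdivrMr // ltr_pMr // ltr1n.
split=> [|k' k'K]; first exact: gp_uhp.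
have := (proj2 z0K) _ k'K; have := (proj2 zK) _ k'K.
rewrite -Et -Es side_gp_gt0 side_gp_gt0 side_gp_ge0.
have A : expR s ^+ 2 <= expR r ^+ 2 by rewrite expR2_mono.
have B : expR r ^+ 2 < expR t ^+ 2 by rewrite expR2_lt.
move: (al _) (be _) => a b0; move: A B; set X := expR s ^+ 2.
by nra.
Qed.

Section OneTile.
Variables (K : seq G) (z0 : C).
Hypothesis z0K : ipoly K z0.
Hypothesis Klines : forall k, k \in K -> line k `<=` poly K.

Lemma poly_boundary : boundaryH (poly K) = [set z | exists2 k, k \in K & line k z].
Proof.
rewrite /boundaryH closureH_poly interior_poly; apply/seteqP; split=> z.
 case=> -[Hz H] nI; apply: contrapT => nL; apply: nI; split=> // k kK.
 rewrite lt_neqAle H // andbT eq_sym; apply/eqP => S0; apply: nL.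
 by exists k.
case=> k kK L; split; first exact: Klines L.
by case=> _ /(_ _ kK); case: L => _ ->; rewrite ltxx.
Qed.

(** Along the first line the equation of the second is nonnegative and affine in [e^(2t)], so a zero
    forces it to vanish identically. Opposite orientations are excluded by the interior point
    [z0]. *)
Lemma poly_touch k k' z : k \in K -> k' \in K -> line k z -> line k' z ->
 line k = line k' /\ hpl k = hpl k'.
Proof.
move=> kK k'K L L'; have [t0 E] := lineP L.
have P t : 0 <= al (k'^-1 * k)%g * expR t ^+ 2 + be (k'^-1 * k)%g.
 by rewrite -side_gp_ge0; apply: (proj2 (Klines kK (gp_line k t))).
have Z : al (k'^-1 * k)%g * expR t0 ^+ 2 + be (k'^-1 * k)%g = 0.
 by apply/eqP; rewrite -side_gp_eq0 E; case: L' => _ ->.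
have [a0 b0] : al (k'^-1 * k)%g = 0 /\ be (k'^-1 * k)%g = 0.
 have := P (t0 + 1); have := P (t0 - 1).
 have := expR2_lt (t0 - 1) t0; have := expR2_lt t0 (t0 + 1).
 rewrite ltrDl ltr01 ltrBlDl ltrDr ltr01 => A B; move: A B Z.
 move: (expR t0 ^+ 2) (expR (t0 - 1) ^+ 2) (expR (t0 + 1) ^+ 2) => X Y W.
 move: (al _) (be _) => a b XW YX Z P1 P2.
 have a0 : a = 0 by apply/eqP; rewrite eq_le; apply/andP; split; nra.
 by split=> //; move: Z; rewrite a0 mul0r add0r.
have [[t ->]|[t Ek]] := same_line a0 b0; first by rewrite line_at hpl_at.
exfalso; have := (proj2 z0K) _ kK; rewrite Ek side_at ?side_Sop; try exact: (proj1 z0K).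
by rewrite oppr_gt0 ltNge ltW // (proj2 z0K).
Qed.

Lemma poly_halfdisc k z : k \in K -> line k z ->
 \forall w \near z, hpl k w -> ipoly K w.
Proof.
move=> kK L; suff : forall s : seq G, {subset s <= K} ->
  \forall w \near z, hpl k w -> ipoly s w by apply.
elim=> [_|k' s IH sK].
 by apply: filterS (nbhs_uhp (proj1 L)) => w; rewrite ipoly_nil.
have {}IH := IH (fun (j : G) js => sK j (mem_behead (s := k' :: s) js)).
have k'K := sK _ (mem_head k' s).
have [_ /(_ _ k'K)] := Klines kK L; rewrite le_eqVlt => /orP[/eqP E|S1].
 have [_ E'] := poly_touch kK k'K L (conj (proj1 L) (esym E)).
 by apply: filterS IH => w IH Hw; rewrite ipoly_cons -E'; split=> //; exact: IH.
have S2 : \forall w \near z, 0 < side_ k' w.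
 by apply: open_nbhs_nbhs; split=> //; exact: open_gt0 (@cts_side k').
apply: filterS2 IH S2 => w IH S2 Hw; rewrite ipoly_cons.
by split; [split=> //; case: Hw|exact: IH].
Qed.

(** Pigeonhole on infinitely many points of a segment: two of them share one of the finitely many
    lines, which then contains the segment. Joining these points to a point off that line gives a
    contradiction in the same way. *)
Lemma hconvex_finite_lines (L : seq G) b z w : hconvex b ->
 (forall u, b u -> exists2 k, k \in L & line k u) -> b z -> b w -> z <> w ->
 exists2 k, k \in L & b `<=` line k.
Proof.
move=> cb bL.
have two z' w' : b z' -> b w' -> z' <> w' ->
  exists2 k, k \in L & line k z' /\ line k w'.
 move=> bz bw zw; have [h [s [t [Es Et st]]]] := join_ex (proj1 cb _ bz) (proj1 cb _ bw).
 have {}st : s < t.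
  by rewrite lt_neqAle st andbT; apply/eqP => E; apply: zw; rewrite -Es -Et E.
 pose r (n : nat) := s + (t - s) / n.+1%:R.
 have br n : b (gp h (r n)).
  apply: (hconvex_gp cb (s := s) (t := t)); rewrite ?Es ?Et //.
  rewrite lerDl divr_ge0 ?subr_ge0 ?(ltW st) //= /r -lerBrDl.
  by rewrite ler_pdivrMr // ler_peMr ?subr_ge0 ?(ltW st) // ler1n.
 have [m [n [k [mn kL Lm Ln]]]] := pigeonhole_ex (fun n => bL _ (br n)).
 have N : gp h (r m) <> gp h (r n).
  move/gp_inj => /addrI E; have : (t - s) * (m.+1%:R^-1 - n.+1%:R^-1) = 0.
   by rewrite mulrBr E subrr.
  move/eqP; rewrite mulf_eq0 subr_eq0 (gt_eqF st) /= subr_eq0 => /eqP /invr_inj.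
  by move/eqP; rewrite eqr_nat eqSS => /eqP E'; move: mn; rewrite E' ltnn.
 exists k => //; rewrite -Es -Et.
 by rewrite -(line_eq2 N (gp_line h _) (gp_line h _) Lm Ln); split; exact: gp_line.
move=> bz bw zw; have [k kL [Lz Lw]] := two _ _ bz bw zw.
exists k => // u bu; apply: contrapT => nLu.
have [h [s [t [Es Et st]]]] := join_ex (proj1 cb _ bz) (proj1 cb _ bw).
have {}st : s < t.
 by rewrite lt_neqAle st andbT; apply/eqP => E; apply: zw; rewrite -Es -Et E.
have Lh : line h = line k.
 by apply: (line_eq2 zw) => //; rewrite -?Es -?Et; exact: gp_line.
pose r (n : nat) := s + (t - s) / n.+1%:R.
have br n : b (gp h (r n)).
 apply: (hconvex_gp cb (s := s) (t := t)); rewrite ?Es ?Et //.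
 rewrite lerDl divr_ge0 ?subr_ge0 ?(ltW st) //= /r -lerBrDl.
 by rewrite ler_pdivrMr // ler_peMr ?subr_ge0 ?(ltW st) // ler1n.
have ur n : u <> gp h (r n) by move=> E; apply: nLu; rewrite -Lh E; exact: gp_line.
have [m [n [k' [mn k'L [L1 Lm] [_ Ln]]]]] := pigeonhole_ex (fun n => two _ _ bu (br n) (ur n)).
have N : gp h (r m) <> gp h (r n).
 move/gp_inj => /addrI E; have : (t - s) * (m.+1%:R^-1 - n.+1%:R^-1) = 0.
  by rewrite mulrBr E subrr.
 move/eqP; rewrite mulf_eq0 subr_eq0 (gt_eqF st) /= subr_eq0 => /eqP /invr_inj.
 by move/eqP; rewrite eqr_nat eqSS => /eqP E'; move: mn; rewrite E' ltnn.
apply: nLu; rewrite -Lh (line_eq2 N (gp_line h _) (gp_line h _) Lm Ln) //.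
Qed.

Lemma line_pts k : gp k 0 <> gp k 1.
Proof. by move/gp_inj/eqP; rewrite eq_sym oner_eq0. Qed.

Lemma side_poly b : side (poly K) b <-> exists2 k, k \in K & b = line k.
Proof.
have bd := poly_boundary; split.
 case=> -[z bz] bB cb bmax.
 have bL u : b u -> exists2 k, k \in K & line k u by move/bB; rewrite bd.
 have [k kK bk] : exists2 k, k \in K & b `<=` line k.
  have [[w [bw zw]]|nw] := pselect (exists w, b w /\ z <> w).
   exact: hconvex_finite_lines cb bL bz bw zw.
  have [k kK Lk] := bL z bz; exists k => // u bu; have [<-//|zu] := pselect (z = u).
  by exfalso; apply: nw; exists u.
 exists k => //; apply/esym; apply: bmax => //; first exact: hconvex_line.
 by rewrite bd => u Lu; exists k.
case=> k kK ->; split.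
- by exists (gp k 0); exact: gp_line.
- by rewrite bd => u Lu; exists k.
- exact: hconvex_line.
move=> b' cb' kb' b'B.
have bL u : b' u -> exists2 k, k \in K & line k u by move/b'B; rewrite bd.
have [k' k'K bk'] := hconvex_finite_lines cb' bL (kb' _ (gp_line k 0))
 (kb' _ (gp_line k 1)) (@line_pts k).
apply/seteqP; split=> //.
by rewrite (line_eq2 (@line_pts k) (gp_line k 0) (gp_line k 1)
 (bk' _ (kb' _ (gp_line k 0))) (bk' _ (kb' _ (gp_line k 1)))).
Qed.

End OneTile.

End Polygons.

(** The coordinates are rounded to a grid of mesh [e], which has finitely many cells in the bounded
    range and at most one point of [X] in each. *)
Lemma separated_finite (R : realType) (T : choiceType) (X : set T) (I : finType)
  (f : I -> T -> R) (M e : R) : 0 < e ->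
 (forall x i, X x -> `|f i x| <= M) ->
 (forall x y, X x -> X y -> (forall i, `|f i x - f i y| < e) -> x = y) ->
 finite_set X.
Proof.
move=> e0 bd sep.
have [[x0 Xx0]|nX] := pselect (exists x, X x); last first.
 suff -> : X = set0 by exact: finite_set0.
 by apply/seteqP; split=> x // Xx; apply: nX; exists x.
pose q i x := Num.truncn ((f i x + M) / e).
pose N := Num.truncn ((M + M) / e).
have pos i x : X x -> 0 <= (f i x + M) / e.
 by move=> /(bd x i); rewrite ler_norml => /andP[H _]; rewrite divr_ge0 ?(ltW e0) //; lra.
have qN i x : X x -> (q i x <= N)%N.
 move=> Xx; apply: le_truncn; apply: ler_wpM2r; first by rewrite invr_ge0 ltW.
 by rewrite lerD2r; have := bd x i Xx; rewrite ler_norml => /andP[].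
pose F x := [ffun i => inord (q i x) : 'I_N.+1].
pose g (c : {ffun I -> 'I_N.+1}) := xget x0 [set x | X x /\ F x = c].
apply: (@sub_finite_set _ _ (g @` setT)); last exact/finite_image/finite_finset.
move=> x Xx; exists (F x) => //; rewrite /g.
have [Xy Ey] : [set y | X y /\ F y = F x] (xget x0 [set y | X y /\ F y = F x]).
 apply: xgetI (conj Xx erefl).
apply: sep => // i; move: (xget _ _) Xy Ey => y Xy /ffunP /(_ i).
rewrite !ffunE => /(congr1 val) /=; rewrite !inordK ?ltnS ?qN // => E.
have := truncn_itv (pos i x Xx); have := truncn_itv (pos i y Xy).
rewrite -!/(q _ _) E => /andP[A1 A2] /andP[B1 B2].
have : `|(f i y + M) / e - (f i x + M) / e| < 1.
 by rewrite ltr_norml; move: A1 A2 B1 B2; rewrite -natr1; lra.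
rewrite -mulrBl normrM normfV (gtr0_norm e0) ltr_pdivrMr // mul1r.
by rewrite opprD addrACA subrr addr0.
Qed.

Lemma seq_min (R : realType) (T : eqType) (f : T -> R) (r : seq T) (a : T) :
 a \in r -> exists2 x, x \in r & forall y, y \in r -> f x <= f y.
Proof.
elim: r a => // b l IH a _; case: l IH => [_|c l IH].
 by exists b; rewrite ?mem_head // => k; rewrite inE => /eqP->.
have [m ml mmin] := IH c (mem_head c l).
have [bm|mb] := leP (f b) (f m).
 exists b; rewrite ?mem_head // => k; rewrite inE => /orP[/eqP->//|/mmin].
 exact: le_trans.
exists m; first by rewrite inE ml orbT.
by move=> k; rewrite inE => /orP[/eqP->|/mmin//]; apply: ltW.
Qed.

(** * Discreteness, the cusp at infinity and Shimizu's lemma *)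

Section Fuchsian.
Variable R : realType.
Variable Gam : set (PSL2 R).
Local Notation C := (Cplx R).
Local Notation G := (PSL2 R).
Hypothesis HF : fuchsian Gam.
Section Discrete.
Implicit Types (g h k : G) (z w : C) (x y t M : R).

Lemma Gam1 : Gam 1%g. Proof. by case: HF. Qed.

Lemma GamV g : Gam g -> Gam g^-1%g.
Proof. by case: HF => H1 H _ Gg; rewrite -[g^-1%g]mul1g; exact: H. Qed.

Lemma GamM g h : Gam g -> Gam h -> Gam (g * h)%g.
Proof. by move=> Gg /GamV Gh; case: HF => _ H _; rewrite -[h]invgK; exact: H. Qed.

Lemma eqs_sym (a b c d a' b' c' d' : R) : eqs a b c d a' b' c' d' ->
 eqs a' b' c' d' a b c d.
Proof.
case=> s [s2 -> -> -> ->]; exists s.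
by rewrite !mulrA s2 !mul1r.
Qed.

Lemma eqs_trans (a b c d a' b' c' d' a2 b2 c2 d2 : R) :
 eqs a b c d a' b' c' d' -> eqs a' b' c' d' a2 b2 c2 d2 -> eqs a b c d a2 b2 c2 d2.
Proof.
case=> s [s2 -> -> -> ->] [s' [s2' -> -> -> ->]]; exists (s * s').
by rewrite mulrACA s2 s2' mulr1 !mulrA.
Qed.

Lemma discr : exists2 e : R, 0 < e & forall g (a b c d : R), Gam g ->
 eqs (ea g) (eb g) (ec g) (ed g) a b c d ->
 `|a - 1| < e -> `|b| < e -> `|c| < e -> `|d - 1| < e -> g = 1%g.
Proof.
case: HF => _ _ /nbhs_ballP[e /= e0 H]; exists e => // g a b c d Gg E Ha Hb Hc Hd.
have dt : \det (mx4 a b c d) == 1.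
 rewrite det2 !mxE /=; have := edet g; case: E => s [s2 -> -> -> ->] <-.
 by rewrite -[a * d]mul1r -[b * c]mul1r -s2; apply/eqP; ring.
have Eg : \pi_G (MkSL2 dt) = g.
 apply: eqsP; apply: eqs_trans (pi_entries (MkSL2 dt)) _; rewrite !mxE /=.
 exact: eqs_sym.
have E1 : MkSL2 dt = 1%g.
 apply: (H (mx4 a b c d)) => //; last by rewrite Eg.
 split=> // i j; rewrite /ball /= !mxE.
 case: i => [[|[|i]] Hi] //; case: j => [[|[|j]] Hj] //=.
 - by rewrite distrC.
 - by rewrite sub0r normrN.
 - by rewrite sub0r normrN.
 - by rewrite distrC.
by rewrite -Eg E1.
Qed.

Lemma finite_bounded M : finite_set [set g | [/\ Gam g, `|ea g| <= M, `|eb g| <= M,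
 `|ec g| <= M & `|ed g| <= M]].
Proof.
have [e e0 He] := discr.
pose f (i : 'I_4) (g : G) := nth 0 [:: ea g; eb g; ec g; ed g] i.
pose M' := Num.max M 1; have M1 : 1 <= M' by rewrite le_max lexx orbT.
have d0 : 0 < e / (2 * M') by rewrite divr_gt0 // mulr_gt0 // (lt_le_trans ltr01).
apply: (@separated_finite _ _ _ _ f M _ d0).
 by move=> g i [_ A B D E]; rewrite /f; case: i => [[|[|[|[|i]]]] Hi] //=.
move=> g h [Gg Ag Bg Dg Eg] [Gh Ah Bh Dh Eh] near.
have := near 0; have := near 1; have := near (Ordinal (isT : (2 < 4)%N)).
have := near (Ordinal (isT : (3 < 4)%N)); rewrite /f /= => n3 n2 n1 n0.
suff : (g * h^-1)%g = 1%g by move/(congr1 (fun k => k * h)%g); rewrite mulgVK mul1g.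
have [s [s2 A B D E]] := mul_entries g h^-1%g.
have [s' [s2' A' B' D' E']] := inv_entries h.
have dh := edet h.
(* Up to sign, an entry of [g h^-1 - 1] is a sum of two products, each of a difference of entries of
   [g] and [h] with an entry of [h]; this explains the mesh [e / (2 M')]. *)
have K (u v u' v' : R) : `|u| < e / (2 * M') -> `|v| < e / (2 * M') ->
  `|u'| <= M -> `|v'| <= M -> `|u * u' + v * v'| < e.
 move=> Hu Hv Hu' Hv'; apply: le_lt_trans (ler_normD _ _) _; rewrite !normrM.
 have MM : M <= M' by rewrite le_max lexx.
 have T x y : `|x| < e / (2 * M') -> `|y| <= M -> `|x| * `|y| < e / 2.
  move=> Hx Hy; apply: (@le_lt_trans _ _ (`|x| * M')).
   by apply: ler_wpM2l => //; exact: le_trans Hy MM.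
  have -> : e / 2 = e / (2 * M') * M'.
   by field; rewrite gt_eqF // (lt_le_trans ltr01).
  nra.
 by rewrite [e]splitr; apply: ltrD; exact: T.
have E1 : eqs (ea (g * h^-1)%g) (eb (g * h^-1)%g) (ec (g * h^-1)%g) (ed (g * h^-1)%g)
  (1 + ((ea g - ea h) * ed h + (eb g - eb h) * (- ec h)))
  ((ea g - ea h) * (- eb h) + (eb g - eb h) * ea h)
  ((ec g - ec h) * ed h + (ed g - ed h) * (- ec h))
  (1 + ((ec g - ec h) * (- eb h) + (ed g - ed h) * ea h)).
 exists (s * s'); rewrite mulrACA s2 s2' mulr1 A B D E A' B' D' E'.
 by split=> //; rewrite -?dh; ring.
apply: (He _ _ _ _ _ _ E1); first by apply: GamM => //; exact: GamV.
all: rewrite ?[1 + _]addrC ?addrK; apply: K; rewrite ?normrN //.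
Qed.

Lemma stab_infP g : stab_inf Gam g <-> Gam g /\ ec g = 0.
Proof.
rewrite /stab_inf /= /mob; have -> : (entry g 1 0 == 0) = (ec g == 0).
 by rewrite /entry -/(ec g) fmorph_eq0.
by split=> -[Gg]; [case: ifP => // /eqP|move=> ->; rewrite eqxx].
Qed.

Lemma movingP g : (Gam `\` stab_inf Gam) g <-> Gam g /\ ec g != 0.
Proof.
split=> -[Gg]; last by move=> c0; split=> // /stab_infP[_] /eqP; rewrite (negPf c0).
by move=> H; split=> //; apply/eqP => c0; apply: H; apply/stab_infP.
Qed.

Lemma vertM x y : (vert x * vert y = vert (x + y))%g.
Proof.
apply: eqsP; apply: eqs_trans (mul_entries _ _) _.
apply: eqs_sym; apply: eqs_trans (vert_entries _) _.
have [s [s2 -> -> -> ->]] := vert_entries x.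
have [s' [s2' -> -> -> ->]] := vert_entries y.
have K : s * s' * (s * s') = 1 by nra.
exists (s * s'); split=> //; last by rewrite -[LHS]K; ring.
- by rewrite -[LHS]K; ring.
- by transitivity (s * s' * (s * s') * (x + y)); [rewrite K mul1r|ring].
- by ring.
Qed.

Lemma vert0 : vert 0 = 1%g :> G.
Proof.
by apply: eqsP; apply: eqs_trans (vert_entries _) _; exact/eqs_sym/one_entries.
Qed.

Lemma vert_inj : injective (@vert R).
Proof.
move=> x y E; have : side_ (vert x) (pt 0 1) = side_ (vert y) (pt 0 1) by rewrite E.
by rewrite !side_vert /= !sub0r => /oppr_inj.
Qed.

Lemma vertV x : (vert x)^-1%g = vert (- x).
Proof. by apply: (mulgI (vert x)); rewrite mulgV vertM subrr vert0. Qed.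

Lemma ec_vertM x g : `|ec (vert x * g)%g| = `|ec g|.
Proof.
have [s [s2 _ _ -> _]] := mul_entries (vert x) g.
have [s' [s2' _ _ -> ->]] := vert_entries x.
rewrite mulr0 mul0r add0r mulr1 mulrA normrM.
have -> : `|s * s'| = 1 by apply/eqP; rewrite -sqrp_eq1 // -normrX expr2 mulrACA s2 s2' mulr1 normr1.
by rewrite mul1r.
Qed.

End Discrete.

Hypothesis HC : cuspidal_at_infinity Gam.
Section Cusp.
Implicit Types (g h k : G) (z w : C) (x y t M : R).

Lemma eqs_vert g x : eqs (ea g) (eb g) (ec g) (ed g) 1 x 0 1 -> g = vert x.
Proof.
by move=> E; apply: eqsP; apply: eqs_trans E _; exact/eqs_sym/vert_entries.
Qed.

Lemma cusp_width : exists2 t, 0 < t & Gam (vert t).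
Proof.
case: HC => p [Gp [p1 tr] /(conj Gp) /stab_infP [_ c0]].
have dt := edet p; rewrite c0 mulr0 subr0 in dt.
have d0 : ed p != 0 by apply: contra_eq_neq dt => ->; rewrite mulr0 eq_sym oner_neq0.
have tr2 : (ea p + ed p) ^+ 2 = 4.
 rewrite -real_normK ?num_real //; move: tr; rewrite /mxtrace !big_ord_recl big_ord0 addr0.
 have -> : lift ord0 ord0 = 1 :> 'I_2 by apply: val_inj.
 by rewrite -/(ea p) -/(ed p) => ->; ring.
have ad : ea p = ed p.
 apply/eqP; rewrite -subr_eq0 -sqrf_eq0; apply/eqP; move: tr2 dt; nra.
have pv : p = vert (eb p / ed p).
 apply: eqs_vert; rewrite c0 ad; exists (ed p); rewrite mulr1 mulr0; split=> //.
 - by rewrite -{1}ad.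
 - by field.
have b0 : eb p / ed p != 0.
 by apply/eqP => b0; apply: p1; rewrite pv b0 vert0.
have [tp|tn] := ltP 0 (eb p / ed p); first by exists (eb p / ed p); rewrite -?pv.
exists (- (eb p / ed p)); first by rewrite oppr_gt0 lt_neqAle b0.
by rewrite -vertV -pv; exact: GamV.
Qed.

(** For [c = 0] the conjugate of a translation is one of length multiplied by [a^2]; otherwise the
    lower left entry becomes [- c^2 t]. The two discreteness arguments below rest on these two
    cases. *)
Lemma conj_vert g t : eqs (ea (g * vert t * g^-1)%g) (eb (g * vert t * g^-1)%g)
 (ec (g * vert t * g^-1)%g) (ed (g * vert t * g^-1)%g)
 (1 - ea g * ec g * t) (ea g ^+ 2 * t) (- (ec g ^+ 2 * t)) (1 + ea g * ec g * t).
Proof.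
apply: eqs_trans (mul_entries _ _) _.
have [s [s2 -> -> -> ->]] := mul_entries g (vert t).
have [s' [s2' -> -> -> ->]] := vert_entries t.
have [s1 [s12 -> -> -> ->]] := inv_entries g.
have dg := edet g.
exists (s * s' * s1); split.
- by rewrite mulrACA s12 mulrACA s2 s2' !mulr1.
- transitivity (s * s' * s1 * ((ea g * ed g - eb g * ec g) - ea g * ec g * t)).
  by ring.
 by rewrite dg.
- by ring.
- by ring.
- transitivity (s * s' * s1 * ((ea g * ed g - eb g * ec g) + ea g * ec g * t)).
  by ring.
 by rewrite dg.
Qed.

(** If [a^2 < 1], repeated conjugation would produce nontrivial translations in [Gam] of length
    tending to 0. Applied to [g] and to its inverse this gives [a^2 = d^2 = 1]. *)
Lemma translation_stab g : stab_inf Gam g -> exists t, g = vert t.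
Proof.
case/stab_infP => Gg c0; have [t0 t0p Gt0] := cusp_width; have [e e0 He] := discr.
have key h : Gam h -> ec h = 0 -> 1 <= ea h ^+ 2.
 move=> Gh ch0; rewrite leNgt; apply/negP => a1.
 have Gn n : Gam (vert ((ea h ^+ 2) ^+ n * t0)).
  elim: n => [|n IH]; first by rewrite expr0 mul1r.
  have -> : vert ((ea h ^+ 2) ^+ n.+1 * t0)
    = (h * vert ((ea h ^+ 2) ^+ n * t0) * h^-1)%g.
   apply/esym/eqs_vert; apply: eqs_trans (conj_vert _ _) _.
   exists 1; rewrite ch0 !(mulr0, mul0r) subr0 addr0 expr0n mul0r oppr0 !mul1r.
   by split; rewrite ?exprS ?mulrA.
  by apply: GamM; [exact: GamM|exact: GamV].
 have : (fun n => (ea h ^+ 2) ^+ n * t0) @ \oo --> 0 * t0.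
  apply: cvgM; last exact: cvg_cst.
  by apply: cvg_expr; rewrite ger0_norm ?sqr_ge0.
 rewrite mul0r => /cvgrPdist_lt /(_ e e0) [n _ /(_ n (leqnn n))] /=.
 rewrite sub0r normrN => small.
 have : vert ((ea h ^+ 2) ^+ n * t0) = 1%g.
  by apply: (He _ _ _ _ _ (Gn n) (vert_entries _)); rewrite ?subrr ?normr0.
 rewrite -vert0 => /vert_inj/eqP; rewrite mulf_eq0 (gt_eqF t0p) orbF.
 rewrite expf_eq0 sqrf_eq0 => /andP[_ /eqP a0].
 by have := edet h; rewrite a0 ch0 mul0r mulr0 subr0 => /eqP; rewrite eq_sym oner_eq0.
have dt := edet g; rewrite c0 mulr0 subr0 in dt.
have A := key _ Gg c0; have B : 1 <= ed g ^+ 2.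
 have [s [s2 Ea _ Ec _]] := inv_entries g.
 have := key _ (GamV Gg); rewrite Ec c0 oppr0 mulr0 => /(_ erefl).
 nra.
have d2 : ed g ^+ 2 = 1 by nra.
have a0 : ea g = ed g by rewrite -[LHS]mulr1 -d2 expr2 mulrA dt mul1r.
exists (ed g * eb g); apply: eqs_vert; exists (ed g).
by rewrite c0 a0 mulrA -expr2 d2 mulr1 mul1r mulr0.
Qed.

(* Shimizu's lemma: conjugating the translation by [g] squares [|c| tau], so a
  minimal nonzero [|c|] among bounded matrices cannot have [|c| tau < 1]. *)
Lemma shimizu g t : 0 < t -> Gam (vert t) -> Gam g -> ec g != 0 -> 1 <= `|ec g| * t.
Proof.
move=> t0 Gt Gg c0; rewrite leNgt; apply/negP => small.
pose M := 2 + t + t^-1.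
pose X := [set h | [/\ Gam h, `|ea h| <= M, `|eb h| <= M, `|ec h| <= M & `|ed h| <= M]].
have ti : 0 < t^-1 by rewrite invr_gt0.
have norm1 s : s * s = 1 -> forall u : R, `|s * u| = `|u|.
 move=> s2 u; rewrite normrM; suff -> : `|s| = 1 by rewrite mul1r.
 by apply/eqP; rewrite -sqrp_eq1 // real_normK ?num_real // expr2 s2.
have red h : Gam h -> ec h != 0 -> `|ec h| * t < 1 ->
  exists h', [/\ X h', ec h' != 0 & `|ec h'| * t = (`|ec h| * t) ^+ 2].
 (* A translation on the left brings [|a|] below [|c| t]; all entries of the conjugate are then
    bounded by [M], independently of [h]. *)
 move=> Gh ch0 hs; pose n := Num.floor (ea h / (ec h * t)).
 pose k := (vert (- (n%:~R * t)) * h)%g.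
 have Gn (j : nat) : Gam (vert (j%:R * t)).
  elim: j => [|j IH]; first by rewrite mul0r vert0; exact: Gam1.
  by rewrite mulrSr mulrDl mul1r -vertM; exact: GamM.
 have Gz (j : int) : Gam (vert (j%:~R * t)).
  case: j => j; first exact: Gn.
  by rewrite NegzE mulrNz mulNr -vertV; apply: GamV; exact: Gn.
 have Gk : Gam k by apply: GamM => //; rewrite -vertV; apply: GamV.
 have [s [s2 Ea _ Ec _]] := mul_entries (vert (- (n%:~R * t))) h.
 have [s' [s2' va vb vc vd]] := vert_entries (- (n%:~R * t)).
 rewrite -/k va vb vc vd in Ea Ec.
 have s3 : s * s' * (s * s') = 1 by nra.
 have {}Ec : ec k = s * s' * ec h by rewrite Ec; ring.
 have {}Ea : ea k = s * s' * (ea h - n%:~R * t * ec h) by rewrite Ea; ring.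
 have ck : `|ec k| = `|ec h| by rewrite Ec norm1.
 have ak : `|ea k| <= `|ec h| * t.
  rewrite Ea norm1 //.
  have -> : ea h - n%:~R * t * ec h = (ea h / (ec h * t) - n%:~R) * (ec h * t).
   by field; rewrite ch0 gt_eqF.
  rewrite !normrM (gtr0_norm t0); apply: ler_piMl; first by rewrite mulr_ge0 // ltW.
  have := floor_itv (ea h / (ec h * t)).
  rewrite -/n intrD1 => /andP[f1 f2]; rewrite ler_norml; lra.
 have [s1 [s12 Fa Fb Fc Fd]] := conj_vert k t.
 exists (k * vert t * k^-1)%g; split.
 - split; first by apply: GamM; [exact: GamM|exact: GamV].
  + rewrite Fa norm1 //; apply: le_trans (ler_normD _ _) _.
   rewrite normr1 normrN !normrM ck (gtr0_norm t0) /M -mulrA.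
   have a0 := normr_ge0 (ea k); nra.
  + rewrite Fb norm1 // normrM (gtr0_norm t0) normrX /M.
   have a1 := le_lt_trans ak hs.
   have : `|ea k| ^+ 2 * t <= 1 * t by rewrite ler_pM2r // expr_le1 // ltW.
   lra.
  + rewrite Fc norm1 // normrN normrM normrX ck (gtr0_norm t0) /M.
   have h0 := normr_ge0 (ec h).
   have : `|ec h| <= t^-1 by rewrite -[t^-1]mul1r ler_pdivlMr // ltW.
   have : `|ec h| ^+ 2 * t <= `|ec h| by nra.
   lra.
  + rewrite Fd norm1 //; apply: le_trans (ler_normD _ _) _.
   rewrite normr1 !normrM ck (gtr0_norm t0) /M -mulrA.
   have a0 := normr_ge0 (ea k); nra.
 - rewrite Fc mulf_neq0 //; first by apply/eqP => z; move: s12; rewrite z; lra.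
  by rewrite oppr_eq0 mulf_neq0 ?[t == 0]gt_eqF // sqrf_eq0 -normr_eq0 ck normr_eq0.
 - rewrite Fc norm1 // normrN normrM normrX ck (gtr0_norm t0); ring.
have [s Xs] : exists s : seq G, X = [set` s] by apply/finite_seqP; exact: finite_bounded.
pose r := [seq x <- s | ec x != 0].
have [g1 [X1 c1 e1]] := red _ Gg c0 small.
have g1r : g1 \in r by rewrite mem_filter c1 /=; move: X1; rewrite Xs.
have [h hr hmin] := seq_min (fun k => `|ec k|) g1r.
have hs : `|ec h| * t < 1.
 have := hmin _ g1r; have : `|ec g1| * t < 1.
  by rewrite e1 expr_lt1 ?mulr_ge0 // ltW.
 nra.
move: hr; rewrite mem_filter => /andP[ch0 hX].
have Xh : X h by rewrite Xs.
have [h' [Xh' ch' eh']] := red h (let: And5 a _ _ _ _ := Xh in a) ch0 hs.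
have h'r : h' \in r by rewrite mem_filter ch' /=; move: Xh'; rewrite Xs.
have := hmin _ h'r; rewrite -(ler_pM2r t0) eh' leNgt => /negP; apply.
by rewrite expr2 gtr_pMl // mulr_gt0 // normr_gt0.
Qed.

End Cusp.

Lemma open_gtc (f : Cplx R -> R) (a : R) :
 continuous f -> open [set z | a < f z].
Proof.
move=> cf; rewrite -[X in open X]/(f @^-1` [set r | a < r]).
by apply: open_comp; [move=> z _; exact: cf|exact: open_gt].
Qed.

Lemma closed_gec (f : Cplx R -> R) (a : R) :
 continuous f -> closed [set z | a <= f z].
Proof.
move=> cf; rewrite -[X in closed X]/(f @^-1` [set r | a <= r]).
by apply: preimage_closed; [move=> z _; exact: cf|exact: closed_ge].
Qed.

(** * Isometric spheres and the common exterior *)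

Section Ford.
Implicit Types (g h k : G) (z w : C) (x y t M c : R).

Definition ctr g : R := - ed g / ec g.

Definition rad g : R := `|ec g|^-1.

(** The squared Euclidean distance from the real point [c]; divided by the squared radius it is
    [den]. *)
Definition nz c z : R := (re z - c) ^+ 2 + im z ^+ 2.

Lemma rad_gt0 g : ec g != 0 -> 0 < rad g.
Proof. by move=> c0; rewrite invr_gt0 normr_gt0. Qed.

Lemma rad2 g : rad g ^+ 2 = (ec g ^+ 2)^-1.
Proof. by rewrite /rad exprVn real_normK ?num_real. Qed.

Lemma nz_gt0 c z : uhp z -> 0 < nz c z.
Proof. by move=> Hz; rewrite ltr_wpDl ?sqr_ge0 // exprn_gt0. Qed.

Lemma den_nz g z : ec g != 0 -> den g z = nz (ctr g) z / rad g ^+ 2.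
Proof. by move=> c0; rewrite rad2 /den /nz /ctr; field. Qed.

Lemma ctrV g : ec g != 0 -> ctr g^-1%g = ea g / ec g.
Proof.
move=> c0; have [s [s2 _ _ Ec Ed]] := inv_entries g; rewrite /ctr Ec Ed.
have s0 : s != 0 by apply/eqP => z; move: s2; rewrite z; lra.
by field; rewrite c0 s0.
Qed.

Lemma ecV g : `|ec g^-1%g| = `|ec g|.
Proof.
have [s [s2 _ _ -> _]] := inv_entries g; rewrite normrM normrN.
suff -> : `|s| = 1 by rewrite mul1r.
by apply/eqP; rewrite -sqrp_eq1 // real_normK ?num_real // expr2 s2.
Qed.

Lemma ecV0 g : (ec g^-1%g == 0) = (ec g == 0).
Proof. by rewrite -normr_eq0 ecV normr_eq0. Qed.

Lemma radV g : rad g^-1%g = rad g. Proof. by rewrite /rad ecV. Qed.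

(** With [im_mob] this says that [g] is the inversion in its isometric circle followed by the
    Euclidean reflection taking its centre to the centre for [g^-1]. *)
Lemma re_mob g z : ec g != 0 -> uhp z ->
 re (mobC g z) = ctr g^-1%g - rad g ^+ 2 * (re z - ctr g) / nz (ctr g) z.
Proof.
move=> c0 Hz; rewrite mobC_re ctrV // rad2; have n0 := nz_gt0 (ctr g) Hz.
rewrite den_nz // rad2; have := edet g; move: n0; rewrite /nz /ctr /qf => n0 dt.
move: (re z) (im z) (ea g) (eb g) (ec g) (ed g) c0 n0 dt => x y a b c d c0 n0 dt.
have n2 : (x * c - - d) ^+ 2 + (y * c) ^+ 2 != 0.
 rewrite (_ : _ + _ = c ^+ 2 * ((x - - d / c) ^+ 2 + y ^+ 2)); last by field.
 by rewrite mulf_neq0 ?sqrf_eq0 // gt_eqF.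
transitivity (a / c - (a * d - b * c) * (c ^+ 2)^-1 * (x - - d / c)
 / ((x - - d / c) ^+ 2 + y ^+ 2)); first by field; rewrite c0.
by rewrite dt mul1r.
Qed.

Lemma im_mob g z : ec g != 0 -> uhp z ->
 im (mobC g z) = rad g ^+ 2 * im z / nz (ctr g) z.
Proof.
move=> c0 Hz; rewrite mobC_im den_nz // invfM invrK; ring.
Qed.

Lemma nz_mob g z : ec g != 0 -> uhp z ->
 nz (ctr g^-1%g) (mobC g z) = rad g ^+ 4 / nz (ctr g) z.
Proof.
move=> c0 Hz; rewrite {1}/nz re_mob // im_mob //.
have := nz_gt0 (ctr g) Hz; rewrite /nz => n0.
by field; rewrite gt_eqF.
Qed.

Lemma sq_bound (u B : R) : u ^+ 2 <= B -> `|u| <= B + 1.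
Proof. by rewrite ler_norml; move=> H; apply/andP; split; nra. Qed.

Lemma vert_mob x z : mobC (vert x) z = pt (re z + x) (im z).
Proof.
have [s [s2 Ha Hb Hc Hd]] := vert_entries x.
have D : den (vert x) z = 1 by rewrite /den Hc Hd mulr0 mulr1 !mul0r add0r expr0n addr0 expr2.
apply: Cext; rewrite ?mobC_re ?mobC_im D divr1 //=.
rewrite /qf Ha Hb Hc Hd; transitivity ((s * s) * (re z + x)); first by ring.
by rewrite s2 mul1r.
Qed.

Lemma den_vert x z : den (vert x) z = 1.
Proof.
have [s [s2 Ha Hb Hc Hd]] := vert_entries x.
by rewrite /den Hc Hd mulr0 mulr1 !mul0r add0r expr0n addr0 expr2.
Qed.

Lemma den_vertM x g z : uhp z -> den (vert x * g)%g z = den g z.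
Proof. by move=> Hz; rewrite denM // den_vert mul1r. Qed.

(** The conditions bound all entries of [g]. The bounds for [a] and [b] need a lower bound of
    [den g z], which comes from Shimizu's lemma. *)
Lemma finite_den M : finite_set [set g | Gam g /\ exists z,
 [/\ `|re z| <= M, 0 < im z, M^-1 <= im z <= M, den g z <= M & `|re (mobC g z)| <= M]].
Proof.
have [tau t0 Gt] := cusp_width.
pose B := (M + 1) * M; pose B2 := M ^+ 3 + M ^+ 2 * (M * tau) ^+ 2 + 1.
pose N := 1 + 2 * M + B + (M + 1 + B * M) + B2 * M + (B2 + B2 * M * M).
apply: sub_finite_set (finite_bounded N) => g [Gg [z [zr zi0 /andP[zi1 zi2] dM gr]]].
have Hz : uhp z by [].
have M0 : 0 < M by exact: lt_le_trans zi2.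
have iM : 1 <= im z * M by rewrite -ler_pdivrMr // div1r.
have B2p : 0 < B2 by rewrite /B2; nra.
have Bp : 0 < B by rewrite /B; nra.
have [c0|c0] := eqVneq (ec g) 0.
 have [t Eg] := translation_stab (proj2 (stab_infP g) (conj Gg c0)).
 have tM : `|t| <= 2 * M.
  have E : re (mobC g z) = re z + t by rewrite Eg vert_mob.
  rewrite -[t](addKr (re z)) -E; apply: le_trans (ler_normD _ _) _; rewrite normrN; lra.
 have [s [s2 Ha Hb Hc Hd]] := vert_entries t.
 have s1 : `|s| = 1 by apply/eqP; rewrite -sqrp_eq1 // real_normK ?num_real // expr2 s2.
 rewrite Eg; split; first by rewrite -Eg.
 - by rewrite Ha mulr1 s1 /N; nra.
 - by rewrite Hb normrM s1 mul1r /N; nra.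
 - by rewrite Hc mulr0 normr0 /N; nra.
 - by rewrite Hd mulr1 s1 /N; nra.
have dp := den_gt0 g Hz.
have cy : `|ec g * im z| <= M + 1.
 by apply: sq_bound; apply: le_trans dM; rewrite /den lerDr sqr_ge0.
have cxd : `|ec g * re z + ed g| <= M + 1.
 by apply: sq_bound; apply: le_trans dM; rewrite /den lerDl sqr_ge0.
have cB : `|ec g| <= B.
 move: cy; rewrite normrM (gtr0_norm zi0) /B; have := normr_ge0 (ec g); nra.
have dB : `|ed g| <= M + 1 + B * M.
 rewrite -[ed g](addKr (ec g * re z)); apply: le_trans (ler_normD _ _) _.
 rewrite normrN normrM; have := normr_ge0 (re z); nra.
have sh := shimizu t0 Gt Gg c0.
have dlow : 1 <= den g z * (M * tau) ^+ 2.
 have A : (ec g * im z) ^+ 2 <= den g z by rewrite /den lerDr sqr_ge0.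
 have A2 : 1 <= (ec g * im z * (M * tau)) ^+ 2.
  rewrite -real_normK ?num_real // -[1](expr1n _ 2) lerXn2r ?nnegrE //.
  rewrite !normrM (gtr0_norm zi0) (gtr0_norm M0) (gtr0_norm t0).
  by nra.
 rewrite exprMn in A2; apply: le_trans A2 _; apply: ler_wpM2r => //.
 exact: sqr_ge0.
(* Both sides are the squared modulus of [az + b]. *)
have key : (ea g * re z + eb g) ^+ 2 + (ea g * im z) ^+ 2
  = re (mobC g z) ^+ 2 * den g z + im z ^+ 2 / den g z.
 rewrite mobC_re; apply: (mulRI (c := den g z)); first by rewrite gt_eqF.
 transitivity (qf g z ^+ 2 + im z ^+ 2); last by field; rewrite gt_eqF.
 rewrite -[im z ^+ 2 in RHS]mulr1 -[1 in RHS](expr1n _ 2) -(edet g) /qf /den; ring.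
have bd : (ea g * re z + eb g) ^+ 2 + (ea g * im z) ^+ 2 <= B2 - 1.
 rewrite key /B2 addrK; apply: lerD.
  rewrite [M ^+ 3]exprSr; apply: ler_pM => //; rewrite ?sqr_ge0 ?(ltW dp) //.
  by rewrite -real_normK ?num_real // lerXn2r ?nnegrE // ltW.
 apply: ler_pM; rewrite ?sqr_ge0 ?invr_ge0 ?(ltW dp) //.
  nra.
 by rewrite -[X in X <= _]mul1r ler_pdivrMr // mulrC.
have ay : `|ea g * im z| <= B2.
 by rewrite -[B2](subrK 1); apply: sq_bound; apply: le_trans bd; rewrite lerDr sqr_ge0.
have axb : `|ea g * re z + eb g| <= B2.
 by rewrite -[B2](subrK 1); apply: sq_bound; apply: le_trans bd; rewrite lerDl sqr_ge0.
have aB : `|ea g| <= B2 * M.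
 move: ay; rewrite normrM (gtr0_norm zi0); have := normr_ge0 (ea g); nra.
have bB : `|eb g| <= B2 + B2 * M * M.
 rewrite -[eb g](addKr (ea g * re z)); apply: le_trans (ler_normD _ _) _.
 rewrite normrN normrM; have := normr_ge0 (ea g); nra.
have P1 : 0 < B * M by nra.
have P2 : 0 < B2 * M by nra.
have P3 : 0 < B2 * M * M by nra.
by split=> //; rewrite /N; lra.
Qed.

Lemma Gam_vertz tau (n : int) : Gam (vert tau) -> Gam (vert (n%:~R * tau)).
Proof.
move=> Gt; have Gn (j : nat) : Gam (vert (j%:R * tau)).
 elim: j => [|j IH]; first by rewrite mul0r vert0; exact: Gam1.
 by rewrite mulrSr mulrDl mul1r -vertM; exact: GamM.
case: n => j; first exact: Gn.
by rewrite NegzE mulrNz mulNr -vertV; apply: GamV => //; exact: Gn.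
Qed.

Lemma translate_re tau x : 0 < tau -> exists n : int, 0 <= x + n%:~R * tau < tau.
Proof.
move=> t0; exists (- Num.floor (x / tau)); rewrite mulrNz mulNr.
have := floor_itv (x / tau); rewrite intrD1 ler_pdivlMr // ltr_pdivrMr // mulrDl mul1r.
by move=> /andP[A B]; apply/andP; split; lra.
Qed.

(** Weak inequalities instead of strict ones; this is the closure of [K] because moving a point
    straight up makes all of them strict. *)
Definition clK : set C :=
 [set z | uhp z /\ forall g, Gam g -> ec g != 0 -> 1 <= den g z].

Lemma KE z : common_ext Gam z <-> uhp z /\ forall g, Gam g -> ec g != 0 -> 1 < den g z.
Proof.
split=> -[Hz H]; split=> // g.
 by move=> Gg c0; have /isom_extE[] := H g (proj2 (movingP g) (conj Gg c0)).
by move=> /movingP[Gg c0]; apply/isom_extE; split=> //; exact: H.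
Qed.

Lemma K_clK z : common_ext Gam z -> clK z.
Proof. by move=> /KE[Hz H]; split=> // g Gg c0; exact/ltW/H. Qed.

Lemma near_bounded z : uhp z -> exists2 M, 0 < M &
 \forall w \near z, [/\ `|re w| <= M, 0 < im w & M^-1 <= im w <= M].
Proof.
rewrite uhpE => Hz; pose M := `|re z| + 2 * im z + 2 / im z + 1.
have P : 0 < 2 / im z by rewrite divr_gt0.
have N := normr_ge0 (re z); have M0 : 0 < M by rewrite /M; lra.
exists M => //; pose e := Num.min (im z / 2) 1.
have e0 : 0 < e by rewrite lt_min ltr01 divr_gt0.
apply: filterS (box_nbhs z e0) => w [H1 H2].
move: H1 H2; rewrite !lt_min => /andP[_ H1] /andP[H2 H3].
have A : `|re w| <= M.
 rewrite -[re w](subrK (re z)); apply: le_trans (ler_normD _ _) _.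
 rewrite /M; lra.
move: H2 H3; rewrite !ltr_norml => /andP[H2 H2'] /andP[H3 H3'].
split=> //; first by lra.
apply/andP; split; last by rewrite /M; lra.
have : M^-1 <= (2 / im z)^-1 by rewrite lef_pV2 ?posrE // /M; lra.
rewrite invf_div; lra.
Qed.

Lemma near_seq (T : eqType) (s : seq T) (P : T -> C -> Prop) z :
 (forall a, a \in s -> \forall w \near z, P a w) ->
 \forall w \near z, forall a, a \in s -> P a w.
Proof.
elim: s => [_|b s IH H]; first by apply: filterS (box_nbhs z ltr01).
have A : \forall w \near z, P b w by apply: H; exact: mem_head.
have B : \forall w \near z, forall a, a \in s -> P a w.
 by apply: IH => a ais; apply: H; rewrite inE ais orbT.
by apply: filterS2 A B => w Pb Ps a; rewrite inE => /orP[/eqP->//|/Ps].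
Qed.

(** An infinite intersection of exteriors is open here by local finiteness: a translation on the
    left does not change the isometric sphere of [g], so [Re (g w)] can be assumed bounded and
    [finite_den] applies. *)
Lemma open_K : open (common_ext Gam).
Proof.
rewrite openE => z /KE[Hz zK]; rewrite /interior.
have [tau t0 Gt] := cusp_width.
have [M M0 nM] := near_bounded Hz; pose N := M + tau + 1 + M^-1.
have iM : 0 < M^-1 by rewrite invr_gt0.
have [s Es] : exists s : seq G, [set g | Gam g /\ exists z,
  [/\ `|re z| <= N, 0 < im z, N^-1 <= im z <= N, den g z <= N &
    `|re (mobC g z)| <= N]] = [set` s].
 by apply/finite_seqP; exact: finite_den.
have Q : \forall w \near z, forall g, g \in s -> Gam g -> ec g != 0 -> 1 < den g w.
 apply: near_seq => g gs; have [gg|ng] := pselect (Gam g /\ ec g != 0); last first.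
  by apply: filterS (box_nbhs z ltr01) => w _ Gg c0; exfalso; apply: ng.
 have : \forall w \near z, 1 < den g w.
  apply: open_nbhs_nbhs; split; last by apply: zK; case: gg.
  exact: open_gtc (@cts_den R g).
 by apply: filterS.
apply: filterS2 nM Q => w [w1 w2 w3] Q; apply/KE; split=> // g Gg c0.
rewrite ltNge; apply/negP => dw.
have [n /andP[n1 n2]] := translate_re (re (mobC g w)) t0.
have Gv := Gam_vertz n Gt.
have E : mobC (vert (n%:~R * tau) * g)%g w = pt (re (mobC g w) + n%:~R * tau) (im (mobC g w)).
 by rewrite mobCM // vert_mob.
have c1 : ec (vert (n%:~R * tau) * g)%g != 0 by rewrite -normr_eq0 ec_vertM normr_eq0.
have : (vert (n%:~R * tau) * g)%g \in s.
 suff : [set` s] (vert (n%:~R * tau) * g)%g by [].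
 rewrite -Es; split; first exact: GamM.
 have iN : N^-1 <= M^-1 by rewrite lef_pV2 ?posrE // /N; lra.
 exists w; split=> //.
 - by rewrite /N; lra.
 - by move: w3 => /andP[? ?]; apply/andP; split; rewrite /N; lra.
 - by rewrite den_vertM // /N; lra.
 - by rewrite E /= ger0_norm // /N; lra.
move=> /Q /(_ (GamM Gv Gg) c1); rewrite den_vertM //; lra.
Qed.

Lemma clK_up z w : clK z -> re w = re z -> im z <= im w -> clK w.
Proof.
move=> [Hz H] E I; have Hw : uhp w by exact: lt_le_trans I.
split=> // g Gg c0; apply: le_trans (H g Gg c0) _; rewrite /den E lerD2l !exprMn.
by apply: ler_wpM2l; [exact: sqr_ge0|rewrite lerXn2r // nnegrE ltW].
Qed.

Lemma K_up z w : clK z -> re w = re z -> im z < im w -> common_ext Gam w.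
Proof.
move=> [Hz H] E I; have Hw : uhp w by exact: lt_trans I.
apply/KE; split=> // g Gg c0; apply: le_lt_trans (H g Gg c0) _.
rewrite /den E ltrD2l !exprMn ltr_pM2l; last by rewrite exprn_even_gt0.
by rewrite ltr_sqr // nnegrE ltW.
Qed.

Lemma closureH_K : closureH (common_ext Gam) = clK.
Proof.
apply/seteqP; split=> z.
 case=> cl Hz; split=> // g Gg c0.
 have : closure [set w | 1 <= den g w] z.
  by apply: closure_subset cl => w /KE[_ /(_ g Gg c0)] /ltW.
 by rewrite -(proj1 (closure_id _) (closed_gec (a := 1) (@cts_den R g))).
move=> zK; apply/closureHP; split; first by case: zK.
move=> e e0; exists (pt (re z) (im z + e / 2)).
 by apply: K_up zK _ _ => //=; rewrite ltrDl divr_gt0.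
rewrite /box /= subrr normr0 addrAC subrr add0r gtr0_norm ?divr_gt0 //; split=> //.
lra.
Qed.

Lemma boundary_K z : boundaryH (common_ext Gam) z <->
 clK z /\ exists g, [/\ Gam g, ec g != 0 & den g z = 1].
Proof.
rewrite /boundaryH closureH_K.
have -> : (common_ext Gam)^° = common_ext Gam by apply/interior_id; exact: open_K.
split.
 case=> zK nK; split=> //; apply: contrapT => nE; apply: nK; apply/KE.
 case: zK => Hz zK; split=> // g Gg c0; rewrite lt_neqAle zK // andbT.
 by apply/eqP => E; apply: nE; exists g.
case=> zK [g [Gg c0 E]]; split=> // /KE[_ /(_ g Gg c0)]; by rewrite E ltxx.
Qed.

(** The inequalities defining [clK], applied to [g] at [z] and to [g^-1] at [g z], are opposite. So
    points of the closure of [K] are identified only along isometric spheres or by translations. *)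
Lemma clK_den g z : clK z -> clK (mobC g z) -> Gam g -> den g z = 1.
Proof.
move=> [Hz zK] [Hgz gK] Gg; have [c0|c0] := eqVneq (ec g) 0.
 have [t ->] := translation_stab (proj2 (stab_infP g) (conj Gg c0)).
 exact: den_vert.
apply/le_anti; rewrite zK // andbT.
have := gK g^-1%g (GamV Gg); rewrite ecV0 => /(_ c0); rewrite denV //.
by rewrite invr_ge1 ?unitfE ?gt_eqF ?den_gt0 //; case/andP.
Qed.

Lemma clK_mob g z : clK z -> Gam g -> den g z = 1 -> clK (mobC g z).
Proof.
move=> [Hz zK] Gg d1; split; first exact: mobC_uhp.
move=> h Gh c0; have := denM h g Hz; rewrite d1 mulr1 => <-.
have [c1|c1] := eqVneq (ec (h * g)%g) 0; last by apply: zK => //; exact: GamM.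
have [t ->] := translation_stab (proj2 (stab_infP _) (conj (GamM Gh Gg) c1)).
by rewrite den_vert.
Qed.

Lemma K_stab g z : common_ext Gam z -> clK (mobC g z) -> Gam g ->
 exists t, g = vert t.
Proof.
move=> zK gK Gg; have d1 := clK_den (K_clK zK) gK Gg.
have [c0|c0] := eqVneq (ec g) 0.
 exact: (translation_stab (proj2 (stab_infP g) (conj Gg c0))).
by move/KE: zK => [_ /(_ g Gg c0)]; rewrite d1 ltxx.
Qed.

End Ford.

(** * Segments with ideal end points, vertical lines and semicircles *)

Section Segments.
Implicit Types (g h k : G) (z w : C) (x y t c r e : R) (p q : sphere R).

Lemma sgn_neq0 (s : R) : s * s = 1 -> s != 0.
Proof. by move=> s2; apply/eqP => z; move: s2; rewrite z; lra. Qed.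

Lemma geod_at g t (u : \bar R) : geod (g * at_ t)%g u = geod g (u + t%:E).
Proof.
case: u => [u||] /=; first by rewrite !geod_fin gp_at.
all: rewrite ?geod_pinf ?geod_ninf.
all: have [s [s2 Ha Hb Hc Hd]] := mul_entries g (at_ t).
all: have [s' [s2' Ha' Hb' Hc' Hd']] := at_entries t.
all: have s0 := sgn_neq0 s2; have s0' := sgn_neq0 s2'.
all: rewrite Ha' Hb' Hc' Hd' in Ha Hb Hc Hd.
all: have e1 : expR (t / 2) != 0 by rewrite gt_eqF ?expR_gt0.
all: have e2 : expR (- (t / 2)) != 0 by rewrite gt_eqF ?expR_gt0.
- have Ec : ec (g * at_ t)%g = s * s' * expR (t / 2) * ec g by rewrite Hc; ring.
 have Ea : ea (g * at_ t)%g = s * s' * expR (t / 2) * ea g by rewrite Ha; ring.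
 have K : s * s' * expR (t / 2) != 0 by rewrite !mulf_neq0.
 rewrite Ec Ea mulf_eq0 (negPf K) /=; case: eqVneq => // c0.
 by rewrite -mulf_div divff // mul1r.
- have Ec : ed (g * at_ t)%g = s * s' * expR (- (t / 2)) * ed g by rewrite Hd; ring.
 have Ea : eb (g * at_ t)%g = s * s' * expR (- (t / 2)) * eb g by rewrite Hb; ring.
 have K : s * s' * expR (- (t / 2)) != 0 by rewrite !mulf_neq0.
 rewrite Ec Ea mulf_eq0 (negPf K) /=; case: eqVneq => // c0.
 by rewrite -mulf_div divff // mul1r.
Qed.

Lemma geod_Sop g (u : \bar R) : geod (g * Sop)%g u = geod g (- u).
Proof.
case: u => [u||] /=; first by rewrite !geod_fin gp_Sop.
all: rewrite ?geod_pinf ?geod_ninf.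
all: have [s [s2 Ha Hb Hc Hd]] := mul_entries g Sop.
all: have [s' [s2' Ha' Hb' Hc' Hd']] := Sop_entries R.
all: have s0 := sgn_neq0 s2; have s0' := sgn_neq0 s2'.
all: rewrite Ha' Hb' Hc' Hd' in Ha Hb Hc Hd.
all: have K : s * s' != 0 by rewrite mulf_neq0.
- have Ec : ec (g * Sop)%g = s * s' * ed g by rewrite Hc; ring.
 have Ea : ea (g * Sop)%g = s * s' * eb g by rewrite Ha; ring.
 rewrite Ec Ea mulf_eq0 (negPf K) /=; case: eqVneq => // c0.
 by rewrite -mulf_div divff // mul1r.
- have Ec : ed (g * Sop)%g = - (s * s') * ec g by rewrite Hd; ring.
 have Ea : eb (g * Sop)%g = - (s * s') * ea g by rewrite Hb; ring.
 rewrite -oppr_eq0 in K.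
 rewrite Ec Ea mulf_eq0 (negPf K) /=; case: eqVneq => // c0.
 by rewrite -mulf_div divff // mul1r.
Qed.

Lemma seg_intro k (s t : \bar R) r : ((s <= r%:E <= t) || (t <= r%:E <= s))%E ->
 seg (geod k s) (geod k t) (gp k r).
Proof.
case/orP => H; first by exists k, s, t, r; rewrite geod_fin.
exists (k * Sop)%g, (- s)%E, (- t)%E, (- r).
rewrite EFinN !geod_Sop !oppeK geod_fin !leeN2.
by case/andP: H => -> ->.
Qed.

(** A segment comes with some parametrization; inside the line of [k] it agrees with the one of [k]
    up to shift and reversal. *)
Lemma seg_sub k p q z : p <> q -> seg p q `<=` line k -> seg p q z ->
 exists (s t : \bar R) r, [/\ geod k s = p, geod k t = q, gp k r = z &
   ((s <= r%:E <= t) || (t <= r%:E <= s))%E].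
Proof.
move=> pq sL [h [s [t [r [Es Et st Er]]]]]; rewrite geod_fin in Er.
have {}Er : gp h r = z by case: Er.
have [srE rtE] := andP st.
have st' : (s < t)%E.
 rewrite lt_neqAle (le_trans srE rtE) andbT; apply/eqP => E; apply: pq.
 by rewrite -Es -Et E.
(* One point does not determine the line, so a second point of the segment is chosen next to [r], in
   whichever direction there is room. *)
have [r' [rr' srt]] : exists r', r != r' /\ (s <= r'%:E <= t)%E.
 have [rt|tr] := boolP (r%:E < t)%E.
  case: t Et st st' rtE rt => [t||] //= Et _ _ _ rt.
   exists t; split; last by rewrite lexx andbT (le_trans srE (ltW rt)).
   by apply/eqP => E; move: rt; rewrite E ltxx.
  exists (r + 1); split; first by rewrite -subr_eq0 opprD addrA subrr sub0r oppr_eq0 oner_eq0.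
  by rewrite leey andbT (le_trans srE) // lee_fin lerDl.
 have Et' : t = r%:E by apply/le_anti; rewrite rtE andbT leNgt.
 case: s Es srE st' st => [s||] //= Es srE st' _.
  exists s; rewrite lexx (ltW st'); split=> //.
  by apply/eqP => E; move: st'; rewrite Et' E ltxx.
 exists (r - 1); split; first by rewrite -subr_eq0 opprB addrC addrNK oner_eq0.
 by rewrite leNye Et' lee_fin gerBl ler01.
have L u : (s <= u%:E <= t)%E -> line k (gp h u).
 by move=> H; apply: sL; exists h, s, t, u; rewrite geod_fin.
have N : gp h r <> gp h r' by move/gp_inj/eqP; rewrite (negPf rr').
have [a0 b0] := line_two N (gp_line h r) (gp_line h r') (L _ st) (L _ srt).
have [[u Eh]|[u Eh]] := same_line a0 b0.
 exists (s + u%:E)%E, (t + u%:E)%E, (r + u).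
 rewrite -!geod_at -Eh Es Et -gp_at -Eh Er EFinD; split=> //.
 by rewrite !leeD2rE ?st.
exists (- (s + u%:E))%E, (- (t + u%:E))%E, (- (r + u)).
rewrite -!geod_Sop -!geod_at -Eh Es Et -gp_Sop -gp_at -Eh Er; split=> //.
by apply/orP; right; rewrite EFinN EFinD !leeN2 !leeD2rE // rtE.
Qed.

(* The two ideal ends of [h] and its points, tested against a half plane. *)
Definition lead k : R := al k^-1%g.

Definition csd k p : Prop := if p is Some z then 0 <= side_ k z else 0 <= lead k.

(** [al (k^-1 * h)] has the sign of the equation of [k] at the forward end of [h]; when this end is
    infinity the leading coefficient takes the place of the value. *)
Lemma al_side k h : al (k^-1 * h)%g =
 if ec h == 0 then lead k * ea h ^+ 2 else ec h ^+ 2 * side_ k (pt (ea h / ec h) 0).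
Proof.
have [s [s2 Ha _ Hc _]] := mul_entries k^-1%g h; rewrite {1}/al Ha Hc.
case: eqVneq => [->|c0].
 rewrite /lead /al; transitivity (s * s * (ea k^-1%g * ec k^-1%g * ea h ^+ 2)); first by ring.
 by rewrite s2 mul1r.
rewrite /side_ /qf /=; transitivity (s * s * ((ea k^-1%g * ea h + eb k^-1%g * ec h)
 * (ec k^-1%g * ea h + ed k^-1%g * ec h))); first by ring.
by rewrite s2; field.
Qed.

Lemma be_side k h : be (k^-1 * h)%g =
 if ed h == 0 then lead k * eb h ^+ 2 else ed h ^+ 2 * side_ k (pt (eb h / ed h) 0).
Proof.
have [s [s2 _ Ha _ Hc]] := mul_entries k^-1%g h; rewrite {1}/be Ha Hc.
case: eqVneq => [->|c0].
 rewrite /lead /al; transitivity (s * s * (ea k^-1%g * ec k^-1%g * eb h ^+ 2)); first by ring.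
 by rewrite s2 mul1r.
rewrite /side_ /qf /=; transitivity (s * s * ((ea k^-1%g * eb h + eb k^-1%g * ed h)
 * (ec k^-1%g * eb h + ed k^-1%g * ed h))); first by ring.
by rewrite s2; field.
Qed.

Lemma csd_pinf k h : csd k (geod h +oo) <-> 0 <= al (k^-1 * h)%g.
Proof.
rewrite geod_pinf al_side; have [c0|c0] := eqVneq (ec h) 0.
 suff A : 0 < ea h ^+ 2 by rewrite /csd (pmulr_lge0 _ A).
 rewrite exprn_even_gt0 //=.
 by apply: contra_eq_neq (edet h) => ->; rewrite c0 mul0r mulr0 subrr eq_sym oner_eq0.
have A : 0 < ec h ^+ 2 by nra.
by rewrite /csd (pmulr_rge0 _ A).
Qed.

Lemma csd_ninf k h : csd k (geod h -oo) <-> 0 <= be (k^-1 * h)%g.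
Proof.
rewrite geod_ninf be_side; have [c0|c0] := eqVneq (ed h) 0.
 suff A : 0 < eb h ^+ 2 by rewrite /csd (pmulr_lge0 _ A).
 rewrite exprn_even_gt0 //=.
 by apply: contra_eq_neq (edet h) => ->; rewrite c0 mul0r mulr0 subrr eq_sym oner_eq0.
have A : 0 < ed h ^+ 2 by nra.
by rewrite /csd (pmulr_rge0 _ A).
Qed.

Lemma seg_chpl k p q : csd k p -> csd k q -> seg p q `<=` chpl k.
Proof.
move=> Hp Hq z [h [s [t [r [Es Et /andP[sr rt] ]]]]]; rewrite geod_fin => -[<-].
split; first exact: gp_uhp.
rewrite side_gp_ge0; have X0 u : 0 < expR u ^+ 2 :> R by rewrite exprn_gt0 ?expR_gt0.
move: Hp Hq sr rt; rewrite -Es -Et; case: s {Es} => [s||] //; case: t {Et} => [t||] //;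
 rewrite ?csd_pinf ?csd_ninf ?geod_fin /csd ?side_gp_ge0 ?lee_fin => H1 H2 // A B.
- by apply: affine_between H1 H2; rewrite !expR2_mono A B.
- have := X0 r; rewrite -expR2_mono in A; nra.
- have := X0 r; rewrite -expR2_mono in B; nra.
- nra.
Qed.

Lemma leadE k : lead k = side_ k (pt 0 1) - side_ k (pt 0 0).
Proof. by rewrite /lead /side_ !qf_axis expr1n mulr1 expr0n mulr0 add0r addrK. Qed.

Lemma lead_vert x : lead (vert x) = 0.
Proof. by rewrite leadE !side_vert /= subrr. Qed.

Lemma lead_circ c r : 0 < r -> lead (circ c r) = - (2 * r)^-1.
Proof. by move=> r0; rewrite leadE !side_circ //=; field; rewrite gt_eqF. Qed.

Lemma qfN z k : side_ (k * Sop)%g z = - side_ k z.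
Proof.
have [s [s2 Ha Hb Hc Hd]] := mul_entries Sop^-1%g k^-1%g.
have [s1 [s12 Ha1 Hb1 Hc1 Hd1]] := inv_entries (@Sop R).
have [s' [s2' Ha' Hb' Hc' Hd']] := Sop_entries R.
rewrite /side_ invgM /qf Ha Hb Hc Hd Ha1 Hb1 Hc1 Hd1 Ha' Hb' Hc' Hd'.
set q1 := ea k^-1%g; set q2 := eb k^-1%g; set q3 := ec k^-1%g; set q4 := ed k^-1%g.
transitivity (- ((s * s) * (s1 * s1) * (s' * s')) *
 (q1 * q3 * (re z ^+ 2 + im z ^+ 2) + (q1 * q4 + q2 * q3) * re z + q2 * q4)).
 by ring.
by rewrite s2 s12 s2' !mulr1 mulN1r.
Qed.

Lemma leadN k : lead (k * Sop)%g = - lead k.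
Proof. by rewrite !leadE !qfN; ring. Qed.

Lemma geod_vert x (u : \bar R) : geod (vert x) u =
 match u with t%:E => Some (pt x (expR t)) | +oo%E => None | -oo%E => Some (pt x 0) end.
Proof.
have [s [s2 Ha Hb Hc Hd]] := vert_entries x; have s0 := sgn_neq0 s2.
case: u => [t||]; first by rewrite geod_fin /gp vert_mob /= add0r.
 by rewrite geod_pinf Hc mulr0 eqxx.
by rewrite geod_ninf Hd mulr1 (negPf s0) Hb; congr (Some (pt _ _)); field.
Qed.

(** With [psi], the arc length parametrization [c + r tanh t], [r / cosh t] of a semicircle. The
    abscissa is increasing, so arcs are described by intervals of real parts. *)
Definition phi c r (u : \bar R) : R := match u with
 t%:E => c + r * ((expR t ^+ 2 - 1) / (expR t ^+ 2 + 1))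
 | +oo%E => c + r | -oo%E => c - r end.

Definition psi r (u : \bar R) : R := match u with
 t%:E => 2 * r * expR t / (expR t ^+ 2 + 1) | _ => 0 end.

Lemma geod_circ c r (u : \bar R) : 0 < r ->
 geod (circ c r) u = Some (pt (phi c r u) (psi r u)).
Proof.
move=> r0; set n := Num.sqrt (2 * r).
have n2 : n * n = 2 * r by rewrite -expr2 sqr_sqrtr // mulr_ge0 // ltW.
have n0 : n != 0 by nra.
have [s [s2 Ha Hb Hc Hd]] : eqs (ea (circ c r)) (eb (circ c r)) (ec (circ c r))
  (ed (circ c r)) ((c + r) / n) ((c - r) / n) n^-1 n^-1.
 apply: mk4E; transitivity (2 * r / (n * n)); first by rewrite -/n; field.
 by rewrite n2 divff // mulf_neq0 ?gt_eqF.
have s0 := sgn_neq0 s2; have sn : s / n != 0 by rewrite mulf_neq0 ?invr_eq0.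
case: u => [t||].
- rewrite geod_fin; congr Some.
 have D : den (circ c r) (pt 0 (expR t)) = (expR t ^+ 2 + 1) / (2 * r).
  rewrite /den Hc Hd /= -n2 mulr0 add0r.
  transitivity (s * s * (expR t ^+ 2 + 1) / (n * n)); first by field.
  by rewrite s2 mul1r.
 apply: Cext; rewrite /gp ?mobC_re ?mobC_im D /=; last by field; rewrite !gt_eqF.
 rewrite qf_axis /al /be Ha Hb Hc Hd.
 transitivity (s * s / (n * n) * ((c + r) * expR t ^+ 2 + (c - r)) / ((expR t ^+ 2 + 1) / (2 * r))).
  by congr (_ / _); field.
 by rewrite s2 n2; field; rewrite !gt_eqF.
- rewrite geod_pinf Hc (negPf sn) Ha; congr (Some (pt _ _)).
 by rewrite /phi; field; rewrite s0 n0.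
- rewrite geod_ninf Hd (negPf sn) Hb; congr (Some (pt _ _)).
 by rewrite /phi; field; rewrite s0 n0.
Qed.

Lemma phi_lt c r (u v : \bar R) : 0 < r -> (u < v)%E -> phi c r u < phi c r v.
Proof.
move=> r0; have F (X : R) : 0 < X -> -1 < (X - 1) / (X + 1) < 1.
 move=> X0; rewrite ltr_pdivlMr ?ltr_pdivrMr ?addr_gt0 //; lra.
have X0 t : 0 < expR t ^+ 2 :> R by rewrite exprn_gt0 ?expR_gt0.
case: u => [u||]; case: v => [v||] //=; rewrite ?lte_fin => H; rewrite ltrD2l.
- rewrite ltr_pM2l // ltr_pdivrMr ?addr_gt0 // mulrAC ltr_pdivlMr ?addr_gt0 //.
 rewrite -expR2_lt in H; have := X0 v; nra.
- by have /andP[_ ?] := F _ (X0 u); rewrite -[X in _ < X]mulr1 ltr_pM2l.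
- by have /andP[? _] := F _ (X0 v); rewrite -[X in X < _]mulrN1 ltr_pM2l.
- by rewrite gtrN.
Qed.

Lemma phi_le c r (u v : \bar R) : 0 < r -> (phi c r u <= phi c r v) = (u <= v)%E.
Proof.
move=> r0; apply/idP/idP => H; last first.
 move: H; rewrite le_eqVlt => /orP[/eqP->//|H]; exact/ltW/phi_lt.
by rewrite leNgt; apply/negP => /(phi_lt c r0); rewrite ltNge H.
Qed.

Lemma line_circ c r z : 0 < r -> line (circ c r) z <-> uhp z /\ nz c z = r ^+ 2.
Proof.
move=> r0; split=> -[Hz H]; split=> //.
 move: H; rewrite side_circ // => /eqP; rewrite mulf_eq0 invr_eq0 mulf_eq0.
 by rewrite (gt_eqF r0) (gt_eqF (ltr0n _ 2)) !orbF subr_eq0 => /eqP.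
by rewrite side_circ // -/(nz c z) H subrr mul0r.
Qed.

Lemma gp_circ_re c r t : 0 < r -> re (gp (circ c r) t) = phi c r t%:E.
Proof.
by move=> r0; have := geod_circ c t%:E r0; rewrite geod_fin => /Some_inj ->.
Qed.

Definition between (a b x : R) : bool := (a <= x <= b) || (b <= x <= a).

Lemma seg_circ c r p q : 0 < r -> p <> q -> seg p q !=set0 ->
 seg p q `<=` line (circ c r) ->
 exists s t : \bar R, [/\ p = Some (pt (phi c r s) (psi r s)),
  q = Some (pt (phi c r t) (psi r t)) &
  forall z, seg p q z <-> line (circ c r) z /\ between (phi c r s) (phi c r t) (re z)].
Proof.
move=> r0 pq [z0 z0s] sL; have [s [t [u [Es Et Eu stu]]]] := seg_sub pq sL z0s.
exists s, t; rewrite -Es -Et !geod_circ //; split=> // z; split; last first.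
 case=> /lineP[v <-]; rewrite /between gp_circ_re // !phi_le // => B.
 by rewrite -!geod_circ //; exact: seg_intro.
rewrite -!geod_circ // Es Et => zs; split; first exact: sL.
have [s' [t' [u' [Es' Et' Eu' H]]]] := seg_sub pq sL zs.
have Q (a b : \bar R) : geod (circ c r) a = geod (circ c r) b -> a = b.
 rewrite !geod_circ // => -[E _]; apply/le_anti.
 by rewrite -!(phi_le c _ _ r0) E lexx.
rewrite -(Q s' s) ?Es' // -(Q t' t) ?Et' // -Eu' /between gp_circ_re //.
by rewrite !phi_le.
Qed.

End Segments.

Lemma in3 (T : eqType) (a b c : T) (s := [:: a; b; c]) :
 [/\ a \in s, b \in s & c \in s].
Proof. by rewrite /s !inE (eqxx a) (eqxx b) (eqxx c) !orbT. Qed.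

Lemma in4 (T : eqType) (a b c d : T) (s := [:: a; b; c; d]) :
 [/\ a \in s, b \in s, c \in s & d \in s].
Proof. by rewrite /s !inE (eqxx a) (eqxx b) (eqxx c) (eqxx d) !orbT. Qed.

Lemma set4P (T : Type) (a b c d p : T) : [set a; b; c; d] p <->
 [\/ p = a, p = c, p = b | p = d].
Proof.
split=> [[[[]|]|]|[]] ->; first [by constructor 1|by constructor 2
 |by constructor 3|by constructor 4|by left; left; left|by left; left; right
 |by left; right|by right].
Qed.

Hypothesis HA : condition_A Gam.

(** * Precells as regions above halves of isometric arcs *)

Section Precells.
Implicit Types (g h k : G) (z w v s : C) (x y t c r e : R) (p q : sphere R) (A : set C).

Definition arc c r e : set C :=
 [set z | [/\ uhp z, nz c z = r ^+ 2 & between c e (re z)]].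

(** The building block of precells: a cuspidal precell is one such set, a non-cuspidal precell is
    two of them, joined along the vertical line above its vertex. *)
Definition Hf c r e : set C :=
 [set z | [/\ uhp z, r ^+ 2 <= nz c z & between c e (re z)]].

(* The part of the isometric sphere of centre c and radius r between its summit
  and the end point with real part e is relevant, and e is maximal. *)
Definition HALF c r e : Prop :=
 [/\ 0 < r, c <> e, (e - c) ^+ 2 <= r ^+ 2,
  exists g, [/\ Gam g, ec g != 0, ctr g = c & rad g = r] &
  arc c r e `<=` clK /\
  forall z, clK z -> nz c z = r ^+ 2 -> (re z - e) * (e - c) <= 0].

Lemma isom_line g : ec g != 0 -> isom_sphere g = line (circ (ctr g) (rad g)).
Proof.
move=> c0; have r0 := rad_gt0 c0; apply/seteqP; split=> z.
 move/isom_sphereE => [Hz]; rewrite den_nz // => H; apply/(line_circ _ _ r0).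
 by split=> //; apply: (mulIf (x := (rad g ^+ 2)^-1)); rewrite ?invr_eq0 ?sqrf_eq0 ?gt_eqF // H divff // sqrf_eq0 gt_eqF.
move/(line_circ _ _ r0) => [Hz H]; apply/isom_sphereE; split=> //.
by rewrite den_nz // H divff // sqrf_eq0 gt_eqF.
Qed.

Lemma relevant_partE g z : Gam g -> ec g != 0 ->
 relevant_part Gam (isom_sphere g) z <->
 clK z /\ nz (ctr g) z = rad g ^+ 2.
Proof.
move=> Gg c0; have r0 := rad_gt0 c0; rewrite /relevant_part isom_line //; split.
 by case=> /(line_circ _ _ r0)[Hz H] /boundary_K[zK _].
case=> zK H; have Hz := proj1 zK; split; first exact/(line_circ _ _ r0).
apply/boundary_K; split=> //; exists g; split=> //.
by rewrite den_nz // H divff // sqrf_eq0 gt_eqF.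
Qed.

Lemma summitP g s : ec g != 0 -> summit (isom_sphere g) s <-> s = pt (ctr g) (rad g).
Proof.
move=> c0; have r0 := rad_gt0 c0; rewrite isom_line //.
have top : line (circ (ctr g) (rad g)) (pt (ctr g) (rad g)).
 by apply/(line_circ _ _ r0); split=> //; rewrite /nz /= subrr expr0n add0r.
have le z : line (circ (ctr g) (rad g)) z -> im z <= rad g.
 case/(line_circ _ _ r0); rewrite uhpE /nz => Hz H.
 by rewrite -ler_sqr ?nnegrE ?(ltW Hz) ?(ltW r0) // -H lerDr sqr_ge0.
split=> [[Is Hs]|->]; last by split.
have E : im s = rad g by apply/le_anti; rewrite le //; exact: (Hs _ top).
have [_] := proj1 (line_circ _ _ r0) Is; rewrite /nz E => /eqP.
rewrite -subr_eq0 addrK sqrf_eq0 subr_eq0 => /eqP Er.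
by apply: Cext.
Qed.

Lemma psi_ge0 r (u : \bar R) : 0 < r -> 0 <= psi r u.
Proof.
move=> r0; case: u => [t||] //=; rewrite divr_ge0 ?mulr_ge0 ?addr_ge0 ?sqr_ge0 ?expR_ge0 //.
exact: ltW.
Qed.

Lemma phi_psi c r (u : \bar R) : 0 < r -> (phi c r u - c) ^+ 2 + psi r u ^+ 2 = r ^+ 2.
Proof.
move=> r0; case: u => [t||] /=; [|ring|ring].
by field.
Qed.

Lemma circle_ex c r e y : 0 < r -> (e - c) ^+ 2 + y ^+ 2 = r ^+ 2 -> 0 <= y ->
 exists u : \bar R, geod (circ c r) u = Some (pt e y).
Proof.
move=> r0 H; rewrite le_eqVlt => /orP[/eqP y0|y0].
 move: H; rewrite -y0 expr0n addr0 => /eqP; rewrite eqf_sqr => /orP[]/eqP E.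
  exists +oo%E; rewrite geod_circ //= -E; congr (Some (pt _ _)); ring.
 exists -oo%E; rewrite geod_circ //=; congr (Some (pt _ _)); lra.
have [u <-] : exists u, gp (circ c r) u = pt e y.
 by apply: lineP; apply/(line_circ _ _ r0).
by exists u%:E; rewrite geod_fin.
Qed.

Lemma seg_arc c r e y : 0 < r -> (e - c) ^+ 2 + y ^+ 2 = r ^+ 2 -> 0 <= y ->
 c <> e -> seg (Some (pt c r)) (Some (pt e y)) = arc c r e.
Proof.
move=> r0 H y0 ce.
have [u Eu] := circle_ex r0 H y0.
have [s Es] : exists s : \bar R, geod (circ c r) s = Some (pt c r).
 by apply: circle_ex => //; [rewrite subrr expr0n add0r|exact: ltW].
have ps : phi c r s = c by move: Es; rewrite geod_circ // => -[].
have pu : phi c r u = e by move: Eu; rewrite geod_circ // => -[].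
apply/seteqP; split=> z; last first.
 case=> Hz nzz B; have [t Et] : exists t, gp (circ c r) t = z.
  by apply: lineP; apply/(line_circ _ _ r0).
 rewrite -Es -Eu -Et; apply: seg_intro; rewrite -!(phi_le c _ _ r0) ps pu.
 by rewrite -gp_circ_re // Et.
have S p : (exists v : \bar R, geod (circ c r) v = p) -> csd (circ c r) p /\ csd (circ c r * Sop)%g p.
 case=> v <-; rewrite geod_circ // /csd qfN.
 have -> : side_ (circ c r) (pt (phi c r v) (psi r v)) = 0.
  by rewrite side_circ //= phi_psi // subrr mul0r.
 by rewrite oppr0 lexx.
have [s1 s2] := S _ (ex_intro _ _ Es); have [u1 u2] := S _ (ex_intro _ _ Eu).
have sub : seg (Some (pt c r)) (Some (pt e y)) `<=` line (circ c r).
 move=> w ws; have [Hw w1] := seg_chpl s1 u1 ws; have [_] := seg_chpl s2 u2 ws.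
 by rewrite qfN oppr_ge0 => w2; split=> //; apply/le_anti; rewrite w1 w2.
move=> zs; have pq : Some (pt c r) <> Some (pt e y) :> sphere R by case.
have [s' [u' [Es' Eu' H']]] := seg_circ r0 pq (ex_intro _ z zs) sub.
have [/(line_circ _ _ r0)[Hz nzz] B] := proj1 (H' z) zs.
split=> //; move: B; case: Es' => <- _; case: Eu' => <- _; exact.
Qed.

(** Condition (A) makes the summit a point of the relevant part other than the end point [p]. The
    arc from the summit to [p] is therefore nondegenerate and lies in the closure of [K]. *)
Lemma part_HALF I p : part_endpoint Gam I p -> exists g e y,
 [/\ Gam g, ec g != 0 & I = isom_sphere g] /\
 [/\ p = Some (pt e y), 0 <= y, (e - ctr g) ^+ 2 + y ^+ 2 = rad g ^+ 2 &
   HALF (ctr g) (rad g) e].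
Proof.
move=> pI; have [[[g /movingP[Gg c0] EI] ca] [q pq Erp]] := pI.
have r0 := rad_gt0 c0.
pose s0 := pt (ctr g) (rad g).
have [s0K nv] : boundaryH (common_ext Gam) s0 /\ ~ vertex Gam (Some s0).
 by apply: (HA (I := I)); [case: pI|rewrite EI; apply/summitP].
have s0r : relevant_part Gam I s0.
 by split=> //; rewrite EI; case: (proj2 (summitP s0 c0) erefl).
have ne : seg p q !=set0 by exists s0; rewrite -Erp.
have sub : seg p q `<=` line (circ (ctr g) (rad g)).
 by rewrite -Erp EI -isom_line // => z [].
have [s [t [Ep Eq H]]] := seg_circ r0 pq ne sub.
exists g, (phi (ctr g) (rad g) s), (psi (rad g) s); split=> //.
have B0 : between (phi (ctr g) (rad g) s) (phi (ctr g) (rad g) t) (ctr g).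
 by move: s0r; rewrite Erp => /H[_].
have pp := phi_psi (ctr g) s r0; have p0 := psi_ge0 s r0.
have ce : ctr g <> phi (ctr g) (rad g) s.
 move=> E; apply: nv; exists I; rewrite (_ : Some s0 = p) // Ep.
 congr (Some (pt _ _)); first exact: E.
 move: pp; rewrite -E subrr expr0n add0r => /eqP; rewrite eqrXn2 ?p0 ?(ltW r0) //.
 by move/eqP => ->.
split=> //; split=> //.
- nra.
- by exists g.
split=> z.
 case=> Hz nzz B; suff : relevant_part Gam I z.
  by rewrite EI => /(relevant_partE _ Gg c0)[].
 rewrite Erp; apply/H; split; first exact/(line_circ _ _ r0).
 move: B B0; rewrite /between; lra.
move=> zK nzz; have : relevant_part Gam I z by rewrite EI; apply/relevant_partE.
rewrite Erp => /H[_]; move: B0; rewrite /between => B0 B.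
nra.
Qed.

Lemma HfE c r e : c < e -> 0 < r ->
 Hf c r e = poly [:: vert c; vert e * Sop; circ c r * Sop]%g.
Proof.
move=> ce r0; have r20 : 0 < 2 * r by lra.
apply/seteqP; split=> z.
 case=> Hz n; rewrite /between => b; split=> // k; rewrite !inE => /or3P[]/eqP->.
 - by rewrite side_vert; lra.
 - by rewrite qfN side_vert; lra.
 - by rewrite qfN side_circ // -mulNr opprB divr_ge0 ?subr_ge0 // ltW.
case=> Hz H; have [i1 i2 i3] := in3 (vert c) (vert e * Sop)%g (circ c r * Sop)%g.
split=> //.
 have := H _ i3; rewrite qfN side_circ // -mulNr opprB pmulr_lge0 ?invr_gt0 //.
 by rewrite subr_ge0.
by have := H _ i1; have := H _ i2; rewrite qfN !side_vert /between; lra.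
Qed.

Lemma HfE' c r e : e < c -> 0 < r ->
 Hf c r e = poly [:: vert e; vert c * Sop; circ c r * Sop]%g.
Proof.
move=> ce r0; have r20 : 0 < 2 * r by lra.
apply/seteqP; split=> z.
 case=> Hz n; rewrite /between => b; split=> // k; rewrite !inE => /or3P[]/eqP->.
 - by rewrite side_vert; lra.
 - by rewrite qfN side_vert; lra.
 - by rewrite qfN side_circ // -mulNr opprB divr_ge0 ?subr_ge0 // ltW.
case=> Hz H; have [i1 i2 i3] := in3 (vert e) (vert c * Sop)%g (circ c r * Sop)%g.
split=> //.
 have := H _ i3; rewrite qfN side_circ // -mulNr opprB pmulr_lge0 ?invr_gt0 //.
 by rewrite subr_ge0.
by have := H _ i1; have := H _ i2; rewrite qfN !side_vert /between; lra.
Qed.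

Definition NCpoly c1 r1 c2 r2 : seq G :=
 [:: vert c1; vert c2 * Sop; circ c1 r1 * Sop; circ c2 r2 * Sop]%g.

Lemma NCpolyE v c1 r1 c2 r2 : c1 < re v < c2 -> 0 < r1 -> 0 < r2 ->
 nz c1 v = r1 ^+ 2 -> nz c2 v = r2 ^+ 2 ->
 Hf c1 r1 (re v) `|` Hf c2 r2 (re v) = poly (NCpoly c1 r1 c2 r2).
Proof.
move=> /andP[v1 v2] r10 r20 n1 n2.
have r1p : 0 < 2 * r1 by lra.
have r2p : 0 < 2 * r2 by lra.
(* Radical axis: the two circle equations differ by a multiple of [re z - re v], so on each side of
   the vertical line through [v] one exterior condition implies the other. *)
have K z : nz c2 z - r2 ^+ 2 = nz c1 z - r1 ^+ 2 + 2 * (c1 - c2) * (re z - re v).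
 by rewrite -n1 -n2 /nz; ring.
apply/seteqP; split=> z.
 move=> H; have Hz : uhp z by case: H => -[].
 have [b [b1 b2]] : c1 <= re z <= c2 /\ r1 ^+ 2 <= nz c1 z /\ r2 ^+ 2 <= nz c2 z.
  have := K z; case: H => -[_ n]; rewrite /between => b E; split; first lra.
  - by split=> //; nra.
  - lra.
  - by split=> //; nra.
 split=> // k; rewrite !inE => /or4P[]/eqP->.
 - by rewrite side_vert; lra.
 - by rewrite qfN side_vert; lra.
 - by rewrite qfN side_circ // -mulNr opprB divr_ge0 ?subr_ge0 // ltW.
 - by rewrite qfN side_circ // -mulNr opprB divr_ge0 ?subr_ge0 // ltW.
case=> Hz H; have [i1 i2 i3 i4] := in4 (vert c1) (vert c2 * Sop)%g
 (circ c1 r1 * Sop)%g (circ c2 r2 * Sop)%g.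
have b1 : c1 <= re z by have := H _ i1; rewrite side_vert; lra.
have b2 : re z <= c2 by have := H _ i2; rewrite qfN side_vert; lra.
have m1 : r1 ^+ 2 <= nz c1 z.
 have := H _ i3; rewrite qfN side_circ // -mulNr opprB pmulr_lge0 ?invr_gt0 //.
 by rewrite subr_ge0.
have m2 : r2 ^+ 2 <= nz c2 z.
 have := H _ i4; rewrite qfN side_circ // -mulNr opprB pmulr_lge0 ?invr_gt0 //.
 by rewrite subr_ge0.
by have [?|?] := leP (re z) (re v); [left|right]; split=> //; rewrite /between; lra.
Qed.

Lemma seg_poly K p q : (forall k, k \in K -> csd k p) -> (forall k, k \in K -> csd k q) ->
 seg p q `<=` poly K.
Proof.
move=> Hp Hq z zs; split; first by case: zs => [h [s [t [r [_ _ _]]]]]; rewrite geod_fin => -[<-]; exact: gp_uhp.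
by move=> k kK; have [] := seg_chpl (Hp k kK) (Hq k kK) zs.
Qed.

Lemma seg_vert x y z : re z = x -> y <= im z -> uhp z -> 0 <= y ->
 seg (Some (pt x y)) None z.
Proof.
move=> Ez yz; rewrite uhpE => Hz; rewrite le_eqVlt => /orP[/eqP y0|y0].
 have := @seg_intro (vert x) -oo%E +oo%E (ln (im z)).
 rewrite !geod_vert -y0 /gp vert_mob /= add0r lnK ?posrE // -Ez ptK leNye leey; exact.
have := @seg_intro (vert x) (ln y)%:E +oo%E (ln (im z)).
rewrite !geod_vert lnK ?posrE // /gp vert_mob /= add0r lnK ?posrE // -Ez ptK.
by rewrite lee_fin ler_ln ?posrE // yz leey; exact.
Qed.

(** A point above the arc lies on a concentric larger semicircle, whose part over the interval joins
    the two vertical rays. So the three boundary segments already span the region. *)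
Lemma Hf_hull (V : set C) c r e y : hconvex V -> 0 < r ->
 (e - c) ^+ 2 + y ^+ 2 = r ^+ 2 -> 0 <= y -> c <> e ->
 seg (Some (pt c r)) None `<=` V -> seg (Some (pt e y)) None `<=` V ->
 seg (Some (pt c r)) (Some (pt e y)) `<=` V -> Hf c r e `<=` V.
Proof.
move=> [_ cV] r0 H y0 ce V1 V2 V3 z [Hz n B].
have [E|N] := eqVneq (nz c z) (r ^+ 2); first by apply: V3; rewrite seg_arc.
have {N} n' : r ^+ 2 < nz c z by rewrite lt_neqAle eq_sym N.
pose q := Num.sqrt (nz c z); have q0 : 0 < q by rewrite sqrtr_gt0 nz_gt0.
have q2 : q ^+ 2 = nz c z by rewrite sqr_sqrtr // ltW // nz_gt0.
have rq : r < q by nra.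
pose u := Num.sqrt (q ^+ 2 - (e - c) ^+ 2).
have u2 : u ^+ 2 = q ^+ 2 - (e - c) ^+ 2.
 rewrite sqr_sqrtr // subr_ge0 q2; move: n'; rewrite -H => n'.
 nra.
have yu : y < u.
 rewrite -ltr_sqr ?nnegrE ?sqrtr_ge0 // u2 q2; move: H n'; lra.
have up : 0 < u by exact: le_lt_trans yu.
have Hu : (e - c) ^+ 2 + u ^+ 2 = q ^+ 2 by rewrite u2; ring.
apply: (cV (pt c q) (pt e u)).
- by apply: V1; apply: seg_vert => //=; exact: ltW.
- by apply: V2; apply: seg_vert => //=; exact: ltW.
- by rewrite (seg_arc q0 Hu (ltW up) ce); split.
Qed.

Lemma csd_out c r p : 0 < r -> csd (circ c r * Sop)%g p <->
 (if p is Some z then r ^+ 2 <= nz c z else True).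
Proof.
move=> r0; have r20 : 0 < 2 * r by lra.
case: p => [z|]; rewrite /csd; last first.
 by rewrite leadN lead_circ // opprK; split=> // _; rewrite invr_ge0 ltW.
by rewrite qfN side_circ // -mulNr opprB pmulr_lge0 ?invr_gt0 // subr_ge0.
Qed.

Lemma csd_vert x p : csd (vert x) p <-> (if p is Some z then x <= re z else True).
Proof. by case: p => [z|]; rewrite /csd ?side_vert ?subr_ge0 // lead_vert. Qed.

Lemma csd_vertS x p : csd (vert x * Sop)%g p <-> (if p is Some z then re z <= x else True).
Proof. by case: p => [z|]; rewrite /csd ?qfN ?side_vert ?oppr_ge0 ?subr_le0 // leadN lead_vert oppr0. Qed.

Lemma polygon_NC v c1 r1 c2 r2 (P : set (sphere R)) : c1 < re v < c2 -> 0 < r1 -> 0 < r2 ->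
 uhp v -> nz c1 v = r1 ^+ 2 -> nz c2 v = r2 ^+ 2 ->
 r2 ^+ 2 <= nz c2 (pt c1 r1) -> r1 ^+ 2 <= nz c1 (pt c2 r2) ->
 (forall p, P p <-> [\/ p = Some (pt c1 r1), p = Some (pt c2 r2), p = Some v | p = None]) ->
 polygon P = Hf c1 r1 (re v) `|` Hf c2 r2 (re v).
Proof.
move=> cvc r10 r20 Hv n1 n2 o1 o2 HP; have /andP[v1 v2] := cvc.
have P1 : P (Some (pt c1 r1)) by apply/HP; constructor 1.
have P2 : P (Some (pt c2 r2)) by apply/HP; constructor 2.
have P3 : P (Some v) by apply/HP; constructor 3.
have P4 : P None by apply/HP; constructor 4.
have top c r : nz c (pt c r) = r ^+ 2 by rewrite /nz /= subrr expr0n add0r.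
apply/seteqP; split=> z.
 rewrite (NCpolyE cvc r10 r20 n1 n2) => H; apply: H; first exact: hconvex_poly.
 have X p : P p -> forall k, k \in NCpoly c1 r1 c2 r2 -> csd k p.
  case/HP => -> k; rewrite !inE => /or4P[]/eqP->;
   rewrite ?(csd_vert, csd_vertS, csd_out) //= ?top ?n1 ?n2 //; lra.
 by move=> p q /X Hp /X Hq; exact: seg_poly.
move=> zH V cV VP.
have e1 : (re v - c1) ^+ 2 + im v ^+ 2 = r1 ^+ 2 by [].
have e2 : (re v - c2) ^+ 2 + im v ^+ 2 = r2 ^+ 2 by [].
have v0 : 0 <= im v by exact: ltW.
case: zH => zH.
- apply: (Hf_hull cV r10 e1 v0 _ _ _ _ zH); rewrite ?ptK; try exact: VP.
 by move=> E; move: v1; rewrite E ltxx.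
- apply: (Hf_hull cV r20 e2 v0 _ _ _ _ zH); rewrite ?ptK; try exact: VP.
 by move=> E; move: v2; rewrite E ltxx.
Qed.

Lemma polygon_CU c r e : 0 < r -> (e - c) ^+ 2 = r ^+ 2 ->
 polygon [set Some (pt e 0); Some (pt c r); None] = Hf c r e.
Proof.
move=> r0 er; pose P : set (sphere R) := [set Some (pt e 0); Some (pt c r); None].
have ce : c <> e.
 nra.
have top : nz c (pt c r) = r ^+ 2 by rewrite /nz /= subrr expr0n add0r.
have bot : nz c (pt e 0) = r ^+ 2 by rewrite /nz /= expr0n addr0.
apply/seteqP; split=> z.
 move=> H; have [lt|lt|//] := ltgtP c e.
  rewrite HfE //; apply: H; first exact: hconvex_poly.
  have X p : P p -> forall k, k \in [:: vert c; vert e * Sop; circ c r * Sop]%g -> csd k p.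
   case=> [[]|] -> k; rewrite !inE => /or3P[]/eqP->;
   rewrite ?(csd_vert, csd_vertS, csd_out) //= ?top ?bot //; lra.
  by move=> p q /X Hp /X Hq; exact: seg_poly.
 rewrite HfE' //; apply: H; first exact: hconvex_poly.
 have X p : P p -> forall k, k \in [:: vert e; vert c * Sop; circ c r * Sop]%g -> csd k p.
  case=> [[]|] -> k; rewrite !inE => /or3P[]/eqP->;
  rewrite ?(csd_vert, csd_vertS, csd_out) //= ?top ?bot //; lra.
 by move=> p q /X Hp /X Hq; exact: seg_poly.
move=> zH V cV VP.
have e1 : (e - c) ^+ 2 + 0 ^+ 2 = r ^+ 2 by lra.
apply: (Hf_hull cV r0 e1 (lexx 0) ce _ _ _ zH); apply: VP; rewrite /=; tauto.
Qed.

Definition NC A v c1 r1 c2 r2 : Prop :=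
 [/\ HALF c1 r1 (re v), HALF c2 r2 (re v), c1 < re v < c2,
   [/\ uhp v, nz c1 v = r1 ^+ 2 & nz c2 v = r2 ^+ 2] &
   A = Hf c1 r1 (re v) `|` Hf c2 r2 (re v)].

Definition CU A c r e : Prop := [/\ HALF c r e, (e - c) ^+ 2 = r ^+ 2 & A = Hf c r e].

Lemma HALF_den c r e z : HALF c r e -> clK z -> r ^+ 2 <= nz c z.
Proof.
case=> r0 _ _ [g [Gg c0 <- <-]] _ [Hz /(_ g Gg c0)].
by rewrite den_nz // ler_pdivlMr ?mul1r // exprn_gt0 // rad_gt0.
Qed.

Lemma HALF_top c r e : HALF c r e -> clK (pt c r).
Proof.
case=> r0 _ _ _ [H _]; apply: H; split=> //.
 by rewrite /nz /= subrr expr0n add0r.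
by rewrite /between re_pt; lra.
Qed.

Lemma noncuspidal_NC A v s1 s2 : noncuspidal_precell Gam A v s1 s2 ->
 exists c1 r1 c2 r2, NC A v c1 r1 c2 r2 /\
  ((s1 = pt c1 r1 /\ s2 = pt c2 r2) \/ (s1 = pt c2 r2 /\ s2 = pt c1 r1)).
Proof.
case=> [[Hv _] [I1 [I2 [I12 [p1 p2] S1 S2 EA]]]].
have [g1 [e1 [y1 [[G1 c1 E1] [Ep1 y10 pp1 H1]]]]] := part_HALF p1.
have [g2 [e2 [y2 [[G2 c2 E2] [Ep2 y20 pp2 H2]]]]] := part_HALF p2.
have {}Ep1 : v = pt e1 y1 by case: Ep1.
have {}Ep2 : v = pt e2 y2 by case: Ep2.
have e1E : e1 = re v by rewrite Ep1. have e2E : e2 = re v by rewrite Ep2.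
have y1E : y1 = im v by rewrite Ep1. have y2E : y2 = im v by rewrite Ep2.
move: pp1 pp2 H1 H2; rewrite e1E e2E y1E y2E -!/(nz _ v) => n1 n2 H1 H2.
have r10 := rad_gt0 c1; have r20 := rad_gt0 c2.
have {S1} S1 : s1 = pt (ctr g1) (rad g1) by move: S1; rewrite E1 => /summitP; exact.
have {S2} S2 : s2 = pt (ctr g2) (rad g2) by move: S2; rewrite E2 => /summitP; exact.
have N : ctr g1 <> ctr g2.
 move=> E; apply: I12; rewrite E1 E2 !isom_line // E.
 suff -> : rad g1 = rad g2 by [].
 by apply/eqP; rewrite -(eqrXn2 (n := 2)) ?ltW // -n1 -n2 E.
(* Each summit lies outside the other sphere. As both circles pass through [v], this places [re v]
   between the two centres. *)
have o1 := HALF_den H2 (HALF_top H1); have o2 := HALF_den H1 (HALF_top H2).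
have N1 : ctr g1 <> re v by case: H1.
have N2 : ctr g2 <> re v by case: H2.
move: (o1) (o2) n1 n2; rewrite /nz !re_pt !im_pt => o1' o2' n1 n2.
have [lt|gt|//] := ltgtP (ctr g1) (ctr g2).
- exists (ctr g1), (rad g1), (ctr g2), (rad g2); split; last by left.
 have cvc : ctr g1 < re v < ctr g2.
  by apply/andP; split; rewrite lt_neqAle; apply/andP; split; try (apply/eqP => //; exact: nesym); nra.
 split=> //; rewrite EA; apply: polygon_NC => //.
 by rewrite S1 S2 => p; exact: set4P.
- exists (ctr g2), (rad g2), (ctr g1), (rad g1); split; last by right.
 have cvc : ctr g2 < re v < ctr g1.
  by apply/andP; split; rewrite lt_neqAle; apply/andP; split; try (apply/eqP => //; exact: nesym); nra.
 split=> //; rewrite EA; apply: polygon_NC => //.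
 rewrite S1 S2 => p; split=> [/set4P[]|[]] ->; first
  [by constructor 1|by constructor 2|by constructor 3|by constructor 4
  |by apply/set4P; constructor 1|by apply/set4P; constructor 2
  |by apply/set4P; constructor 3|by apply/set4P; constructor 4].
Qed.

Lemma cuspidal_CU A p s : cuspidal_precell Gam A p s ->
 exists c r e, [/\ CU A c r e, s = pt c r & p = Some (pt e 0)].
Proof.
case=> [[bp _] [I [pI S EA]]].
have [g [e [y [[Gg c0 EI] [Ep y0 pp H]]]]] := part_HALF pI.
have yE : y = 0.
 case: bp => [|[x]]; rewrite Ep // => /Some_inj /(congr1 (@im R)) /=.
 by [].
have ES : s = pt (ctr g) (rad g) by move: S; rewrite EI => /summitP; exact.
rewrite yE expr0n addr0 in pp; rewrite yE in Ep.
exists (ctr g), (rad g), e; split=> //; split=> //.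
by rewrite EA Ep ES; apply: polygon_CU => //; exact: rad_gt0.
Qed.

End Precells.

Variable AA : set (set (Cplx R)).
Hypothesis HB : basal_family Gam AA.

(** * How precells of a basal family fit together *)

Section Basal.
Implicit Types (g h k : G) (z w v s : C) (x y t c r e : R) (p q : sphere R) (A : set C).

Lemma ltr_ex2 (a b c' : R) : a < b -> a < c' -> exists m, [/\ a < m, m < b & m < c'].
Proof.
move=> ab ac; exists ((a + Num.min b c') / 2).
have : Num.min b c' <= b by rewrite ge_min lexx.
have : Num.min b c' <= c' by rewrite ge_min lexx orbT.
have : a < Num.min b c' by rewrite lt_min ab.
by move: (Num.min _ _) => m *; split; lra.
Qed.

Lemma gtr_ex2 (a b c' : R) : b < a -> c' < a -> exists m, [/\ m < a, b < m & c' < m].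
Proof.
move=> ab ac; exists ((a + Num.max b c') / 2).
have : b <= Num.max b c' by rewrite le_max lexx.
have : c' <= Num.max b c' by rewrite le_max lexx orbT.
have : Num.max b c' < a by rewrite gt_max ab.
by move: (Num.max _ _) => m *; split; lra.
Qed.

Definition sbt (a b x : R) : bool := (a < x < b) || (b < x < a).

Lemma clK_closed z : uhp z -> (forall e, 0 < e -> exists2 w, clK w & box z e w) ->
 clK z.
Proof.
move=> Hz H; rewrite -closureH_K; apply/closureHP; split=> // e e0.
have e2 : 0 < e / 2 by lra.
have [w wK [B1 B2]] := H _ e2.
move: wK; rewrite -closureH_K => /closureHP[_ /(_ _ e2)][u uK [B3 B4]].
exists u => //; move: B1 B2 B3 B4; rewrite !ltr_norml => B1 B2 B3 B4.
by split; rewrite ltr_norml; lra.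
Qed.

Lemma arc_pt c r e x : HALF c r e -> sbt c e x ->
 exists y, [/\ 0 < y, nz c (pt x y) = r ^+ 2, arc c r e (pt x y) & clK (pt x y)].
Proof.
move=> [r0 ce er _ [H _]] B; pose y := Num.sqrt (r ^+ 2 - (x - c) ^+ 2).
have y2 : 0 < r ^+ 2 - (x - c) ^+ 2.
 by rewrite subr_gt0; apply: lt_le_trans er; move: B; rewrite /sbt => /orP[]/andP[? ?]; nra.
have y0 : 0 < y by rewrite sqrtr_gt0.
have n : nz c (pt x y) = r ^+ 2 by rewrite /nz /= sqr_sqrtr ?ltW //; ring.
have a : arc c r e (pt x y) by split=> //; move: B; rewrite /sbt /between /=; lra.
by exists y; split=> //; exact: H.
Qed.

(** Over a common abscissa both arcs lie in the closure of [K], so neither is below the other. Equal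
    heights at two abscissas determine centre and radius, and maximality of [e] settles the end. *)
Lemma HALF_strict_eq c r e c' r' e' x : HALF c r e -> HALF c' r' e' ->
 sbt c e x -> sbt c' e' x -> [/\ c = c', r = r' & e = e'].
Proof.
move=> H H' B B'.
have F u : sbt c e u -> sbt c' e' u -> r ^+ 2 - (u - c) ^+ 2 = r' ^+ 2 - (u - c') ^+ 2.
 move=> b b'; have [y [y0 n _ yK]] := arc_pt H b.
 have [y' [y0' n' _ yK']] := arc_pt H' b'.
 have := HALF_den H yK'; have := HALF_den H' yK; move: n n'; rewrite /nz /=; lra.
(* The second abscissa: [m] is half the least distance from [x] to the four ends of the two
   intervals. *)
have [x2 [xx b2 b2']] : exists x2, [/\ x2 <> x, sbt c e x2 & sbt c' e' x2].
 pose m := Num.min (Num.min `|x - c| `|x - e|) (Num.min `|x - c'| `|x - e'|) / 2.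
 have m0 : 0 < m.
  rewrite divr_gt0 // !lt_min !normr_gt0 !subr_eq0.
  move: B B'; rewrite /sbt => B B'.
  by rewrite -!(rwP andP); split; split; apply/eqP; lra.
 have [m1 m2 m3 m4] : [/\ m * 2 <= `|x - c|, m * 2 <= `|x - e|, m * 2 <= `|x - c'| & m * 2 <= `|x - e'|].
  by rewrite /m divfK //; split; rewrite !ge_min lexx ?orbT.
 exists (x + m); split; first by lra.
  by move: m1 m2 B; rewrite /sbt => m1 m2 /orP[]B; [rewrite ger0_norm in m1; last lra|rewrite ger0_norm in m2; last lra];
   [rewrite ler0_norm in m2; last lra|rewrite ler0_norm in m1; last lra]; lra.
 by move: m3 m4 B'; rewrite /sbt => k1 k2 /orP[]B'; [rewrite ger0_norm in k1; last lra|rewrite ger0_norm in k2; last lra];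
   [rewrite ler0_norm in k2; last lra|rewrite ler0_norm in k1; last lra]; lra.
have E1 := F _ B B'; have E2 := F _ b2 b2'.
have cc : c = c'.
 nra.
have rr : r = r'.
 case: H H' => r0 _ _ _ _ [r0' _ _ _ _].
 apply/eqP; rewrite -(eqrXn2 (n := 2)) ?(ltW r0) ?(ltW r0') //.
 by apply/eqP; move: E1; rewrite cc; lra.
split=> //; subst c' r'.
have key f f' : HALF c r f -> HALF c r f' -> sbt c f x -> sbt c f' x ->
  ~ (f - c) ^+ 2 < (f' - c) ^+ 2.
 move=> [_ _ _ _ [_ K]] K' bf bf' lt.
 have bu : sbt c f' ((f + f') / 2).
  move: bf bf' lt; rewrite /sbt => /orP[]/andP[? ?] /orP[]/andP[? ?] lt; try lra.
   have : f < f' by nra. lra.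
  have : f' < f by nra. lra.
 have [y [y0 n _ yK]] := arc_pt K' bu; have := K _ yK n; rewrite /=.
 move: bf bf' lt; rewrite /sbt => /orP[]/andP[? ?] /orP[]/andP[? ?] lt; nra.
have [lt|gt|eq] := ltgtP ((e - c) ^+ 2) ((e' - c) ^+ 2).
- by case: (key _ _ H H' B B' lt).
- by case: (key _ _ H' H B' B gt).
move: B B' eq; rewrite /sbt => /orP[]/andP[? ?] /orP[]/andP[? ?] eq; try lra.
 nra.
nra.
Qed.

Lemma HALF_eq c r e c' r' e' x : HALF c r e -> HALF c' r' e' ->
 sbt c e x -> between c' e' x -> [/\ c = c', r = r' & e = e'].
Proof.
move=> H H' B B'; have ce' : c' <> e' by case: H'.
have [x' b b'] : exists2 x', sbt c e x' & sbt c' e' x'.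
 (* [x] may be an end of the second interval, so it is moved slightly towards its midpoint. *)
 pose m := (c' + e') / 2.
 pose lo := Num.min c e; pose hi := Num.max c e.
 have lh : lo < x < hi.
  by move: B; rewrite /sbt /lo /hi gt_min lt_max => /orP[]/andP[-> ->]; rewrite ?orbT.
 have E u : lo < u < hi -> sbt c e u.
  rewrite /sbt /lo /hi; have [l|l] := leP c e.
   by move=> ->.
  by move=> ->; rewrite orbT.
 have [xm|mx|xm] := ltgtP x m.
 - have [q [q1 q2 q3]] : exists q : R, [/\ x < q, q < m & q < hi] by apply: ltr_ex2 => //; case/andP: lh.
  exists q; first by apply: E; move: lh; lra.
  by move: B' q1 q2; rewrite /between /sbt /m; lra.
 - have [q [q1 q2 q3]] : exists q : R, [/\ q < x, m < q & lo < q] by apply: gtr_ex2 => //; case/andP: lh.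
  exists q; first by apply: E; move: lh; lra.
  by move: B' q1 q2; rewrite /between /sbt /m; lra.
 exists x => //; move: B' xm; rewrite /between /sbt /m => B' ->.
 by lra.
exact: HALF_strict_eq H H' b b'.
Qed.

Lemma HALF_sub c r e : HALF c r e -> Hf c r e `<=` clK.
Proof.
move=> H z [Hz n B]; have [r0 ce er _ [aK _]] := H.
have clos y x u : between c e x -> 0 < y -> y ^+ 2 = r ^+ 2 - (x - c) ^+ 2 ->
  y <= u -> clK (pt x u).
 move=> b y0 y2 yu; apply: (@clK_up (pt x y)) => //.
 by apply: aK; split=> //; rewrite /nz /= y2; ring.
have B2 : (re z - c) ^+ 2 <= (e - c) ^+ 2.
 by move: B; rewrite /between => /orP[]/andP[? ?]; nra.
have [lt|ge] := ltP ((re z - c) ^+ 2) (r ^+ 2).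
 rewrite -(ptK z); apply: (clos (Num.sqrt (r ^+ 2 - (re z - c) ^+ 2))) => //.
 - by rewrite sqrtr_gt0 subr_gt0.
 - by rewrite sqr_sqrtr // subr_ge0 ltW.
 - rewrite -ler_sqr ?nnegrE ?sqrtr_ge0 ?(ltW Hz) // sqr_sqrtr ?subr_ge0 ?(ltW lt) //.
  by move: n; rewrite /nz; lra.
(* Only the vertical line over an ideal end point is left, where the arc has height 0; its points
   are limits of points in neighbouring columns. *)
have Ez : re z = e.
 by move: B2 ge er B ce; rewrite /between => B2 ge er /orP[]/andP[? ?] ce; nra.
have er2 : (e - c) ^+ 2 = r ^+ 2 by apply/le_anti; rewrite er -Ez ge.
apply: clK_closed => // d d0; rewrite uhpE in Hz.
pose m := Num.min (Num.min (d / 2) r) (im z ^+ 2 / (2 * r)).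
have m0 : 0 < m by rewrite !lt_min r0 !divr_gt0 ?exprn_gt0 ?mulr_gt0.
have [m1 m2 m3] : [/\ m <= d / 2, m <= r & m * (2 * r) <= im z ^+ 2].
 by rewrite -ler_pdivlMr ?mulr_gt0 //; split; rewrite !ge_min lexx ?orbT.
have [ec|ec] := ltP c e.
 have re : e - c = r.
  nra.
 exists (pt (e - m) (im z)); last by rewrite /box /= Ez subrr normr0 addrAC subrr add0r normrN gtr0_norm //; split=> //; lra.
 have q : 0 < r ^+ 2 - (e - m - c) ^+ 2 by nra.
 apply: (clos (Num.sqrt (r ^+ 2 - (e - m - c) ^+ 2))).
 - by rewrite /between; lra.
 - by rewrite sqrtr_gt0.
 - by rewrite sqr_sqrtr // ltW.
 - by rewrite -ler_sqr ?nnegrE ?sqrtr_ge0 ?(ltW Hz) // sqr_sqrtr ?(ltW q) //; nra.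
have re : c - e = r.
 apply/eqP; rewrite -(eqrXn2 (n := 2)) ?(ltW r0) ?subr_ge0 ?(ltW ec) // -er2.
 by apply/eqP; ring.
exists (pt (e + m) (im z)); last by rewrite /box /= Ez subrr normr0 addrAC subrr add0r gtr0_norm //; split=> //; lra.
have q : 0 < r ^+ 2 - (e + m - c) ^+ 2 by nra.
apply: (clos (Num.sqrt (r ^+ 2 - (e + m - c) ^+ 2))).
- by rewrite /between; lra.
- by rewrite sqrtr_gt0.
- by rewrite sqr_sqrtr // ltW.
- by rewrite -ler_sqr ?nnegrE ?sqrtr_ge0 ?(ltW Hz) // sqr_sqrtr ?(ltW q) //; nra.
Qed.

Lemma HALF_notK c r e z : HALF c r e -> nz c z = r ^+ 2 -> ~ common_ext Gam z.
Proof.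
case=> r0 _ _ [g [Gg c0 <- <-]] _ n /KE[Hz /(_ g Gg c0)].
by rewrite den_nz // n divff ?ltxx // sqrf_eq0 gt_eqF // rad_gt0.
Qed.

Lemma clK_vert t z : Gam (vert t) -> clK z -> clK (pt (re z + t) (im z)).
Proof.
move=> Gt zK; rewrite -vert_mob; apply: (clK_mob zK Gt); exact: den_vert.
Qed.

Lemma HALF_vert c r e t : Gam (vert t) -> HALF c r e -> HALF (c + t) r (e + t).
Proof.
move=> Gt [r0 ce er [g [Gg c0 Ec Er]] [aK be_]].
have GtN : Gam (vert (- t)) by rewrite -vertV; exact: GamV.
split=> //; first by move/addIr.
- lra.
- exists (g * vert (- t))%g.
 have [s [s2 _ _ Hc Hd]] := mul_entries g (vert (- t)).
 have [s' [s2' Ha' Hb' Hc' Hd']] := vert_entries (- t).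
 have s0 := sgn_neq0 s2; have s0' := sgn_neq0 s2'.
 have Hc2 : ec (g * vert (- t))%g = s * s' * ec g by rewrite Hc Ha' Hc'; ring.
 have Hd2 : ed (g * vert (- t))%g = s * s' * (ed g - ec g * t) by rewrite Hd Hb' Hd'; ring.
 have ss : s * s' != 0 by rewrite mulf_neq0.
 split; first exact: GamM.
 + by rewrite Hc2 mulf_neq0.
 + by rewrite /ctr Hc2 Hd2 -Ec /ctr; field; rewrite c0 s0 s0'.
 + rewrite /rad Hc2 normrM -Er /rad (_ : `|s * s'| = 1) ?mul1r //.
  by apply/eqP; rewrite -sqrp_eq1 // -normrX expr2 mulrACA s2 s2' mulr1 normr1.
split=> z.
 case=> Hz n B; rewrite -(ptK z) -[re z](subrK t).
 apply: (clK_vert Gt (z := pt (re z - t) (im z))); apply: aK; split=> //.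
  by rewrite -n /nz /=; congr (_ ^+ 2 + _); ring.
 by move: B; rewrite /between /=; lra.
move=> zK n; have := be_ _ (clK_vert GtN zK); rewrite /nz /= => H.
have /H : (re z - t - c) ^+ 2 + im z ^+ 2 = r ^+ 2 by rewrite -n /nz; congr (_ ^+ 2 + _); ring.
by rewrite (_ : (_ - (e + t)) * _ = (re z - t - e) * (e - c)) //; move: (re z) => u; ring.
Qed.

Lemma Hf_vert c r e t : mobC (vert t) @` Hf c r e = Hf (c + t) r (e + t).
Proof.
apply/seteqP; split=> z.
 case=> w [Hw n B] <-; rewrite vert_mob; split=> //.
  by rewrite (le_trans n) // /nz /= le_eqVlt; apply/orP; left; apply/eqP; congr (_ ^+ 2 + _); ring.
 by move: B; rewrite /between /=; lra.
case=> Hz n B; exists (pt (re z - t) (im z)); last by rewrite vert_mob /= subrK ptK.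
split=> //; last by move: B; rewrite /between /=; lra.
rewrite (le_trans n) // /nz /= le_eqVlt; apply/orP; left; apply/eqP; congr (_ ^+ 2 + _); ring.
Qed.

Definition half_of A c r e : Prop :=
 [\/ exists v c' r', NC A v c r c' r' /\ e = re v,
   exists v c' r', NC A v c' r' c r /\ e = re v | CU A c r e].

Lemma half_of_HALF A c r e : half_of A c r e -> HALF c r e.
Proof. by case=> [[v [c' [r' [[] ? ? ? ? ? ->]]]]|[v [c' [r' [[] ? ? ? ? ? ->]]]]|[]]. Qed.

Lemma half_of_sub A c r e : half_of A c r e -> Hf c r e `<=` A.
Proof.
case=> [[v [c' [r' [[_ _ _ _ ->] ->]]]]|[v [c' [r' [[_ _ _ _ ->] ->]]]]|[_ _ ->]] //.
Qed.

Lemma precell_cases A : precell Gam A ->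
 [\/ exists v c1 r1 c2 r2, NC A v c1 r1 c2 r2, exists c r e, CU A c r e |
   exists x y, strip_precell Gam A x y].
Proof.
case=> [[v [s1 [s2 /noncuspidal_NC[c1 [r1 [c2 [r2 [H _]]]]]]]]|
 [v [s /cuspidal_CU[c [r [e [H _ _]]]]]]|H].
- by constructor 1; exists v, c1, r1, c2, r2.
- by constructor 2; exists c, r, e.
- by constructor 3.
Qed.

Lemma strip_poly x y : [set z | uhp z /\ x <= re z <= y]
 = poly [:: vert x; vert y * Sop]%g.
Proof.
apply/seteqP; split=> z.
 case=> Hz b; split=> // k; rewrite !inE => /orP[]/eqP->; rewrite ?qfN side_vert; lra.
case=> Hz H; split=> //.
have := H (vert x); have := H (vert y * Sop)%g.
rewrite !inE (eqxx (vert x)) (eqxx (vert y * Sop)%g) !orbT => /(_ isT) + /(_ isT).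
rewrite qfN !side_vert; lra.
Qed.

Lemma precell_poly A : precell Gam A -> exists K z0, A = poly K /\ ipoly K z0.
Proof.
have P (K : seq G) z0 : uhp z0 -> (forall k, k \in K -> 0 < side_ k z0) -> ipoly K z0 by [].
case/precell_cases => [[v [c1 [r1 [c2 [r2 [H1 H2 cvc [Hv n1 n2] EA]]]]]]|[c [r [e [H er EA]]]]|
 [x [y [xy _ _ EA _]]]].
- have r10 : 0 < r1 by case: H1. have r20 : 0 < r2 by case: H2.
 exists (NCpoly c1 r1 c2 r2), (pt (re v) (im v + 1)).
 rewrite EA (NCpolyE cvc r10 r20 n1 n2); split=> //; rewrite uhpE in Hv.
 have o c r : nz c v = r ^+ 2 -> r ^+ 2 < nz c (pt (re v) (im v + 1)).
  by move=> <-; rewrite /nz /=; nra.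
 apply: P => [|k]; first by rewrite uhpE /=; lra.
 rewrite !inE => /or4P[]/eqP->; rewrite ?qfN ?side_vert ?side_circ //=; try lra.
  by rewrite -mulNr opprB divr_gt0 ?mulr_gt0 // subr_gt0; exact: o.
 by rewrite -mulNr opprB divr_gt0 ?mulr_gt0 // subr_gt0; exact: o.
- have [r0 ce _ _ _] := H.
 have [lt|gt|//] := ltgtP c e.
 + exists [:: vert c; vert e * Sop; circ c r * Sop]%g, (pt ((c + e) / 2) (2 * r)).
  rewrite EA HfE //; split=> //; apply: P => [|k]; first by rewrite uhpE /= mulr_gt0.
  rewrite !inE => /or3P[]/eqP->; rewrite ?qfN ?side_vert ?side_circ //=; try lra.
  by rewrite -mulNr opprB divr_gt0 ?mulr_gt0 // subr_gt0; nra.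
 + exists [:: vert e; vert c * Sop; circ c r * Sop]%g, (pt ((c + e) / 2) (2 * r)).
  rewrite EA HfE' //; split=> //; apply: P => [|k]; first by rewrite uhpE /= mulr_gt0.
  rewrite !inE => /or3P[]/eqP->; rewrite ?qfN ?side_vert ?side_circ //=; try lra.
  by rewrite -mulNr opprB divr_gt0 ?mulr_gt0 // subr_gt0; nra.
- exists [:: vert x; vert y * Sop]%g, (pt ((x + y) / 2) 1).
 rewrite EA; split; first exact: strip_poly.
 apply: P => [|k]; first by rewrite uhpE /=.
 by rewrite !inE => /orP[]/eqP->; rewrite ?qfN side_vert /=; lra.
Qed.

Lemma precell_dense A : precell Gam A -> A `<=` closure (A^°).
Proof.
by case/precell_poly => K [z0 [-> Hz]]; rewrite interior_poly; exact: closure_ipoly Hz.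
Qed.

Lemma precell_int A : precell Gam A -> A^° !=set0.
Proof. by case/precell_poly => K [z0 [-> Hz]]; rewrite interior_poly; exists z0. Qed.

Lemma precell_closed A : precell Gam A -> closureH A = A.
Proof. by case/precell_poly => K [z0 [-> Hz]]; rewrite closureH_poly. Qed.

Lemma precell_uhp A : precell Gam A -> A `<=` uhp.
Proof. by case/precell_poly => K [z0 [-> Hz]]; exact: poly_sub. Qed.

Lemma precell_clK A : precell Gam A -> A `<=` clK.
Proof.
case/precell_cases => [[v [c1 [r1 [c2 [r2 [H1 H2 _ _ ->]]]]]]|[c [r [e [H _ ->]]]]|
 [x [y [_ _ _ _ AK]]]] z.
- by case=> [/(HALF_sub H1)|/(HALF_sub H2)].
- exact: HALF_sub.
- by move/AK/K_clK.
Qed.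

Lemma pAA A : AA A -> precell Gam A.
Proof. by case: HB => H _; exact: H. Qed.

Lemma fund_id g A A' z : AA A -> AA A' -> Gam g -> A^° z -> A'^° (mobC g z) -> g = 1%g.
Proof.
case: HB => _ [_ [_ _ dis _]] AAA AAA' Gg zA zA'; apply: contrapT => g1.
have := dis g 1%g Gg Gam1 g1; apply/eqP/set0P; exists (mobC g z); split.
 by exists z => //; apply: interiorS zA => w wA; exists A.
by exists (mobC g z); [apply: interiorS zA' => w wA; exists A'|exact: mobC1].
Qed.

Lemma cover z : uhp z -> exists g A w, [/\ Gam g, AA A, A w & mobC g w = z].
Proof.
case: HB => _ [clos [_ sub _ cov]] Hz.
have [g Gg [w wK Ew]] : (\bigcup_(g in Gam) (mobC g @` closureH (\bigcup_(A in AA) A)^°)) z.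
 by rewrite cov.
have : (\bigcup_(A in AA) A) w.
 rewrite -clos; case: wK => w1 w2; split=> //; apply: closure_subset w1.
 exact: interior_subset.
by case=> A AAA Aw; exists g, A, w.
Qed.

Lemma box_avoid z e a b : 0 < e -> exists x, [/\ box z e (pt x (im z)), x <> a & x <> b].
Proof.
move=> e0; have K d : 0 <= d -> d < e -> box z e (pt (re z + d) (im z)).
 by move=> d0 de; rewrite /box /= subrr normr0 addrAC subrr add0r ger0_norm.
have [na|ea] := pselect (re z + 0 <> a /\ re z + 0 <> b).
 by exists (re z + 0); case: na; split=> //; apply: K.
have [na|ea'] := pselect (re z + e / 3 <> a /\ re z + e / 3 <> b).
 by exists (re z + e / 3); case: na; split=> //; apply: K; lra.
exists (re z + e / 2); split; first by apply: K; lra.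
all: move=> E; move: ea ea'; rewrite !not_andP !not_notP; lra.
Qed.

Definition colpt A x : Prop :=
 (exists c r e, half_of A c r e /\ sbt c e x) \/
 (exists a b, strip_precell Gam A a b /\ a < x < b).

(** Away from at most one exceptional abscissa, such as that of the vertex, an interior point
    determines the half arc or strip over which it lies. Precells are compared in this way. *)
Lemma int_col A : precell Gam A -> exists a, forall z, A^° z -> re z <> a -> colpt A (re z).
Proof.
case/precell_cases => [[v [c1 [r1 [c2 [r2 H]]]]]|[c [r [e H]]]|[x [y H]]].
- have [H1 H2 cvc [Hv n1 n2] EA] := H; exists (re v) => z; rewrite {1}EA.
 have r10 : 0 < r1 by case: H1. have r20 : 0 < r2 by case: H2.
 rewrite (NCpolyE cvc r10 r20 n1 n2) interior_poly => -[Hz Hk] N.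
 have [i1 i2 i3 i4] := in4 (vert c1) (vert c2 * Sop)%g
  (circ c1 r1 * Sop)%g (circ c2 r2 * Sop)%g.
 have b1 : c1 < re z by have := Hk _ i1; rewrite side_vert subr_gt0.
 have b2 : re z < c2 by have := Hk _ i2; rewrite qfN side_vert oppr_gt0 subr_lt0.
 left; have [l|g|//] := ltgtP (re z) (re v).
  exists c1, r1, (re v); split; last by rewrite /sbt b1 l.
  by constructor 1; exists v, c2, r2.
 exists c2, r2, (re v); split; last by rewrite /sbt b2 g orbT.
 by constructor 2; exists v, c1, r1.
- have [H1 er EA] := H; exists c => z zA _; left; exists c, r, e; split; first by constructor 3.
 have [r0 ce _ _ _] := H1; move: zA; rewrite EA; have [lt|gt|//] := ltgtP c e.
  rewrite HfE // interior_poly => -[Hz Hk].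
  have [i1 i2 i3] := in3 (vert c) (vert e * Sop)%g (circ c r * Sop)%g.
  have := Hk _ i1; have := Hk _ i2; rewrite qfN !side_vert /sbt; lra.
 rewrite HfE' // interior_poly => -[Hz Hk].
 have [i1 i2 i3] := in3 (vert e) (vert c * Sop)%g (circ c r * Sop)%g.
 have := Hk _ i1; have := Hk _ i2; rewrite qfN !side_vert /sbt; lra.
- have [xy _ _ EA _] := H; exists x => z zA _; right; exists x, y; split=> //.
 move: zA; rewrite EA -/(re _) strip_poly interior_poly => -[Hz Hk].
 have := Hk (vert x); have := Hk (vert y * Sop)%g.
 rewrite !inE (eqxx (vert x)) (eqxx (vert y * Sop)%g) !orbT => /(_ isT) + /(_ isT).
 rewrite qfN !side_vert; lra.
Qed.

Lemma half_of_inj A A' c r e : half_of A c r e -> half_of A' c r e -> A = A'.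
Proof.
have NCC B B' v v' c1 r1 c2 r2 c3 r3 : NC B v c1 r1 c2 r2 -> NC B' v' c1 r1 c3 r3 ->
  re v = re v' -> B = B'.
 move=> [H1 H2 cvc _ ->] [H1' H2' cvc' _ ->] E; rewrite -E in H2' cvc' *.
 suff [-> -> _] : [/\ c2 = c3, r2 = r3 & re v = re v] by [].
 apply: (@HALF_eq _ _ _ _ _ _ (Num.min ((re v + c2) / 2) ((re v + c3) / 2)) H2 H2').
  move: cvc cvc'; rewrite /sbt; move: (re v) => u cvc cvc'.
  have : u < Num.min ((u + c2) / 2) ((u + c3) / 2) <= (u + c2) / 2 by rewrite lt_min ge_min lexx; lra.
  by move: (Num.min _ _) => m; lra.
 move: cvc cvc'; rewrite /between; move: (re v) => u cvc cvc'.
 have : u < Num.min ((u + c2) / 2) ((u + c3) / 2) <= (u + c3) / 2 by rewrite lt_min ge_min lexx orbT; lra.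
 by move: (Num.min _ _) => m; lra.
have NCC' B B' v v' c1 r1 c2 r2 c3 r3 : NC B v c2 r2 c1 r1 -> NC B' v' c3 r3 c1 r1 ->
  re v = re v' -> B = B'.
 move=> [H2 H1 cvc _ ->] [H2' H1' cvc' _ ->] E; rewrite -E in H2' cvc' *.
 suff [-> -> _] : [/\ c2 = c3, r2 = r3 & re v = re v] by [].
 apply: (@HALF_eq _ _ _ _ _ _ (Num.max ((re v + c2) / 2) ((re v + c3) / 2)) H2 H2').
  move: cvc cvc'; rewrite /sbt; move: (re v) => u cvc cvc'.
  have : (u + c2) / 2 <= Num.max ((u + c2) / 2) ((u + c3) / 2) < u by rewrite gt_max le_max lexx; lra.
  by move: (Num.max _ _) => m; lra.
 move: cvc cvc'; rewrite /between; move: (re v) => u cvc cvc'.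
 have : (u + c3) / 2 <= Num.max ((u + c2) / 2) ((u + c3) / 2) < u by rewrite gt_max le_max lexx orbT; lra.
 by move: (Num.max _ _) => m; lra.
case=> [[v [c' [r' [H E]]]]|[v [c' [r' [H E]]]]|H];
 case=> [[v2 [c2 [r2 [H2 E2]]]]|[v2 [c2 [r2 [H2 E2]]]]|H2].
- by apply: NCC H H2 _; rewrite -E.
- by exfalso; case: H H2 => _ _ + _ _ [_ _ + _ _]; rewrite -E -E2; lra.
- exfalso; case: H H2 => _ _ _ [Hv n _] _ [_ er _]; rewrite uhpE in Hv.
 by move: er n; rewrite /nz -E; nra.
- by exfalso; case: H H2 => _ _ + _ _ [_ _ + _ _]; rewrite -E -E2; lra.
- by apply: NCC' H H2 _; rewrite -E.
- exfalso; case: H H2 => _ _ _ [Hv _ n] _ [_ er _]; rewrite uhpE in Hv.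
 by move: er n; rewrite /nz -E; nra.
- exfalso; case: H2 H => _ _ _ [Hv n _] _ [_ er _]; rewrite uhpE in Hv.
 by move: er n; rewrite /nz -E2; nra.
- exfalso; case: H2 H => _ _ _ [Hv _ n] _ [_ er _]; rewrite uhpE in Hv.
 by move: er n; rewrite /nz -E2; nra.
- by case: H H2 => _ _ -> [_ _ ->].
Qed.

Lemma strip_no_half A a b c r e x : strip_precell Gam A a b -> HALF c r e ->
 sbt c e x -> ~ (a <= x <= b).
Proof.
move=> [ab _ _ EA AK] H B xab; have [y [y0 n _ _]] := arc_pt H B.
apply: (HALF_notK H n); apply: AK; rewrite EA; split=> //.
Qed.

(** The ends of a strip are infinite vertices, hence ends of half arcs. These arcs lie outside the
    strip, because the strip is contained in [K] and no point of an isometric sphere is. *)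
Lemma strip_end A a b : strip_precell Gam A a b ->
 exists c r c' r', [/\ HALF c r a, HALF c' r' b, (a - c) ^+ 2 = r ^+ 2,
  (b - c') ^+ 2 = r' ^+ 2 & c < a /\ b < c'].
Proof.
move=> S; have [ab [[_ va] _] [[_ vb] _] EA AK] := S.
have [I1 p1] := va; have [I2 p2] := vb.
have [g1 [e1 [y1 [[G1 c1 _] [Ep1 _ pp1 H1]]]]] := part_HALF p1.
have [g2 [e2 [y2 [[G2 c2 _] [Ep2 _ pp2 H2]]]]] := part_HALF p2.
have [Ea Ya] : a = e1 /\ 0 = y1.
 by move/Some_inj: Ep1 => E; have := congr1 (@re R) E; have := congr1 (@im R) E.
have [Eb Yb] : b = e2 /\ 0 = y2.
 by move/Some_inj: Ep2 => E; have := congr1 (@re R) E; have := congr1 (@im R) E.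
subst e1 y1 e2 y2; rewrite expr0n addr0 in pp1; rewrite expr0n addr0 in pp2.
exists (ctr g1), (rad g1), (ctr g2), (rad g2); split=> //.
have [_ N1 _ _ _] := H1; have [_ N2 _ _ _] := H2.
split; rewrite ltNge; apply/negP => le.
 have lt : a < ctr g1 by rewrite lt_neqAle le andbT; apply/eqP => E; apply: N1.
 have [m [m1 m2 m3]] := ltr_ex2 lt ab.
 by apply: (strip_no_half (x := m) S H1); rewrite /sbt; lra.
have lt : ctr g2 < b by rewrite lt_neqAle le andbT; apply/eqP.
have [m [m1 m2 m3]] := gtr_ex2 lt ab.
by apply: (strip_no_half (x := m) S H2); rewrite /sbt; lra.
Qed.

Lemma strip_inj A A' a b a' b' x : strip_precell Gam A a b -> strip_precell Gam A' a' b' ->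
 a < x < b -> a' < x < b' -> A = A'.
Proof.
move=> S S' xb xb'; have [_ _ _ EA _] := S; have [_ _ _ EA' _] := S'.
have [c1 [r1 [c2 [r2 [H1 H2 _ _ [l1 l2]]]]]] := strip_end S.
have [c1' [r1' [c2' [r2' [H1' H2' _ _ [l1' l2']]]]]] := strip_end S'.
suff [Ea Eb] : a = a' /\ b = b' by rewrite EA EA' Ea Eb.
split.
 have [lt|gt|//] := ltgtP a a'; exfalso.
 - have [m [m1 m2 m3]] := gtr_ex2 l1' lt.
  by apply: (strip_no_half (x := m) S H1'); rewrite /sbt; lra.
 - have [m [m1 m2 m3]] := gtr_ex2 l1 gt.
  by apply: (strip_no_half (x := m) S' H1); rewrite /sbt; lra.
have [lt|gt|//] := ltgtP b b'; exfalso.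
- have [m [m1 m2 m3]] := ltr_ex2 l2 lt.
 by apply: (strip_no_half (x := m) S' H2); rewrite /sbt; lra.
- have [m [m1 m2 m3]] := ltr_ex2 l2' gt.
 by apply: (strip_no_half (x := m) S H2'); rewrite /sbt; lra.
Qed.

Lemma precell_inj A A' z : precell Gam A -> precell Gam A' -> A^° z -> A'^° z -> A = A'.
Proof.
move=> pA pA' zA zA'; have [a Ha] := int_col pA; have [b Hb] := int_col pA'.
have : nbhs z (A^° `&` A'^°).
 by apply: filterI; apply: open_nbhs_nbhs; split=> //; exact: open_interior.
move/nbhs_box => [e e0 eU]; have [x [bx xa xb]] := box_avoid z a b e0.
have [xA xA'] := eU _ bx; have := Ha _ xA xa; have := Hb _ xA' xb; rewrite /=.
case=> [[c [r [f [hf B]]]]|[u [v [S uv]]]] [[c' [r' [f' [hf' B']]]]|[u' [v' [S' uv']]]].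
- have [E1 E2 E3] := HALF_strict_eq (half_of_HALF hf) (half_of_HALF hf') B B'.
 by subst; exact: half_of_inj hf' hf.
- by case: (strip_no_half S' (half_of_HALF hf) B); move: uv'; lra.
- by case: (strip_no_half S (half_of_HALF hf') B'); move: uv; lra.
- exact: strip_inj S' S uv' uv.
Qed.

(** A fundamental region controls interiors only. Since a precell lies in the closure of its
    interior, meeting the interior of another precell produces a common interior point, which
    determines the group element and the precell. *)
Lemma fund g A A' z : AA A -> AA A' -> Gam g -> A^° z -> A' (mobC g z) -> g = 1%g /\ A = A'.
Proof.
move=> AAA AAA' Gg zA gzA'; have pA := pAA AAA; have pA' := pAA AAA'.
have : nbhs (mobC g z) ((mobC g @` A)^°).
 apply: open_nbhs_nbhs; split; first exact: open_interior.
 by rewrite interior_mobC; [exists z|exact: precell_uhp].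
move/(precell_dense pA' gzA') => [w [wA']]; rewrite interior_mobC; last exact: precell_uhp.
case=> u uA Eu; rewrite -Eu in wA'; have g1 := fund_id AAA AAA' Gg uA wA'.
by split=> //; rewrite g1 mobC1 in wA'; exact: precell_inj pA pA' uA wA'.
Qed.

(** A point just above the arc is in [K] and in a translate of some member of the family; the
    translating element must fix infinity, and the member then has the translated half arc on its
    boundary. *)
Lemma pairing c r e : HALF c r e ->
 exists t A, [/\ Gam (vert t), AA A & half_of A (c + t) r (e + t)].
Proof.
move=> H; have ce : c <> e by case: H.
pose x := (c + e) / 2; have B : sbt c e x by rewrite /sbt /x; lra.
have [y [y0 n _ yK]] := arc_pt H B; pose z := pt x (y + 1).
have zK : common_ext Gam z by apply: (K_up yK) => //=; rewrite ltrDl.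
have [g [A [w [Gg AAA Aw Ew]]]] := cover (proj1 (K_clK zK)).
have pA := pAA AAA; have wK := precell_clK pA Aw.
have [t Et] : exists t, (g^-1)%g = vert t.
 apply: (K_stab zK); last exact: GamV.
 by rewrite -Ew mobCK //; case: wK.
have Gt : Gam (vert t) by rewrite -Et; exact: GamV.
have Ezw : w = pt (x + t) (y + 1).
 have := vert_mob t z; rewrite -Et -Ew mobCK ?Ew //; exact: (proj1 wK).
have Ht := HALF_vert Gt H.
have Bt : sbt (c + t) (e + t) (re w) by rewrite Ezw /=; move: B; rewrite /sbt; lra.
exists t, A; split=> //; case: (precell_cases pA).
- move=> [v [c1 [r1 [c2 [r2 N]]]]]; have [H1 H2 cvc _ EA] := N.
 have [b|b] : between c1 (re v) (re w) \/ between c2 (re v) (re w).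
  by move: Aw; rewrite EA => -[[_ _]|[_ _]]; [left|right].
 - by have [-> -> ->] := HALF_eq Ht H1 Bt b; constructor 1; exists v, c2, r2.
 - by have [-> -> ->] := HALF_eq Ht H2 Bt b; constructor 2; exists v, c1, r1.
- move=> [c1 [r1 [e1 N]]]; have [H1 _ EA] := N.
 have b : between c1 e1 (re w) by move: Aw; rewrite EA => -[].
 by have [-> -> ->] := HALF_eq Ht H1 Bt b; constructor 3.
- move=> [a [b S]]; exfalso; apply: (strip_no_half S Ht Bt).
 by case: S => _ _ _ EA _; move: Aw; rewrite EA => -[].
Qed.

End Basal.

(** * Side pairings and the cycles of precells *)

Section Cycles.
Implicit Types (g h k : G) (z w v s : C) (x y t c r e : R) (p q : sphere R) (A : set C) (o : bool).

Lemma sbt_mid c e : c <> e -> sbt c e ((c + e) / 2).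
Proof. by move=> ce; rewrite /sbt; have [?|?|//] := ltgtP c e; lra. Qed.

Lemma sbt_between c e x : sbt c e x -> between c e x.
Proof. by rewrite /sbt /between; lra. Qed.

Lemma Hf_int c r e z : 0 < r -> uhp z -> sbt c e (re z) -> r ^+ 2 < nz c z -> (Hf c r e)^° z.
Proof.
move=> r0 Hz b n; have r20 : 0 < 2 * r by lra.
have X K : Hf c r e = poly K -> (forall k, k \in K -> 0 < side_ k z) -> (Hf c r e)^° z.
 by move=> -> H; rewrite interior_poly; split.
have P : 0 < - ((r ^+ 2 - nz c z) / (2 * r)) by rewrite -mulNr opprB divr_gt0 ?subr_gt0.
have [lt|gt] : c < e \/ e < c by move: b; rewrite /sbt; lra.
 apply: (X _ (HfE lt r0)) => k; rewrite !inE => /or3P[]/eqP->; rewrite ?qfN ?side_vert ?side_circ //;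
 move: b; rewrite /sbt; lra.
apply: (X _ (HfE' gt r0)) => k; rewrite !inE => /or3P[]/eqP->; rewrite ?qfN ?side_vert ?side_circ //;
move: b; rewrite /sbt; lra.
Qed.

Lemma half_int A c r e z : half_of A c r e -> uhp z -> sbt c e (re z) -> r ^+ 2 < nz c z -> A^° z.
Proof.
move=> H Hz b n; have [r0 _ _ _ _] := half_of_HALF H.
exact: (interiorS (half_of_sub H)) (Hf_int r0 Hz b n).
Qed.

Lemma half_mem_NC A c r e z v c1 r1 c2 r2 : HALF c r e -> sbt c e (re z) -> A z ->
 NC A v c1 r1 c2 r2 ->
 [/\ c = c1, r = r1 & e = re v] \/ [/\ c = c2, r = r2 & e = re v].
Proof.
move=> H b Az [H1 H2 _ _ EA]; move: Az; rewrite EA => -[[_ _ B]|[_ _ B]].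
- by left; exact: HALF_eq H H1 b B.
- by right; exact: HALF_eq H H2 b B.
Qed.

Lemma half_mem_CU A c r e z c1 r1 e1 : HALF c r e -> sbt c e (re z) -> A z ->
 CU A c1 r1 e1 -> [/\ c = c1, r = r1 & e = e1].
Proof. by move=> H b Az [H1 _ EA]; move: Az; rewrite EA => -[_ _ B]; exact: HALF_eq H H1 b B. Qed.

Lemma half_mem_strip A c r e z a b : HALF c r e -> sbt c e (re z) -> A z ->
 ~ strip_precell Gam A a b.
Proof.
move=> H B Az S; have [_ _ _ EA _] := S; apply: (strip_no_half S H B).
by move: Az; rewrite EA => -[].
Qed.

Lemma half_pt A c r e : half_of A c r e -> exists z, [/\ uhp z, sbt c e (re z), r ^+ 2 < nz c z & A z].
Proof.
move=> H; have [r0 ce _ _ _] := half_of_HALF H.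
exists (pt ((c + e) / 2) (2 * r)).
have Hz : uhp (pt ((c + e) / 2) (2 * r)) by rewrite uhpE /= mulr_gt0.
have n : r ^+ 2 < nz c (pt ((c + e) / 2) (2 * r)).
 by rewrite /nz /=; nra.
split=> //; first exact: sbt_mid.
by apply: interior_subset; apply: (half_int H) => //; exact: sbt_mid.
Qed.

Lemma NC_halves A v c1 r1 c2 r2 : NC A v c1 r1 c2 r2 ->
 half_of A c1 r1 (re v) /\ half_of A c2 r2 (re v).
Proof. by move=> H; split; [constructor 1; exists v, c2, r2|constructor 2; exists v, c1, r1]. Qed.

Lemma CU_NC A c r e v c1 r1 c2 r2 : CU A c r e -> ~ NC A v c1 r1 c2 r2.
Proof.
move=> U N; have hU : half_of A c r e by constructor 3.
have [z [Hz b _ Az]] := half_pt hU.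
have [_ er _] := U; have [_ _ _ [Hv n1 n2] _] := N; rewrite uhpE in Hv.
by have := half_mem_NC (half_of_HALF hU) b Az N; case=> -[E1 E2 E3]; move: er n1 n2; rewrite E1 E2 E3 /nz; nra.
Qed.

Lemma nonvertical_half A b : nonvertical_side Gam A b ->
 exists c r e, half_of A c r e /\ b = arc c r e.
Proof.
have E v c r : 0 < im v -> nz c v = r ^+ 2 -> 0 < r -> c <> re v ->
  seg (Some (pt c r)) (Some v) = arc c r (re v).
 by move=> v0 n r0 ne; rewrite -{1}(ptK v) seg_arc // ltW.
case=> [[v [s1 [s2 [/noncuspidal_NC[c1 [r1 [c2 [r2 [N S]]]]] Eb]]]]|
    [v [s [/cuspidal_CU[c [r [e [U Ev Es]]]] Eb]]]].
- have [h1 h2] := NC_halves N; have [H1 H2 cvc [Hv n1 n2] _] := N.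
 have [r10 ne1 _ _ _] := H1; have [r20 ne2 _ _ _] := H2.
 by case: S Eb => -[-> ->] [->|->]; [exists c1, r1, (re v)|exists c2, r2, (re v)|exists c2, r2, (re v)|exists c1, r1, (re v)];
  rewrite E.
- have [H er _] := U; have [r0 ce _ _ _] := H; exists c, r, e; split; first by constructor 3.
 by rewrite Eb Es Ev seg_arc // expr0n addr0.
Qed.

Lemma half_nonvertical A c r e : precell Gam A -> half_of A c r e ->
 nonvertical_side Gam A (arc c r e).
Proof.
move=> pA hA; have [z [Hz b _ Az]] := half_pt hA; have H := half_of_HALF hA.
have E v c0 r0 : 0 < im v -> nz c0 v = r0 ^+ 2 -> 0 < r0 -> c0 <> re v ->
  arc c0 r0 (re v) = seg (Some (pt c0 r0)) (Some v).
 by move=> v0 n rp ne; rewrite -{2}(ptK v) seg_arc // ltW.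
case: pA => [[v [s1 [s2 N0]]]|[v [s U0]]|[x [y S]]]; last by case: (half_mem_strip H b Az S).
- left; exists v, s1, s2; split=> //.
 have [c1 [r1 [c2 [r2 [N S]]]]] := noncuspidal_NC N0.
 have [H1 H2 _ [Hv n1 n2] _] := N.
 have [r10 ne1 _ _ _] := H1; have [r20 ne2 _ _ _] := H2.
 have := half_mem_NC H b Az N; case=> -[-> -> ->]; rewrite E //;
  case: S => -[-> ->]; [by left|by right|by right|by left].
- right; exists v, s; split=> //.
 have [c1 [r1 [e1 [U Ev Es]]]] := cuspidal_CU U0.
 have [H1 er _] := U; have [r0 ce _ _ _] := H1.
 have [-> -> ->] := half_mem_CU H b Az U.
 by rewrite Ev Es seg_arc // expr0n addr0.
Qed.

Lemma arc_inj c r e c' r' e' : HALF c r e -> HALF c' r' e' -> arc c r e = arc c' r' e' ->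
 [/\ c = c', r = r' & e = e'].
Proof.
move=> H H' E; have [_ ce _ _ _] := H; have b := sbt_mid ce.
have [y [_ _ a _]] := arc_pt H b; rewrite E in a; case: a => _ _ B.
exact: HALF_eq H H' b B.
Qed.

(** The inversion fixes the isometric sphere pointwise, so [g] acts on it as a Euclidean reflection
    in a vertical line: heights are kept and half arcs go to half arcs. *)
Lemma mob_sph g z : ec g != 0 -> uhp z -> nz (ctr g) z = rad g ^+ 2 ->
 mobC g z = pt (ctr g^-1%g - (re z - ctr g)) (im z).
Proof.
move=> c0 Hz n; have r0 : rad g ^+ 2 != 0 by rewrite sqrf_eq0 gt_eqF ?rad_gt0.
apply: Cext; rewrite ?re_mob ?im_mob // n; last by rewrite mulrAC divff ?mul1r.
by rewrite mulrAC divff ?mul1r.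
Qed.

Lemma arc_image g e : ec g != 0 ->
 mobC g @` arc (ctr g) (rad g) e = arc (ctr g^-1%g) (rad g) (ctr g^-1%g + ctr g - e).
Proof.
move=> c0; apply/seteqP; split=> z.
 case=> w [Hw n B] <-; rewrite (mob_sph c0 Hw n); split=> //.
  by rewrite -n /nz !re_pt !im_pt; congr (_ + _); ring.
 by move: B; rewrite /between re_pt; move: (re w) => u; lra.
case=> Hz n B; pose w := pt (ctr g + ctr g^-1%g - re z) (im z).
have Hw : uhp w by [].
have nw : nz (ctr g) w = rad g ^+ 2.
 by rewrite -n /nz !re_pt !im_pt; congr (_ + _); ring.
exists w; last by rewrite (mob_sph c0 Hw nw) /w re_pt im_pt -[RHS]ptK; congr pt; ring.
by split=> //; move: B; rewrite /between /w re_pt; move: (re z) => u; lra.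
Qed.

Lemma den_sph g z : ec g != 0 -> nz (ctr g) z = rad g ^+ 2 -> den g z = 1.
Proof. by move=> c0 n; rewrite den_nz // n divff // sqrf_eq0 gt_eqF ?rad_gt0. Qed.

Lemma HALF_image g e : Gam g -> ec g != 0 -> HALF (ctr g) (rad g) e ->
 HALF (ctr g^-1%g) (rad g) (ctr g^-1%g + ctr g - e).
Proof.
move=> Gg c0 [r0 ce er _ [aK be_]]; split=> //; first lra.
- by rewrite (_ : (_ - _) ^+ 2 = (e - ctr g) ^+ 2) //; ring.
- by exists g^-1%g; rewrite ecV0 radV; split=> //; exact: GamV.
split; first rewrite -arc_image // => z [w wa <-].
 by have [Hw n _] := wa; apply: (clK_mob (aK _ wa) Gg); exact: den_sph.
move=> z zK n; have Hz := proj1 zK; have c0' : ec g^-1%g != 0 by rewrite ecV0.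
have n' : nz (ctr g^-1%g) z = rad g^-1%g ^+ 2 by rewrite radV.
have wK := clK_mob zK (GamV Gg) (den_sph c0' n').
have Ew := mob_sph c0' Hz n'; rewrite invgK in Ew; rewrite Ew in wK.
have := be_ _ wK; rewrite /nz re_pt im_pt.
move=> H; have {}H := H _; have : (ctr g - (re z - ctr g^-1%g) - ctr g) ^+ 2 + im z ^+ 2 = rad g ^+ 2.
 by rewrite -n /nz; congr (_ + _); ring.
by move/H; move: (re z) => u; nra.
Qed.

(** A side pairing in coordinates: [g] has the given half arc on its isometric sphere, and [A'] is a
    member of the family above the image half arc, whose end is the reflected abscissa. *)
Definition pr c r e g A' : Prop :=
 [/\ Gam g, ec g != 0, ctr g = c, rad g = r &
   AA A' /\ half_of A' (ctr g^-1%g) r (ctr g^-1%g + c - e)].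

Lemma pr_ex c r e : HALF c r e -> exists g A', pr c r e g A'.
Proof.
move=> H; have [r0 ce er [g [Gg c0 Ec Er]] _] := H.
have H' : HALF (ctr g) (rad g) e by rewrite Ec Er.
have [t [A [Gt AAA hA]]] := pairing (HALF_image Gg c0 H').
have [s [s2 Ha Hb Hc Hd]] := mul_entries (vert t) g.
have [s' [s2' Ha' Hb' Hc' Hd']] := vert_entries t.
have s0 := sgn_neq0 s2; have s0' := sgn_neq0 s2'.
have Hc2 : ec (vert t * g)%g = s * s' * ec g by rewrite Hc Hc' Hd'; ring.
have Hd2 : ed (vert t * g)%g = s * s' * ed g by rewrite Hd Hc' Hd'; ring.
have Ha2 : ea (vert t * g)%g = s * s' * (ea g + t * ec g) by rewrite Ha Ha' Hb'; ring.
have ss : s * s' != 0 by rewrite mulf_neq0.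
have k0 : ec (vert t * g)%g != 0 by rewrite Hc2 mulf_neq0.
have Ek : ctr (vert t * g)^-1%g = ctr g^-1%g + t.
 by rewrite !ctrV // Hc2 Ha2; field; rewrite c0 s0 s0'.
exists (vert t * g)%g, A; split=> //.
- exact: GamM.
- by rewrite -Ec /ctr Hc2 Hd2; field; rewrite c0 s0 s0'.
- by rewrite -Er /rad ec_vertM.
split=> //; rewrite Ek -Ec -Er.
by rewrite (_ : _ - e = ctr g^-1%g + ctr g - e + t) //; ring.
Qed.

Lemma same_half A A' c r e t : AA A -> AA A' -> Gam (vert t) -> half_of A c r e ->
 half_of A' (c + t) r (e + t) -> t = 0 /\ A = A'.
Proof.
move=> AAA AAA' Gt hA hA'; have [r0 ce _ _ _] := half_of_HALF hA.
have [z [Hz b n Az]] := half_pt hA.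
have zA : A^° z by exact: half_int hA Hz b n.
have : A' (mobC (vert t) z).
 apply: (half_of_sub hA'); rewrite -Hf_vert; exists z => //; split=> //; first exact: ltW.
 exact: sbt_between.
case/(fund AAA AAA' Gt zA) => E ->; split=> //.
by apply: vert_inj; rewrite E vert0.
Qed.

(** Elements whose isometric spheres have the same centre differ by a translation on the left. It is
    trivial because both image half arcs bound members of the family. *)
Lemma pr_uniq c r e g A g' A' : HALF c r e -> pr c r e g A -> pr c r e g' A' -> g = g' /\ A = A'.
Proof.
move=> H [Gg c0 Ec Er [AAA hA]] [Gg' c0' Ec' Er' [AAA' hA']].
have [t Et] : exists t, (g' * g^-1)%g = vert t.
 apply: translation_stab; apply/stab_infP; split; first by apply: GamM => //; exact: GamV.
 have [s [s2 _ _ Hc _]] := mul_entries g' g^-1%g.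
 have [s' [s2' Ha' _ Hc' _]] := inv_entries g.
 rewrite Hc Ha' Hc'; have : ec g' * ed g - ed g' * ec g = 0.
  by move: Ec'; rewrite -Ec /ctr !mulNr => /oppr_inj/eqP; rewrite eqr_div // => /eqP E; lra.
 move=> E; rewrite (_ : ec g' * _ + _ = s' * (ec g' * ed g - ed g' * ec g)); last by ring.
 by rewrite E !mulr0.
have Gt : Gam (vert t) by rewrite -Et; apply: GamM => //; exact: GamV.
have Eg : g' = (vert t * g)%g by rewrite -Et mulgVK.
have [y [y0 n _ yK]] := arc_pt H (sbt_mid (let: And5 _ ce _ _ _ := H in ce)).
have Hz : uhp (pt ((c + e) / 2) y) by [].
have E1 := mob_sph c0 Hz; rewrite Ec Er in E1; have {}E1 := E1 n.
have E2 := mob_sph c0' Hz; rewrite Ec' Er' in E2; have {}E2 := E2 n.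
have Ect : ctr g'^-1%g = ctr g^-1%g + t.
 move: E2; rewrite Eg mobCM // vert_mob E1 !re_pt => /(congr1 (@re R)); rewrite !re_pt; lra.
have := hA'; rewrite Ect (_ : _ + t + c - e = ctr g^-1%g + c - e + t); last by ring.
case/(same_half AAA AAA' Gt hA) => t0 EA.
by rewrite Eg t0 vert0 mul1g.
Qed.

Lemma paired_sideP A c r e g A' : half_of A c r e ->
 paired_side Gam AA (arc c r e) g A' <-> pr c r e g A'.
Proof.
move=> hA; have H := half_of_HALF hA; have [r0 ce _ _ _] := H; split.
 case=> /movingP[Gg c0] sub AAA' nv.
 have K x : sbt c e x -> r ^+ 2 - (x - c) ^+ 2 = rad g ^+ 2 - (x - ctr g) ^+ 2.
  move=> b; have [y [y0 n a _]] := arc_pt H b.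
  have := sub _ a; rewrite isom_line // => /(line_circ _ _ (rad_gt0 c0))[_].
  by move: n; rewrite /nz re_pt im_pt; lra.
 have K1 := K _ (sbt_mid ce).
 have K2 : r ^+ 2 - ((c + 3 * e) / 4 - c) ^+ 2 = rad g ^+ 2 - ((c + 3 * e) / 4 - ctr g) ^+ 2.
  by apply: K; rewrite /sbt; lra.
 have Ec : ctr g = c.
  have : (ctr g - c) * (e - c) = 0 by move: K1 K2; move: (ctr g) => u; lra.
  move/eqP; rewrite mulf_eq0 !subr_eq0 => /orP[/eqP//|/eqP E]; by case: ce.
 have Er : rad g = r.
  have E : rad g ^+ 2 = r ^+ 2 by move: K1; rewrite Ec; lra.
  by apply/eqP; rewrite -(eqrXn2 (n := 2)) ?(ltW r0) ?(ltW (rad_gt0 c0)) // E.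
 split=> //; split=> //.
 have [c' [r' [e' [h' Eb]]]] := nonvertical_half nv.
 move: Eb; rewrite -Ec -Er arc_image // => Eb.
 have H1 : HALF (ctr g) (rad g) e by rewrite Ec Er.
 by have [-> -> ->] := arc_inj (HALF_image Gg c0 H1) (half_of_HALF h') Eb.
case=> Gg c0 Ec Er [AAA' hA']; split=> //; first exact/movingP.
 move=> z [Hz n _]; apply/isom_sphereE; split=> //.
 by apply: den_sph => //; rewrite Ec Er.
have := arc_image e c0; rewrite Ec Er => ->.
by apply: half_nonvertical hA' ; exact: pAA.
Qed.

Lemma assignedP A g : AA A -> assigned Gam AA A g <-> exists c r e A', half_of A c r e /\ pr c r e g A'.
Proof.
move=> AAA; split.
 case=> b [A' [/nonvertical_half[c [r [e [hA ->]]]] /(paired_sideP _ _ hA) P]].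
 by exists c, r, e, A'.
case=> c [r [e [A' [hA P]]]]; exists (arc c r e), A'; split; last exact/(paired_sideP _ _ hA).
by apply: half_nonvertical hA; exact: pAA.
Qed.

Lemma NC_uniq A v c1 r1 c2 r2 v' c1' r1' c2' r2' : NC A v c1 r1 c2 r2 ->
 NC A v' c1' r1' c2' r2' -> [/\ v = v', c1 = c1', r1 = r1', c2 = c2' & r2 = r2'].
Proof.
move=> N N'; have [h1 h2] := NC_halves N.
have [z1 [_ b1 _ A1]] := half_pt h1; have [z2 [_ b2 _ A2]] := half_pt h2.
have [_ _ cvc [Hv n1 n2] _] := N; have [_ _ cvc' [Hv' n1' n2'] _] := N'.
have E1 : [/\ c1 = c1', r1 = r1' & re v = re v'].
 by case: (half_mem_NC (half_of_HALF h1) b1 A1 N') => -[E1 E2 E3] //; move: cvc cvc'; rewrite E1 E3; lra.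
have E2 : [/\ c2 = c2', r2 = r2' & re v = re v'].
 by case: (half_mem_NC (half_of_HALF h2) b2 A2 N') => -[F1 F2 F3] //; move: cvc cvc'; rewrite F1 F3; lra.
case: E1 E2 => E1 E2 E3 [E4 E5 _]; split=> //.
apply: Cext => //; apply/eqP; rewrite -(eqrXn2 (n := 2)) ?(ltW Hv) ?(ltW Hv') //.
by move: n1 n1'; rewrite /nz E1 E2 E3 => n1 n1'; apply/eqP; lra.
Qed.

Lemma NC_vertex A A' v v' c1 r1 c2 r2 c1' r1' c2' r2' t : AA A -> AA A' -> Gam (vert t) ->
 NC A v c1 r1 c2 r2 -> NC A' v' c1' r1' c2' r2' -> re v' = re v + t -> t = 0 /\ A = A'.
Proof.
move=> AAA AAA' Gt N N' Ev; have [h1 _] := NC_halves N; have [h1' _] := NC_halves N'.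
have [_ _ cvc _ _] := N; have [_ _ cvc' _ _] := N'.
have H1 := HALF_vert Gt (half_of_HALF h1); have H1' := half_of_HALF h1'.
apply: (same_half AAA AAA' Gt h1).
have [m [m1 m2 m3]] : exists m, [/\ m < re v', c1 + t < m & c1' < m].
 by apply: gtr_ex2; move: cvc cvc'; rewrite Ev; lra.
have b : sbt (c1 + t) (re v + t) m by rewrite /sbt -Ev m1 m2.
have b' : sbt c1' (re v') m by rewrite /sbt m1 m3.
by have [-> -> ->] := HALF_strict_eq H1 H1' b b'.
Qed.

Definition atv A v : Prop := exists c1 r1 c2 r2, NC A v c1 r1 c2 r2.

Lemma attachedP A v : AA A -> attached Gam A v <-> atv A v.
Proof.
move=> AAA; split.
 by case=> s1 [s2 /noncuspidal_NC[c1 [r1 [c2 [r2 [N _]]]]]]; exists c1, r1, c2, r2.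
case=> c1 [r1 [c2 [r2 N]]]; case: (pAA AAA) => [[v' [s1 [s2 N0]]]|[v' [s U0]]|[x [y S]]].
- have [d1 [q1 [d2 [q2 [N' _]]]]] := noncuspidal_NC N0.
 by have [-> _ _ _ _] := NC_uniq N N'; exists s1, s2.
- have [d1 [q1 [e1 [U _ _]]]] := cuspidal_CU U0.
 by case: (CU_NC U N).
- have [h1 _] := NC_halves N; have [z [_ b _ Az]] := half_pt h1.
 by case: (half_mem_strip (half_of_HALF h1) b Az S).
Qed.

(* Step of a cycle: through the left ([o = true]) or right non-vertical side of [A]. *)
Definition stp o A v h A' : Prop := exists c1 r1 c2 r2, NC A v c1 r1 c2 r2 /\
 pr (if o then c1 else c2) (if o then r1 else r2) (re v) h A'.

Lemma stp_ex o A v : atv A v -> exists h A', stp o A v h A'.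
Proof.
case=> c1 [r1 [c2 [r2 N]]]; have [H1 H2 _ _ _] := N.
have [h [A' P]] : exists h A', pr (if o then c1 else c2) (if o then r1 else r2) (re v) h A'.
 by case: o; apply: pr_ex.
by exists h, A', c1, r1, c2, r2.
Qed.

Lemma stp_uniq o A v h A' h2 A2 : stp o A v h A' -> stp o A v h2 A2 -> h = h2 /\ A' = A2.
Proof.
case=> c1 [r1 [c2 [r2 [N P]]]] [d1 [q1 [d2 [q2 [N' P']]]]].
have [_ E1 E2 E3 E4] := NC_uniq N N'; subst d1 q1 d2 q2; have [H1 H2 _ _ _] := N.
by apply: pr_uniq P P'; case: (o).
Qed.

(** The pairing reflects left and right, so the new precell is entered through the side opposite to
    the one by which the next step leaves it. The inverse of a step is a step in the other
    direction. *)
Lemma stp_V o A v h A' : AA A -> stp o A v h A' ->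
 AA A' /\ stp (~~ o) A' (mobC h v) h^-1%g A.
Proof.
move=> AAA [c1 [r1 [c2 [r2 [N [Gh c0 Ec Er [AAA' hA']]]]]]]; split=> //.
have [H1 H2 cvc [Hv n1 n2] EA] := N; have [hl hr] := NC_halves N.
have nv : nz (ctr h) v = rad h ^+ 2 by rewrite Ec Er; case: (o).
have Ehv := mob_sph c0 Hv nv.
have lt2 : (ctr h - re v) ^+ 2 < rad h ^+ 2.
 by rewrite uhpE in Hv; rewrite -nv /nz; nra.
have inv4 d : d = ctr h -> pr (ctr h^-1%g) (rad h) (ctr h^-1%g + d - re v) h^-1%g A.
 move=> ->; split; rewrite ?ecV0 ?radV ?invgK //; first exact: GamV.
 split=> //; rewrite (_ : _ + _ - (_ - re v) = re v); last by ring.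
 by rewrite Ec Er; case: (o).
have vE v' : uhp v' -> nz (ctr h^-1%g) v' = rad h ^+ 2 -> re v' = ctr h^-1%g + ctr h - re v -> v' = mobC h v.
 move=> Hv' n' E; rewrite Ehv; apply: Cext; rewrite ?re_pt ?im_pt; first by rewrite E; ring.
 apply/eqP; rewrite -(eqrXn2 (n := 2)) ?(ltW Hv) ?(ltW Hv') //; apply/eqP.
 by move: n' nv; rewrite /nz E; lra.
rewrite -Ec -Er in hA'; case: o hA' Ec Er => /= hA' Ec Er.
- case: hA' => [[v' [c' [r' [N' E]]]]|[v' [c' [r' [N' E]]]]|[_ er _]].
 + by case: N' => _ _ + _ _; rewrite -E Ec; lra.
 + have [_ _ _ [Hv' n' n2'] _] := N'; rewrite -(vE v') //.
  by exists c', r', (ctr h^-1%g), (rad h); split=> //; rewrite -E; exact: inv4.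
 + by move: er lt2; lra.
- case: hA' => [[v' [c' [r' [N' E]]]]|[v' [c' [r' [N' E]]]]|[_ er _]].
 + have [_ _ _ [Hv' n' n2'] _] := N'; rewrite -(vE v') //.
  by exists (ctr h^-1%g), (rad h), c', r'; split=> //; rewrite -E; exact: inv4.
 + by case: N' => _ _ + _ _; rewrite -E Ec; lra.
 + by move: er lt2; lra.
Qed.

Lemma stp_ne A v h A1 h' A2 : stp true A v h A1 -> stp false A v h' A2 -> h <> h'.
Proof.
case=> c1 [r1 [c2 [r2 [N [_ _ Ec _ _]]]]] [d1 [q1 [d2 [q2 [N' [_ _ Ec' _ _]]]]]].
have [_ E1 E2 E3 E4] := NC_uniq N N'; have [_ _ cvc _ _] := N.
by move=> E; move: Ec Ec' cvc; rewrite E -E3 => -> ->; lra.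
Qed.

Lemma stp_assigned o A v h A1 h' A2 : AA A -> stp o A v h A1 -> stp (~~ o) A v h' A2 ->
 assigned Gam AA A = [set h; h'].
Proof.
have main B w k B1 k' B2 : AA B -> stp true B w k B1 -> stp false B w k' B2 ->
  assigned Gam AA B = [set k; k'].
 move=> AAB s1 s2; have [c1 [r1 [c2 [r2 [N P1]]]]] := s1.
 have [d1 [q1 [d2 [q2 [N' P2]]]]] := s2.
 have [_ E1 E2 E3 E4] := NC_uniq N N'; subst d1 q1 d2 q2.
 have [h1 h2] := NC_halves N; have [H1 H2 _ _ _] := N.
 apply/seteqP; split=> g.
  case/(assignedP _ AAB) => c [r [e [A' [hB P]]]].
  have [z [_ b _ Bz]] := half_pt hB.
  case: (half_mem_NC (half_of_HALF hB) b Bz N) => -[E1 E2 E3]; subst c r e.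
   by left; case: (pr_uniq H1 P P1).
  by right; case: (pr_uniq H2 P P2).
 by case=> ->; apply/(assignedP _ AAB); [exists c1, r1, (re w), B1|exists c2, r2, (re w), B2].
case: o => /= AAA s1 s2; first exact: main s1 s2.
by rewrite setUC; exact: main s2 s1.
Qed.

Lemma stp_atv o A v h A' : AA A -> stp o A v h A' -> [/\ Gam h, atv A v, AA A' & atv A' (mobC h v)].
Proof.
move=> AAA S; have [AAA' S'] := stp_V AAA S.
case: S => c1 [r1 [c2 [r2 [N [Gh _ _ _ _]]]]]; case: S' => d1 [q1 [d2 [q2 [N' _]]]].
by split=> //; [exists c1, r1, c2, r2|exists d1, q1, d2, q2].
Qed.

(** The flag [o] fixes for the whole cycle through which non-vertical side it leaves. The default of
    [xget] is not reached when the precell is attached to the transported vertex. *)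
Definition nxt o v (p : set C * G) : set C * G :=
 xget (set0, 1%g) [set q : set C * G | stp o p.1 (mobC p.2 v) q.2 q.1].

Fixpoint cyc o v A n : set C * G :=
 if n is m.+1 then let p := cyc o v A m in let q := nxt o v p in (q.1, q.2 * p.2)%g
 else (A, 1%g).

Definition cA o v A n := (cyc o v A n).1.

Definition cg o v A n := (cyc o v A n).2.

Definition ch o v A n := (nxt o v (cyc o v A n)).2.

Lemma cgS o v A n : cg o v A n.+1 = (ch o v A n * cg o v A n)%g. Proof. by []. Qed.

Lemma cg0 o v A : cg o v A 0 = 1%g. Proof. by []. Qed.

Lemma cA0 o v A : cA o v A 0 = A. Proof. by []. Qed.

Lemma nxtP o v (p : set C * G) : atv p.1 (mobC p.2 v) -> stp o p.1 (mobC p.2 v) (nxt o v p).2 (nxt o v p).1.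
Proof.
move=> H; rewrite /nxt; have [h [A' S]] := stp_ex o H.
by have := xgetPex (set0, 1%g) (ex_intro [set q : set C * G | stp o p.1 (mobC p.2 v) q.2 q.1] (A', h) S).
Qed.

Lemma cycP o v A n : AA A -> atv A v ->
 [/\ AA (cA o v A n), Gam (cg o v A n), atv (cA o v A n) (mobC (cg o v A n) v) &
   stp o (cA o v A n) (mobC (cg o v A n) v) (ch o v A n) (cA o v A n.+1)].
Proof.
move=> AAA HAv; have Hv : uhp v by case: HAv => c1 [r1 [c2 [r2 [_ _ _ []]]]].
elim: n => [|n [I1 I2 I3 I4]].
 have a1 : atv A (mobC 1%g v) by rewrite mobC1.
 by split=> //; [exact: Gam1|exact: (@nxtP o v (A, 1%g) a1)].
have [Gh _ AAA' a'] := stp_atv I1 I4.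
have I3' : atv (cA o v A n.+1) (mobC (cg o v A n.+1) v) by rewrite cgS mobCM.
by split=> //; [exact: GamM|exact: (@nxtP o v (cyc o v A n.+1) I3')].
Qed.

Lemma cyc_same o v A m n : AA A -> atv A v -> cg o v A m = cg o v A n -> cA o v A m = cA o v A n.
Proof.
move=> AAA a E; have [I1 _ [c1 [r1 [c2 [r2 N]]]] _] := cycP o m AAA a.
have [J1 _ [d1 [q1 [d2 [q2 N']]]] _] := cycP o n AAA a.
rewrite -E in N'; have G0 : Gam (vert 0) by rewrite vert0; exact: Gam1.
by case: (NC_vertex I1 J1 G0 N N' (esym (addr0 _))).
Qed.

(** Steps can be undone by [stp_V], so a coincidence in the sequence can be moved back; the first
    repetition is a return to the start. *)
Lemma cyc_back o v A m n : AA A -> atv A v -> cg o v A m.+1 = cg o v A n.+1 -> cg o v A m = cg o v A n.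
Proof.
move=> AAA a E; have EA := cyc_same AAA a E.
have [I1 I2 I3 I4] := cycP o m AAA a; have [J1 J2 J3 J4] := cycP o n AAA a.
have Hv : uhp v by case: a => c1 [r1 [c2 [r2 [_ _ _ []]]]].
have [_ S1] := stp_V I1 I4; have [_ S2] := stp_V J1 J4.
rewrite -!mobCM // -!cgS in S1 S2; rewrite -EA -E in S2.
have [/invg_inj Eh _] := stp_uniq S1 S2.
by apply: (mulgI (ch o v A m)); rewrite -cgS E cgS Eh.
Qed.

(** The transported vertices stay in the closure of [K], hence at constant height, and by
    [finite_den] only finitely many elements up to translation bring [v] there. Two elements of the
    sequence that agree up to a translation are equal, by [NC_vertex]. *)
Lemma cyc_return o v A : AA A -> atv A v -> exists2 n, (0 < n)%N & cg o v A n = 1%g.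
Proof.
move=> AAA a; have Hv : uhp v by case: a => c1 [r1 [c2 [r2 [_ _ _ []]]]].
have vK B w : AA B -> atv B w -> clK w.
 move=> AAB [c1 [r1 [c2 [r2 [H1 _ _ [Hw n1 _] EB]]]]]; apply: (precell_clK (pAA AAB)).
 by rewrite EB; left; split; rewrite ?n1 // /between; lra.
have [tau t0 Gt] := cusp_width.
pose M := `|re v| + im v + (im v)^-1 + tau + 1.
have v0 : 0 < im v := Hv; have iv0 : 0 < (im v)^-1 by rewrite invr_gt0.
have nv0 := normr_ge0 (re v).
have fin := finite_den M; move/finite_seqP: fin => [s Es].
have P n : exists2 x, x \in s & exists2 t, Gam (vert t) & x = (vert t * cg o v A n)%g.
 have [I1 I2 I3 _] := cycP o n AAA a.
 have d1 : den (cg o v A n) v = 1 by apply: clK_den => //; [exact: vK a|exact: vK I3].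
 have [m Hm] := translate_re (re (mobC (cg o v A n) v)) t0.
 have Gm := Gam_vertz m Gt.
 exists (vert (m%:~R * tau) * cg o v A n)%g; last by exists (m%:~R * tau).
 have : [set` s] (vert (m%:~R * tau) * cg o v A n)%g; last by [].
 rewrite -Es; split; first exact: GamM.
 exists v; rewrite den_vertM // d1 mobCM // vert_mob re_pt; split=> //.
 - by rewrite /M; lra.
 - apply/andP; split; last by rewrite /M; lra.
  by rewrite invf_ple ?posrE // /M; lra.
 - by rewrite /M; lra.
 - by rewrite ler_norml; move: Hm; rewrite /M; lra.
have [m [n [x [mn _ [t1 G1 E1] [t2 G2 E2]]]]] := pigeonhole_ex P.
have [t G0 E] : exists2 t, Gam (vert t) & cg o v A n = (vert t * cg o v A m)%g.
 exists (- t2 + t1); first by rewrite -vertM -vertV; apply: GamM => //; exact: GamV.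
 by rewrite -vertM -vertV -mulgA -E1 E2 mulKg.
have Emn : cg o v A m = cg o v A n.
 have [I1 _ [c1 [r1 [c2 [r2 N]]]] _] := cycP o m AAA a.
 have [J1 _ [d1 [q1 [d2 [q2 N']]]] _] := cycP o n AAA a.
 have Er : re (mobC (cg o v A n) v) = re (mobC (cg o v A m) v) + t by rewrite E mobCM // vert_mob.
 by have [t00 _] := NC_vertex I1 J1 G0 N N' Er; rewrite E t00 vert0 mul1g.
exists (n - m)%N; first by rewrite subn_gt0.
have : forall i j, (i <= j)%N -> cg o v A i = cg o v A j -> cg o v A (j - i) = 1%g.
 elim=> [j _ H|i IH [//|j]]; first by rewrite subn0 -H.
 by rewrite ltnS subSS => ij /(cyc_back AAA a); exact: IH.
by apply; rewrite // ltnW.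
Qed.

Lemma cycle_eltS (c : seq (set C * G)) j : (j < size c)%N ->
 cycle_elt c j.+1 = ((cycle_term c j).2 * cycle_elt c j)%g.
Proof. by move=> jc; rewrite /cycle_elt (take_nth (set0, 1%g)) // foldl_rcons. Qed.

Lemma cycle_elt0 (c : seq (set C * G)) : cycle_elt c 0 = 1%g.
Proof. by rewrite /cycle_elt take0. Qed.

Definition period o v A (k : nat) : Prop :=
 [/\ (0 < k)%N, cg o v A k = 1%g & forall j, (0 < j < k)%N -> cg o v A j <> 1%g].

Lemma period_ex o v A : AA A -> atv A v -> exists k : nat, period o v A k.
Proof.
move=> AAA a; have [n n0 En] := cyc_return o AAA a.
have ex : exists n, (0 < n)%N && `[< cg o v A n = 1%g >] by exists n; rewrite n0; apply/asboolP.
case: (ex_minnP ex) => k /andP[k0 /asboolP Ek] km; exists k; split=> // j /andP[j0 jk] Ej.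
have := km j; rewrite j0; have -> : `[< cg o v A j = 1%g >] by apply/asboolP.
by move=> /(_ isT); rewrite leqNgt jk.
Qed.

Definition clist o v A (k : nat) := mkseq (fun j => (cA o v A j, ch o v A j)) k.

Lemma clist_term o v A (k : nat) j : (j < k)%N -> cycle_term (clist o v A k) j = (cA o v A j, ch o v A j).
Proof. by move=> jk; rewrite /cycle_term nth_mkseq. Qed.

Lemma clist_elt o v A (k : nat) j : (j <= k)%N -> cycle_elt (clist o v A k) j = cg o v A j.
Proof.
elim: j => [|j IH] jk; first by rewrite cycle_elt0.
by rewrite cycle_eltS ?size_mkseq // clist_term // IH ?(ltnW jk).
Qed.

Lemma ncycle_ex o v A (k : nat) : AA A -> atv A v -> period o v A k ->
 noncuspidal_cycle Gam AA A (ch o v A 0) (clist o v A k).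
Proof.
move=> AAA a [k0 Ek km]; have Hv : uhp v by case: a => c1 [r1 [c2 [r2 [_ _ _ []]]]].
split.
- split=> //; have [_ _ _ S] := cycP o 0 AAA a.
 have [h' [A' S']] := stp_ex (~~ o) a.
 rewrite cg0 mobC1 in S; have := stp_assigned AAA S S'; rewrite ?cA0 => ->; by left.
- by rewrite size_mkseq clist_term.
- exists v; first exact/attachedP.
 rewrite size_mkseq => j jk; have [I1 _ I3 _] := cycP o j AAA a.
 by rewrite clist_term // clist_elt ?(ltnW jk) //; split=> //; exact/attachedP.
- rewrite size_mkseq => j jk; rewrite !clist_term ?(ltnW jk) //.
 have [I1 I2 I3 I4] := cycP o j AAA a; have [J1 J2 J3 J4] := cycP o j.+1 AAA a.
 have [_ S] := stp_V I1 I4; rewrite -mobCM // -cgS in S.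
 by rewrite (stp_assigned J1 J4 S).
- rewrite size_mkseq clist_elt // Ek; split=> // j /andP[j0 jk].
 by rewrite clist_elt ?(ltnW jk) //; apply: km; rewrite j0.
Qed.

(** A cycle is forced: its first element selects one of the two sides, and the condition on assigned
    elements makes every later step leave through the side not just used. *)
Lemma ncycleP A h (c : seq (set C * G)) : noncuspidal_cycle Gam AA A h c ->
 exists o v (k : nat), [/\ AA A, atv A v, period o v A k, h = ch o v A 0 & c = clist o v A k].
Proof.
case=> [[AAA asg] [c0 Ec0] [v /(attachedP _ AAA) a Hat] Hnext [Eend Hne]].
have Hv : uhp v by case: (a) => c1 [r1 [c2 [r2 [_ _ _ []]]]].
have [b Eh] : exists b, h = ch b v A 0.
 have [_ _ _ S1] := cycP true 0 AAA a; have [_ _ _ S2] := cycP false 0 AAA a.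
 have E : assigned Gam AA A = [set ch true v A 0; ch false v A 0] := stp_assigned AAA S1 S2.
 by move: asg; rewrite E => -[->|->]; [exists true|exists false].
move: b Eh => o Eh.
have key j : (j < size c)%N -> cycle_term c j = (cA o v A j, ch o v A j) /\ cycle_elt c j = cg o v A j.
 elim: j => [|j IH] jc; first by rewrite Ec0 cycle_elt0 Eh.
 have [Et Ee] := IH (ltnW jc); have Eg : cycle_elt c j.+1 = cg o v A j.+1.
  by rewrite cycle_eltS ?(ltnW jc) // Et Ee.
 split=> //; have [I1 I2 I3 I4] := cycP o j AAA a; have [J1 J2 J3 J4] := cycP o j.+1 AAA a.
 have [AAj atj] := Hat _ jc; have {}atj := proj1 (attachedP _ AAj) atj.
 have EA : (cycle_term c j.+1).1 = cA o v A j.+1.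
  move: atj J3; rewrite Eg => -[c1 [r1 [c2 [r2 N]]]] [d1 [q1 [d2 [q2 N']]]].
  have G0 : Gam (vert 0) by rewrite vert0; exact: Gam1.
  by case: (NC_vertex AAj J1 G0 N N' (esym (addr0 _))).
 have [_ S] := stp_V I1 I4; rewrite -mobCM // -cgS in S.
 have E1 := stp_assigned J1 J4 S; have E2 := Hnext _ jc.
 rewrite EA Et /= in E2; rewrite E1 in E2.
 have ne : ch o v A j.+1 <> ((ch o v A j)^-1)%g.
  move: J4 S; case: (o) => /= J4 S; first exact: stp_ne J4 S.
  by move=> E; apply: (stp_ne S J4).
 rewrite (surjective_pairing (cycle_term c j.+1)) EA; congr (_, _).
 have : [set (cycle_term c j.+1).2; (ch o v A j)^-1%g] (ch o v A j.+1) by rewrite -E2; left.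
 by case=> [<-|/ne].
have Esz : cycle_elt c (size c) = cg o v A (size c).
 move: c0 key; case: (size c) (@cycle_eltS c) => // n /(_ n (ltnSn n)) Es _ key.
 by have [Et Ee] := key _ (ltnSn n); rewrite Es Et Ee.
exists o, v, (size c); split=> //.
 split=> //; first by rewrite -Esz.
 by move=> j jk; have [_ <-] := key j (proj2 (andP jk)); exact: Hne.
apply: (@eq_from_nth _ (set0, 1%g)); first by rewrite size_mkseq.
by move=> j jc; rewrite nth_mkseq //; have [] := key _ jc.
Qed.

End Cycles.

(** Connectedness of the interval: the supremum of the times up to which [P] holds throughout is
    attained, and cannot be smaller than [t]. *)
Lemma real_clopen (P : R -> Prop) (s t : R) : s <= t -> P s ->
 (forall r, s <= r <= t -> P r -> exists2 e, 0 < e &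
   forall r', s <= r' <= t -> `|r' - r| < e -> P r') ->
 (forall r, s <= r <= t -> (forall e, 0 < e -> exists r',
   [/\ s <= r' <= t, `|r' - r| < e & P r']) -> P r) -> P t.
Proof.
move=> st Ps op cl; pose S := [set r | s <= r <= t /\ forall r', s <= r' <= r -> P r'].
have Ss : S s.
 split; first by rewrite lexx.
 by move=> r' sr; have -> : r' = s by apply/le_anti; rewrite andbC.
have ub : ubound S t by move=> r [/andP[]].
have hs : has_sup S by split; [exists s|exists t].
pose m := sup S; have sm : s <= m by apply: ub_le_sup => //; exists t.
have mt : m <= t by apply: ge_sup => //; exists s.
have below r : s <= r < m -> P r.
 case/andP=> sr rm; have mr : 0 < m - r by lra.
 have [r' [_ Sr'] rr'] := sup_adherent mr hs.
 apply: Sr'; rewrite sr /=; move: rr'; rewrite -/m; lra.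
have Pm : P m.
 apply: cl; first by rewrite sm.
 move=> e e0; have [ms|sm'] := leP m s.
  have Ems : m = s by apply/le_anti; rewrite ms sm.
  by exists s; rewrite lexx st Ems subrr normr0.
 have me : m - e < m by lra.
 have [r [r1 r2 r3]] := gtr_ex2 sm' me.
 exists r; split; [lra|by rewrite ltr_norml; lra|by apply: below; lra].
have smt : s <= m <= t by rewrite sm.
have [e e0 He] := op _ smt Pm.
have [tm|mt'] := leP t m; first by have <- : m = t by apply/le_anti; rewrite mt tm.
have me : m < m + e by lra.
have [r [r1 r2 r3]] := ltr_ex2 mt' me.
suff : S r by move=> /(ub_le_sup (ex_intro _ t ub)); rewrite -/m; lra.
split; first lra.
move=> r' /andP[sr r'r]; have [lt|ge] := ltP r' m; first by apply: below; rewrite sr.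
by apply: He; [lra|rewrite ltr_norml; lra].
Qed.

(** * The precells around an inner vertex fill a polygon with complete sides *)

Section Tiles.
Implicit Types (g h : G) (z w v u : C) (x y t c r e : R) (p q : sphere R) (A B : set C) (o : bool).

Lemma seg_cross (k : G) z w : uhp z -> uhp w -> side_ k z < 0 -> 0 < side_ k w ->
 exists h s t r, [/\ gp h s = z, gp h t = w, s <= r <= t & line k (gp h r)] \/
  [/\ gp h s = w, gp h t = z, s <= r <= t & line k (gp h r)].
Proof.
move=> Hz Hw z0 w0; have [h [s [t [Es Et st]]]] := join_ex Hz Hw.
have ct : {within `[s, t], continuous (fun r => side_ k (gp h r))}.
 apply: continuous_subspaceT => r; apply: (@continuous_comp _ _ _ (gp h) (side_ k)).
  exact: cts_gp.
 exact: cts_side.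
have mm : Num.min (side_ k (gp h s)) (side_ k (gp h t)) <= 0 <= Num.max (side_ k (gp h s)) (side_ k (gp h t)).
 by rewrite Es Et ge_min le_max (ltW z0) (ltW w0) orbT.
have [r rst E] := IVT st ct mm.
exists h, s, t, r; left; split=> //; split=> //; exact: gp_uhp.
Qed.

Lemma seg_cross_in (V : set C) (k : G) z w : hconvex V -> V z -> V w -> side_ k z < 0 -> 0 < side_ k w ->
 exists2 u, V u & line k u.
Proof.
move=> cV Vz Vw z0 w0; have [h [s [t [r H]]]] := seg_cross (cV.1 _ Vz) (cV.1 _ Vw) z0 w0.
by exists (gp h r); case: H => -[Es Et H1 H2] //; apply: (hconvex_gp cV _ _ H1); rewrite ?Es ?Et.
Qed.

Lemma NC_memP A v c1 r1 c2 r2 z : NC A v c1 r1 c2 r2 ->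
 A z <-> [/\ uhp z, c1 <= re z <= c2, r1 ^+ 2 <= nz c1 z & r2 ^+ 2 <= nz c2 z].
Proof.
case=> [H1 H2 cvc [Hv n1 n2] EA]; have [r10 _ _ _ _] := H1; have [r20 _ _ _ _] := H2.
have r1p : 0 < 2 * r1 by lra.
have r2p : 0 < 2 * r2 by lra.
rewrite EA (NCpolyE cvc r10 r20 n1 n2); split.
 case=> Hz H; have [i1 i2 i3 i4] := in4 (vert c1) (vert c2 * Sop)%g
  (circ c1 r1 * Sop)%g (circ c2 r2 * Sop)%g.
 have := H _ i1; have := H _ i2; have := H _ i3; have := H _ i4.
 rewrite !qfN !side_vert !side_circ // -!/(nz _ _) -!mulNr !opprB.
 rewrite !pmulr_lge0 ?invr_gt0 // !subr_ge0 => -> -> b2 b1; split=> //.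
 by rewrite b1.
case=> Hz /andP[b1 b2] m1 m2; split=> // k; rewrite !inE => /or4P[]/eqP->.
- by rewrite side_vert subr_ge0.
- by rewrite qfN side_vert oppr_ge0 subr_le0.
- by rewrite qfN side_circ // -mulNr opprB divr_ge0 ?subr_ge0 // ltW.
- by rewrite qfN side_circ // -mulNr opprB divr_ge0 ?subr_ge0 // ltW.
Qed.

Lemma NC_intP A v c1 r1 c2 r2 z : NC A v c1 r1 c2 r2 ->
 A^° z <-> [/\ uhp z, c1 < re z < c2, r1 ^+ 2 < nz c1 z & r2 ^+ 2 < nz c2 z].
Proof.
case=> [H1 H2 cvc [Hv n1 n2] EA]; have [r10 _ _ _ _] := H1; have [r20 _ _ _ _] := H2.
have r1p : 0 < 2 * r1 by lra.
have r2p : 0 < 2 * r2 by lra.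
rewrite EA (NCpolyE cvc r10 r20 n1 n2) interior_poly; split.
 case=> Hz H; have [i1 i2 i3 i4] := in4 (vert c1) (vert c2 * Sop)%g
  (circ c1 r1 * Sop)%g (circ c2 r2 * Sop)%g.
 have := H _ i1; have := H _ i2; have := H _ i3; have := H _ i4.
 rewrite !qfN !side_vert !side_circ // -!/(nz _ _) -!mulNr !opprB.
 rewrite !pmulr_lgt0 ?invr_gt0 // !subr_gt0 => -> -> b2 b1; split=> //.
 by rewrite b1.
case=> Hz /andP[b1 b2] m1 m2; split=> // k; rewrite !inE => /or4P[]/eqP->.
- by rewrite side_vert subr_gt0.
- by rewrite qfN side_vert oppr_gt0 subr_lt0.
- by rewrite qfN side_circ // -mulNr opprB divr_gt0 ?subr_gt0.
- by rewrite qfN side_circ // -mulNr opprB divr_gt0 ?subr_gt0.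
Qed.

Lemma open_ltc (f : C -> R) a : continuous f -> open [set z | f z < a].
Proof.
move=> cf; rewrite -[X in open X]/(f @^-1` [set r | r < a]).
by apply: open_comp; [move=> z _; exact: cf|exact: open_lt].
Qed.

Lemma open_sbt a d : open [set z : C | sbt a d (re z)].
Proof.
have -> : [set z : C | sbt a d (re z)] =
  ([set z | a < re z] `&` [set z | re z < d]) `|` ([set z | d < re z] `&` [set z | re z < a]).
 apply/seteqP; split=> z; rewrite /= /sbt; first by case/orP=> /andP[? ?]; [left|right].
 by case=> -[? ?]; apply/orP; [left|right]; apply/andP.
by apply: openU; apply: openI; first [exact: open_gtc (@cts_re R)|exact: open_ltc (@cts_re R)].
Qed.

Lemma near_open (U : set C) z : open U -> U z -> nbhs z U.
Proof. by move=> oU Uz; apply: open_nbhs_nbhs. Qed.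

Lemma near_mob (U : set C) h z : open U -> uhp z -> U (mobC h z) -> nbhs z [set w | U (mobC h w)].
Proof. by move=> oU Hz Uz; exact: (cts_mobC Hz (near_open oU Uz)). Qed.

Lemma near_mob_out A h z : precell Gam A -> uhp z -> ~ A (mobC h z) -> nbhs z [set w | ~ A (mobC h w)].
Proof.
move=> pA Hz nA; have Hm := mobC_uhp h Hz.
have : nbhs (mobC h z) [set w | ~ A w].
 apply: contrapT => N; apply: nA; rewrite -(precell_closed pA); split=> // U Uz.
 apply: contrapT => M; apply: N; apply: filterS Uz => w Uw Aw; apply: M; by exists w.
exact: (cts_mobC Hz).
Qed.

(** The pairing turns the points just below the arc into points above the image arc, so [A] and the
    pulled back neighbour together fill a neighbourhood. *)
Lemma arc_near A c r e h A' z : half_of A c r e -> pr c r e h A' -> uhp z ->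
 nz c z = r ^+ 2 -> sbt c e (re z) -> \forall w \near z, A w \/ A' (mobC h w).
Proof.
move=> hA [Gh c0 Ec Er [AAA' hA']] Hz n b; have [r0 ce _ _ _] := half_of_HALF hA.
have E := mob_sph c0 Hz; rewrite Ec Er in E; have {}E := E n.
have b' : sbt (ctr h^-1%g) (ctr h^-1%g + c - e) (re (mobC h z)).
 by rewrite E re_pt; move: b; rewrite /sbt; move: (re z) => x; lra.
have n1 : nbhs z [set w : C | sbt c e (re w)].
 by apply: near_open; first exact: open_sbt.
have n2 : nbhs z [set w : C | sbt (ctr h^-1%g) (ctr h^-1%g + c - e) (re (mobC h w))].
 pose U : set C := [set w | sbt (ctr h^-1%g) (ctr h^-1%g + c - e) (re w)].
 have oU : open U by exact: open_sbt.
 have Uz : U (mobC h z) by [].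
 have K := near_mob oU Hz Uz.
 exact: K.
have nb := @filterI C (nbhs z) (@nbhs_filter C z) _ _ (nbhs_uhp Hz)
 (@filterI C (nbhs z) (@nbhs_filter C z) _ _ n1 n2).
apply: filterS nb => w [Hw [bw bw']].
have [n'|n'] := leP (r ^+ 2) (nz c w).
 by left; apply: (half_of_sub hA); split=> //; exact: sbt_between.
right; apply: (half_of_sub hA'); split; [exact: mobC_uhp| |exact: sbt_between].
rewrite nz_mob // Ec Er ler_pdivlMr ?nz_gt0 // (_ : r ^+ 4 = r ^+ 2 * r ^+ 2); last by ring.
nra.
Qed.

Section NCtile.
Variables (A0 : set C) (v : C) (N : nat).
Hypotheses (A0A : AA A0) (A0v : atv A0 v) (perN : period true v A0 N).
Local Notation g_ := (cg true v A0).
Local Notation A_ := (cA true v A0).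
Local Notation h_ := (ch true v A0).

Let Hv : uhp v. Proof. by case: A0v => c1 [r1 [c2 [r2 [_ _ _ []]]]]. Qed.

Let N0 : (0 < N)%N. Proof. by case: perN. Qed.

Let gN : g_ N = 1%g. Proof. by case: perN. Qed.

Let AN : A_ N = A0.
Proof. by rewrite -(cA0 true v A0); apply: (cyc_same A0A A0v); rewrite gN cg0. Qed.

Let AAj j : AA (A_ j). Proof. by case: (cycP true j A0A A0v). Qed.

Let Ggj j : Gam (g_ j). Proof. by case: (cycP true j A0A A0v). Qed.

Let dat j : exists c2 r2, NC (A_ j) (mobC (g_ j) v) (ctr (h_ j)) (rad (h_ j)) c2 r2 /\
 pr (ctr (h_ j)) (rad (h_ j)) (re (mobC (g_ j) v)) (h_ j) (A_ j.+1).
Proof.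
have [_ _ _ [c1 [r1 [c2 [r2 [Nj P]]]]]] := cycP true j A0A A0v.
by have [_ _ Ec Er _] := P; rewrite Ec Er; exists c2, r2.
Qed.

Let dat' j : exists c1 r1, NC (A_ j.+1) (mobC (g_ j.+1) v) c1 r1 (ctr (h_ j)^-1%g) (rad (h_ j)) /\
 pr (ctr (h_ j)^-1%g) (rad (h_ j)) (re (mobC (g_ j.+1) v)) (h_ j)^-1%g (A_ j).
Proof.
have [_ _ _ S] := cycP true j A0A A0v.
have [_ [c1 [r1 [c2 [r2 [Nj P]]]]]] := stp_V (AAj j) S; rewrite -mobCM // -cgS in Nj P.
rewrite /= in P; have [_ _ Ec Er _] := P; rewrite radV in Er; exists c1, r1; rewrite Ec Er; by split.
Qed.

Let hc0 j : ec (h_ j) != 0. Proof. by have [c2 [r2 [_ []]]] := dat j. Qed.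

(** The half planes of the left vertical sides of the pulled back precells. The right vertical side
    of [A_ j.+1] lies on the same line as the left one of [A_ j], since [h_ j] maps the vertical
    line over its centre to a vertical line. *)
Definition NCK : seq G := [seq ((g_ j)^-1 * vert (ctr (h_ j)))%g | j <- iota 0 N].

Lemma NCK_side j z : uhp z ->
 (0 < side_ ((g_ j)^-1 * vert (ctr (h_ j)))%g z) = (ctr (h_ j) < re (mobC (g_ j) z)).
Proof.
move=> Hz; rewrite -{1}(mobCK (g_ j) Hz) side_gt0_mobC; last exact: mobC_uhp.
by rewrite side_vert subr_gt0.
Qed.

Lemma NCK_sidele j z : uhp z ->
 (0 <= side_ ((g_ j)^-1 * vert (ctr (h_ j)))%g z) = (ctr (h_ j) <= re (mobC (g_ j) z)).
Proof.
move=> Hz; rewrite -{1}(mobCK (g_ j) Hz) side_ge0_mobC; last exact: mobC_uhp.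
by rewrite side_vert subr_ge0.
Qed.

Let re_h j z : uhp z -> re (mobC (h_ j) z) =
 ctr (h_ j)^-1%g - rad (h_ j) ^+ 2 * (re z - ctr (h_ j)) / nz (ctr (h_ j)) z.
Proof. exact: re_mob. Qed.

(** A complete side is made of two vertical sides meeting at a summit: above it the side of [A_ j],
    below it the pulled back side of [A_ j.+1]. *)
Let left_cover j z : uhp z -> re (mobC (g_ j) z) = ctr (h_ j) ->
 A_ j (mobC (g_ j) z) \/
 (A_ j.+1 (mobC (g_ j.+1) z) /\ re (mobC (g_ j.+1) z) = ctr (h_ j)^-1%g).
Proof.
move=> Hz E; have Hw := mobC_uhp (g_ j) Hz; rewrite cgS mobCM //; move: (mobC _ z) Hw E => w Hw E.
have [c2 [r2 [Nj _]]] := dat j; have [c1 [r1 [Nj' _]]] := dat' j.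
have [H1 _ cvc _ EA] := Nj; have [_ H2 cvc' _ EA'] := Nj'.
have Er : re (mobC (h_ j) w) = ctr (h_ j)^-1%g by rewrite re_h // E subrr mulr0 mul0r subr0.
have [n|n] := leP (rad (h_ j) ^+ 2) (nz (ctr (h_ j)) w).
 by left; rewrite EA; left; split=> //; rewrite E /between; lra.
right; split=> //; rewrite EA'; right; split; first exact: mobC_uhp.
 rewrite nz_mob // ler_pdivlMr ?nz_gt0 // (_ : _ ^+ 4 = rad (h_ j) ^+ 2 * rad (h_ j) ^+ 2); last by ring.
 nra.
by rewrite Er /between; lra.
Qed.

(** If a pulled back precell reached beyond a line, its interior would meet the line, hence one of
    the two precells with a vertical side there, and agree with it by [fund]. But points of a
    vertical side are not interior. *)
Lemma NCU_sub i z : uhp z -> A_ i (mobC (g_ i) z) -> poly NCK z.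
Proof.
move=> Hz Az; split=> // _ /mapP[j _ ->]; rewrite leNgt; apply/negP => neg.
set k := (_ * _)%g in neg.
pose V := mobC (g_ i)^-1%g @` (A_ i)^°.
have pAi := pAA (AAj i).
have AiH w : (A_ i)^° w -> uhp w by move=> /interior_subset; exact: (precell_uhp pAi).
have VP w : V w <-> uhp w /\ (A_ i)^° (mobC (g_ i) w).
 split; first by case=> u Au <-; have Hu := AiH _ Au; rewrite mobCKV //; split=> //; exact: mobC_uhp.
 by case=> Hw Aw; exists (mobC (g_ i) w) => //; rewrite mobCK.
have cV : hconvex V.
 have [K [z0 [EK z0K]]] := precell_poly pAi.
 split=> [w /VP[]//|a b /VP[Ha Aa] /VP[Hb Ab] u /(segP _ Ha Hb)[h [s [t [r [Es Et srt Eu]]]]]].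
 apply/VP; rewrite -Eu; split; first exact: gp_uhp.
 rewrite mobC_gp; rewrite -Es mobC_gp in Aa; rewrite -Et mobC_gp in Ab.
 by move: Aa Ab; rewrite EK interior_poly => Aa Ab; exact: (hconvex_gp (hconvex_ipoly K) Aa Ab srt).
have approx w (U : set C) : uhp w -> A_ i (mobC (g_ i) w) -> open U -> U w -> exists2 w', V w' & U w'.
 move=> Hw Aw oU Uw.
 have : nbhs (mobC (g_ i) w) [set u | U (mobC (g_ i)^-1%g u)].
  by apply: near_mob => //; [exact: mobC_uhp|rewrite mobCK].
 case/(precell_dense pAi Aw) => w' [Aw' Uw'].
 by exists (mobC (g_ i)^-1%g w') => //; exists w'.
have [a Va na] : exists2 a, V a & side_ k a < 0.
 by apply: (approx z [set u | side_ k u < 0]) => //; exact: open_ltc (@cts_side _ k).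
have [b Vb nb] : exists2 b, V b & 0 < side_ k b.
 apply: (approx v [set u | 0 < side_ k u]) => //.
 - have [c2 [r2 [Ni _]]] := dat i; have [H1 _ cvc [Hw n1 n2] _] := Ni.
  by apply/(NC_memP _ Ni); rewrite n1 n2 !lexx; split=> //; lra.
 - exact: open_gt0 (@cts_side _ k).
 - rewrite /= /k NCK_side //; have [c2 [r2 [Nj _]]] := dat j; have [_ _ cvc _ _] := Nj; lra.
have [u Vu [Hu ku]] := seg_cross_in cV Va Vb na nb.
have Ekj : re (mobC (g_ j) u) = ctr (h_ j).
 by apply/le_anti; rewrite -NCK_sidele // -/k ku lexx andbT leNgt -NCK_side // -/k ku ltxx.
have [_ Au] := proj1 (VP u) Vu.
have tr l : A_ l (mobC (g_ l) u) -> g_ i = g_ l /\ A_ i = A_ l.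
 move=> Al; have Gil : Gam (g_ l * (g_ i)^-1)%g by apply: GamM => //; exact: GamV.
 have : A_ l (mobC (g_ l * (g_ i)^-1)%g (mobC (g_ i) u)).
  by rewrite -mobCM // mulgVK.
 move=> /(fund (AAj i) (AAj l) Gil Au)[E ->]; split=> //.
 by rewrite -[g_ i]mul1g -E mulgVK.
case: (left_cover Hu Ekj) => [/tr[Eg EA]|[/tr[Eg EA] Er]].
 move: Au; rewrite EA Eg; have [c2 [r2 [Nj _]]] := dat j; move/(NC_intP _ Nj) => [_ + _ _].
 by rewrite Ekj ltxx.
move: Au; rewrite EA Eg; have [c1 [r1 [Nj _]]] := dat' j; move/(NC_intP _ Nj) => [_ + _ _].
by rewrite Er ltxx andbF.
Qed.

Definition NCU : set C := [set z | uhp z /\ exists2 j, (j < N)%N & A_ j (mobC (g_ j) z)].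

Lemma NCU_lt j z : uhp z -> (j <= N)%N -> A_ j (mobC (g_ j) z) -> NCU z.
Proof.
move=> Hz; rewrite leq_eqVlt => /orP[/eqP->|jN] Az; split=> //; last by exists j.
by exists 0%N => //; move: Az; rewrite AN gN cg0 cA0.
Qed.

Lemma NCU_out z : uhp z -> ~ NCU z -> nbhs z [set w | ~ NCU w].
Proof.
move=> Hz nU.
have : \forall w \near z, forall j, j \in iota 0 N -> ~ A_ j (mobC (g_ j) w).
 apply: near_seq => j; rewrite mem_iota add0n => /andP[_ jN].
 by apply: near_mob_out => //; [exact: pAA|move=> Az; apply: nU; split=> //; exists j].
by apply: filterS => w H [_ [j jN Aw]]; apply: (H j _ Aw); rewrite mem_iota.
Qed.

Lemma NCK_v : ipoly NCK v.
Proof.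
split=> // _ /mapP[j _ ->]; rewrite NCK_side //.
by have [c2 [r2 [[_ _ cvc _ _] _]]] := dat j; lra.
Qed.

Let reK j z : ipoly NCK z -> (j < N)%N -> ctr (h_ j) < re (mobC (g_ j) z).
Proof.
move=> [Hz H] jN; rewrite -NCK_side //; apply: H; apply/mapP; exists j => //.
by rewrite mem_iota.
Qed.

(** Across each non-vertical side the neighbour in the cycle takes over. The radical axis identity
    shows that the two arcs meet only at [v], the one point excluded here. *)
Lemma NCU_open z : ipoly NCK z -> z <> v -> NCU z -> nbhs z NCU.
Proof.
move=> zK zv [Hz [j jN Az]].
(* The cyclically preceding index: for [j = 0] it is [N.-1]. *)
have [i [iN0 iN Ei EAi]] : exists i, [/\ (i < N)%N, (i.+1 <= N)%N, g_ i.+1 = g_ j & A_ i.+1 = A_ j].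
 case: j jN Az => [|j] jN Az; last by exists j; rewrite ltnW.
 exists N.-1; rewrite prednK //; split=> //.
have [c2 [r2 [Nj Pj]]] := dat j; have [c1 [r1 [Ni Pi]]] := dat' i.
rewrite EAi Ei in Ni Pi.
have [_ E1 E2 E3 E4] := NC_uniq Nj Ni; subst c1 r1 c2 r2.
have [H1 H2 cvc [Hvj n1 n2] _] := Nj; have [hl hr] := NC_halves Nj.
have Hw := mobC_uhp (g_ j) Hz.
have [_ bw m1 m2] := proj1 (NC_memP _ Nj) Az.
have b1 := reK zK jN.
have b2 : re (mobC (g_ j) z) < ctr (h_ i)^-1%g.
 rewrite -Ei cgS mobCM // re_h; last exact: mobC_uhp.
 rewrite gtrDl oppr_lt0 divr_gt0 ?nz_gt0 //; last exact: mobC_uhp.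
 by rewrite mulr_gt0 ?exprn_gt0 ?rad_gt0 // subr_gt0; exact: reK.
have Kid : nz (ctr (h_ i)^-1%g) (mobC (g_ j) z) - rad (h_ i) ^+ 2 =
  nz (ctr (h_ j)) (mobC (g_ j) z) - rad (h_ j) ^+ 2
  + 2 * (ctr (h_ j) - ctr (h_ i)^-1%g) * (re (mobC (g_ j) z) - re (mobC (g_ j) v)).
 rewrite -n1 -n2 /nz; move: (re (mobC (g_ j) z)) (im (mobC (g_ j) z)) => x y.
 by move: (re (mobC (g_ j) v)) (im (mobC (g_ j) v)) => x' y'; ring.
have pull (h : G) (A' : set C) : Gam h -> (\forall w \near mobC (g_ j) z, A_ j w \/ A' (mobC h w)) ->
  (forall w, uhp w -> A' (mobC h (mobC (g_ j) w)) -> NCU w) -> nbhs z NCU.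
 move=> Gh /(cts_mobC Hz) nr Hn; apply: filterS (filterI (nbhs_uhp Hz) nr) => w [Hw' [Aw|Aw]].
  by split=> //; exists j.
 exact: Hn.
have [e1|e1] := eqVneq (nz (ctr (h_ j)) (mobC (g_ j) z)) (rad (h_ j) ^+ 2).
 have [e2|e2] := eqVneq (nz (ctr (h_ i)^-1%g) (mobC (g_ j) z)) (rad (h_ i) ^+ 2).
  exfalso; apply: zv.
  have Er : re (mobC (g_ j) z) = re (mobC (g_ j) v).
   move: Kid; rewrite e1 e2 !subrr add0r => /esym/eqP; rewrite !mulf_eq0 !subr_eq0 => /orP[/orP[|]|/eqP//].
    by rewrite pnatr_eq0.
   by move=> /eqP E; move: cvc; rewrite E; lra.
  have Ez : mobC (g_ j) z = mobC (g_ j) v.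
   apply: Cext => //; apply/eqP; rewrite -(eqrXn2 (n := 2)) ?(ltW Hw) ?(ltW Hvj) //.
   by move: e1 n1; rewrite /nz Er => e1 n1; apply/eqP; lra.
  by rewrite -(mobCK (g_ j) Hz) Ez mobCK.
 have lt : re (mobC (g_ j) z) < re (mobC (g_ j) v).
  have : 0 < nz (ctr (h_ i)^-1%g) (mobC (g_ j) z) - rad (h_ i) ^+ 2.
   lra.
  rewrite Kid e1 subrr add0r; move: (re _) (re (mobC _ v)) cvc => x x' cvc; nra.
 have b : sbt (ctr (h_ j)) (re (mobC (g_ j) v)) (re (mobC (g_ j) z)) by rewrite /sbt b1 lt.
 apply: (pull (h_ j) (A_ j.+1)); first by case: Pj.
  exact: (arc_near hl Pj Hw e1 b).
 move=> w Hw' Aw; apply: (@NCU_lt j.+1) => //; by rewrite cgS mobCM.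
have [e2|e2] := eqVneq (nz (ctr (h_ i)^-1%g) (mobC (g_ j) z)) (rad (h_ i) ^+ 2).
 have lt : re (mobC (g_ j) v) < re (mobC (g_ j) z).
  have : 0 < nz (ctr (h_ j)) (mobC (g_ j) z) - rad (h_ j) ^+ 2.
   lra.
  move: Kid; rewrite e2 subrr; move: (re _) (re (mobC _ v)) cvc => x x' cvc; nra.
 have b : sbt (ctr (h_ i)^-1%g) (re (mobC (g_ j) v)) (re (mobC (g_ j) z)).
  by rewrite /sbt lt b2 orbT.
 apply: (pull (h_ i)^-1%g (A_ i)); first by case: Pi.
  exact: (arc_near hr Pi Hw e2 b).
 move=> w Hw' Aw; split=> //; exists i => //.
 by move: Aw; rewrite -Ei cgS mobCM // mobCK //; exact: mobC_uhp.
have Ao : (A_ j)^° (mobC (g_ j) z).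
 apply/(NC_intP _ Nj); split=> //; first by rewrite b1.
  by rewrite lt_neqAle eq_sym e1.
 by rewrite lt_neqAle eq_sym e2.
have := near_mob (@open_interior _ (A_ j)) Hz Ao => nr.
apply: filterS (filterI (nbhs_uhp Hz) nr) => w [Hw' /= Aw]; split=> //; exists j => //.
exact: interior_subset Aw.
Qed.

(** The union is open and closed in the open polygon without [v]. The segment to [z] starts at an
    interior point of [A0] not collinear with [z] and [v], so it avoids [v]. *)
Lemma NCU_ipoly : ipoly NCK `<=` NCU.
Proof.
move=> z zK; have Hz := zK.1.
have vU : NCU v.
 split=> //; exists 0%N => //; rewrite cg0 cA0 mobC1.
 case: A0v => c1 [r1 [c2 [r2 N1]]]; have [H1 _ cvc [Hw n1 n2] _] := N1.
 by apply/(NC_memP _ N1); rewrite n1 n2 !lexx; split=> //; lra.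
have [->//|zv] := pselect (z = v).
have [kk [s0 [t0 [E1 E2 _]]]] := join_ex Hz Hv.
have kz : line kk z by rewrite -E1; exact: gp_line.
have kv : line kk v by rewrite -E2; exact: gp_line.
have [u Au nu] : exists2 u, A0^° u & side_ kk u <> 0.
 have [u0 Au0] := precell_int (pAA A0A).
 have [k0|k0] := eqVneq (side_ kk u0) 0; last by exists u0 => //; exact/eqP.
 have Hu0 : uhp u0 by apply: (precell_uhp (pAA A0A)); exact: interior_subset.
 have [w [Aw _ w0]] := near_pos (conj Hu0 k0) (near_open (@open_interior _ A0) Au0).
 by exists w => // E; rewrite E ltxx in w0.
have Hu : uhp u by apply: (precell_uhp (pAA A0A)); exact: interior_subset.
have sub : A0 `<=` poly NCK.
 move=> w Aw; have Hw := precell_uhp (pAA A0A) Aw.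
 by apply: (@NCU_sub 0%N) => //; rewrite cg0 cA0 mobC1.
have uK : ipoly NCK u by rewrite -interior_poly; exact: interiorS sub _ Au.
have uU : NCU u.
 by split=> //; exists 0%N => //; rewrite cg0 cA0 mobC1; exact: interior_subset.
have [h [s [t [Es Et st]]]] := join_ex Hu Hz.
have inK r : s <= r <= t -> ipoly NCK (gp h r).
 by move=> srt; apply: (hconvex_gp (hconvex_ipoly NCK) _ _ srt); rewrite ?Es ?Et.
have ne r : gp h r <> v.
 move=> Ev; apply: nu; have : line kk u; last by case.
 rewrite (@line_eq2 _ kk h z v) //; last by rewrite -Ev; exact: gp_line.
  by rewrite -Es; exact: gp_line.
 by rewrite -Et; exact: gp_line.
rewrite -Et; apply: (@real_clopen (fun r => NCU (gp h r)) s t) => //; first by rewrite Es.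
 move=> r srt rU; have nb := NCU_open (inK _ srt) (@ne r) rU.
 have /(@nbhs_ballP R) [e /= e0 eU] : nbhs r [set r' | NCU (gp h r')] := @cts_gp R h r _ nb.
 by exists e => // r' _ rr'; apply: eU; rewrite -ball_normE /= distrC.
move=> r srt H; apply: contrapT => nU; have nb := NCU_out (gp_uhp h r) nU.
have /(@nbhs_ballP R) [e /= e0 eU] : nbhs r [set r' | ~ NCU (gp h r')] := @cts_gp R h r _ nb.
have [r' [_ rr' rU]] := H _ e0.
by apply: (eU r') => //; rewrite -ball_normE /= distrC.
Qed.

Lemma NCU_poly : NCU = poly NCK.
Proof.
apply/seteqP; split=> z; first by case=> Hz [j _ Az]; exact: NCU_sub Hz Az.
move=> zK; apply: contrapT => nU.
have [w [wK nw]] := closure_ipoly NCK_v zK (NCU_out zK.1 nU).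
by apply: nw; exact: NCU_ipoly.
Qed.

Lemma NCK_lines k : k \in NCK -> line k `<=` poly NCK.
Proof.
case/mapP => j; rewrite mem_iota add0n => /andP[_ jN] -> z [Hz E]; rewrite -NCU_poly.
have Ekj : re (mobC (g_ j) z) = ctr (h_ j).
 by apply/le_anti; rewrite -NCK_sidele // E lexx andbT leNgt -NCK_side // E ltxx.
by case: (left_cover Hz Ekj) => [Az|[Az _]]; [apply: (@NCU_lt j) => //; exact: ltnW|exact: (@NCU_lt j.+1)].
Qed.

(** [v] is an interior point of the union over the cycle, so no other translate of a precell has
    room for its vertex there. *)
Lemma NC_orbit g A' : Gam g -> AA A' -> atv A' (mobC g v) -> exists j, [/\ (j < N)%N, g = g_ j & A' = A_ j].
Proof.
move=> Gg AAA' [c1 [r1 [c2 [r2 N1]]]].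
have [H1 _ cvc [Hw n1 n2] _] := N1.
have Av : A' (mobC g v) by apply/(NC_memP _ N1); rewrite n1 n2 !lexx; split=> //; lra.
have nb : nbhs (mobC g v) [set w | ipoly NCK (mobC g^-1%g w)].
 by apply: near_mob => //; [exact: open_ipoly|rewrite mobCK //; exact: NCK_v].
have [w [Aw wK]] := precell_dense (pAA AAA') Av nb.
have Hw' : uhp w by apply: (precell_uhp (pAA AAA')); exact: interior_subset.
have [_ [j jN Aj]] := NCU_ipoly wK.
have Gj : Gam (g_ j * g^-1)%g by apply: GamM => //; exact: GamV.
rewrite -mobCM // in Aj; have [E ->] := fund AAA' (AAj j) Gj Aw Aj.
by exists j; split=> //; rewrite -[g]mul1g -E mulgVK.
Qed.

End NCtile.

End Tiles.

(** * Cells, their translates and the tessellation *)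

Section CellSets.
Implicit Types (g h : G) (z w v u : C) (x y t r e : R) (p q : sphere R) (A B X : set C) (o : bool).
Local Notation is_cell := (is_cell Gam AA).

Let uA A z : AA A -> A z -> uhp z. Proof. by move=> /pAA pA; exact: (precell_uhp pA). Qed.

Lemma atv_uhp A v : atv A v -> uhp v.
Proof. by case=> c1 [r1 [c2 [r2 [_ _ _ []]]]]. Qed.

(** The cell described without a cycle, as the union of all translated precells with vertex [v].
    Independence of choices and equivariance become immediate. *)
Definition NCtile v : set C :=
 [set z | uhp z /\ exists g A', [/\ Gam g, AA A', atv A' (mobC g v) & A' (mobC g z)]].

Lemma NCtile_U A v N : AA A -> atv A v -> period true v A N -> NCtile v = NCU A v N.
Proof.
move=> AAA a perN; have Hv := atv_uhp a; apply/seteqP; split=> z.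
 case=> Hz [g [A' [Gg AAA' a' Az]]]; split=> //.
 have [j [jN Eg EA]] := NC_orbit AAA a perN Gg AAA' a'.
 by exists j => //; rewrite -Eg -EA.
case=> Hz [j jN Az]; split=> //; exists (cg true v A j), (cA true v A j).
by have [I1 I2 I3 _] := cycP true j AAA a.
Qed.

(** Starting through the other side traverses the same cycle backwards. *)
Lemma cyc_rev A v N i : AA A -> atv A v -> cg true v A N = 1%g -> (i <= N)%N ->
 cg false v A i = cg true v A (N - i).
Proof.
move=> AAA a EN; have Hv := atv_uhp a; elim: i => [|i IH] iN; first by rewrite subn0 EN.
have E := IH (ltnW iN); have [m Em] : exists m, (N - i = m.+1)%N.
 by exists (N - i).-1; rewrite prednK // subn_gt0.
have -> : (N - i.+1 = m)%N by rewrite subnS Em.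
rewrite Em in E; have [I1 I2 I3 I4] := cycP false i AAA a.
have [J1 J2 J3 J4] := cycP true m AAA a.
have [K1 S] := stp_V J1 J4; rewrite -mobCM // -cgS -E in S.
have [_ _ K3 _] := cycP true m.+1 AAA a; rewrite -E in K3.
have EA : cA false v A i = cA true v A m.+1.
 move: I3 K3 => [c1 [r1 [c2 [r2 N1]]]] [d1 [q1 [d2 [q2 N2]]]].
 have G0 : Gam (vert 0) by rewrite vert0; exact: Gam1.
 by case: (NC_vertex I1 K1 G0 N1 N2 (esym (addr0 _))).
rewrite -EA in S; have [Eh _] := stp_uniq I4 S.
by rewrite cgS Eh E cgS mulKg.
Qed.

Lemma orbit_all o A v k g A' : AA A -> atv A v -> period o v A k -> Gam g -> AA A' ->
 atv A' (mobC g v) -> exists j, [/\ (j < k)%N, g = cg o v A j & A' = cA o v A j].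
Proof.
move=> AAA a per Gg AAA' a'; have Hv := atv_uhp a.
have [N perN] := period_ex true AAA a.
have [j [jN Eg EA]] := NC_orbit AAA a perN Gg AAA' a'.
have [j' [jk Eg']] : exists j' : nat, (j' < k)%N /\ g = cg o v A j'.
 case: o per => per; last first.
  have [N0 EN _] := perN; have [k0 Ek km] := per.
  case: j jN Eg EA => [|j] jN Eg EA; first by exists 0%N.
  have E : cg false v A (N - j.+1) = g.
   by rewrite (cyc_rev AAA a EN) ?leq_subr // subKn // ltnW.
  have lt : (N - j.+1 < N)%N by rewrite ltn_subrL.
  exists (N - j.+1)%N; split=> //; rewrite ltnNge; apply/negP => kN.
  have := cyc_rev AAA a EN (ltnW (leq_ltn_trans kN lt)); rewrite Ek => E1.
  have [_ _ Nm] := perN; apply: (Nm (N - k)%N) => //.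
  by rewrite subn_gt0 (leq_ltn_trans kN lt) ltn_subrL k0.
 have [k0 Ek km] := per; have [N0 EN Nm] := perN.
 exists j; split=> //; apply: leq_trans jN _; rewrite leqNgt; apply/negP => kN.
 by apply: (Nm k); rewrite ?k0.
exists j'; split=> //; have [I1 _ I3 _] := cycP o j' AAA a.
move: I3 a'; rewrite -Eg' => -[c1 [r1 [c2 [r2 N1]]]] [d1 [q1 [d2 [q2 N2]]]].
have G0 : Gam (vert 0) by rewrite vert0; exact: Gam1.
by case: (NC_vertex I1 AAA' G0 N1 N2 (esym (addr0 _))).
Qed.

Lemma cycle_union o A v k (c := clist o v A k) : AA A -> atv A v -> period o v A k ->
 \bigcup_(j < size c) (mobC (cycle_elt c j)^-1%g @` (cycle_term c j).1) = NCtile v.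
Proof.
move=> AAA a per; have Hv := atv_uhp a; apply/seteqP; split=> z.
 case=> j /=; rewrite size_mkseq => jk; rewrite clist_term // clist_elt ?(ltnW jk) //=.
 case=> w Aw <-; have [I1 I2 I3 _] := cycP o j AAA a; have Hw := uA I1 Aw.
 split; first exact: mobC_uhp.
 by exists (cg o v A j), (cA o v A j); rewrite mobCKV.
case=> Hz [g [A' [Gg AAA' a' Az]]].
have [j [jk Eg EA]] := orbit_all AAA a per Gg AAA' a'.
exists j; first by rewrite /= size_mkseq.
rewrite clist_term // clist_elt ?(ltnW jk) //= -Eg -EA; exists (mobC g z) => //.
by rewrite mobCK.
Qed.

Lemma NC_CUF A v p s : atv A v -> ~ cuspidal_precell Gam A p s.
Proof.
case=> c1 [r1 [c2 [r2 N]]] /cuspidal_CU[c [r [e [U _ _]]]].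
exact: CU_NC U N.
Qed.

Lemma NC_stripF A v x y : atv A v -> ~ strip_precell Gam A x y.
Proof.
case=> c1 [r1 [c2 [r2 N]]]; have [h1 _] := NC_halves N; have [z [_ b _ Az]] := half_pt h1.
exact: half_mem_strip (half_of_HALF h1) b Az.
Qed.

Lemma CU_stripF A c r e x y : CU A c r e -> ~ strip_precell Gam A x y.
Proof.
move=> U; have h1 : half_of A c r e by constructor 3.
by have [z [_ b _ Az]] := half_pt h1; exact: half_mem_strip (half_of_HALF h1) b Az.
Qed.

Lemma cell_NC A v B : AA A -> atv A v -> is_cell A B <-> B = NCtile v.
Proof.
move=> AAA a; split.
 case=> h [c [cyc ->]]; case: cyc => [[x [y [_ S _ _]]]|[p [A' [_ [s U _] _]]]|].
 - by case: (NC_stripF a S).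
 - by case: (NC_CUF a U).
 move=> nc; have [b [v' [k [_ a' per _ Ec]]]] := ncycleP nc.
 rewrite Ec cycle_union //; congr NCtile.
 move: a a' => [c1 [r1 [c2 [r2 N1]]]] [d1 [q1 [d2 [q2 N2]]]].
 by have [] := NC_uniq N2 N1.
move=> ->; have [k per] := period_ex true AAA a.
exists (ch true v A 0), (clist true v A k); split; last by rewrite cycle_union.
by constructor 3; exact: ncycle_ex.
Qed.

(** The ideal triangle with vertices [a], [b] and infinity: the quadratic condition says that [z] is
    not inside the semicircle over the interval. *)
Definition Tri a b : set C :=
 [set z | [/\ uhp z, between a b (re z) & 0 <= (re z - a) * (re z - b) + im z ^+ 2]].

Lemma CU_pr A c r e h A' : CU A c r e -> pr c r e h A' ->
 CU A' (ctr h^-1%g) r (ctr h^-1%g + c - e).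
Proof.
move=> [H er EA] [Gh c0 Ec Er [AAA' hA']].
have er' : (ctr h^-1%g + c - e - ctr h^-1%g) ^+ 2 = r ^+ 2 by rewrite -er; ring.
case: hA' => [[v [c' [r' [N E]]]]|[v [c' [r' [N E]]]]|//]; exfalso;
have [_ _ _ [Hv n1 n2] _] := N; rewrite uhpE in Hv; move: er'; rewrite E.
 by move: n1; rewrite /nz; nra.
by move: n2; rewrite /nz; nra.
Qed.

Lemma CU_union A c r e h A' : CU A c r e -> pr c r e h A' ->
 Tri c e = [set z | uhp z /\ (A z \/ A' (mobC h z))].
Proof.
move=> U P; have U' := CU_pr U P; have [H er EA] := U; have [H' _ EA'] := U'.
have [r0 ce _ _ _] := H; have [Gh c0 Ec Er _] := P.
(* The paired precell in the coordinates of [z]: the inversion exchanges outside and inside of the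
   circle and turns the column condition into one relating [re z] and [nz c z]. *)
have hz z : uhp z -> A' (mobC h z) <->
  nz c z <= r ^+ 2 /\ between 0 ((e - c) * nz c z) (r ^+ 2 * (re z - c)).
 move=> Hz; rewrite EA'; have n0 := nz_gt0 c Hz.
 have E1 : re (mobC h z) = ctr h^-1%g - r ^+ 2 * (re z - c) / nz c z by rewrite re_mob // Ec Er.
 have E2 : (r ^+ 2 <= nz (ctr h^-1%g) (mobC h z)) = (nz c z <= r ^+ 2).
  rewrite nz_mob // Ec Er ler_pdivlMr // (_ : r ^+ 4 = r ^+ 2 * r ^+ 2); last by ring.
  by rewrite ler_pM2l // exprn_gt0.
 have E3 : between (ctr h^-1%g) (ctr h^-1%g + c - e) (re (mobC h z)) =
   between 0 ((e - c) * nz c z) (r ^+ 2 * (re z - c)).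
  rewrite E1 /between; move: (ctr _) => d.
  have -> : r ^+ 2 * (re z - c) = (r ^+ 2 * (re z - c) / nz c z) * nz c z by rewrite divfK ?gt_eqF.
  move: (r ^+ 2 * (re z - c) / nz c z) => m; rewrite mulfK ?gt_eqF //.
  rewrite pmulr_lge0 // pmulr_lle0 // !ler_pM2r //.
  by apply/idP/idP; lra.
 split; first by case=> _; rewrite E2 E3.
 by case=> ? ?; split; rewrite ?E2 ?E3 //; exact: mobC_uhp.
apply/seteqP; split=> z.
 case=> Hz b q; split=> //; rewrite (hz z Hz) EA; move: b q; rewrite uhpE in Hz.
 have [n|n] := leP (r ^+ 2) (nz c z); first by move=> b _; left; split.
 move=> b q; right; split; first exact: ltW.
 move: b q; rewrite /between /nz; move: (re z) (im z) Hz => x y y0 b q.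
 have k1 : (e - c) * ((x - c) ^+ 2 + y ^+ 2) * (e - c) = r ^+ 2 * ((x - c) ^+ 2 + y ^+ 2).
  by rewrite -er; ring.
 have [lt|gt|//] := ltgtP c e.
  apply/orP; left; apply/andP; split; first by apply: mulr_ge0; [exact: sqr_ge0|lra].
  nra.
 apply/orP; right; apply/andP; split; last by apply: mulr_ge0_le0; [exact: sqr_ge0|lra].
 nra.
case=> Hz; rewrite (hz z Hz) EA => K; split=> //.
 case: K => [[_ _ b //]|[n b]]; rewrite uhpE in Hz.
 move: n b; rewrite /between /nz; move: (re z) (im z) Hz => x y y0 n b.
 have [lt|gt|//] := ltgtP c e.
  have : 0 <= x - c.
   rewrite -(pmulr_rge0 _ (exprn_gt0 2 r0)); case/orP: b => /andP[b1 b2] //.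
   have : 0 <= (e - c) * ((x - c) ^+ 2 + y ^+ 2) by apply: mulr_ge0; [lra|apply: addr_ge0; exact: sqr_ge0].
   lra.
  by move=> x0; apply/orP; left; nra.
 have : x - c <= 0.
  rewrite -(pmulr_rle0 _ (exprn_gt0 2 r0)); case/orP: b => /andP[b1 b2] //.
  have : (e - c) * ((x - c) ^+ 2 + y ^+ 2) <= 0 by apply: mulr_le0_ge0; [lra|apply: addr_ge0; exact: sqr_ge0].
  lra.
 by move=> x0; apply/orP; right; nra.
suff : (e - c) * (re z - c) <= nz c z by rewrite /nz; lra.
case: K => [[_ n b]|[n b]].
 by apply: le_trans n; rewrite -er; move: b; rewrite /between; move: (re z) => x; nra.
have n0 := nz_gt0 c Hz; move: b; rewrite -er /between; move: (nz c z) n0 (re z) => m m0 x b.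
have [lt|gt|//] := ltgtP c e.
 suff : (e - c) * ((e - c) * (x - c)) <= (e - c) * m by rewrite ler_pM2l ?subr_gt0.
 have : 0 < (e - c) * m by nra.
 by move: b; lra.
suff : (e - c) * m <= (e - c) * ((e - c) * (x - c)) by rewrite ler_nM2l ?subr_lt0.
have : (e - c) * m < 0 by nra.
by move: b; lra.
Qed.

Lemma Tri_image A c r e h A' : AA A -> CU A c r e -> pr c r e h A' ->
 mobC h @` Tri c e = Tri (ctr h^-1%g) (ctr h^-1%g + c - e).
Proof.
move=> AAA U P; have U' := CU_pr U P; have [Gh c0 Ec Er [AAA' hA']] := P.
have P' : pr (ctr h^-1%g) r (ctr h^-1%g + c - e) h^-1%g A.
 split; rewrite ?ecV0 ?radV ?invgK //; first exact: GamV.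
 split=> //; rewrite Ec (_ : c + ctr h^-1%g - _ = e); last by ring.
 by constructor 3.
rewrite (CU_union U P) (CU_union U' P'); apply/seteqP; split=> z.
 by case=> w [Hw Aw] <-; split; [exact: mobC_uhp|rewrite mobCK //; case: Aw; [right|left]].
case=> Hz K; exists (mobC h^-1%g z); last by rewrite mobCKV.
by split; [exact: mobC_uhp|rewrite mobCKV //; case: K; [right|left]].
Qed.

Lemma CU_precell A c r e : AA A -> CU A c r e -> cuspidal_precell Gam A (Some (pt e 0)) (pt c r).
Proof.
move=> AAA U; have h1 : half_of A c r e by constructor 3.
have [z [_ b _ Az]] := half_pt h1.
case: (pAA AAA) => [[v [s1 [s2 N0]]]|[v [s U0]]|[x [y S]]].
- have [d1 [q1 [d2 [q2 [N _]]]]] := noncuspidal_NC N0.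
 by case: (CU_NC U N).
- have [d1 [q1 [e1 [U1 E1 E2]]]] := cuspidal_CU U0.
 by have [-> -> ->] := half_mem_CU (half_of_HALF h1) b Az U1; rewrite -E1 -E2.
- by case: (half_mem_strip (half_of_HALF h1) b Az S).
Qed.

Lemma cuspidal_cycleP A c r e h p A' cc : CU A c r e ->
 cuspidal_cycle Gam AA A h p A' cc <->
 [/\ AA A, pr c r e h A', p = Some (pt e 0) & cc = [:: (A, h); (A', h^-1%g)]].
Proof.
move=> U; have hA : half_of A c r e by constructor 3.
have [H er EA] := U; have [r0 ce _ _ _] := H.
have [z [_ b _ Az]] := half_pt hA.
have E0 : seg (Some (pt c r)) (Some (pt e 0)) = arc c r e by rewrite seg_arc // expr0n addr0.
split.
 case=> AAA [s U0 ps] ->.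
 have [d1 [q1 [e1 [U1 E1 E2]]]] := cuspidal_CU U0.
 have [F1 F2 F3] := half_mem_CU (half_of_HALF hA) b Az U1; subst d1 q1 e1.
 by split=> //; apply/(paired_sideP _ _ hA); rewrite -E0 -E2 -E1.
case=> AAA P -> ->; split=> //; exists (pt c r); first exact: CU_precell.
by rewrite E0; exact/(paired_sideP _ _ hA).
Qed.

Lemma cell_CU A c r e B : AA A -> CU A c r e -> is_cell A B <-> B = Tri c e.
Proof.
move=> AAA U; have hA : half_of A c r e by constructor 3.
have un h A' : pr c r e h A' -> \bigcup_(j < size [:: (A, h); (A', h^-1%g)])
  (mobC (cycle_elt [:: (A, h); (A', h^-1%g)] j)^-1%g @` (cycle_term [:: (A, h); (A', h^-1%g)] j).1) = Tri c e.
 move=> P; have [_ _ _ _ [AAA' _]] := P; rewrite (CU_union U P); apply/seteqP; split=> z.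
  case=> -[|[|j]] //= _; rewrite /cycle_elt /cycle_term /=.
   case=> w Aw; rewrite invg1 mobC1 => <-; split; last by left.
   exact: uA Aw.
  case=> w Aw; rewrite mulg1 => <-; have Hw := uA AAA' Aw.
  by split; [exact: mobC_uhp|right; rewrite mobCKV].
 case=> Hz [Az|Az].
  by exists 0%N => //; rewrite /cycle_elt /cycle_term /= invg1; exists z => //; rewrite mobC1.
 exists 1%N => //; rewrite /cycle_elt /cycle_term /= mulg1; exists (mobC h z) => //.
 by rewrite mobCK.
split.
 case=> h [cc [cyc ->]]; case: cyc => [[x [y [_ S _ _]]]|[p [A' cyc]]|nc].
 - by case: (CU_stripF U S).
 - by have [_ P _ ->] := proj1 (cuspidal_cycleP h p A' cc U) cyc; exact: un.
 - have [b' [v' [k [_ [c1 [r1 [c2 [r2 N]]]] per _ Ec]]]] := ncycleP nc.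
  by case: (CU_NC U N).
move=> ->; have [h [A' P]] := pr_ex (half_of_HALF hA).
exists h, [:: (A, h); (A', h^-1%g)]; split; last by rewrite un.
by constructor 2; exists (Some (pt e 0)), A'; apply/(cuspidal_cycleP _ _ _ _ U).
Qed.

Lemma cell_strip A x y B : AA A -> strip_precell Gam A x y -> is_cell A B <-> B = A.
Proof.
move=> AAA S.
have un : \bigcup_(j < size [:: (A, 1%g : G)])
  (mobC (cycle_elt [:: (A, 1%g : G)] j)^-1%g @` (cycle_term [:: (A, 1%g : G)] j).1) = A.
 apply/seteqP; split=> z.
  case=> -[|j] //= _; rewrite /cycle_elt /cycle_term /= invg1.
  by case=> w Aw; rewrite mobC1 => <-.
 by move=> Az; exists 0%N => //; rewrite /cycle_elt /cycle_term /= invg1; exists z => //; rewrite mobC1.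
split.
 case=> h [cc [cyc ->]]; case: cyc => [[x' [y' [_ _ -> ->]]]|[p [A' [_ [s U0 _] _]]]|nc]; first exact: un.
  have [d1 [q1 [e1 [U1 _ _]]]] := cuspidal_CU U0.
  by case: (CU_stripF U1 S).
 have [b' [v' [k [_ a per _ Ec]]]] := ncycleP nc.
 by case: (NC_stripF a S).
move=> ->; exists 1%g, [:: (A, 1%g)]; split; last by rewrite un.
by constructor 1; exists x, y.
Qed.

Lemma mob_poly g (K : seq G) : mobC g @` poly K = poly [seq (g * k)%g | k <- K].
Proof.
apply/seteqP; split=> z.
 case=> w [Hw H] <-; split; first exact: mobC_uhp.
 by move=> _ /mapP[k kK ->]; rewrite side_ge0_mobC //; exact: H.
case=> Hz H; exists (mobC g^-1%g z); last by rewrite mobCKV.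
split; first exact: mobC_uhp.
move=> k kK; rewrite -(side_ge0_mobC g) ?mobCKV //; last exact: mobC_uhp.
by apply: H; apply/mapP; exists k.
Qed.

Lemma mob_ipoly g (K : seq G) z : uhp z ->
 ipoly [seq (g * k)%g | k <- K] (mobC g z) <-> ipoly K z.
Proof.
move=> Hz; split=> -[Hw H].
 by split=> // k kK; rewrite -(side_gt0_mobC g) //; apply: H; apply/mapP; exists k.
split; first exact: mobC_uhp.
by move=> _ /mapP[k kK ->]; rewrite side_gt0_mobC //; exact: H.
Qed.

Lemma Tri_poly a b : a < b -> Tri a b =
 poly [:: vert a; vert b * Sop; circ ((a + b) / 2) ((b - a) / 2) * Sop]%g.
Proof.
move=> ab; have r0 : 0 < (b - a) / 2 by lra.
have r20 : 0 < 2 * ((b - a) / 2) by lra.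
have E z : side_ (circ ((a + b) / 2) ((b - a) / 2) * Sop)%g z =
  ((re z - a) * (re z - b) + im z ^+ 2) / (2 * ((b - a) / 2)).
 by rewrite qfN side_circ // -mulNr; congr (_ / _); move: (re z) (im z) => x y; field.
apply/seteqP; split=> z.
 case=> Hz bz q; split=> // k; rewrite !inE => /or3P[]/eqP->.
 - by rewrite side_vert; move: bz; rewrite /between; lra.
 - by rewrite qfN side_vert; move: bz; rewrite /between; lra.
 - by rewrite E divr_ge0 // ltW.
case=> Hz H; have [i1 i2 i3] := in3 (vert a) (vert b * Sop)%g
 (circ ((a + b) / 2) ((b - a) / 2) * Sop)%g.
have := H _ i1; have := H _ i2; have := H _ i3.
rewrite E qfN !side_vert pmulr_lge0 ?invr_gt0 // => q b2 b1; split=> //.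
by rewrite /between; lra.
Qed.

Lemma TriC a b : Tri a b = Tri b a.
Proof.
by apply/seteqP; split=> z [Hz bz q]; split=> //; [move: bz; rewrite /between orbC|rewrite mulrC|
 move: bz; rewrite /between orbC|rewrite mulrC].
Qed.

Definition good_poly (K : seq G) : Prop := (exists z0, ipoly K z0) /\ forall k, k \in K -> line k `<=` poly K.

Lemma Tri_good a b : a < b ->
 good_poly [:: vert a; vert b * Sop; circ ((a + b) / 2) ((b - a) / 2) * Sop]%g.
Proof.
move=> ab; have r0 : 0 < (b - a) / 2 by lra.
have E (k : G) z : line k z -> uhp z /\ side_ k z = 0 by [].
split.
 exists (pt ((a + b) / 2) (b - a)); split; first by rewrite uhpE /= subr_gt0.
 move=> k; rewrite !inE => /or3P[]/eqP->; rewrite ?qfN ?side_vert ?re_pt; [lra|lra|].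
 by rewrite side_circ // -mulNr; apply: divr_gt0; [rewrite re_pt im_pt subrr; nra|lra].
move=> k; rewrite !inE => /or3P[]/eqP-> z; rewrite -Tri_poly //.
- case/E => Hz; rewrite side_vert => /eqP; rewrite subr_eq0 => /eqP Ex.
 split=> //; first by rewrite Ex /between; lra.
 nra.
- rewrite line_Sop => /E[Hz]; rewrite side_vert => /eqP; rewrite subr_eq0 => /eqP Ex.
 split=> //; first by rewrite Ex /between; lra.
 nra.
- rewrite line_Sop => /(line_circ _ _ r0)[Hz]; rewrite uhpE in Hz; rewrite /nz => n; split=> //.
  by rewrite /between; apply/orP; left; move: n; move: (re z) (im z) Hz => x y y0 n; nra.
 by move: n; move: (re z) (im z) => x y n; nra.
Qed.

Lemma strip_good a b : a < b -> good_poly [:: vert a; vert b * Sop]%g.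
Proof.
move=> ab; split.
 exists (pt ((a + b) / 2) 1); split; first by rewrite uhpE.
 by move=> k; rewrite !inE => /orP[]/eqP->; rewrite ?qfN side_vert re_pt; lra.
move=> k; rewrite !inE => /orP[]/eqP-> z; rewrite -strip_poly ?line_Sop => -[Hz];
 rewrite side_vert => /eqP; rewrite subr_eq0 => /eqP Ez; split=> //; rewrite Ez; lra.
Qed.

Lemma good_mob g (K : seq G) : good_poly K -> good_poly [seq (g * k)%g | k <- K].
Proof.
case=> -[z0 z0K] HK; split; first by exists (mobC g z0); apply/mob_ipoly => //; case: z0K.
move=> _ /mapP[k kK ->]; rewrite -line_mobC -mob_poly => _ [w kw <-].
by exists w => //; exact: HK kw.
Qed.

Lemma cell_good A B : AA A -> is_cell A B -> exists2 K, B = poly K & good_poly K.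
Proof.
move=> AAA cB; case: (precell_cases (pAA AAA)) => [[v a]|[c [r [e U]]]|[x [y S]]].
- have EB := proj1 (cell_NC B AAA a) cB; have [N per] := period_ex true AAA a.
 exists (NCK A v N); first by rewrite EB (NCtile_U AAA a per) (NCU_poly AAA a per).
 split; first by exists v; exact: NCK_v.
 exact: (NCK_lines AAA a per).
- have EB := proj1 (cell_CU B AAA U) cB; have [[_ ce _ _ _] _ _] := U.
 have [lt|gt|//] := ltgtP c e.
  by eexists; [rewrite EB; exact: Tri_poly|exact: Tri_good].
 by eexists; [rewrite EB TriC; exact: Tri_poly|exact: Tri_good].
- have EB := proj1 (cell_strip B AAA S) cB; have [xy _ _ EA _] := S.
 by eexists; [rewrite EB EA; exact: strip_poly|exact: strip_good].
Qed.

Lemma cell_ex A : AA A -> exists B, is_cell A B.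
Proof.
move=> AAA; case: (precell_cases (pAA AAA)) => [[v a]|[c [r [e U]]]|[x [y S]]].
- by eexists; apply/(cell_NC _ AAA a).
- by eexists; apply/(cell_CU _ AAA U).
- by eexists; apply/(cell_strip _ AAA S).
Qed.

Lemma cell_uniq A B B' : AA A -> is_cell A B -> is_cell A B' -> B = B'.
Proof.
move=> AAA cB cB'; case: (precell_cases (pAA AAA)) => [[v a]|[c [r [e U]]]|[x [y S]]].
- by rewrite (proj1 (cell_NC B AAA a) cB) (proj1 (cell_NC B' AAA a) cB').
- by rewrite (proj1 (cell_CU B AAA U) cB) (proj1 (cell_CU B' AAA U) cB').
- by rewrite (proj1 (cell_strip B AAA S) cB) (proj1 (cell_strip B' AAA S) cB').
Qed.

Lemma NCtile_mob g v : uhp v -> Gam g -> mobC g @` NCtile v = NCtile (mobC g v).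
Proof.
move=> Hv Gg; apply/seteqP; split=> z.
 case=> w [Hw [k [A' [Gk AAA' a' Aw]]]] <-; split; first exact: mobC_uhp.
 exists (k * g^-1)%g, A'; rewrite -!mobCM // mulgVK; split=> //.
 by apply: GamM => //; exact: GamV.
case=> Hz [k [A' [Gk AAA' a' Az]]]; exists (mobC g^-1%g z); last by rewrite mobCKV.
split; first exact: mobC_uhp.
exists (k * g)%g, A'; rewrite mobCM // mobCM ?mobCKV //; last exact: mobC_uhp.
by split=> //; exact: GamM.
Qed.

(** Seen from any of its points, a cell is a translate of the cell of the precell containing that
    point; all precells of a cycle have the same cell up to [Gam]. *)
Lemma cell_parts A B z : AA A -> is_cell A B -> B z -> exists g A' B',
 [/\ Gam g, AA A', is_cell A' B', A' (mobC g z) & B = mobC g^-1%g @` B'].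
Proof.
move=> AAA cB Bz.
have inv (X Y : set C) g : X `<=` uhp -> mobC g @` X = Y -> X = mobC g^-1%g @` Y.
 move=> Xu <-; apply/seteqP; split=> w; first by move=> Xw; exists (mobC g w); [exists w|rewrite mobCK //; exact: Xu].
 by case=> _ [u Xu' <-] <-; rewrite mobCK //; exact: Xu.
case: (precell_cases (pAA AAA)) => [[v a]|[c [r [e U]]]|[x [y S]]].
- have EB := proj1 (cell_NC B AAA a) cB; move: Bz; rewrite EB => -[Hz [g [A' [Gg AAA' a' Az]]]].
 exists g, A', (NCtile (mobC g v)); split=> //; first exact/(cell_NC _ AAA' a').
 apply: inv; first by move=> w [].
 by apply: NCtile_mob => //; exact: atv_uhp a.
- have EB := proj1 (cell_CU B AAA U) cB.
 have [h [A' P]] := pr_ex (let: And3 H _ _ := U in H).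
 have [Gh _ _ _ [AAA' _]] := P.
 move: Bz; rewrite EB (CU_union U P) => -[Hz [Az|Az]].
  exists 1%g, A, B; rewrite mobC1 invg1; split=> //; first exact: Gam1.
  rewrite -(CU_union U P) -EB; apply/seteqP; split=> w; first by exists w => //; rewrite mobC1.
  by case=> u Bu; rewrite mobC1 => <-.
 exists h, A', (Tri (ctr h^-1%g) (ctr h^-1%g + c - e)); split=> //.
  by apply/(cell_CU _ AAA' (CU_pr U P)).
 rewrite -(CU_union U P); apply: inv; first by move=> w [].
 exact: Tri_image AAA U P.
- have EB := proj1 (cell_strip B AAA S) cB.
 exists 1%g, A, B; rewrite mobC1 invg1; split=> //; [exact: Gam1|by rewrite -EB|].
 apply/seteqP; split=> w; first by exists w => //; rewrite mobC1.
 by case=> u Bu; rewrite mobC1 => <-.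
Qed.

Lemma cell_sub A B : AA A -> is_cell A B -> A `<=` B.
Proof.
move=> AAA cB z Az; have Hz := uA AAA Az.
case: (precell_cases (pAA AAA)) => [[v a]|[c [r [e U]]]|[x [y S]]].
- rewrite (proj1 (cell_NC B AAA a) cB); split=> //; exists 1%g, A; rewrite !mobC1; split=> //.
 exact: Gam1.
- have [h [A' P]] := pr_ex (let: And3 H _ _ := U in H).
 by rewrite (proj1 (cell_CU B AAA U) cB) (CU_union U P); split=> //; left.
- by rewrite (proj1 (cell_strip B AAA S) cB).
Qed.

Definition tile X : Prop := exists g A B, [/\ Gam g, AA A, is_cell A B & X = mobC g @` B].

Lemma tile_good X : tile X -> exists2 K, X = poly K & good_poly K.
Proof.
case=> g [A [B [Gg AAA cB ->]]]; have [K -> gK] := cell_good AAA cB.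
by exists [seq (g * k)%g | k <- K]; [exact: mob_poly|exact: good_mob].
Qed.

Lemma tile_uhp X : tile X -> X `<=` uhp.
Proof. by case/tile_good => K -> _; exact: poly_sub. Qed.

Lemma cell_uhp A B : AA A -> is_cell A B -> B `<=` uhp.
Proof. by move=> AAA cB; have [K -> _] := cell_good AAA cB; exact: poly_sub. Qed.

Lemma mob_img g h X : X `<=` uhp -> mobC g @` (mobC h @` X) = mobC (g * h)%g @` X.
Proof.
move=> Xu; apply/seteqP; split=> z.
 by case=> _ [w Xw <-] <-; exists w => //; rewrite mobCM //; exact: Xu.
by case=> w Xw <-; exists (mobC h w); [exists w|rewrite mobCM //; exact: Xu].
Qed.

Lemma tile_mob g X : Gam g -> tile X -> tile (mobC g @` X).
Proof.
move=> Gg [h [A [B [Gh AAA cB ->]]]]; exists (g * h)%g, A, B; split=> //; first exact: GamM.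
by rewrite mob_img //; exact: cell_uhp cB.
Qed.

Lemma tile_part X z : tile X -> X z -> exists g A B,
 [/\ Gam g, AA A, is_cell A B, A (mobC g z) & X = mobC g^-1%g @` B].
Proof.
case=> h [A [B [Gh AAA cB ->]]] [w Bw <-]; have Hw := cell_uhp AAA cB Bw.
have [g [A' [B' [Gg AAA' cB' Aw ->]]]] := cell_parts AAA cB Bw.
exists (g * h^-1)%g, A', B'; split=> //; first by apply: GamM => //; exact: GamV.
 by rewrite -mobCM // mulgVK.
by rewrite mob_img ?invgM ?invgK //; exact: cell_uhp cB'.
Qed.

Lemma tile_int X : tile X -> X^° !=set0.
Proof. by case/tile_good => K -> [[z0 z0K] _]; exists z0; rewrite interior_poly. Qed.

Lemma tile_dense X : tile X -> X `<=` closure (X^°).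
Proof. by case/tile_good => K -> [[z0 z0K] _]; rewrite interior_poly; exact: closure_ipoly z0K. Qed.

(** Overlapping tiles share an interior point of some translated precell. By [fund] this precell is
    a part of both, and it determines the tile. *)
Lemma tile_eq X X' z : tile X -> tile X' -> X^° z -> X' z -> X = X'.
Proof.
move=> tX tX' Xz X'z.
have [z1 [X'1 X1]] := tile_dense tX' X'z (near_open (@open_interior _ X) Xz).
have [g [A [B [Gg AAA cB Az EX]]]] := tile_part tX (interior_subset X1).
have H1 := tile_uhp tX (interior_subset X1).
have oI : open (X^° `&` X'^°) by apply: openI; exact: open_interior.
have nb : nbhs (mobC g z1) [set w | (X^° `&` X'^°) (mobC g^-1%g w)].
 have K : (X^° `&` X'^°) (mobC g^-1%g (mobC g z1)) by rewrite mobCK.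
 exact: (@near_mob (X^° `&` X'^°) g^-1%g (mobC g z1) oI (mobC_uhp g H1) K).
have [w [Aw [_ X'w]]] := precell_dense (pAA AAA) Az nb.
have Hw := uA AAA (interior_subset Aw).
have [g2 [A2 [B2 [Gg2 AAA2 cB2 Az2 EX']]]] := tile_part tX' (interior_subset X'w).
rewrite -mobCM // in Az2.
have [E EA] := fund AAA AAA2 (GamM Gg2 (GamV Gg)) Aw Az2.
have Eg : g2 = g by rewrite -[RHS]mul1g -E mulgVK.
subst A2; by rewrite EX EX' Eg (cell_uniq AAA cB cB2).
Qed.

Lemma tile_cover z : uhp z -> exists2 X, tile X & X z.
Proof.
move=> Hz; have [g [A [w [Gg AAA Aw Ew]]]] := cover Hz.
have [B cB] := cell_ex AAA; exists (mobC g @` B); first by exists g, A, B.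
by exists w => //; exact: cell_sub cB _ Aw.
Qed.

Lemma tile_side X K b : X = poly K -> good_poly K -> side X b <-> exists2 k, k \in K & b = line k.
Proof. by move=> -> [[z0 z0K] HK]; exact: side_poly HK b. Qed.

Lemma base_setP z : base_set Gam AA z <-> exists X b, [/\ tile X, side X b & b z].
Proof.
split.
 case=> g [A [B [b [Gg AAA cB sb [w bw <-]]]]].
 have [K EB gK] := cell_good AAA cB.
 have [k kK Eb] := proj1 (tile_side b EB gK) sb; have gK' := good_mob g gK.
 exists (mobC g @` B), (mobC g @` b); split; [by exists g, A, B| |by exists w].
 apply/(tile_side _ _ gK'); first by rewrite EB mob_poly.
 by exists (g * k)%g; [apply/mapP; exists k|rewrite Eb line_mobC].
case=> X [b [[g [A [B [Gg AAA cB EX]]]] sb bz]].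
have [K EB gK] := cell_good AAA cB; have gK' := good_mob g gK.
have E : X = poly [seq (g * k)%g | k <- K] by rewrite EX EB mob_poly.
have [_ /mapP[k kK ->] Eb] := proj1 (tile_side b E gK') sb.
exists g, A, B, (line k); split=> //; first by apply/(tile_side _ EB gK); exists k.
by rewrite line_mobC -Eb.
Qed.

End CellSets.

(** * Sides of the given convex region and half planes inside it *)

Section ConvexSides.
Implicit Types (g h k : G) (z w v u : C) (x y t r e c : R) (p q : sphere R) (V F b : set C).

Lemma open_int_eq (V : set C) : open V -> V^° = V.
Proof. by move/interior_id. Qed.

Lemma hconvex_mob g V : hconvex V -> hconvex (mobC g @` V).
Proof.
move=> cV; have Vu := cV.1; split; first by move=> _ [w /Vu Hw <-]; exact: mobC_uhp.
move=> _ _ [z Vz <-] [w Vw <-] u /(segP _ (mobC_uhp g (Vu _ Vz)) (mobC_uhp g (Vu _ Vw))).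
case=> h [s [t [r [Es Et srt <-]]]].
exists (gp (g^-1 * h)%g r); last by rewrite mobC_gp mulVKg.
apply: (hconvex_gp cV _ _ srt); rewrite -mobC_gp ?Es ?Et mobCK //; exact: Vu.
Qed.

Lemma circ_between V c r z w u : hconvex V -> 0 < r -> V z -> V w -> uhp u ->
 nz c z = r ^+ 2 -> nz c w = r ^+ 2 -> nz c u = r ^+ 2 -> between (re z) (re w) (re u) -> V u.
Proof.
move=> cV r0 Vz Vw Hu nz_z nz_w nz_u b.
have pp (a : C) : uhp a -> nz c a = r ^+ 2 -> exists t, gp (circ c r) t = a.
 by move=> Ha na; apply: lineP; apply/(line_circ _ _ r0).
have [t1 E1] := pp _ (cV.1 _ Vz) nz_z; have [t2 E2] := pp _ (cV.1 _ Vw) nz_w.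
have [t E] := pp _ Hu nz_u.
move: b; rewrite -E1 -E2 -E !gp_circ_re // /between !phi_le // !lee_fin => /orP[]b; rewrite -E1 in Vz; rewrite -E2 in Vw.
 exact: hconvex_gp cV Vz Vw b.
exact: hconvex_gp cV Vw Vz b.
Qed.

(** The arcs from the third point to the segment on the imaginary axis sweep out a triangle with
    nonempty interior. *)
Lemma triangle_interior V s t u : hconvex V -> s < t -> V (pt 0 (expR s)) -> V (pt 0 (expR t)) ->
 V u -> re u != 0 -> V^° !=set0.
Proof.
move=> cV st Vs Vt Vu u0; have Hu := cV.1 _ Vu; rewrite uhpE in Hu.
have ax y : expR s <= y <= expR t -> V (pt 0 y).
 move=> yst; have y0 : 0 < y by have := expR_gt0 s; lra.
 have g1 r : gp 1%g r = pt 0 (expR r) :> C by rewrite /gp mobC1.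
 rewrite -(lnK y0) -g1; apply: (hconvex_gp cV (s := s) (t := t)); rewrite ?g1 //.
 have Ey : expR (ln y) = y by rewrite lnK // posrE.
 by rewrite -(ler_expR s) -(ler_expR (ln y)) Ey.
move: (re u) (im u) u0 Hu (ptK u) => a b a0 b0 Eu; subst u.
have key x y : 0 < x * a -> x * a < a ^+ 2 -> 0 < y ->
  expR s ^+ 2 * (a ^+ 2 - a * x) < (y ^+ 2) * a ^+ 2 - a * x * b ^+ 2 - x * a * (a ^+ 2 - a * x) ->
  (y ^+ 2) * a ^+ 2 - a * x * b ^+ 2 - x * a * (a ^+ 2 - a * x) < expR t ^+ 2 * (a ^+ 2 - a * x) -> V (pt x y).
 move=> x0 x1 y0 k1 k2.
 have a20 : 0 < a ^+ 2 by lra.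
 have d0 : 0 < a ^+ 2 - a * x by lra.
 (* The squared height at which the geodesic through [(x, y)] and [(a, b)] meets the imaginary axis;
    [k1] and [k2] place it between the two given points. *)
 pose q := (y ^+ 2 * a ^+ 2 - a * x * b ^+ 2 - x * a * (a ^+ 2 - a * x)) / (a ^+ 2 - a * x).
 have q1 : expR s ^+ 2 < q by rewrite ltr_pdivlMr.
 have q2 : q < expR t ^+ 2 by rewrite ltr_pdivrMr.
 have q0 : 0 < q by nra; rewrite exprn_gt0 ?expR_gt0.
 pose m := Num.sqrt q; have m0 : 0 < m by rewrite sqrtr_gt0.
 have m2 : m ^+ 2 = q by rewrite sqr_sqrtr // ltW.
 have ms : expR s <= m <= expR t.
  by apply/andP; split; rewrite -ler_sqr ?nnegrE ?expR_ge0 ?(ltW m0) // m2 ltW.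
 pose c := (a ^+ 2 + b ^+ 2 - q) / (2 * a).
 pose r := Num.sqrt (c ^+ 2 + q).
 have cq0 : 0 < c ^+ 2 + q by nra.
 have r0 : 0 < r by rewrite sqrtr_gt0.
 have r2 : r ^+ 2 = c ^+ 2 + q by rewrite sqr_sqrtr // ltW.
 have ca : c * (2 * a) = a ^+ 2 + b ^+ 2 - q by rewrite divfK // mulf_neq0.
 apply: (@circ_between V c r _ _ _ cV r0 (ax _ ms) Vu) => //.
 - by rewrite /nz !re_pt !im_pt m2 r2; ring.
 - by rewrite /nz !re_pt !im_pt r2; lra.
 - rewrite /nz !re_pt !im_pt r2.
  have qd : q * (a ^+ 2 - a * x) = y ^+ 2 * a ^+ 2 - a * x * b ^+ 2 - x * a * (a ^+ 2 - a * x).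
   by rewrite divfK // gt_eqF.
  have : a ^+ 2 * (x ^+ 2 - 2 * c * x + y ^+ 2 - q) = 0.
   have -> : a ^+ 2 * (x ^+ 2 - 2 * c * x + y ^+ 2 - q) =
    a ^+ 2 * x ^+ 2 - (c * (2 * a)) * a * x + a ^+ 2 * y ^+ 2 - q * (a ^+ 2 - a * x) - q * a * x by ring.
   by rewrite ca qd; ring.
  by move/eqP; rewrite mulf_eq0 (gt_eqF a20) /= => /eqP; lra.
 - by rewrite !re_pt /between; have [?|?|E] := ltgtP a 0; [apply/orP; right; nra|apply/orP; left; nra|rewrite E eqxx in a0].
have a20 : 0 < a ^+ 2 by nra.
pose M := (expR s ^+ 2 + expR t ^+ 2) / 2.
have Ms : expR s ^+ 2 < M < expR t ^+ 2 by have := expR2_lt s t; rewrite st /M; lra.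
have Mp : 0 < M by nra; lra.
(* The height over [a / 2] for which [q] becomes the mean [M] of the squared heights of the two
   points on the axis. *)
pose y0 := Num.sqrt (M / 2 + b ^+ 2 / 2 + a ^+ 2 / 4).
have y02 : y0 ^+ 2 = M / 2 + b ^+ 2 / 2 + a ^+ 2 / 4.
 by rewrite sqr_sqrtr //; have := sqr_ge0 b; lra.
have y0p : 0 < y0 by rewrite sqrtr_gt0; have := sqr_ge0 b; lra.
pose f0 (z : C) := re z * a; pose f1 (z : C) := a ^+ 2 - re z * a.
pose f2 (z : C) := (im z ^+ 2) * a ^+ 2 - a * re z * b ^+ 2 - re z * a * (a ^+ 2 - a * re z).
pose f3 (z : C) := f2 z - expR s ^+ 2 * (a ^+ 2 - a * re z).
pose f4 (z : C) := expR t ^+ 2 * (a ^+ 2 - a * re z) - f2 z.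
have c0 : continuous f0 by apply: (@cts_reim _ (fun x y => x * a)) => *; do ?[assumption|exact: cvg_cst|exact: cvg_sqr|apply: cvgB|apply: cvgM].
have c1 : continuous f1 by apply: (@cts_reim _ (fun x y => a ^+ 2 - x * a)) => *; do ?[assumption|exact: cvg_cst|exact: cvg_sqr|apply: cvgB|apply: cvgM].
have c3 : continuous f3.
 apply: (@cts_reim _ (fun x y => y ^+ 2 * a ^+ 2 - a * x * b ^+ 2 - x * a * (a ^+ 2 - a * x)
  - expR s ^+ 2 * (a ^+ 2 - a * x))) => *; do ?[assumption|exact: cvg_cst|exact: cvg_sqr|apply: cvgB|apply: cvgM].
have c4 : continuous f4.
 apply: (@cts_reim _ (fun x y => expR t ^+ 2 * (a ^+ 2 - a * x) -
  (y ^+ 2 * a ^+ 2 - a * x * b ^+ 2 - x * a * (a ^+ 2 - a * x)))) => *; do ?[assumption|exact: cvg_cst|exact: cvg_sqr|apply: cvgB|apply: cvgM].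
pose W : set C := [set z | 0 < f0 z] `&` ([set z | 0 < f1 z] `&` ([set z | 0 < f3 z] `&`
 ([set z | 0 < f4 z] `&` @uhp R))).
have oW : open W by do !(apply: openI; first exact: open_gt0); exact: open_uhp.
exists (pt (a / 2) y0); apply: (@interiorS _ W) => [z [w0 [w1 [w3 [w4 w5]]]]|].
 rewrite -(ptK z); apply: key => //.
 - by move: w1; rewrite /= /f1; lra.
 - by move: w3; rewrite /= /f3 /f2; lra.
 - by move: w4; rewrite /= /f4 /f2; lra.
rewrite (open_int_eq oW); split; [|split; [|split; [|split]]]; rewrite /= ?uhpE //.
- by rewrite /f0 re_pt; lra.
- by rewrite /f1 re_pt; lra.
- by rewrite /f3 /f2 re_pt im_pt y02; nra.
- by rewrite /f4 /f2 re_pt im_pt y02; nra.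
Qed.

Lemma noncollinear V k z w u : hconvex V -> V z -> V w -> V u -> z <> w -> line k z -> line k w ->
 side_ k u <> 0 -> V^° !=set0.
Proof.
move=> cV Vz Vw Vu zw /lineP[s Ez] /lineP[t Et] ku.
have cV' := hconvex_mob k^-1%g cV.
have m r : mobC k^-1%g (gp k r) = pt 0 (expR r) by rewrite mobC_gp mulVg /gp mobC1.
have V1 : (mobC k^-1%g @` V) (pt 0 (expR s)) by exists z => //; rewrite -Ez m.
have V2 : (mobC k^-1%g @` V) (pt 0 (expR t)) by exists w => //; rewrite -Et m.
have V3 : (mobC k^-1%g @` V) (mobC k^-1%g u) by exists u.
have r0 : re (mobC k^-1%g u) != 0.
 have Hu := cV.1 _ Vu; apply/eqP => E; apply: ku; rewrite /side_.
 have := qfM 1%g k^-1%g Hu; rewrite mul1g => ->; by rewrite qf1 E mul0r.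
have [st|st|st] := ltgtP s t; last by case: zw; rewrite -Ez -Et st.
 have [x] := triangle_interior cV' st V1 V2 V3 r0; rewrite interior_mobC; last exact: cV.1.
 by case=> y Vy _; exists y.
have [x] := triangle_interior cV' st V2 V1 V3 r0; rewrite interior_mobC; last exact: cV.1.
by case=> y Vy _; exists y.
Qed.

(** A subset of the boundary of an open set has empty interior, so by [noncollinear] a convex one
    cannot contain three non-collinear points. *)
Lemma side_line F b : open F -> b `<=` boundaryH F -> hconvex b -> b !=set0 -> exists k, b `<=` line k.
Proof.
move=> oF sub cb [z bz]; have noint : ~ (b^° !=set0).
 case=> x xb; have [[clx _] _] := sub _ (interior_subset xb).
 have [y [Fy yb]] := clx _ (near_open (@open_interior _ b) xb).
 by have [_] := sub _ (interior_subset yb); rewrite (open_int_eq oF).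
have [[w [bw zw]]|N] := pselect (exists w, b w /\ z <> w).
 have [k [s [t [Es Et _]]]] := join_ex (cb.1 _ bz) (cb.1 _ bw).
 have kz : line k z by rewrite -Es; exact: gp_line.
 have kw : line k w by rewrite -Et; exact: gp_line.
 exists k => u bu; split; first exact: cb.1 bu.
 apply: contrapT => ku; apply: noint; exact: noncollinear cb bz bw bu zw kz kw ku.
have [k [s [t [Es _ _]]]] := join_ex (cb.1 _ bz) (cb.1 _ bz).
exists k => u bu; have -> : u = z by apply: contrapT => uz; apply: N; exists u; split=> // /esym.
by rewrite -Es; exact: gp_line.
Qed.

Lemma hconvex1 z : uhp z -> hconvex [set z].
Proof.
move=> Hz; split=> [_ -> //|_ _ -> -> u /(segP _ Hz Hz)[h [s [t [r [Es Et srt <-]]]]]].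
have st : s = t by apply: (@gp_inj _ h); rewrite Es Et.
by rewrite /= -Es; congr gp; apply/le_anti; move: srt; rewrite st andbC.
Qed.

(** Sides are maximal convex subsets of the boundary, so Zorn's lemma applies. Only nonempty sets
    are asked to contain [z], because the union of the empty chain is empty. *)
Lemma side_through F z : boundaryH F z -> exists2 b, side F b & b z.
Proof.
move=> Fz; have Hz : uhp z by case: Fz => -[].
pose P b := [/\ hconvex b, b `<=` boundaryH F & b !=set0 -> b z].
have [|A [[cA sA Az] maxA]] := @Zorn_bigcup C P.
 move=> S SP tot; split.
 - split=> [u [X SX Xu]|u w [X SX Xu] [Y SY Yw]].
   by have [cX _ _] := SP _ SX; exact: cX.1 Xu.
  have [cX _ _] := SP _ SX; have [cY _ _] := SP _ SY.
  case: (tot _ _ SX SY) => sub a sa.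
   by exists Y => //; apply: (cY.2 u w) => //; exact: sub.
  by exists X => //; apply: (cX.2 u w) => //; exact: sub.
 - by move=> u [X SX Xu]; have [_ sX _] := SP _ SX; exact: sX.
 - by case=> u [X SX Xu]; have [_ _ Xz] := SP _ SX; exists X => //; apply: Xz; exists u.
have A0 : A z.
 apply: contrapT => nAz; have EA : A = set0.
  by apply/seteqP; split=> // u Au; apply: nAz; apply: Az; exists u.
 apply: (maxA [set z]); last by split; [exact: hconvex1|by move=> _ ->|].
 by rewrite EA; split=> // H; apply: (H z).
exists A => //; split=> //; first by exists z.
move=> b' cb' Ab' sb'; apply/seteqP; split=> //; apply: contrapT => N.
apply: (maxA b') => //; split=> // _; exact: Ab'.
Qed.

Lemma boundary_lines F : open F -> finite_set (side F) ->
 exists L : seq G, forall z, boundaryH F z -> exists2 k, k \in L & line k z.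
Proof.
move=> oF fin; pose f b := xget (1%g : G) [set k | b `<=` line k].
have /finite_seqP[L EL] := finite_image f fin.
exists L => z /side_through[b sb bz]; have [b0 sub cb _] := sb.
have [k bk] := side_line oF sub cb b0.
exists (f b); last exact: (xgetPex 1%g (ex_intro [set k | b `<=` line k] k bk)).
by have : [set` L] (f b) by rewrite -EL; exists b.
Qed.

Lemma hpl_dichotomy F k z : open F -> (forall u, hpl k u -> ~ boundaryH F u) ->
 hpl k z -> closureH F z -> hpl k `<=` F.
Proof.
move=> oF av kz Fz w kw.
have cl u : hpl k u -> closureH F u -> F u.
 move=> ku Fu; apply: contrapT => nF; apply: (av u ku); split=> //.
 by rewrite (open_int_eq oF).
have [h [s [t [H st]]]] : exists h s t, ((gp h s = z /\ gp h t = w)) /\ s <= t.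
 by have [h [s [t [? ? ?]]]] := join_ex kz.1 kw.1; exists h, s, t.
have inK r : s <= r <= t -> hpl k (gp h r).
 by move=> srt; apply: (hconvex_gp (hconvex_hpl k) _ _ srt); rewrite ?H.1 ?H.2.
rewrite -H.2; apply: (@real_clopen (fun r => F (gp h r)) s t) => //; first by rewrite H.1; exact: cl.
 move=> r srt rF; have /(@nbhs_ballP R) [e /= e0 eU] : nbhs r [set r' | F (gp h r')] :=
  @cts_gp R h r _ (near_open oF rF).
 by exists e => // r' _ rr'; apply: eU; rewrite -ball_normE /= distrC.
move=> r srt Hr; apply: cl; first exact: inK.
split; last exact: gp_uhp.
move=> U /(@cts_gp R h r) /(@nbhs_ballP R) [e /= e0 eU].
have [r' [_ rr' rF]] := Hr _ e0; exists (gp h r'); split=> //.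
by apply: (eU r'); rewrite -ball_normE /= distrC.
Qed.

Lemma side_lead k z : side_ k z = lead k * (re z ^+ 2 + im z ^+ 2) +
 (side_ k (pt 1 0) - side_ k (pt 0 0) - lead k) * re z + side_ k (pt 0 0).
Proof. by rewrite leadE /side_ /qf !re_pt !im_pt; ring. Qed.

(* A half plane inside a fundamental region is bounded away from the cusp, and
  hence from every translate of the cusp. *)
Lemma free_lead F k (tau : R) g : fundamental_region Gam F -> hpl k `<=` F ->
 0 < tau -> Gam (vert tau) -> Gam g -> lead (g * k)%g <= 0.
Proof.
move=> [_ _ dis _] kF t0 Gt Gg; rewrite leNgt; apply/negP => l0.
set m := (g * k)%g in l0.
pose B := side_ m (pt 1 0) - side_ m (pt 0 0) - lead m.
pose D := side_ m (pt 0 0).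
(* Were the leading coefficient positive, a horizontal segment of length [tau] at this height would
   lie in the half plane. Its two ends are identified by [Gam], although both come from [F]. *)
pose y := 1 + (`|B| * tau + `|D|) / lead m.
have N1 := normr_ge0 B.
have Q0 : 0 <= (`|B| * tau + `|D|) / lead m by rewrite divr_ge0 ?(ltW l0) // addr_ge0 // mulr_ge0 // ltW.
have y1 : 1 <= y by rewrite /y lerDl.
have yl : lead m * y = lead m + `|B| * tau + `|D| by rewrite /y; field; rewrite gt_eqF.
have pos x : 0 <= x <= tau -> hpl m (pt x y).
 move=> xt; split; first by rewrite uhpE /=; lra.
 rewrite side_lead -/B -/D re_pt im_pt.
 have b1 : - (`|B| * tau) <= B * x.
  have := ler_norm (- B); rewrite normrN => nB; nra.
 have b2 : - `|D| <= D by have := ler_norm (- D); rewrite normrN; lra.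
 have b3 : lead m * y <= lead m * y ^+ 2 by rewrite ler_pM2l // expr2; nra.
 have b4 : 0 <= lead m * x ^+ 2 by nra.
 lra.
have back x : 0 <= x <= tau -> F (mobC g^-1%g (pt x y)).
 move=> /pos Hp; apply: kF; have : mobC g @` hpl k = hpl m by exact: hpl_mobC.
 move=> E; move: Hp; rewrite -E => -[w kw <-]; by rewrite mobCK //; case: kw.
have Hx0 : uhp (pt 0 y) by rewrite uhpE /=; lra.
have F0 := back 0 _; have F1 := back tau _.
have G1 : Gam (g^-1 * vert tau * g)%g by apply: GamM => //; apply: GamM => //; exact: GamV.
have ne : (g^-1 * vert tau * g)%g <> 1%g.
 move=> E; have : vert tau = 1%g :> G.
  by rewrite -[vert tau](mulVKg g) -[(g^-1 * _)%g](mulgK g) E mul1g mulgV.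
 by rewrite -vert0 => /vert_inj; lra.
have := dis _ _ G1 Gam1 ne; apply/eqP/set0P; exists (mobC g^-1%g (pt tau y)); split.
 exists (mobC g^-1%g (pt 0 y)); first by apply: F0; rewrite lexx ltW.
 rewrite -mobCM // mulgK mobCM // vert_mob re_pt im_pt add0r //.
by exists (mobC g^-1%g (pt tau y)); [apply: F1; rewrite lexx ltW|exact: mobC1].
Qed.

Definition cusp_pt c : Prop := exists g, [/\ Gam g, ec g != 0 & ea g / ec g = c].

(** By [free_lead] the equation of the pulled back half plane is at most 0 at [c1], [c2] and
    infinity, hence on the ideal triangle they span; the identity [K] below writes its value at [z]
    as a combination with nonnegative weights. *)
Lemma free_hull F k (tau : R) c1 c2 z g : fundamental_region Gam F ->
 hpl k `<=` F -> 0 < tau -> Gam (vert tau) -> cusp_pt c1 -> cusp_pt c2 -> Gam g ->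
 uhp z -> c1 < re z < c2 -> (re z - c1) * (c2 - re z) <= im z ^+ 2 -> ~ hpl k (mobC g z).
Proof.
move=> fF kF t0 Gt [g1 [G1 e1 E1]] [g2 [G2 e2 E2]] Gg Hz zc zy kz.
pose m := (g^-1 * k)%g.
have mz : 0 < side_ m z.
 by rewrite -(side_gt0_mobC g) // /m mulVKg; case: kz.
have Ld h : Gam h -> lead (h * m)%g <= 0.
 by move=> Gh; rewrite /m mulgA; apply: (free_lead fF kF t0 Gt); apply: GamM => //; exact: GamV.
have L0 : lead m <= 0 by have := Ld _ Gam1; rewrite mul1g.
have end_ h c : Gam h -> ec h != 0 -> ea h / ec h = c -> side_ m (pt c 0) <= 0.
 move=> Gh eh Eh; have := Ld _ (GamV Gh).
 rewrite /lead invgM invgK al_side (negbTE eh) Eh pmulr_rle0 // exprn_even_gt0 //.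
have s1 := end_ _ _ G1 e1 E1; have s2 := end_ _ _ G2 e2 E2.
rewrite (side_lead m z) in mz; rewrite (side_lead m (pt c1 0)) re_pt im_pt in s1.
rewrite (side_lead m (pt c2 0)) re_pt im_pt in s2; move: mz s1 s2.
move: (side_ m (pt 1 0) - side_ m (pt 0 0) - lead m) => b; move: (side_ m (pt 0 0)) => d.
move: (lead m) L0 (re z) (im z) zc zy => a a0 x y xc yx mz s1 s2.
have : 0 < (c2 - c1) * (a * (x ^+ 2 + y ^+ 2) + b * x + d) by nra; lra.
have K : (c2 - c1) * (a * (x ^+ 2 + y ^+ 2) + b * x + d) =
 (c2 - x) * (a * (c1 ^+ 2 + 0 ^+ 2) + b * c1 + d) + (x - c1) * (a * (c2 ^+ 2 + 0 ^+ 2) + b * c2 + d)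
 + (c2 - c1) * a * (y ^+ 2 - (x - c1) * (c2 - x)) by ring.
rewrite K; have : (c2 - x) * (a * (c1 ^+ 2 + 0 ^+ 2) + b * c1 + d) <= 0 by nra; lra.
have : (x - c1) * (a * (c2 ^+ 2 + 0 ^+ 2) + b * c2 + d) <= 0 by nra; lra.
have : (c2 - c1) * a * (y ^+ 2 - (x - c1) * (c2 - x)) <= 0.
 by apply: mulr_le0_ge0; [apply: mulr_ge0_le0 => //; lra|lra].
lra.
Qed.

End ConvexSides.

(** The rectangle [[1/4, 3/4] x [4, 5]] has area 1/2; countable subadditivity of planar Lebesgue
    measure bounds this by the total area of the squares of half side [s l], [m] for each [l]. *)
Lemma cover_area (m : nat) (s : nat -> R) (a b : nat -> nat -> R) (K : R) :
 (forall l, 0 <= s l) ->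
 (forall x y, 1 / 4 <= x <= 3 / 4 -> 4 <= y <= 5 -> exists l i,
   [/\ (i < m)%N, `|x - a l i| <= s l & `|y - b l i| <= s l]) ->
 (forall N, \sum_(0 <= l < N) m%:R * (4 * s l ^+ 2) <= K) -> 1 / 2 <= K.
Proof.
move=> s0 cov bd.
pose mu := (@lebesgue_measure R \x @lebesgue_measure R)%E.
pose box l i := ([set` `[a l i - s l, a l i + s l]%R] : set (measurableTypeR R)) `*`
 ([set` `[b l i - s l, b l i + s l]%R] : set (measurableTypeR R)).
pose X l := \big[setU/set0]_(i < m) box l i.
pose E0 := ([set` `[1 / 4, 3 / 4]%R] : set (measurableTypeR R)) `*`
 ([set` `[4, 5]%R] : set (measurableTypeR R)).
have mbox l i : measurable (box l i) by apply: measurableX; exact: measurable_itv.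
have mX l : measurable (X l) by apply: bigsetU_measurable => i _; exact: mbox.
have mE0 : measurable E0 by apply: measurableX; exact: measurable_itv.
have sub : E0 `<=` \bigcup_l X l.
 move=> [x y] [/= xE yE]; rewrite !in_itv /= in xE yE.
 have [l [i [im h1 h2]]] := cov x y xE yE.
 exists l => //; rewrite /X -bigcup_mkord; exists i => //.
 by move: h1 h2; rewrite !ler_norml => h1 h2; split; rewrite /= in_itv /=; lra.
have muE0 : mu E0 = (1 / 2)%:E.
 rewrite /mu product_measure1E; [|exact: measurable_itv|exact: measurable_itv].
 rewrite [X in (X * _)%E]lebesgue_measure_itv [X in (_ * X)%E]lebesgue_measure_itv /= !lte_fin.
 have -> : (1 / 4 : R) < 3 / 4 by lra.
 have -> : (4 : R) < 5 by lra.
 by rewrite -!EFinB -EFinM; congr EFin; lra.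
have mubox l i : (mu (box l i) <= (4 * s l ^+ 2)%:E)%E.
 rewrite /mu product_measure1E; [|exact: measurable_itv|exact: measurable_itv].
 rewrite [X in (X * _)%E]lebesgue_measure_itv [X in (_ * X)%E]lebesgue_measure_itv /= !lte_fin.
 have [s00|s00] := eqVneq (s l) 0.
  by rewrite s00 !subr0 !addr0 !ltxx mule0 lee_fin expr0n mulr0.
 have sp : 0 < s l by rewrite lt_neqAle eq_sym s00 s0.
 have -> : a l i - s l < a l i + s l by lra.
 have -> : b l i - s l < b l i + s l by lra.
 rewrite -!EFinB -EFinM lee_fin le_eqVlt; apply/orP; left; apply/eqP; ring.
have muX l : (mu (X l) <= (m%:R * (4 * s l ^+ 2))%:E)%E.
 apply: le_trans (Boole_inequality _ _) _; first by move=> i _; exact: mbox.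
 apply: (@le_trans _ _ (\sum_(i < m) (4 * s l ^+ 2)%:E)%E); first by apply: lee_sum => i _; exact: mubox.
 rewrite sumEFin lee_fin sumr_const card_ord.
 lra.
have le1 : (mu E0 <= \sum_(0 <= n <oo) mu (X n))%E.
 exact: (measure_sigma_subadditive mu mX mE0 sub).
rewrite muE0 in le1.
suff : (\big[+%E/0%R]_(0 <= n <oo) mu (X n) <= K%:E)%E.
 by move=> /(le_trans le1); rewrite lee_fin.
apply: lime_le; first by apply: is_cvg_nneseries => n _ _; exact: measure_ge0.
apply: nearW => N; apply: le_trans (_ : (\sum_(0 <= l < N) (m%:R * (4 * s l ^+ 2))%:E <= _)%E).
 by apply: lee_sum => l _; exact: muX.
by rewrite sumEFin lee_fin.
Qed.

(** * Ideal triangles, cusp regions and an invariant of pairs of points *)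

Section Cusps.
Implicit Types (g h k l : G) (z w v u : C) (x y t r e c d p q : R).

Lemma mob_mk4 (a b c d : R) z : a * d - b * c = 1 -> uhp z ->
 mobC (mk4 a b c d) z = pt ((a * c * (re z ^+ 2 + im z ^+ 2) + (a * d + b * c) * re z + b * d)
   / ((c * re z + d) ^+ 2 + (c * im z) ^+ 2)) (im z / ((c * re z + d) ^+ 2 + (c * im z) ^+ 2)).
Proof.
move=> dt Hz; have [s [s2 Ha Hb Hc Hd]] := mk4E dt.
have Ed : den (mk4 a b c d) z = (c * re z + d) ^+ 2 + (c * im z) ^+ 2.
 rewrite /den Hc Hd (_ : _ + _ = s * s * ((c * re z + d) ^+ 2 + (c * im z) ^+ 2)); last by ring.
 by rewrite s2 mul1r.
have Eq : qf (mk4 a b c d) z = a * c * (re z ^+ 2 + im z ^+ 2) + (a * d + b * c) * re z + b * d.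
 rewrite /qf Ha Hb Hc Hd -[RHS]mul1r -s2; ring.
by apply: Cext; rewrite ?mobC_re ?mobC_im Ed ?Eq.
Qed.

Definition aff d p : G := mk4 (Num.sqrt d) (p / Num.sqrt d) 0 (Num.sqrt d)^-1.

Lemma mob_aff d p z : 0 < d -> uhp z -> mobC (aff d p) z = pt (d * re z + p) (d * im z).
Proof.
move=> d0 Hz; have s0 : Num.sqrt d != 0 by rewrite gt_eqF ?sqrtr_gt0.
rewrite mob_mk4 //; last by rewrite mulr0 subr0 divff.
have E : Num.sqrt d * Num.sqrt d = d by rewrite -expr2 sqr_sqrtr // ltW.
move: (re z) (im z) (Num.sqrt d) s0 E => x y q s0 E; rewrite -E; congr pt; field; exact: s0.
Qed.

(** With its inverse [tau2], a rotation of order 3 of the ideal triangle 0, 1, infinity: [tau1]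
    sends 0 to infinity, [tau2] sends 1 there. *)
Definition tau1 : G := mk4 1 (-1) 1 0.

Definition tau2 : G := mk4 0 1 (-1) 1.

(** The part of the ideal triangle 0, 1, infinity above the top of its semicircle. The centre of the
    triangle has height [sqrt 3 / 2], so the three rotated copies cover the triangle. *)
Definition cusp : set C := [set w | [/\ uhp w, 0 <= re w <= 1 & 1 / 2 <= im w]].

Lemma triangle_cusps w : uhp w -> 0 <= re w <= 1 -> re w <= re w ^+ 2 + im w ^+ 2 ->
 [\/ cusp w, cusp (mobC tau1 w) | cusp (mobC tau2 w)].
Proof.
move=> Hw; have [y1|y1] := leP (1 / 2) (im w); first by move=> *; constructor 1.
have H1 := mobC_uhp tau1 Hw; have H2 := mobC_uhp tau2 Hw; move: H1 H2.
rewrite {1}uhpE in Hw; rewrite !mob_mk4 //; try by ring.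
move: (re w) (im w) y1 Hw => x y y1 y0 H1 H2 x01 q.
have [x2|x2] := leP x (1 / 2).
 constructor 2; split=> //; rewrite ?re_pt ?im_pt.
  apply/andP; split; first by rewrite divr_ge0 ?(ltW n1) //; nra.
  by rewrite ler_pdivrMr //; nra.
 rewrite ler_pdivlMr //; nra.
constructor 3; split=> //; rewrite ?re_pt ?im_pt.
 apply/andP; split; first by rewrite divr_ge0 ?(ltW n2) //; nra.
 by rewrite ler_pdivrMr //; nra.
rewrite ler_pdivlMr //; nra.
Qed.

Lemma line_avoid k l : csd (k * Sop)%g (geod l -oo%E) -> csd (k * Sop)%g (geod l +oo%E) ->
 forall u, line l u -> ~ hpl k u.
Proof.
move=> c1 c2 u /lineP[t <-] [_ pos].
have : seg (geod l -oo%E) (geod l +oo%E) (gp l t).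
 by have := @seg_intro l -oo%E +oo%E t; rewrite leNye leey; exact.
by move=> /(seg_chpl c1 c2)[_]; rewrite qfN; lra.
Qed.

(** The end points of the lines divide the real axis. Over a gap, points inside the semicircle lie
    in a half plane that no line of [L] enters, and the others in an ideal triangle covered by three
    cusp regions. Points beyond all end points lie in a vertical half plane. *)
Lemma cusp_cover (L : seq G) : exists S : seq G, forall z, uhp z ->
 (exists2 k, k \in S & cusp (mobC k z)) \/
 exists k, hpl k z /\ forall l, l \in L -> forall u, line l u -> ~ hpl k u.
Proof.
(* 0 and 1 ensure two different end points, so that a point exactly over the largest one still
   bounds a gap. *)
pose E := [:: 0; 1 : R] ++ [seq ea l / ec l | l <- L] ++ [seq eb l / ed l | l <- L].
have avoid k : csd (k * Sop)%g None -> (forall e, e \in E -> csd (k * Sop)%g (Some (pt e 0))) ->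
  forall l, l \in L -> forall u, line l u -> ~ hpl k u.
 move=> c0 cE l lL; apply: line_avoid.
  rewrite geod_ninf; case: eqP => // _; apply: cE; rewrite /E !mem_cat orbC.
  by rewrite (map_f (fun l => eb l / ed l)) ?orbT.
 rewrite geod_pinf; case: eqP => // _; apply: cE; rewrite /E !mem_cat orbC.
 by rewrite (map_f (fun l => ea l / ec l)) ?orbT.
pose kap (pq : R * R) := (aff (pq.2 - pq.1) pq.1)^-1%g.
pose S := [seq (h * kap pq)%g | h <- [:: 1%g; tau1; tau2], pq <- [seq (p, q) | p <- E, q <- E]].
have [E0 E1] : 0 \in E /\ 1 \in E by rewrite /E !inE !eqxx !orbT.
have gap p q z : p \in E -> q \in E -> p < q -> uhp z -> p <= re z <= q ->
  (forall e, e \in E -> e <= p \/ q <= e) ->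
  (exists2 k, k \in S & cusp (mobC k z)) \/
  exists k, hpl k z /\ forall l, l \in L -> forall u, line l u -> ~ hpl k u.
 move=> pE qE pq Hz zpq nE; have r0 : 0 < (q - p) / 2 by lra.
 have r20 : 0 < 2 * ((q - p) / 2) by lra.
 have [neg|pos] := ltP ((re z - p) * (re z - q) + im z ^+ 2) 0.
  right; exists (circ ((p + q) / 2) ((q - p) / 2)); split.
   split=> //; rewrite side_circ //; apply: divr_gt0 => //.
   by move: neg; move: (re z) (im z) => x y; nra.
  apply: avoid; first exact/(csd_out _ _ r0).
  move=> e /nE ne; apply/(csd_out _ _ r0); rewrite /nz re_pt im_pt.
  by case: ne => ne; nra.
 left; have d0 : 0 < q - p by lra.
 pose w := pt ((re z - p) / (q - p)) (im z / (q - p)).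
 have Hw : uhp w by rewrite uhpE im_pt divr_gt0.
 have Ew : mobC (kap (p, q)) z = w.
  have Ez : z = mobC (aff (q - p) p) w.
   rewrite mob_aff // re_pt im_pt -[LHS]ptK; congr pt; field; by rewrite gt_eqF.
  by rewrite /kap {1}Ez mobCK.
 have w01 : 0 <= re w <= 1.
  rewrite re_pt; apply/andP; split; first by rewrite divr_ge0 ?(ltW d0) //; lra.
  by rewrite ler_pdivrMr //; lra.
 have wq : re w <= re w ^+ 2 + im w ^+ 2.
  rewrite re_pt im_pt -subr_ge0.
  rewrite (_ : _ - _ = ((re z - p) * (re z - q) + im z ^+ 2) / (q - p) ^+ 2); last first.
   by move: (re z) (im z) => x y; field; rewrite gt_eqF.
  nra.
 have inS h : h \in [:: 1%g; tau1; tau2] -> (h * kap (p, q))%g \in S.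
  by move=> tS; apply/allpairsP; exists (h, (p, q)); split=> //; apply/allpairsP; exists (p, q).
 have [i1 i2 i3] := in3 (1%g : G) tau1 tau2.
 have := triangle_cusps Hw w01 wq; rewrite -Ew => -[cw|cw|cw].
 - by exists (1 * kap (p, q))%g; [exact: (inS _ i1)|rewrite mul1g].
 - exists (tau1 * kap (p, q))%g; [exact: (inS _ i2)|by rewrite (mobCM tau1 _ Hz)].
 - exists (tau2 * kap (p, q))%g; [exact: (inS _ i3)|by rewrite (mobCM tau2 _ Hz)].
exists S => z Hz.
have [[e1 e1E e1x]|nlo] := pselect (exists2 e, e \in E & e <= re z); last first.
 right; have [e eE emin] := seq_min id E0; exists (vert e * Sop)%g; split.
  split=> //; rewrite qfN side_vert oppr_gt0 subr_lt0 ltNge; apply/negP => h; apply: nlo.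
  by exists e.
 apply: avoid.
  by rewrite /csd leadN leadN lead_vert !oppr0.
 move=> e' e'E; rewrite /csd qfN qfN side_vert opprK re_pt subr_ge0; exact: emin.
have [[e2 e2E e2x]|nhi] := pselect (exists2 e, e \in E & re z < e).
 have m1 : e1 \in [seq e <- E | e <= re z] by rewrite mem_filter e1x.
 have m2 : e2 \in [seq e <- E | re z < e] by rewrite mem_filter e2x.
 have [p + pmax] := seq_min (fun e : R => - e) m1; rewrite mem_filter => /andP[px pE].
 have [q + qmin] := seq_min id m2; rewrite mem_filter => /andP[qx qE].
 apply: (gap p q) => //; [lra|by rewrite px ltW|].
 move=> e eE; have [ex|ex] := leP e (re z); [left|right].
  by rewrite -lerN2; apply: pmax; rewrite mem_filter ex.
 by apply: qmin; rewrite mem_filter ex.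
have all e : e \in E -> e <= re z by move=> eE; rewrite leNgt; apply/negP => h; apply: nhi; exists e.
have [e eE emax] := seq_min (fun e : R => - e) E0.
have [ez|ez] := eqVneq e (re z); last first.
 right; exists (vert e); split.
  by split=> //; rewrite side_vert subr_gt0 lt_neqAle ez all.
 apply: avoid; first by rewrite /csd leadN lead_vert oppr0.
 by move=> e' e'E; rewrite /csd qfN side_vert re_pt oppr_ge0 subr_le0 -lerN2; exact: emax.
have [a aE ax] : exists2 a, a \in E & a < e.
 have h0 := all 0 E0; have h1 := all 1 E1; rewrite -ez in h0 h1.
 by exists 0 => //; lra.
have m1 : a \in [seq a <- E | a < e] by rewrite mem_filter ax.
have [p + pmax] := seq_min (fun e : R => - e) m1; rewrite mem_filter => /andP[px pE].
apply: (gap p e) => //; first by rewrite ez lexx andbT -ez ltW.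
move=> b bE; have [bx|bx] := ltP b e; [left|by right].
by rewrite -lerN2; apply: pmax; rewrite mem_filter bx.
Qed.

(** [2 (cosh d - 1)] for the hyperbolic distance [d]: an invariant measure of closeness without
    logarithms. *)
Definition ud z w : R := ((re z - re w) ^+ 2 + (im z - im w) ^+ 2) / (im z * im w).

Lemma ud_mob h z w : uhp z -> uhp w -> ud (mobC h z) (mobC h w) = ud z w.
Proof.
move=> Hz Hw; rewrite !uhpE in Hz Hw; have [c0|c0] := eqVneq (ec h) 0.
 have d1 : ea h * ed h = 1 by have := edet h; rewrite c0 mulr0 subr0.
 have d0 : ed h != 0 by nra; rewrite mulr0 eq_sym oner_neq0.
 rewrite /ud !mobC_re !mobC_im /qf /den c0.
 move: (re z) (re w) (im z) (im w) Hz Hw => x x' y y' y0 y0'.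
 have -> : ea h = (ed h)^-1 by apply: (mulRI d0); rewrite d1 mulVf.
 by field; rewrite d0 !gt_eqF.
rewrite /ud !re_mob // !im_mob //; have r0 := rad_gt0 c0.
have nz0 := nz_gt0 (ctr h) Hz; have nw0 := nz_gt0 (ctr h) Hw; move: nz0 nw0; rewrite /nz.
move: (re z) (re w) (im z) (im w) Hz Hw => x x' y y' y0 y0' n1 n2.
move: (ctr _) (rad h) r0 n1 n2 => c' r r0; move: (ctr h) => c n1 n2.
by field; rewrite ?gt_eqF.
Qed.

End Cusps.

Hypothesis HG : geometrically_finite Gam.

(** * An area bound for the number of disjoint isometric rectangles *)

Section NoFamily.
Implicit Types (g h k : G) (z w v u : C) (x y t r e c d : R).

(** The affine image of [(0, 1) x (3, 6)]. The factors leave room around the smaller rectangle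
    [[1/4, 3/4] x [4, 5]] and keep the set above isometric spheres of comparable size. *)
Definition rect c1 c2 : set C :=
 [set z | [/\ uhp z, c1 < re z < c2 & 3 * (c2 - c1) < im z < 6 * (c2 - c1)]].

(* [M] isometric rectangles hanging between two translates of the cusp and
  embedded in the quotient surface. *)
Definition family (P : nat -> R * R) (M : nat) : Prop :=
 (forall i, (i < M)%N -> [/\ (P i).1 < (P i).2, cusp_pt (P i).1 & cusp_pt (P i).2]) /\
 forall i j g z, (i < M)%N -> (j < M)%N -> Gam g -> rect (P i).1 (P i).2 z ->
  rect (P j).1 (P j).2 (mobC g z) -> i = j /\ g = 1%g.

(** The point is moved into the closure of the convex region. There it cannot lie in a half plane
    missing the boundary, since such a half plane is contained in the region and is excluded by
    [free_hull]; so a cusp region receives it. *)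
Lemma region_cusps : exists S : seq G, forall c1 c2 z, uhp z -> cusp_pt c1 -> cusp_pt c2 ->
 c1 < re z < c2 -> (re z - c1) * (c2 - re z) <= im z ^+ 2 ->
 exists g k, [/\ Gam g, k \in S & cusp (mobC k (mobC g z))].
Proof.
have [F [fF cF fin]] := HG; have [oF Fu _ cov] := fF.
have [L HL] := boundary_lines oF fin; have [S HS] := cusp_cover L.
have [tau t0 Gt] := cusp_width.
exists S => c1 c2 z Hz cc1 cc2 zc zy.
have [g Gg [w wF Ew]] : (\bigcup_(g in Gam) (mobC g @` closureH F)) z by rewrite cov.
have Hw : uhp w by case: wF.
have Ez : mobC g^-1%g z = w by rewrite -Ew mobCK.
have GV := GamV Gg.
case: (HS w Hw) => [[k kS kw]|[k [kw av]]].
 by exists g^-1%g, k; rewrite Ez.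
exfalso; have kF : hpl k `<=` F.
 apply: (hpl_dichotomy oF _ kw wF) => u ku /HL[l lL lu]; exact: av lL u lu ku.
by apply: (free_hull fF kF t0 Gt cc1 cc2 GV Hz zc zy); rewrite Ez.
Qed.

(** Squares of side 1/100 covering the cusp region from its lower edge upwards; at level [l] their
    hyperbolic size is of order [1 / (50 + l)]. *)
Definition sq (l i : nat) : set C := [set w | i%:R <= re w * 100 <= i.+1%:R /\
 (50 + l%:R) <= im w * 100 <= (50 + l.+1%:R)].

Lemma cusp_sq w : cusp w -> exists l i, (i < 101)%N /\ sq l i w.
Proof.
case=> Hw x01 y0; pose X := re w * 100; pose Y := im w * 100 - 50.
have X0 : 0 <= X by rewrite /X; lra.
have Y0 : 0 <= Y by rewrite /Y; lra.
exists (Num.truncn Y), (Num.truncn X); split.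
 have := truncn_itv X0 => /andP[h _]; rewrite -(ltr_nat R); apply: le_lt_trans h _; rewrite /X; lra.
have /andP[h1 h2] := truncn_itv X0; have /andP[h3 h4] := truncn_itv Y0.
by split; rewrite -/X; [rewrite h1 ltW|move: h3 h4; rewrite /Y; lra].
Qed.

Lemma scaled_ud (x x' y y' I T : R) : 0 < T -> I <= x <= I + 1 -> I <= x' <= I + 1 ->
 T <= y <= T + 1 -> T <= y' <= T + 1 -> ((x - x') ^+ 2 + (y - y') ^+ 2) / (y * y') <= 2 / T ^+ 2.
Proof.
move=> T0 hx hx' hy hy'; have y0 : 0 < y by lra.
have y0' : 0 < y' by lra.
have h1 : (x - x') ^+ 2 <= 1 by nra.
have h2 : (y - y') ^+ 2 <= 1 by nra.
have h3 : T ^+ 2 <= y * y' by nra; apply: ler_pM; lra.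
apply: ler_pM; [by apply: addr_ge0; exact: sqr_ge0|by rewrite invr_ge0 mulr_ge0 // ltW|lra|].
by rewrite lef_pV2 ?posrE ?mulr_gt0 ?exprn_gt0.
Qed.

Lemma sq_ud l i w w' : sq l i w -> sq l i w' -> ud w w' <= 2 / (50 + l%:R) ^+ 2.
Proof.
case=> a1 a2 [b1 b2]; have l0 : 0 <= l%:R :> R by exact: ler0n.
have T0 : 0 < 50 + l%:R :> R by lra.
rewrite -[i.+1%:R]natr1 in a1 b1; rewrite -[l.+1%:R]natr1 addrA in a2 b2.
have := scaled_ud T0 a1 b1 a2 b2; rewrite /ud -!mulrBl !exprMn -mulrDl mulrACA -expr2.
lra.
Qed.

Lemma ud_near x y w : 1 / 4 <= x <= 3 / 4 -> 4 <= y <= 5 -> uhp w ->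
 ud (pt x y) w <= 1 / 500 -> 0 < re w < 1 /\ 3 < im w < 6.
Proof.
rewrite uhpE /ud re_pt im_pt; move: (re w) (im w) => a b xb yb b0.
rewrite ler_pdivrMr ?mulr_gt0 //; last by lra.
move=> H; have h1 := sqr_ge0 (x - a); have h2 := sqr_ge0 (y - b).
have yb5 : y * b <= 5 * b by nra.
have b6 : b < 6 by rewrite ltNge; apply/negP => B; nra.
have b3 : 3 < b by rewrite ltNge; apply/negP => B; nra.
have : (x - a) ^+ 2 <= 6 / 100 by lra.
by move=> h; split; [nra|lra].
Qed.

Definition in0 w := 1 / 4 <= re w <= 3 / 4 /\ 4 <= im w <= 5.

Lemma in0_bounds w : in0 w -> [/\ uhp w, 0 < re w < 1 & 3 < im w < 6].
Proof. by case; rewrite uhpE; move: (re w) (im w) => x y *; split; lra. Qed.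

Lemma rect_aff c1 c2 w : c1 < c2 -> uhp w -> 0 < re w < 1 -> 3 < im w < 6 ->
 rect c1 c2 (mobC (aff (c2 - c1) c1) w).
Proof.
move=> d0 Hw w1 w2; split; first exact: mobC_uhp.
 rewrite mob_aff ?subr_gt0 // re_pt; move: (re w) w1 => x w1; nra.
rewrite mob_aff ?subr_gt0 // im_pt; move: (im w) w2 => x w2; nra.
Qed.

Lemma hull_aff c1 c2 w (z := mobC (aff (c2 - c1) c1) w) : c1 < c2 -> in0 w ->
 c1 < re z < c2 /\ (re z - c1) * (c2 - re z) <= im z ^+ 2.
Proof.
move=> d0 w0; have [Hw _ _] := in0_bounds w0; rewrite /z mob_aff ?subr_gt0 // re_pt im_pt.
case: w0; move: (re w) (im w) => x y x0 y0; split; first nra.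
have : (c2 - c1) ^+ 2 * (x * (1 - x)) <= (c2 - c1) ^+ 2 * y ^+ 2.
 by apply: ler_wpM2l; [exact: sqr_ge0|nra].
by move=> h; lra.
Qed.

Lemma near_in0 w w' (Q : R) : 0 < Q -> in0 w -> in0 w' -> ud w w' <= 2 * Q ->
 (re w - re w') ^+ 2 <= 64 * Q /\ (im w - im w') ^+ 2 <= 64 * Q.
Proof.
move=> Q0 [_ h1] [_ h2]; rewrite /ud; move: (re w) (re w') (im w) (im w') h1 h2 => x x' y y' h1 h2.
have p : 0 < y * y' by nra; lra.
rewrite ler_pdivrMr // => U; have s1 := sqr_ge0 (x - x'); have s2 := sqr_ge0 (y - y').
have : y * y' <= 25 by nra.
by move=> h; split; nra.
Qed.

Lemma inv_sq_step (u : R) : 0 < u -> ((u + 1) ^+ 2)^-1 <= u^-1 - (u + 1)^-1.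
Proof.
move=> u0; have u1 : 0 < u + 1 by lra.
have -> : u^-1 - (u + 1)^-1 = (u * (u + 1))^-1 by field; rewrite !gt_eqF.
by rewrite lef_pV2 ?posrE ?mulr_gt0 ?exprn_gt0 // expr2; nra.
Qed.

Lemma inv_sq_sum (a : R) N : 0 < a -> \sum_(0 <= l < N) ((a + l%:R + 1) ^+ 2)^-1 <= a^-1.
Proof.
move=> a0; suff : \sum_(0 <= l < N) ((a + l%:R + 1) ^+ 2)^-1 <= a^-1 - (a + N%:R)^-1.
 have : 0 <= (a + N%:R)^-1 by rewrite invr_ge0 addr_ge0 // ltW.
 by lra.
elim: N => [|N IH]; first by rewrite big_geq // addr0 subrr.
rewrite big_nat_recr //= -[N.+1%:R]natr1 addrA.
have p : 0 < a + N%:R by rewrite ltr_wpDr.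
have := inv_sq_step p; lra.
Qed.

(** There are [m] squares on each level, and each receives points of only one inner rectangle. With
    more than [m Lc] rectangles, one avoids all levels below [Lc]; its inner rectangle of area 1/2
    is then covered by sets so small that their total area is less. *)
Lemma no_family : exists M, forall P, ~ family P M.
Proof.
have [S HS] := region_cusps.
pose n := size S; pose m := (n * 101)%N.
(* The covering has total area at most [256 m / (49 + Lc)], which is less than 1/2 for this
   value. *)
pose Lc := (m * 512).+1.
exists (m * Lc).+1 => P [Pc Pd].
pose mm i := aff ((P i).2 - (P i).1) (P i).1.
have in0u w : in0 w -> uhp w by case/in0_bounds.
have rec i w : (i < (m * Lc).+1)%N -> uhp w -> 0 < re w < 1 -> 3 < im w < 6 ->
  rect (P i).1 (P i).2 (mobC (mm i) w).
 by move=> iM; have [d0 _ _] := Pc i iM; exact: rect_aff.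
(* Points sent to one square are so close that the pullback of the second lands in the large
   rectangle around the first; disjointness of the family then identifies rectangles and group
   elements. *)
have close i j w w' g g' k l ii : (i < (m * Lc).+1)%N -> (j < (m * Lc).+1)%N -> in0 w -> in0 w' ->
  Gam g -> Gam g' -> sq l ii (mobC k (mobC g (mobC (mm i) w))) ->
  sq l ii (mobC k (mobC g' (mobC (mm j) w'))) -> i = j /\ ud w w' <= 2 / (50 + l%:R) ^+ 2.
 move=> iM jM w0 w0' Gg Gg' s1 s2; have U := sq_ud s1 s2.
 have Hw := in0u _ w0; have Hw' := in0u _ w0'.
 have Hm := mobC_uhp (mm i) Hw; have Hm' := mobC_uhp (mm j) Hw'.
 pose z2 := mobC g^-1%g (mobC g' (mobC (mm j) w')).
 pose w2 := mobC (mm i)^-1%g z2.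
 have Hz2 : uhp z2 by do !apply: mobC_uhp.
 have Hw2 : uhp w2 by apply: mobC_uhp.
 have E2 : mobC g z2 = mobC g' (mobC (mm j) w') by rewrite mobCKV //; apply: mobC_uhp.
 have U2 : ud w w2 <= 2 / (50 + l%:R) ^+ 2.
  rewrite -(ud_mob (mm i) Hw Hw2) mobCKV //.
  rewrite -(ud_mob g Hm Hz2) E2.
  by rewrite -(ud_mob k) //; apply: mobC_uhp.
 have l0 : 0 <= l%:R :> R by exact: ler0n.
 have le8 : 2 / (50 + l%:R) ^+ 2 <= 1 / 500 :> R by rewrite ler_pdivrMr ?exprn_gt0 ?ltr_wpDr //; nra.
 have [x01 y01] : 0 < re w2 < 1 /\ 3 < im w2 < 6.
  apply: (@ud_near (re w) (im w)) => //; [exact: w0.1|exact: w0.2|].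
  by rewrite ptK; exact: le_trans U2 le8.
 have r2 := rec i w2 iM Hw2 x01 y01; rewrite mobCKV // in r2.
 have rj : rect (P j).1 (P j).2 (mobC (mm j) w').
  by have [_ b1 b2] := in0_bounds w0'; exact: rec.
 have Gz : Gam (g^-1 * g')%g by apply: GamM => //; exact: GamV.
 have r2' : rect (P i).1 (P i).2 (mobC (g^-1 * g')%g (mobC (mm j) w')) by rewrite mobCM.
 have [ji E] := Pd _ _ _ _ jM iM Gz rj r2'; split=> //.
 have E3 : z2 = mobC (mm j) w' by rewrite /z2 -mobCM // E mobC1.
 by move: U2; rewrite /w2 E3 ji mobCK.
have cov i w : (i < (m * Lc).+1)%N -> in0 w -> exists g k l ii, [/\ Gam g, k \in S, (ii < 101)%N &
  sq l ii (mobC k (mobC g (mobC (mm i) w)))].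
 move=> iM w0; have Hw := in0u _ w0; have [d0 cc1 cc2] := Pc i iM.
 have [g [k [Gg kS cw]]] : exists g k, [/\ Gam g, k \in S & cusp (mobC k (mobC g (mobC (mm i) w)))].
  have [h1 h2] := hull_aff d0 w0; exact: (HS _ _ _ (mobC_uhp (mm i) Hw) cc1 cc2 h1 h2).
 by have [l [ii [h1 h2]]] := cusp_sq cw; exists g, k, l, ii.
have [i iM high] : exists2 i, (i < (m * Lc).+1)%N & forall w g k l ii, in0 w -> Gam g -> k \in S ->
  (ii < 101)%N -> (l < Lc)%N -> ~ sq l ii (mobC k (mobC g (mobC (mm i) w))).
 apply: contrapT => N.
 have D (i : 'I_(m * Lc).+1) : exists q : 'I_n * 'I_101 * 'I_Lc, exists w g, [/\ in0 w, Gam g &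
   sq q.2 q.1.2 (mobC (nth 1%g S q.1.1) (mobC g (mobC (mm i) w)))].
  apply: contrapT => N2; apply: N; exists i => // w g k l ii w0 Gg kS h1 h2 s; apply: N2.
  have kn : (index k S < n)%N by rewrite index_mem.
  by exists (Ordinal kn, Ordinal h1, Ordinal h2), w, g; rewrite /= nth_index.
 have [f Hf] := choice D.
 have inj : injective f.
  move=> i j E; have [w [g [w0 Gg s]]] := Hf i; have [w' [g' [w0' Gg' s']]] := Hf j.
  rewrite -E in s'; apply: val_inj.
  by have [] := close _ _ _ _ _ _ _ _ _ (ltn_ord i) (ltn_ord j) w0 w0' Gg Gg' s s'.
 have := leq_card f inj; rewrite !card_prod !card_ord -/m ltnn //.
pose W (l q : nat) : set C := [set w | in0 w /\ exists2 g, Gam g &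
 sq (Lc + l) (q %% 101) (mobC (nth 1%g S (q %/ 101)) (mobC g (mobC (mm i) w)))].
(* One sample point is kept for each square that is met. Every other point sent to that square is
   close to the sample in both coordinates. *)
have [wc Hwc] : exists wc : nat -> nat -> C, forall l q w, W l q w -> W l q (wc l q).
 exists (fun l q => xget (pt 0 0) (W l q)) => l q w Ww.
 exact: (xgetPex (pt 0 0) (ex_intro (W l q) w Ww)).
pose a l q := re (wc l q); pose b l q := im (wc l q).
(* By [near_in0] the bound [2 / (50 + l)^2] on [ud] bounds squared coordinate differences by
   [64 / (50 + l)^2]. *)
pose s (l : nat) : R := 8 / (50 + (Lc + l)%:R).
have s0 l : 0 <= s l by rewrite divr_ge0 // addr_ge0.
have : 1 / 2 <= m%:R * 256 / (49 + Lc%:R) :> R.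
 apply: (cover_area (m := m) (s := s) (a := a) (b := b)) => //.
  move=> x y xE yE; have w0 : in0 (pt x y) by [].
  have [g [k [l [ii [Gg kS i101 sw]]]]] := cov i _ iM w0.
  have lL : (Lc <= l)%N by rewrite leqNgt; apply/negP => h; exact: high w0 Gg kS i101 h sw.
  pose q := (index k S * 101 + ii)%N.
  have qd : (q %/ 101 = index k S)%N by rewrite /q divnMDl // divn_small // addn0.
  have qm : (q %% 101 = ii)%N by rewrite /q modnMDl modn_small.
  have Wx : W (l - Lc)%N q (pt x y).
   by split=> //; exists g => //; rewrite subnKC // qd qm nth_index.
  have [w0' [g' Gg' sw']] := Hwc _ _ _ Wx.
  have [_ [g2 Gg2 s2]] := Wx.
  have [_ U] := close _ _ _ _ _ _ _ _ _ iM iM w0 w0' Gg2 Gg' s2 sw'.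
  have EL : (50 + (Lc + (l - Lc))%:R) = 50 + l%:R :> R by rewrite subnKC.
  rewrite EL in U.
  have sE : s (l - Lc)%N ^+ 2 = 64 * ((50 + l%:R) ^+ 2)^-1.
   by rewrite /s subnKC // expr_div_n; congr (_ * _); ring.
  have q0 : 0 < ((50 + l%:R) ^+ 2)^-1 :> R by rewrite invr_gt0 exprn_gt0.
  have [D1 D2] := near_in0 q0 w0 w0' U.
  have sqle (u : R) : u ^+ 2 <= 64 * ((50 + l%:R) ^+ 2)^-1 -> `|u| <= s (l - Lc)%N.
   by rewrite -sE => h; rewrite -ler_sqr ?nnegrE // real_normK // num_real.
  exists (l - Lc)%N, q; split; [|exact: sqle|exact: sqle].
  have kn : (index k S < n)%N by rewrite index_mem.
  by rewrite /q /m; apply: (@leq_trans ((index k S).+1 * 101)); [rewrite mulSn addnC ltn_add2r|rewrite leq_mul2r].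
 move=> N; rewrite -mulr_sumr -mulrA; apply: ler_wpM2l => //.
 apply: le_trans (_ : 256 * \sum_(0 <= l < N) ((49 + Lc%:R + l%:R + 1) ^+ 2)^-1 <= _); last first.
  by apply: ler_wpM2l => //; exact: inv_sq_sum.
 rewrite mulr_sumr; apply: ler_sum => l _; rewrite /s expr_div_n le_eqVlt; apply/orP; left; apply/eqP.
 rewrite natrD (_ : 50 + _ = 49 + Lc%:R + l%:R + 1 :> R); last by ring.
 lra.
have E : Lc%:R = m%:R * 512 + 1 :> R by rewrite /Lc -(natr1 (m * 512)) (natrM _ m 512).
rewrite ler_pdivlMr // E.
by move: (m%:R : R) => M M0; lra.
Qed.

End NoFamily.

(** * Finiteness of the basal family *)

Section Finiteness.
Implicit Types (g h k : G) (z w v u : C) (x y t r e c d : R) (A : set C).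

Lemma den_ge1 g z : ec g != 0 -> (1 <= den g z) = (rad g ^+ 2 <= nz (ctr g) z).
Proof. by move=> c0; rewrite den_nz // ler_pdivlMr ?mul1r // exprn_gt0 // rad_gt0. Qed.

Lemma den_gt1 g z : ec g != 0 -> (1 < den g z) = (rad g ^+ 2 < nz (ctr g) z).
Proof. by move=> c0; rewrite den_nz // ltr_pdivlMr ?mul1r // exprn_gt0 // rad_gt0. Qed.

Lemma ctr_vertM x g : ec g != 0 -> ctr (vert x * g)%g = ctr g.
Proof.
move=> c0; have [s [s2 _ _ Ec Ed]] := mul_entries (vert x) g.
have [t [t2 _ _ Fc Fd]] := vert_entries x.
rewrite /ctr Ec Ed Fc Fd mulr0 !mul0r !add0r mulr1.
by field; rewrite c0 !sgn_neq0.
Qed.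

Lemma rad_le g t : 0 < t -> Gam (vert t) -> Gam g -> ec g != 0 -> rad g <= t.
Proof.
move=> t0 Gt Gg c0; have a0 : 0 < `|ec g| by rewrite normr_gt0.
by rewrite /rad -(ler_pM2l a0) mulfV ?gt_eqF //; exact: (shimizu t0 Gt Gg c0).
Qed.

(** The summit has bounded coordinates and [den] equal to 1, so [finite_den] applies after a
    translation on the left, which changes neither centre nor radius. *)
Lemma big_radii eps B : 0 < eps ->
 finite_set [set c | `|c| <= B /\ exists g, [/\ Gam g, ec g != 0, ctr g = c & eps <= rad g]].
Proof.
move=> e0; have [tau t0 Gt] := cusp_width.
pose M := `|B| + tau + eps^-1 + 1.
have ei : 0 < eps^-1 by rewrite invr_gt0.
have B0 := normr_ge0 B.
have fin := finite_image (@ctr) (finite_den M); apply: sub_finite_set fin.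
move=> c [cB [g [Gg c0 gc ge]]].
have r0 := rad_gt0 c0; pose z : C := pt c (rad g).
have [n nP] := translate_re (re (mobC g z)) t0.
exists (vert (n%:~R * tau) * g)%g; last by rewrite ctr_vertM.
split; first by apply: GamM => //; exact: Gam_vertz.
exists z; rewrite re_pt im_pt den_vertM // mobCM // vert_mob re_pt (_ : den g z = 1); last first.
 by rewrite (den_sph c0) // /nz gc re_pt im_pt; ring.
have rt : rad g <= tau.
 exact: rad_le.
have lB := ler_norm B.
split=> //; [|apply/andP; split; [|]| |]; rewrite /M; try lra.
 apply: le_trans ge; rewrite -[X in _ <= X]invrK lef_pV2 ?posrE //; lra.
by rewrite ger0_norm; lra.
Qed.

Lemma HALF_cusp c r e : HALF c r e -> cusp_pt c.
Proof.
case=> _ _ _ [g [Gg c0 gc _]] _; exists g^-1%g; split; [exact: GamV|by rewrite ecV0|].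
by rewrite -ctrV ?ecV0 // invgK.
Qed.

(** Neither summit is inside an isometric circle, and one small radius bounds both by [sqrt 5] times
    the gap. A circle reaching height three times the gap between the two centres would enclose one
    of the summits. *)
Lemma rect_K c1 r1 e1 c2 r2 e2 : HALF c1 r1 e1 -> HALF c2 r2 e2 -> c1 < c2 ->
 r1 <= 2 * (c2 - c1) \/ r2 <= 2 * (c2 - c1) -> rect c1 c2 `<=` common_ext Gam.
Proof.
move=> H1 H2 c12 rg z [Hz x12 y12]; apply/KE => //; split=> // g Gg c0; rewrite den_gt1 //.
have [_ /(_ g Gg c0)] := HALF_top H1; have [_ /(_ g Gg c0)] := HALF_top H2.
have [_ /(_ _ _ _)] := HALF_top H2.
rewrite !den_ge1 //.
have r10 : 0 < r1 by case: H1.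
have r20 : 0 < r2 by case: H2.
have := HALF_den H2 (HALF_top H1); have := HALF_den H1 (HALF_top H2).
rewrite /nz !re_pt !im_pt; move: (re z) (im z) x12 y12 (ctr g) (rad g ^+ 2) => x y x12 y12 c q a1 a2 _ b2 b1.
have [q1 q2] : r1 ^+ 2 <= 5 * (c2 - c1) ^+ 2 /\ r2 ^+ 2 <= 5 * (c2 - c1) ^+ 2.
 by case: rg => rg; [have : r1 ^+ 2 <= 4 * (c2 - c1) ^+ 2|have : r2 ^+ 2 <= 4 * (c2 - c1) ^+ 2]; nra.
have [cx|cx] := leP c x.
 nra.
nra.
Qed.

(* Radii near an accumulation point of centers tend to 0, so that consecutive
  gaps eventually dominate the radii. *)
Lemma accumulating_family x0 (s : R) c0 r0 e0 : s = 1 \/ s = -1 -> HALF c0 r0 e0 ->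
 (forall d, 0 < d -> exists (u : R) r e, [/\ 0 < u < d, r < d & HALF (x0 + s * u) r e]) ->
 forall M, exists P, family P M.
Proof.
move=> s1 H0 acc M; have r00 : 0 < r0 by case: H0.
pose X : Type := {p : R * R | 0 < p.1 < r0 / 2 /\ exists e, HALF (x0 + s * p.1) p.2 e}.
(* Offsets more than halve and the next radius is less than half the present offset, so each gap
   exceeds the radius at its inner end. *)
have step (p : X) : exists q : X, 2 * (sval q).1 < (sval p).1 /\ 2 * (sval q).2 < (sval p).1.
 case: p => -[u r] /= [/andP[u0 u1] _].
 have [u' [r' [e' [/andP[a b] c h]]]] := acc (u / 2) (divr_gt0 u0 (ltr0Sn _ 1)).
 have hq : 0 < (u', r').1 < r0 / 2 /\ exists e, HALF (x0 + s * (u', r').1) (u', r').2 e.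
  by split; [rewrite /= a /=; lra|exists e'].
 by exists (exist _ (u', r') hq) => /=; lra.
have [f Hf] := choice step.
have [u0 [r1 [e1 [/andP[a b] _ h]]]] := acc (r0 / 2) (divr_gt0 r00 (ltr0Sn _ 1)).
have hq : 0 < (u0, r1).1 < r0 / 2 /\ exists e, HALF (x0 + s * (u0, r1).1) (u0, r1).2 e.
 by split; [rewrite /= a b|exists e1].
pose F n := iter n f (exist _ (u0, r1) hq : X).
pose U n := (sval (F n)).1; pose V n := (sval (F n)).2.
have UP n : 0 < U n < r0 / 2 /\ exists e, HALF (x0 + s * U n) (V n) e by exact: (svalP (F n)).
have US n : 2 * U n.+1 < U n /\ 2 * V n.+1 < U n by exact: (Hf (F n)).
have Umono m n : (m <= n)%N -> U n <= U m.
 move=> /subnK <-; elim: (n - m)%N => [|d IH]; first by rewrite add0n lexx.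
 by rewrite addSn; have := US (d + m)%N; have := UP (d + m).+1; lra.
pose P n := if s == 1 then (x0 + U n.+1, x0 + U n) else (x0 - U n, x0 - U n.+1).
have PE n : (s = 1 /\ P n = (x0 + U n.+1, x0 + U n)) \/ (s = -1 /\ P n = (x0 - U n, x0 - U n.+1)).
 rewrite /P; case: s1 => ->; first by rewrite eqxx; left.
 by rewrite (_ : (-1 == 1 :> R) = false); [right|apply/eqP; lra].
have Plt n : (P n).1 < (P n).2.
 by have [p _] := UP n.+1; have := US n; case: (PE n) => -[_ ->] /=; lra.
have rK n : rect (P n).1 (P n).2 `<=` common_ext Gam.
 have [_ [e h1]] := UP n; have [p [e' h2]] := UP n.+1; have us := US n.
 have := Plt n; case: (PE n) => -[sE ->] /= lt; rewrite sE ?mul1r ?mulN1r in h1 h2.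
  by apply: (@rect_K _ (V n.+1) e' _ (V n) e) => //; left; lra.
 by apply: (@rect_K _ (V n) e _ (V n.+1) e') => //; right; lra.
exists P; split.
 move=> i _; split=> //; have [_ [e1' h1]] := UP i; have [_ [e2' h2]] := UP i.+1.
  by case: (PE i) => -[sE ->] /=; rewrite sE ?mul1r ?mulN1r in h1 h2; [exact: HALF_cusp h2|exact: HALF_cusp h1].
 by case: (PE i) => -[sE ->] /=; rewrite sE ?mul1r ?mulN1r in h1 h2; [exact: HALF_cusp h1|exact: HALF_cusp h2].
move=> i j g z _ _ Gg zi zj; have zK := rK _ _ zi; have gK := rK _ _ zj.
have [t gt] := K_stab zK (K_clK gK) Gg.
(* All rectangles lie within [r0 / 2] of [x0], while by [rad_le] a nontrivial translation of [Gam]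
   has length at least the radius [r0]. *)
have Ht : `|t| < r0 -> t = 0.
 move=> tr; apply: contrapT => /eqP tn0.
 have H (a' : R) : 0 < a' -> Gam (vert a') -> r0 <= a'.
  by case: H0 => _ _ _ [g0 [Gg0 c0g _ gr]] _ a0 Ga; rewrite -gr; exact: rad_le.
 have Gt : Gam (vert t) by rewrite -gt.
 have := H `|t|; rewrite normr_gt0 tn0; case: (ltgtP t 0) tn0 => // tt _ /(_ isT); last first.
  by rewrite gtr0_norm // in tr * => /(_ Gt); lra.
 by rewrite ltr0_norm // in tr * => h0; have := h0 _; rewrite -vertV; move/(_ (GamV Gt)); lra.
case: zi => _ zi _; case: zj => _ + _; rewrite gt vert_mob re_pt => zj.
have [pi _] := UP i; have [pi1 _] := UP i.+1; have [pj _] := UP j; have [pj1 _] := UP j.+1.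
have t0 : t = 0.
 by apply: Ht; rewrite ltr_norml; case: (PE i) (PE j) zi zj => -[sE ->] [[sE' ->]|[sE' ->]] /=; lra.
rewrite t0 addr0 in zj; rewrite t0 vert0; split=> //.
apply/eqP; case: (ltngtP i j) => // ij; exfalso; have := Umono _ _ ij;
 by case: (PE i) (PE j) zi zj => -[sE ->] [[sE' ->]|[sE' ->]] /=; lra.
Qed.

(** [x0] is the supremum of the points with only finitely many elements of [Y] below them. Every
    neighbourhood of it contains infinitely many elements, and then so does one fixed side. *)
Lemma accumulation (Y : set R) (a b : R) : infinite_set Y -> (forall y, Y y -> a <= y <= b) ->
 exists x0 s, (s = 1 \/ s = -1) /\
  forall d, 0 < d -> infinite_set [set y | Y y /\ 0 < s * (y - x0) < d].
Proof.
move=> iY Yab; have [y0 y0Y] := infinite_setN0 iY.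
have ab : a <= b by have := Yab _ y0Y; lra.
pose S := [set x | a <= x <= b /\ finite_set (Y `&` [set y | y < x])].
have Sa : S a.
 split; first by rewrite lexx.
 rewrite (_ : _ `&` _ = set0) // -subset0 => y [/Yab /= h1 h2]; lra.
have hS : has_sup S by split; [exists a|exists b => x [/andP[]]].
pose x0 := sup S.
have near d : 0 < d -> infinite_set (Y `&` [set y | x0 - d < y < x0 + d]).
 move=> d0 fin; have [x [_ Sx] xd] := sup_adherent d0 hS.
 have fin2 : finite_set (Y `&` [set y | y < x0 + d / 2]).
  apply: sub_finite_set (_ : _ `<=` (Y `&` [set y | y < x]) `|` (Y `&` [set y | x0 - d < y < x0 + d])) _.
   move=> y [/= yY yx]; have [h|h] := ltP y x; [by left|right; split=> //=].
   by rewrite -/x0 in xd; apply/andP; split; lra.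
  by rewrite finite_setU.
 have [xb|xb] := leP (x0 + d / 2) b.
  have ax0 : a <= x0 by apply: sup_ubound => //; exact: (proj2 hS).
  have : x0 + d / 2 <= x0.
   by apply: sup_ubound; [exact: (proj2 hS)|split => //; lra].
  lra.
 by apply: iY; apply: sub_finite_set fin2 => y yY; split=> //=; have := Yab _ yY; lra.
exists x0.
have [[s [s1 h]]|N] := pselect (exists s : R, (s = 1 \/ s = -1) /\
  forall d, 0 < d -> infinite_set [set y | Y y /\ 0 < s * (y - x0) < d]).
 by exists s.
have fin s : s = 1 \/ s = -1 -> exists2 d : R, 0 < d & finite_set [set y | Y y /\ 0 < s * (y - x0) < d].
 move=> s1; apply: contrapT => N'; apply: N; exists s; split=> // d d0 fd; apply: N'; by exists d.
have [d1 d10 f1] := fin 1 (or_introl erefl); have [d2 d20 f2] := fin (-1) (or_intror erefl).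
have [m [m1 m2]] : exists m : R, [/\ 0 < m, m <= d1 & m <= d2].
 by have [h|h] := leP d1 d2; [exists d1|exists d2]; split=> //; rewrite ?lexx ?ltW.
move=> m3; case: (near m m1); apply: sub_finite_set (_ : _ `<=` [set y | Y y /\ 0 < 1 * (y - x0) < d1] `|`
  [set y | Y y /\ 0 < -1 * (y - x0) < d2] `|` [set x0]) _.
 move=> y [/= yY yx]; case: (ltgtP y x0) => h; [left; right|left; left|by right]; split=> //; lra.
by rewrite !finite_setU.
Qed.

(** Infinitely many centres in an interval would accumulate; by [big_radii] their radii become small
    near the limit, which gives families of every size. *)
Lemma finite_centers (tau : R) : finite_set [set c | 0 <= c <= tau /\ exists r e, HALF c r e].
Proof.
apply: contrapT => inf.
have [x0 [s [s1 acc]]] := accumulation inf (fun (y : R) yX => proj1 yX).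
have [c0 [_ [r0 [e0 H0]]]] := infinite_setN0 inf.
have [M HM] := no_family.
have [|P /HM//] := accumulating_family s1 H0 (x0 := x0) _ M.
move=> d d0; have fb := @big_radii d `|tau| d0.
have [y [[[yt [r [e H]]] yd] nb]] := infinite_setN0 (infinite_setD (acc d d0) fb).
exists (s * (y - x0)), r, e; rewrite mulrA (_ : s * s = 1) ?mul1r ?subrKC; last by case: s1 => ->; ring.
split=> //; rewrite ltNge; apply/negP => dr; apply: nb; split.
 by rewrite !ger0_norm; lra.
by case: H => _ _ _ [g [Gg g0 gc gr]] _; exists g; split=> //; rewrite gr.
Qed.

Lemma HALF_dir_eq c r e r' e' : HALF c r e -> HALF c r' e' -> (c < e) = (c < e') ->
 r = r' /\ e = e'.
Proof.
move=> H H'; have [_ /eqP ce _ _ _] := H; have [_ /eqP ce' _ _ _] := H'.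
case: (ltgtP c e) ce => // lt _; case: (ltgtP c e') ce' => // lt' _ _.
 have [m [m1 m2 m3]] := ltr_ex2 lt lt'.
 have [||_ -> ->//] := HALF_eq (x := m) H H'; first by rewrite /sbt m1 m2.
 by rewrite /between (ltW m1) (ltW m3).
have [m [m1 m2 m3]] := gtr_ex2 lt lt'.
have [||_ -> ->//] := HALF_eq (x := m) H H'; first by rewrite /sbt m1 m2 orbT.
by rewrite /between (ltW m1) (ltW m3) orbT.
Qed.

Lemma finite_subsingleton (T : Type) (X : set T) : (forall a b : T, X a -> X b -> a = b) -> finite_set X.
Proof.
move=> h; have [[x Xx]|N] := pselect (exists x : T, X x); last first.
 by rewrite (_ : X = set0) // -subset0 => x Xx; apply: N; exists x.
by apply: sub_finite_set (finite_set1 x) => y Xy; exact: h.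
Qed.

(** Up to translation a precell is determined by a centre modulo [tau] and a direction, a strip by
    the half arc ending at its left end; and no two members of the family are translates of each
    other. *)
Lemma finite_AA : finite_set AA.
Proof.
have [tau t0 Gt] := cusp_width.
pose X := [set c | 0 <= c <= tau /\ exists r e, HALF c r e].
have norm c r e : HALF c r e -> exists c0 (n : int), X c0 /\ c = c0 + n%:~R * tau.
 move=> H; have [n nP] := translate_re c t0.
 exists (c + n%:~R * tau), (- n); split; last by rewrite mulrNz mulNr addrK.
 split; first lra.
 by exists r, (e + n%:~R * tau); apply: HALF_vert => //; exact: Gam_vertz.
have diff (n n' : int) : Gam (vert ((n' - n)%:~R * tau)) by exact: Gam_vertz.
have dE c0 (n n' : int) : c0 + n%:~R * tau + (n' - n)%:~R * tau = c0 + n'%:~R * tau.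
 by rewrite intrB; ring.
pose F1 (o : bool) c0 := [set A | AA A /\ exists (n : int) r e,
 half_of A (c0 + n%:~R * tau) r e /\ (c0 + n%:~R * tau < e) = o].
pose F2 c0 := [set A | AA A /\ exists (n : int) r a b,
 [/\ strip_precell Gam A a b, HALF (c0 + n%:~R * tau) r a & c0 + n%:~R * tau < a]].
have move_e (o : bool) c0 n n' r e r' e' : HALF (c0 + n%:~R * tau) r e ->
  HALF (c0 + n'%:~R * tau) r' e' -> (c0 + n%:~R * tau < e) = o -> (c0 + n'%:~R * tau < e') = o ->
  r' = r /\ e' = e + (n' - n)%:~R * tau.
 move=> H H' h h'; have := HALF_vert (diff n n') H; rewrite dE => H2.
 apply: (HALF_dir_eq H' H2); by rewrite h' -(dE _ n) ltrD2r.
have fin1 o c0 : finite_set (F1 o c0).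
 apply: finite_subsingleton => A A' [AAA [n [r [e [H h]]]]] [AAA' [n' [r' [e' [H' h']]]]].
 have [? ?] := move_e o _ _ _ _ _ _ _ (half_of_HALF H) (half_of_HALF H') h h'; subst r' e'.
 rewrite -(dE _ n) in H'; by have [] := same_half AAA AAA' (diff n n') H H'.
have fin2 c0 : finite_set (F2 c0).
 apply: finite_subsingleton => A A' [AAA [n [r [a [b [S H h]]]]]] [AAA' [n' [r' [a' [b' [S' H' h']]]]]].
 have [_ ?] := move_e true _ _ _ _ _ _ _ H H' h h'; subst a'.
 have [ab _ _ EA _] := S; have [ab' _ _ EA' _] := S'.
 have ab2 : a < b' - (n' - n)%:~R * tau by lra.
 have [x [x1 x2 x3]] := ltr_ex2 ab ab2.
 have [] := @fund (vert ((n' - n)%:~R * tau)) A A' (pt x 1) AAA AAA' (diff n n') => //.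
  rewrite EA strip_poly interior_poly; split; first exact: ltr01.
  by move=> k; rewrite !inE => /orP[]/eqP->; rewrite ?qfN side_vert re_pt; lra.
 rewrite vert_mob EA'; split; first exact: ltr01.
 by rewrite /= lerD2r (ltW x1) -lerBrDr ltW.
have fX := finite_centers tau.
apply: sub_finite_set (_ : _ `<=` (\bigcup_(c in X) F1 true c) `|` (\bigcup_(c in X) F1 false c) `|`
 (\bigcup_(c in X) F2 c)) _; last first.
 by rewrite !finite_setU; do !split; apply: bigcup_finite.
have half A c r e : AA A -> half_of A c r e ->
  ((\bigcup_(c in X) F1 true c) `|` (\bigcup_(c in X) F1 false c) `|` (\bigcup_(c in X) F2 c)) A.
 move=> AAA H; have [c0 [n [X0 E]]] := norm _ _ _ (half_of_HALF H); left.
 case h : (c < e); [left|right]; exists c0 => //; split=> //; exists n, r, e; by rewrite -E.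
move=> A AAA; case: (precell_cases (pAA AAA)).
- by case=> v [c1 [r1 [c2 [r2 /NC_halves [H _]]]]]; exact: half H.
- by case=> c [r [e H]]; apply: (half A c r e) => //; constructor 3.
case=> a [b S]; have [c [r [_ [_ [H _ _ _ [ca _]]]]]] := strip_end S.
have [c0 [n [X0 E]]] := norm _ _ _ H; right; exists c0 => //; split=> //.
by exists n, r, a, b; rewrite -E.
Qed.

End Finiteness.

(** * Local finiteness of the tessellation and the sides of tiles *)

Section Walls.
Implicit Types (g h k l : G) (z w v u : C) (x y t r e c d : R) (A X B b : set C) (K : seq G).

Lemma precell_bounded A : precell Gam A -> exists M, forall z, A z -> `|re z| <= M.
Proof.
move=> /precell_cases[].
- move=> [v [c1 [r1 [c2 [r2 H]]]]]; exists (`|c1| + `|c2|) => z.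
 by rewrite (NC_memP _ H) => -[_ h _ _]; rewrite ler_norml; have := ler_norm c1; have := ler_norm c2;
  have := ler_norm (- c1); have := ler_norm (- c2); rewrite !normrN; lra.
- move=> [c [r [e [_ _ ->]]]]; exists (`|c| + `|e|) => z [_ _]; rewrite /between => h.
 rewrite ler_norml; have := ler_norm c; have := ler_norm e;
  have := ler_norm (- c); have := ler_norm (- e); rewrite !normrN; lra.
- move=> [a [b [_ _ _ -> _]]]; exists (`|a| + `|b|) => z [_] /=; rewrite -/(re z) => h.
 rewrite ler_norml; have := ler_norm a; have := ler_norm b;
  have := ler_norm (- a); have := ler_norm (- b); rewrite !normrN; lra.
Qed.

Lemma AA_bounded : exists2 M, 0 < M & forall A z, AA A -> A z -> `|re z| <= M.
Proof.
have [s Es] := (finite_seqP _).1 finite_AA.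
have sub A : A \in s -> precell Gam A by move=> As; apply: pAA; rewrite Es.
suff [M M0 HM] : exists2 M, 0 < M & forall A, A \in s -> forall z, A z -> `|re z| <= M.
 by exists M => // A z; rewrite Es => /HM; exact.
elim: s sub {Es} => [|A s IH] sub; first by exists 1.
have [|M M0 HM] := IH; first by move=> A' h; apply: sub; rewrite inE h orbT.
have [N HN] := precell_bounded (sub A (mem_head _ _)).
exists (M + `|N|); first by rewrite ltr_wpDr.
move=> A'; rewrite inE => /orP[/eqP->|h] z Az.
 by apply: le_trans (HN _ Az) _; have := ler_norm N; lra.
by apply: le_trans (HM _ h _ Az) _; rewrite lerDl.
Qed.

Lemma den_le1 g z : Gam g -> uhp z -> clK (mobC g z) -> den g z <= 1.
Proof.
move=> Gg Hz [_ /(_ g^-1%g (GamV Gg))]; rewrite ecV0 denV //.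
have d0 := den_gt0 g Hz; have [c0 _|c0] := eqVneq (ec g) 0.
 have [t ->] : exists t, g = vert t by apply: translation_stab; apply/stab_infP.
 by rewrite den_vert lexx.
by move=> /(_ isT); rewrite -[X in X <= _]invr1 lef_pV2 ?posrE.
Qed.

(** Only finitely many tiles come near [z], by [finite_den], [finite_AA] and the bounded abscissas
    of precells; those not containing [z] are closed and keep a distance. *)
Lemma tiles_near z : uhp z -> \forall w \near z, forall X, tile X -> X w -> X z.
Proof.
move=> Hz; have [M M0 near] := near_bounded Hz; have [N N0 HN] := AA_bounded.
pose Q := N + M + 1 + M^-1.
have Mi : 0 < M^-1 by rewrite invr_gt0.
have fin := finite_den Q.
pose F g A : set (set C) := [set X | exists2 B, is_cell Gam AA A B & X = mobC g^-1%g @` B].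
have finT : finite_set (\bigcup_(g in [set g | Gam g /\ exists z,
 [/\ `|re z| <= Q, 0 < im z, Q^-1 <= im z <= Q, den g z <= Q & `|re (mobC g z)| <= Q]])
 \bigcup_(A in AA) F g A).
 apply: bigcup_finite => // g _; apply: bigcup_finite; first exact: finite_AA.
 move=> A AAA; apply: finite_subsingleton => X X' [B cB ->] [B' cB' ->].
 by rewrite (cell_uniq AAA cB cB').
have [s Es] := (finite_seqP _).1 finT.
have inS w X : uhp w -> `|re w| <= M /\ M^-1 <= im w <= M -> tile X -> X w -> X \in s.
 move=> Hw [b1 b2] tX Xw; have [g [A [B [Gg AAA cB Aw EX]]]] := tile_part tX Xw.
 suff : [set` s] X by [].
 rewrite -Es; exists g; last by exists A => //; exists B.
 have cw : clK (mobC g w) by apply: (precell_clK _ Aw); exact: pAA.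
 split=> //; exists w; rewrite /Q; split; rewrite -?uhpE //; try lra.
 - apply/andP; split; last lra.
  by apply: le_trans (_ : M^-1 <= _); [rewrite lef_pV2 ?posrE //|]; lra.
 - by have := den_le1 Gg Hw cw; lra.
 - by have := HN _ _ AAA Aw; lra.
have n2 : \forall w \near z, forall X, X \in s -> tile X -> X w -> X z.
 apply: near_seq => X _.
 have [Xz|nXz] := pselect (X z); first by apply: filterE.
 have [tX|ntX] := pselect (tile X); last by apply: filterE.
 have [K EK _] := tile_good tX.
 have [k kK neg] : exists2 k, k \in K & side_ k z < 0.
  apply: contrapT => no; apply: nXz; rewrite EK; split=> // k kK; rewrite leNgt; apply/negP => h.
  by apply: no; exists k.
 have : nbhs z [set w | side_ k w < 0].
  by apply: near_open => //; apply: open_ltc; exact: cts_side.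
 apply: filterS => w /= h _; rewrite EK => -[_ /(_ k kK)]; lra.
near=> w => X tX Xw.
have [h1 h2 h3] : [/\ `|re w| <= M, 0 < im w & M^-1 <= im w <= M] by near: w.
have Hn : forall X, X \in s -> tile X -> X w -> X z by near: w.
by apply: Hn => //; apply: (inS w) => //; split.
Unshelve. all: by end_near.
Qed.

Lemma gp_near k t0 (P : C -> Prop) : (\forall w \near gp k t0, P w) -> \forall t \near t0, P (gp k t).
Proof. by move=> n; exact: (@cts_gp R k t0 _ n). Qed.

(** If the lines crossed at [z], points of the first line near [z] would lie strictly inside the
    second half plane, and points next to them in both. *)
Lemma halfdisc_disjoint k k' z : line k z -> line k' z ->
 (\forall w \near z, ~ (hpl k w /\ hpl k' w)) -> line k = line k' /\ hpl k' = hpl (k * Sop)%g.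
Proof.
move=> kz kz' nb; pose m := (k'^-1 * k)%g.
have [t0 Et] := lineP kz.
have := side_gp_eq0 k' k t0; rewrite Et -/m (proj2 kz') eqxx => /esym /eqP m0.
have [a0|a0] := eqVneq (al m) 0.
 have b0 : be m = 0 by move: m0; rewrite a0 mul0r add0r.
 have [[t E]|[t E]] := same_line a0 b0.
  exfalso; have [w [nw Hw pw]] := near_pos kz nb; apply: nw; split; first by split.
  by rewrite -(hpl_at k' t) -E.
 split; first by rewrite E line_at line_Sop.
 apply/predeqP => w; split=> -[Hw h]; split=> //; move: h;
  by rewrite E qfN side_at // qfN opprK.
exfalso; have bn : \forall t \near t0, nbhs (gp k t) [set w | ~ (hpl k w /\ hpl k' w)].
 by apply: (@gp_near k t0 (fun w => nbhs w [set w | ~ (hpl k w /\ hpl k' w)])); rewrite Et;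
  exact: (nbhs_interior nb).
have /nbhs_ballP[d /= d0 Hd] := bn.
have [t td tp] : exists2 t, `|t0 - t| < d & 0 < al m * expR t ^+ 2 + be m.
 case: (ltgtP 0 (al m)) a0 => // a0 _.
  exists (t0 + d / 2); first by rewrite opprD addNKr normrN gtr0_norm; lra.
  have : expR t0 ^+ 2 < expR (t0 + d / 2) ^+ 2 by rewrite expR2_lt; lra.
  nra.
 exists (t0 - d / 2); first by rewrite opprB addrC subrK gtr0_norm; lra.
 have : expR (t0 - d / 2) ^+ 2 < expR t0 ^+ 2 by rewrite expR2_lt; lra.
 nra.
have bt := Hd t td; have hp : hpl k' (gp k t) by split; [exact: gp_uhp|rewrite side_gp_gt0].
have n2 := near_open (@open_hpl _ k') hp.
have n12 := @filterI C (nbhs (gp k t)) (@nbhs_filter C (gp k t)) _ _ bt n2.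
have [w [[bw kw'] Hw pw]] := near_pos (gp_line k t) n12.
by apply: bw; split.
Qed.

Lemma tile_pt X z : tile X -> X z -> X^° z \/
 exists K k, [/\ X = poly K, good_poly K, k \in K & line k z].
Proof.
move=> tX Xz; have [K EK gK] := tile_good tX.
have [[k kK k0]|no] := pselect (exists2 k, k \in K & side_ k z = 0).
 by right; exists K, k; split=> //; split=> //; rewrite EK in Xz; case: Xz.
left; rewrite EK in Xz *; rewrite interior_poly; case: Xz => Hz Xz; split=> // k kK.
rewrite lt_neqAle Xz // andbT; apply/negP => /eqP h; apply: no; by exists k.
Qed.

Definition wall K k : Prop := [/\ tile (poly K), good_poly K & k \in K].

Lemma wall_base K k : wall K k -> line k `<=` base_set Gam AA.
Proof.
move=> [tX gK kK] z kz; apply/base_setP; exists (poly K), (line k); split=> //.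
by apply/(tile_side (K := K)) => //; exists k.
Qed.

Lemma wall_near K k z : wall K k -> line k z -> \forall w \near z, hpl k w -> ipoly K w.
Proof. by case=> _ [[z0 z0K] gl] kK kz; exact: (poly_halfdisc z0K gl kK kz). Qed.

Lemma base_setE z : base_set Gam AA z <-> uhp z /\ forall X, tile X -> ~ X^° z.
Proof.
split.
 move=> /base_setP[X [b [tX sb bz]]]; have [K EK gK] := tile_good tX.
 have /(tile_side b EK gK)[k kK Eb] := sb; rewrite Eb in bz.
 split=> [|X' tX' Xz']; first by case: bz.
 have Xz : X z by rewrite EK; exact: (gK.2 _ kK _ bz).
 have E := tile_eq tX' tX Xz' Xz; move: Xz'; rewrite E EK interior_poly => -[_ /(_ k kK)].
 by case: bz => _ ->; rewrite ltxx.
move=> [Hz no]; have [X tX Xz] := tile_cover Hz.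
have [/(no _ tX)//|[K [k [EK gK kK kz]]]] := tile_pt tX Xz.
by apply: (wall_base (K := K)) kz; split=> //; rewrite -EK.
Qed.

Lemma base_wall z : base_set Gam AA z -> exists K k, wall K k /\ line k z.
Proof.
move=> /base_setP[X [b [tX sb bz]]]; have [K EK gK] := tile_good tX.
have /(tile_side b EK gK)[k kK Eb] := sb; exists K, k; rewrite -Eb; split=> //; split=> //.
by rewrite -EK.
Qed.

(** A point just beyond the wall lies in another tile, which contains [z] by [tiles_near]. The half
    disks of the two tiles at [z] are disjoint, so their lines agree with opposite orientation. *)
Lemma wall_other K k z : wall K k -> line k z -> exists K' k',
 [/\ wall K' k', line k' = line k & hpl k' = hpl (k * Sop)%g].
Proof.
move=> Wk kz; have [tX gK kK] := Wk; have Hz : uhp z by case: kz.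
have [w [nw Hw nk]] := near_neg kz (tiles_near Hz).
have [X' tX' Xw'] := tile_cover Hw.
have Xz' := nw _ tX' Xw'.
have Xz : poly K z by exact: (gK.2 _ kK _ kz).
have XX' : poly K <> X' by move=> E; move: Xw'; rewrite -E => -[_ /(_ k kK)]; rewrite leNgt nk.
have [X'i|[K' [k' [EK gK' kK' kz']]]] := tile_pt tX' Xz'.
 by case: XX'; rewrite (tile_eq tX' tX X'i Xz).
have Wk' : wall K' k' by split=> //; rewrite -EK.
exists K', k'; split=> //.
 have [|//] := halfdisc_disjoint kz kz' _.
 apply: (@filterS C _ (nbhs_filter z) _ _ _ (@filterI C (nbhs z) (@nbhs_filter C z) _ _
  (wall_near Wk kz) (wall_near Wk' kz'))) => u [h1 h2] [/h1 p1 /h2 p2].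
 apply: XX'; apply: (tile_eq tX tX' (z := u)); first by rewrite interior_poly.
 by rewrite EK; exact: ipoly_sub.
have [|//] := halfdisc_disjoint kz kz' _.
apply: (@filterS C _ (nbhs_filter z) _ _ _ (@filterI C (nbhs z) (@nbhs_filter C z) _ _
 (wall_near Wk kz) (wall_near Wk' kz'))) => u [h1 h2] [/h1 p1 /h2 p2].
apply: XX'; apply: (tile_eq tX tX' (z := u)); first by rewrite interior_poly.
by rewrite EK; exact: ipoly_sub.
Qed.

(** On both sides of the wall a half disk lies in an open tile, so near [z] nothing of [BS] is left
    but the line. *)
Lemma base_near K k z : wall K k -> line k z -> \forall w \near z, base_set Gam AA w <-> line k w.
Proof.
move=> Wk kz; have [K' [k' [Wk' El Eh]]] := wall_other Wk kz.
have kz' : line k' z by rewrite El.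
have n12 := @filterI C (nbhs z) (@nbhs_filter C z) _ _ (wall_near Wk kz) (wall_near Wk' kz').
have Hz : uhp z by case: kz.
have n123 := @filterI C (nbhs z) (@nbhs_filter C z) _ _ n12 (nbhs_uhp Hz).
apply: filterS n123 => w [[h1 h2] Hw]; split; last by move=> h; exact: (wall_base Wk h).
move=> /base_setE[_ no]; split=> //; case: (ltgtP (side_ k w) 0) => // s; exfalso.
 have [t2 _ _] := Wk'; apply: (no _ t2); rewrite interior_poly; apply: h2; rewrite Eh; split=> //.
 by rewrite qfN oppr_gt0.
by have [t2 _ _] := Wk; apply: (no _ t2); rewrite interior_poly; apply: h1; split.
Qed.

End Walls.

(** * Derivatives along geodesics *)

Section Derivatives.
Implicit Types (g h k : G) (z w v u : C) (x y t e d : R).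

Lemma den_axis h t : den h (pt 0 (expR t)) = ec h ^+ 2 * expR t ^+ 2 + ed h ^+ 2.
Proof. by rewrite /den re_pt im_pt; ring. Qed.

Lemma gp_re h t : re (gp h t) = (al h * expR t ^+ 2 + be h) / den h (pt 0 (expR t)).
Proof. by rewrite /gp mobC_re qf_axis. Qed.

Lemma gp_im h t : im (gp h t) = expR t / den h (pt 0 (expR t)).
Proof. by rewrite /gp mobC_im. Qed.

Lemma den_axis0 h t : ec h ^+ 2 * expR t ^+ 2 + ed h ^+ 2 != 0.
Proof. by rewrite -den_axis; apply: den_neq0; rewrite /uhp /= expR_gt0. Qed.

Lemma velocity2 h t : (velocity h t).2 =
 pt (2 * ec h * ed h * expR t ^+ 2 / (ec h ^+ 2 * expR t ^+ 2 + ed h ^+ 2) ^+ 2)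
   (expR t * (ed h ^+ 2 - ec h ^+ 2 * expR t ^+ 2) / (ec h ^+ 2 * expR t ^+ 2 + ed h ^+ 2) ^+ 2).
Proof.
have J0 : jfac h (pt 0 (expR t)) ^+ 2 != 0 by rewrite expf_neq0 // jfac_neq0 // /uhp /= expR_gt0.
rewrite /velocity /mobT /=; apply: (mulIf J0); rewrite divfK //.
have -> : jfac h (pt 0 (expR t)) = pt (ed h) (ec h * expR t).
 by rewrite -[LHS]ptK jfac_re jfac_im re_pt im_pt mulr0 add0r.
have := den_axis0 h t; move: (expR t) => E D0.
move: (ec h) (ed h) D0 => c d D0.
by apply: Cext; rewrite /re /im /=; field; apply: contra_neq D0 => <-; ring.
Qed.

Lemma is_derive_val (f : R -> R) t (a b : R) : is_derive t 1 f a -> a = b -> is_derive t 1 f b.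
Proof. by move=> h <-. Qed.

Lemma derive_affE2 (a b : R) t : is_derive t 1 (fun s => a * expR s ^+ 2 + b) (2 * a * expR t ^+ 2).
Proof.
apply: is_derive_eq; rewrite /GRing.scale /= ; ring.
Qed.

Lemma derive_quot h (f : R -> R) t f' (D := ec h ^+ 2 * expR t ^+ 2 + ed h ^+ 2) : is_derive t 1 f f' ->
 is_derive t 1 (fun s => f s / (ec h ^+ 2 * expR s ^+ 2 + ed h ^+ 2))
  ((f' * D - f t * (2 * ec h ^+ 2 * expR t ^+ 2)) / D ^+ 2).
Proof.
move=> hf; have hd := derive_affE2 (ec h ^+ 2) (ed h ^+ 2) t; have d0 := den_axis0 h t.
have hV := @is_deriveV R _ t _ 1 d0 hd.
apply: is_derive_val (is_deriveM hf hV) _.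
by rewrite /GRing.scale /= -/D; field; exact: d0.
Qed.

Lemma gp_derive h t : is_derive t 1 (fun s => re (gp h s)) (re (velocity h t).2) /\
 is_derive t 1 (fun s => im (gp h s)) (im (velocity h t).2).
Proof.
have D0 : ec h ^+ 2 * expR t ^+ 2 + ed h ^+ 2 != 0.
 by rewrite -den_axis; apply: den_neq0; rewrite /uhp /= expR_gt0.
have dt := edet h.
rewrite velocity2 re_pt im_pt; split.
 rewrite (_ : (fun s => re (gp h s)) =
  fun s => (al h * expR s ^+ 2 + be h) / (ec h ^+ 2 * expR s ^+ 2 + ed h ^+ 2)); last first.
  by apply/funext => s; rewrite gp_re den_axis.
 apply: is_derive_val (derive_quot h (derive_affE2 _ _ _)) _.
 congr (_ / _); rewrite /al /be -[RHS]mulr1 -dt; ring.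
rewrite (_ : (fun s => im (gp h s)) = fun s => expR s / (ec h ^+ 2 * expR s ^+ 2 + ed h ^+ 2)); last first.
 by apply/funext => s; rewrite gp_im den_axis.
apply: is_derive_val (derive_quot h (is_derive_expR t)) _.
congr (_ / _); ring.
Qed.

Definition dside k z u : R := 2 * lead k * (re z * re u + im z * im u) +
 (side_ k (pt 1 0) - side_ k (pt 0 0) - lead k) * re u.

Lemma side_derive k (c : R -> C) t u : is_derive t 1 (fun s => re (c s)) (re u) ->
 is_derive t 1 (fun s => im (c s)) (im u) ->
 is_derive t 1 (fun s => side_ k (c s)) (dside k (c t) u).
Proof.
move=> h1 h2; rewrite (_ : (fun s => side_ k (c s)) = fun s => lead k * (re (c s) ^+ 2 + im (c s) ^+ 2) +
 (side_ k (pt 1 0) - side_ k (pt 0 0) - lead k) * re (c s) + side_ k (pt 0 0)); last first.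
 by apply/funext => s; rewrite side_lead.
apply: is_derive_eq; rewrite /dside /GRing.scale /=; ring.
Qed.

(** At a point of the line, crossing it transversally means that [al (k^-1 * h)] is not 0. *)
Lemma side_gp_derive k h t : side_ k (gp h t) = 0 ->
 dside k (gp h t) (velocity h t).2 = 2 * al (k^-1 * h)%g * expR t ^+ 2 / den h (pt 0 (expR t)).
Proof.
move=> s0; have [h1 h2] := gp_derive h t.
have d1 := side_derive k h1 h2.
have D0 : ec h ^+ 2 * expR t ^+ 2 + ed h ^+ 2 != 0.
 by rewrite -den_axis; apply: den_neq0; rewrite /uhp /= expR_gt0.
set m := (k^-1 * h)%g.
have d2 : is_derive t 1 (fun s => side_ k (gp h s))
  ((2 * al m * expR t ^+ 2 * (ec h ^+ 2 * expR t ^+ 2 + ed h ^+ 2) -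
   (al m * expR t ^+ 2 + be m) * (2 * ec h ^+ 2 * expR t ^+ 2)) / (ec h ^+ 2 * expR t ^+ 2 + ed h ^+ 2) ^+ 2).
 rewrite (_ : (fun s => side_ k (gp h s)) =
  fun s => (al m * expR s ^+ 2 + be m) / (ec h ^+ 2 * expR s ^+ 2 + ed h ^+ 2)); last first.
  apply/funext => s; rewrite -side_gp den_axis mulfK //.
  by rewrite -den_axis; apply: den_neq0; rewrite /uhp /= expR_gt0.
 exact: (derive_quot h (derive_affE2 _ _ _)).
have := @derive_val _ _ _ _ _ _ _ d1; rewrite (@derive_val _ _ _ _ _ _ _ d2) => <-.
have := side_gp k h t; rewrite s0 mul0r -/m => <-; rewrite den_axis.
by field; apply: contra_neq D0 => <-; ring.
Qed.

Lemma derive_cvg_pt (c : R -> C) t u : is_derive t 1 (fun s => re (c s)) (re u) ->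
 is_derive t 1 (fun s => im (c s)) (im u) -> c @ t --> c t.
Proof.
move=> h1 h2; rewrite -[c t]ptK (_ : c = fun s => pt (re (c s)) (im (c s))); last first.
 by apply/funext => s; rewrite ptK.
apply: cvg_pt; apply: differentiable_continuous; apply/derivable1_diffP.
 by case: h1.
by case: h2.
Qed.

End Derivatives.

(** * Crossing times and the ideal ends of geodesics *)

Section Crossing.
Implicit Types (g h k l : G) (z w v u : C) (x y t r e c d : R) (A X B b : set C) (K : seq G).
Local Notation BS := (base_set Gam AA).

Lemma line_zero k h t : line k (gp h t) -> al (k^-1 * h)%g * expR t ^+ 2 + be (k^-1 * h)%g = 0.
Proof. by move=> kt; have := side_gp_eq0 k h t; rewrite (proj2 kt) eqxx => /esym/eqP. Qed.

Lemma al0_line k h t : line k (gp h t) -> al (k^-1 * h)%g = 0 <-> forall s, line k (gp h s).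
Proof.
move=> kt; have E := line_zero kt; split.
 move=> a0 s; split; first exact: gp_uhp.
 by apply/eqP; rewrite side_gp_eq0 a0 mul0r add0r; move: E; rewrite a0 mul0r add0r => ->.
move=> all; have := side_gp_eq0 k h (t + 1); rewrite (proj2 (all _)) eqxx => /esym/eqP E2.
have := expR2_lt t (t + 1); rewrite ltrDl ltr01 => lt.
have /eqP : al (k^-1 * h)%g * (expR (t + 1) ^+ 2 - expR t ^+ 2) = 0 by lra; lra.
by rewrite mulf_eq0 => /orP[/eqP//|/eqP]; lra.
Qed.

(** Tangency allows any differentiable curve in [BS]. Near the base point such a curve stays on one
    line, so the equation of the line has derivative 0 along it, and this derivative is a nonzero
    multiple of [al]. *)
Lemma tangentP K k h t : wall K k -> line k (gp h t) ->
 tangent_to BS (velocity h t) <-> forall s, line k (gp h s).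
Proof.
move=> Wk kt; rewrite -(al0_line kt).
have [s0 z0] : side_ k (gp h t) = 0 /\ (velocity h t).1 = gp h t by split; [exact: kt.2|].
split.
 case=> c [c0 cB h1 h2]; have cc := derive_cvg_pt h1 h2.
 rewrite z0 in c0; rewrite c0 in cc.
 have nl : \forall s \near 0, line k (c s).
  have n2 : \forall s \near 0, (BS (c s) <-> line k (c s)) by exact: (cc _ (base_near Wk kt)).
  by apply: (@filterS2 _ _ (nbhs_filter _) _ _ _ _ n2 cB) => s [h3 _] /h3.
 have d1 := side_derive k h1 h2; rewrite c0 (side_gp_derive s0) in d1.
 have d0 : is_derive (0 : R) 1 (fun s => side_ k (c s)) 0.
  apply: (@near_eq_is_derive _ _ _ (cst 0)); rewrite ?oner_neq0 //.
  by apply: filterS nl => s [_ ->].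
 have := @derive_val _ _ _ _ _ _ _ d1; rewrite (@derive_val _ _ _ _ _ _ _ d0) => /esym/eqP.
 rewrite mulf_eq0 invr_eq0 (negbTE (den_neq0 _ _)) ?orbF; last by rewrite /uhp /= expR_gt0.
 have e0 : expR t ^+ 2 != 0 by rewrite expf_neq0 // gt_eqF ?expR_gt0.
 by rewrite (mulf_eq0 _ (expR t ^+ 2)) (negbTE e0) orbF mulf_eq0 pnatr_eq0 => /eqP.
move/(al0_line kt) => all; exists (fun s => gp (h * at_ t)%g s).
have [h1 h2] := gp_derive (h * at_ t)%g 0.
rewrite velocity_at add0r in h1 h2; split=> //.
 by rewrite gp_at add0r.
by apply: filterE => s; apply: (wall_base Wk); rewrite gp_at.
Unshelve. all: by end_near.
Qed.

Definition cross h : set R := [set t | cross_section Gam AA (velocity h t)].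

Lemma crossP h t : cross h t <-> exists K k, [/\ wall K k, line k (gp h t) & ~ forall s, line k (gp h s)].
Proof.
split.
 case=> _ Bt nT; have [K [k [Wk kt]]] := base_wall Bt.
 by exists K, k; split=> // all; apply: nT; apply/(tangentP Wk kt).
move=> [K [k [Wk kt nT]]]; split; first exact: SH_velocity.
 exact: (wall_base Wk).
by move/(tangentP Wk kt).
Qed.

Lemma cross_Sop h t : cross (h * Sop)%g t <-> cross h (- t).
Proof.
split=> /crossP[K [k [Wk kt nT]]]; apply/crossP; exists K, k; split=> //.
- by rewrite -gp_Sop.
- by move=> all; apply: nT => s; rewrite gp_Sop.
- by rewrite gp_Sop.
- by move=> all; apply: nT => s; have := all (- s); rewrite gp_Sop opprK.
Qed.

Lemma cross_at h s t : cross (h * at_ s)%g t <-> cross h (t + s).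
Proof. by rewrite /cross /= velocity_at. Qed.

Lemma cross_mob g h t : Gam g -> cross (g * h)%g t <-> cross h t.
Proof.
have sub g' h' : Gam g' -> cross h' t -> cross (g' * h')%g t.
 move=> Gg /crossP[K [k [[tX gK kK] kt nT]]]; apply/crossP.
 exists [seq (g' * k)%g | k <- K], (g' * k)%g; split.
 - split; [by rewrite -mob_poly; exact: tile_mob|exact: good_mob|exact: map_f].
 - by rewrite -line_mobC -mobC_gp; exists (gp h' t).
 move=> all; apply: nT => s; have := all s; rewrite -line_mobC -mobC_gp => -[w kw E].
 by rewrite -(mobCK g' (gp_uhp h' s)) -E mobCK //; case: kw.
move=> Gg; split; last exact: sub.
by move=> /(sub _ _ (GamV Gg)); rewrite mulKg.
Qed.

Lemma line_once k h s t : line k (gp h t) -> line k (gp h s) -> (~ forall s, line k (gp h s)) -> s = t.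
Proof.
move=> kt ks nT; have E1 := line_zero kt; have E2 := line_zero ks.
have a0 : al (k^-1 * h)%g != 0 by apply/eqP => /(al0_line kt).
have : expR s ^+ 2 = expR t ^+ 2 by apply: (mulfI a0); lra.
move=> E; by apply: le_anti; rewrite -(expR2_mono s t) -(expR2_mono t s) E lexx.
Qed.

Lemma cross_isolated h t : cross h t ->
 exists2 e, 0 < e & forall s, `|s - t| < e -> s <> t -> ~ BS (gp h s).
Proof.
move=> /crossP[K [k [Wk kt nT]]].
have /nbhs_ballP[e /= e0 He] := gp_near (base_near Wk kt).
exists e => // s st nst Bs; apply: nst; apply: (line_once kt _ nT).
by apply/(He s _); rewrite // /ball /= distrC.
Qed.

Lemma cross_not_inside h K k t : wall K k -> (forall r, line k (gp h r)) -> ~ cross h t.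
Proof.
move=> Wk all /cross_isolated[e e0 He].
apply: (He (t + e / 2)).
- by rewrite addrC addKr gtr0_norm; lra.
- lra.
by apply: (wall_base Wk).
Qed.

Lemma not_cross_near h t : ~ cross h t -> \forall s \near t, ~ cross h s.
Proof.
move=> nc; have [Bt|nB] := pselect (BS (gp h t)).
 have [K [k [Wk kt]]] := base_wall Bt.
 have all : forall s, line k (gp h s).
  by apply: contrapT => nT; apply: nc; apply/crossP; exists K, k.
 by apply: filterE => s; exact: (@cross_not_inside h K k s Wk all).
have [X [tX Xt]] : exists X, tile X /\ X^° (gp h t).
 apply: contrapT => no; apply: nB; apply/base_setE => //; split; first exact: gp_uhp.
 by move=> X tX Xt; apply: no; exists X.
have n1 : \forall s \near t, X^° (gp h s).
 by apply: gp_near; apply: near_open => //; exact: open_interior.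
apply: filterS n1 => s Xs -[_ /base_setE[_ /(_ X tX)] //].
Qed.

(** Crossing times are isolated, and a time without crossing has a neighbourhood without crossings;
    so they cannot accumulate. *)
Lemma finite_cross h (a b : R) : finite_set (cross h `&` [set t | a <= t <= b]).
Proof.
apply: contrapT => inf.
have [x0 [s [s1 acc]]] := accumulation inf (fun (y : R) yX => proj2 yX).
have [e e0 He] : exists2 e, 0 < e & forall t, `|t - x0| < e -> t <> x0 -> ~ cross h t.
 have [c0|nc] := pselect (cross h x0).
  have [e e0 He] := cross_isolated c0; exists e => // t h1 h2 [_ Bt _]; exact: He h1 h2 Bt.
 have /nbhs_ballP[e /= e0 He] := not_cross_near nc; exists e => // t h1 _; apply: He.
 by rewrite /ball /= distrC.
have [y [[cy _] yb]] := infinite_setN0 (acc e e0).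
apply: (He y) => //; last by move=> E; move: yb; rewrite E subrr mulr0 ltxx.
by rewrite ltr_norml; case: s1 yb => ->; lra.
Qed.

Lemma next_cross h t0 t : t0 < t -> cross h t -> exists t1, [/\ t0 < t1 <= t, cross h t1 &
 forall s, t0 < s < t1 -> ~ cross h s].
Proof.
move=> lt ct; have [s Es] := (finite_seqP _).1 (finite_cross h t0 t).
have inE x : x \in s <-> cross h x /\ t0 <= x <= t.
 by have : [set` s] x <-> (cross h `&` [set t1 | t0 <= t1 <= t]) x by rewrite Es.
have ts : t \in [seq x <- s | t0 < x] by rewrite mem_filter lt; apply/inE; split=> //; lra.
have [x + xmin] := seq_min id ts; rewrite mem_filter => /andP[x0 /inE[cx xb]].
exists x; split=> //; first lra.
move=> r rb cr; have : x <= r by apply: xmin; rewrite mem_filter (_ : t0 < r) /=; [apply/inE; split=> //; lra|lra].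
lra.
Qed.

Lemma al_pos k h t0 t : line k (gp h t0) -> 0 < side_ k (gp h t) -> (0 < al (k^-1 * h)%g) = (t0 < t).
Proof.
move=> kt; rewrite side_gp_gt0 => p; have E := line_zero kt; rewrite -expR2_lt.
have : 0 < al (k^-1 * h)%g * (expR t ^+ 2 - expR t0 ^+ 2) by lra; lra.
move: (al _) (expR t ^+ 2) (expR t0 ^+ 2) => a x y; rewrite -[y < x]subr_gt0; move: (x - y) => q aq.
nra.
Qed.

(** The wall is oriented so that [h] enters its positive side; if it leaves the given tile, the tile
    beyond comes from [wall_other]. *)
Lemma cross_wall h t0 : cross h t0 -> exists K k, [/\ wall K k, line k (gp h t0), 0 < al (k^-1 * h)%g &
 exists2 e, 0 < e & forall t, t0 < t < t0 + e -> ipoly K (gp h t)].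
Proof.
have half K k : wall K k -> line k (gp h t0) -> 0 < al (k^-1 * h)%g ->
  exists2 e, 0 < e & forall t, t0 < t < t0 + e -> ipoly K (gp h t).
 move=> Wk kt a0; have /nbhs_ballP[e /= e0 He] := gp_near (wall_near Wk kt).
 exists e => // t tb; apply: He; first by rewrite /ball /= ltr_norml; lra.
 split; first exact: gp_uhp.
 have E := line_zero kt; rewrite side_gp_gt0.
 have : expR t0 ^+ 2 < expR t ^+ 2 by rewrite expR2_lt; lra.
 nra.
move=> /crossP[K [k [Wk kt nT]]].
have a0 : al (k^-1 * h)%g != 0 by apply/eqP => /(al0_line kt).
case: (ltgtP 0 (al (k^-1 * h)%g)) a0 => // a0 _.
 by exists K, k; split=> //; exact: (half K k).
have [K' [k' [Wk' El Eh]]] := wall_other Wk kt.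
have kt' : line k' (gp h t0) by rewrite El.
have a0' : 0 < al (k'^-1 * h)%g.
 have neg : side_ k (gp h (t0 + 1)) < 0.
  rewrite ltNge side_gp_ge0 -ltNge.
  have E := line_zero kt.
  have : expR t0 ^+ 2 < expR (t0 + 1) ^+ 2 by rewrite expR2_lt; lra.
  nra.
 have : hpl k' (gp h (t0 + 1)) by rewrite Eh; split; [exact: gp_uhp|rewrite qfN oppr_gt0].
 by case=> _ /(al_pos kt') ->; lra.
by exists K', k'; split=> //; exact: (half K' k').
Qed.

(** The geodesic can leave the open tile only through a side, and having been in the interior it
    does not run inside that side; so leaving is a crossing. *)
Lemma stay K h t0 t1 : tile (poly K) -> good_poly K -> (exists2 e, 0 < e & forall t, t0 < t < t0 + e -> ipoly K (gp h t)) ->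
 (forall t, t0 < t < t1 -> ~ cross h t) -> forall t, t0 < t < t1 -> ipoly K (gp h t).
Proof.
move=> tX gK [e e0 He] nc t tb.
have [s [s1 s2 s3]] : exists s : R, [/\ t0 < s, s < t0 + e & s < t].
 by apply: ltr_ex2; lra.
apply: (@real_clopen (fun r => ipoly K (gp h r)) s t); first lra.
- by apply: He; lra.
- move=> r _ Kr; have /nbhs_ballP[d /= d0 Hd] := gp_near (near_open (@open_ipoly _ K) Kr).
 by exists d => // r' _ h1; apply: Hd; rewrite /ball /= distrC.
move=> r rb lim; split; first exact: gp_uhp.
have ge k : k \in K -> 0 <= side_ k (gp h r).
 move=> kK; rewrite leNgt; apply/negP => neg.
 have n1 : nbhs (gp h r) [set w | side_ k w < 0].
  by apply: near_open => //; apply: open_ltc; exact: cts_side.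
 have /nbhs_ballP[d /= d0 Hd] := gp_near n1.
 have [r' [_ h1 [_ /(_ k kK)]]] := lim d d0.
 have : side_ k (gp h r') < 0 by apply: Hd; rewrite /ball /= distrC.
 by lra.
move=> k kK; rewrite lt_neqAle ge // andbT; apply/negP => /eqP k0.
have kr : line k (gp h r) by split; [exact: gp_uhp|].
apply: (nc r); first lra.
apply/crossP; exists K, k; split=> // all.
have [_ /(_ k kK)] : ipoly K (gp h s) by apply: He; lra.
by rewrite (proj2 (all s)) ltxx.
Qed.

(** Near the common point [BS] consists of the first line alone, so a piece of the second lies on
    it. *)
Lemma wall_meet K k K' k' z : wall K k -> wall K' k' -> line k z -> line k' z -> line k = line k'.
Proof.
move=> Wk Wk' kz kz'; have [t0 Et] := lineP kz'.
rewrite -Et in kz; have n1 := gp_near (base_near Wk kz).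
have /nbhs_ballP[e /= e0 He] := n1.
have kt : line k (gp k' (t0 + e / 2)).
 apply/(He (t0 + e / 2)); first by rewrite /ball /= opprD addNKr normrN gtr0_norm; lra.
 by apply: (wall_base Wk'); exact: gp_line.
apply: (line_eq2 (z := gp k' t0) (w := gp k' (t0 + e / 2))) => //; try exact: gp_line.
by move=> /gp_inj; lra.
Qed.

Lemma compact_box (M : R) : compact [set w : C | `|re w| <= M /\ `|im w| <= M].
Proof.
have -> : [set w : C | `|re w| <= M /\ `|im w| <= M] =
  (fun p : R * R => pt p.1 p.2) @` (([set` `[- M, M]%R] : set R) `*` ([set` `[- M, M]%R] : set R)).
 apply/predeqP => w; split=> [[h1 h2]|[[x y] /= [h1 h2] <-]].
  by exists (re w, im w); rewrite /= ?ptK // !in_itv /= -!ler_norml.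
 by move: h1 h2; rewrite !in_itv /= -!ler_norml.
apply: continuous_compact; last by apply: compact_setX; exact: segment_compact.
apply: continuous_subspaceT => p; apply: cvg_pt; [exact: cvg_fst|exact: cvg_snd].
Qed.

Lemma ideal_chpl X k p : X `<=` chpl k -> ideal_boundary X p -> csd k p.
Proof.
move=> Xk [clX bp]; case: p clX bp => [z|] clX bp; rewrite /csd leNgt; apply/negP => neg.
 have n1 : nbhs z [set w | side_ k w < 0].
  by apply: near_open => //; apply: open_ltc; exact: cts_side.
 have [_ [[w Xw <-] [w' /= w'n [E]]]] := clX _ (one_point_compactification_some_nbhs _ _ n1).
 by have [_] := Xk w Xw; rewrite -E; lra.
(* With a negative leading coefficient the closed half plane is contained in a Euclidean disk, by
   completing the square, so infinity is not in its closure. *)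
pose L := lead k; pose B := side_ k (pt 1 0) - side_ k (pt 0 0) - lead k.
pose c := - B / (2 * L); pose rho := B ^+ 2 / (4 * L ^+ 2) - side_ k (pt 0 0) / L.
pose M := `|c| + `|rho| + 1.
have cc := @compact_box M.
have cl : closed [set w : C | `|re w| <= M /\ `|im w| <= M].
 by apply: compact_closed => //; exact: norm_hausdorff.
have nN : nbhs (None : sphere R) ((Some @` (~` [set w : C | `|re w| <= M /\ `|im w| <= M])) `|` [set None]).
 by exists [set w : C | `|re w| <= M /\ `|im w| <= M].
have [_ [[w Xw <-] [[w' /= w'n [E]]|//]]] := clX _ nN.
apply: w'n; rewrite E; have [_] := Xk w Xw; rewrite side_lead -/L -/B => ge.
have dd : (re w - c) ^+ 2 + im w ^+ 2 <= rho.
 rewrite -subr_ge0 -(pmulr_rge0 _ (_ : 0 < - L)) ?oppr_gt0 //.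
 rewrite (_ : - L * _ = L * (re w ^+ 2 + im w ^+ 2) + B * re w + side_ k (pt 0 0)) //.
 by rewrite /rho /c; field; rewrite lt_eqF.
have s1 := sqr_ge0 (re w - c); have s2 := sqr_ge0 (im w).
have a1 : `|re w - c| <= `|rho| + 1 by apply: sq_bound; have := ler_norm rho; lra.
have a2 : `|im w| <= `|rho| + 1 by apply: sq_bound; have := ler_norm rho; lra.
split; last by have := normr_ge0 c; rewrite /M; lra.
by have := ler_normD (re w - c) c; rewrite subrK /M; lra.
Qed.

Lemma bdry_geod h : bdry_pt (geod h +oo).
Proof. by rewrite geod_pinf; case: eqP => _; [left|right; exists (ea h / ec h)]. Qed.

Lemma expR_large (a b : R) : exists t, a < t /\ b < expR t.
Proof.
exists (`|a| + `|b| + 1); have := ler_norm a; have := ler_norm b; have := normr_ge0 a; have := normr_ge0 b.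
by have := expR_ge1Dx (`|a| + `|b| + 1); lra.
Qed.

Lemma ray_ideal X h t0 : (forall t, t0 < t -> X (gp h t)) -> ideal_boundary X (geod h +oo).
Proof.
move=> Xh; split; last exact: bdry_geod.
rewrite geod_pinf; have dt := edet h; case: eqP => [c0|/eqP c0] U.
 case=> K [cK _] KU.
 have cI : compact (@im R @` K) by apply: continuous_compact cK; apply: continuous_subspaceT; exact: cts_im.
 have [M [_ HM]] := compact_bounded cI.
 have bd w : K w -> im w <= M + 1.
  move=> Kw; apply: le_trans (ler_norm _) _; apply: (HM (M + 1)); first lra.
  by exists w.
 have d0 : 0 < ed h ^+ 2.
  by rewrite exprn_even_gt0 //=; apply: contra_eq_neq dt => ->; rewrite c0 !mulr0 subr0 eq_sym oner_neq0.
 have [t [tt te]] := expR_large t0 ((M + 1) * ed h ^+ 2).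
 exists (Some (gp h t)); split; first by exists (gp h t) => //; exact: Xh.
 apply: KU; left; exists (gp h t) => // /bd; rewrite gp_im den_axis c0 expr0n mul0r add0r.
 by rewrite ler_pdivrMr //; lra.
move=> nU; have /nbhs_box[e e0 He] : nbhs (pt (ea h / ec h) 0 : C) [set w : C | U (Some w)] by exact: nU.
(* Chosen so that for [e^t > q] both coordinates of [gp h t] are within [e] of the end
   [ea h / ec h]. *)
pose c := ec h; pose q := `|ed h / c ^+ 3| / e + (c ^+ 2 * e)^-1 + 1.
have c2 : 0 < c ^+ 2 by rewrite exprn_even_gt0.
have q1 : 0 <= `|ed h / c ^+ 3| / e by rewrite divr_ge0 // ltW.
have q2 : 0 < (c ^+ 2 * e)^-1 by rewrite invr_gt0 mulr_gt0.
have [t [tt te]] := expR_large t0 q.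
exists (Some (gp h t)); split; first by exists (gp h t) => //; exact: Xh.
apply: (He (gp h t)).
have E0 := expR_gt0 t; have d2 := sqr_ge0 (ed h).
have E1 : 1 < expR t by rewrite /q in te; lra.
have E2 : expR t < expR t ^+ 2 by nra.
have Dge : c ^+ 2 * expR t ^+ 2 <= ec h ^+ 2 * expR t ^+ 2 + ed h ^+ 2 by rewrite -/c lerDl.
have Dp : 0 < ec h ^+ 2 * expR t ^+ 2 + ed h ^+ 2 by nra; rewrite mulr_gt0 // exprn_gt0.
split.
 rewrite gp_re den_axis re_pt.
 have -> : (al h * expR t ^+ 2 + be h) / (ec h ^+ 2 * expR t ^+ 2 + ed h ^+ 2) - ea h / ec h =
   - (ed h / c ^+ 3) * (c ^+ 2 / (ec h ^+ 2 * expR t ^+ 2 + ed h ^+ 2)).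
  rewrite /al /be /c -[ed h / ec h ^+ 3]mulr1 -dt; field.
  lra.
 rewrite normrM normrN [X in _ * X]ger0_norm; last by rewrite divr_ge0 // ltW.
 rewrite mulrA ltr_pdivrMr //.
 have h1 : `|ed h / c ^+ 3| < e * expR t ^+ 2.
  by rewrite [e * _]mulrC -ltr_pdivrMr //; rewrite /q in te; lra.
 apply: lt_le_trans (_ : e * expR t ^+ 2 * c ^+ 2 <= _); first by rewrite ltr_pM2r.
 nra.
rewrite gp_im den_axis im_pt subr0 ger0_norm; last by rewrite divr_ge0 ?ltW.
rewrite ltr_pdivrMr //; apply: lt_le_trans (_ : e * (c ^+ 2 * expR t ^+ 2) <= _); last by rewrite ler_pM2l.
have h2 : 1 < (c ^+ 2 * e) * expR t.
 have m0 : 0 < c ^+ 2 * e by nra.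
 by rewrite -ltr_pdivrMl // mulr1; rewrite /q in te; lra.
have := ltr_pM2r E0 1 (c ^+ 2 * e * expR t); rewrite h2 mul1r expr2 => h3.
lra.
Qed.

Lemma side_zero k l s r : s <= r -> side_ k (gp l s) < 0 -> 0 <= side_ k (gp l r) ->
 exists t, [/\ s <= t <= r, line k (gp l t) & ~ forall t, line k (gp l t)].
Proof.
move=> sr neg; rewrite side_gp_ge0; set a := al _; set b := be _ => pos.
have neg2 : a * expR s ^+ 2 + b < 0 by rewrite ltNge -side_gp_ge0 -ltNge.
have := sr; rewrite -expR2_mono => sr2.
have a0 : 0 < a by rewrite ltNge; apply/negP => h; nra.
have q0 : 0 < - b / a by rewrite divr_gt0 //; nra.
exists (ln (- b / a) / 2).
have E : expR (ln (- b / a) / 2) ^+ 2 = - b / a by rewrite expr2 expR_half lnK.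
split.
- by rewrite -(expR2_mono s) -(expR2_mono _ r) E ler_pdivlMr // ler_pdivrMr //; apply/andP; split; lra.
- split; first exact: gp_uhp.
 have E2 : a * (- b / a) + b = 0 by field; rewrite gt_eqF.
 by apply/eqP; rewrite side_gp_eq0 -/a -/b E E2.
by move=> /(_ s)[_]; lra.
Qed.

Lemma finite_ubound (Y : set R) : finite_set Y -> exists M, forall y, Y y -> y <= M.
Proof.
move/finite_seqP => [s ->]; elim: s => [|a s [M HM]]; first by exists 0.
exists (`|a| + `|M|) => y; have := ler_norm a; have := ler_norm M; have := normr_ge0 a; have := normr_ge0 M.
by rewrite /= inE => ? ? ? ? /orP[/eqP->|/HM]; lra.
Qed.

(** The fixed segment from [gp h 0] to [z] crosses every such wall, because its start is on the
    negative side. It meets finitely many walls, and [h] crosses each line only once. *)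
Lemma crossed_far h z : uhp z -> finite_set [set t | 0 < t /\ exists K k,
 [/\ wall K k, line k (gp h t), 0 < al (k^-1 * h)%g & 0 <= side_ k z]].
Proof.
move=> Hz; have [l [s [r [El Er sr]]]] := join_ex (gp_uhp h 0) Hz.
apply: sub_finite_set (_ : _ `<=` \bigcup_(u in cross l `&` [set u | s <= u <= r])
  [set t | exists K k, [/\ wall K k, line k (gp l u), line k (gp h t) & ~ forall s, line k (gp h s)]]) _.
 move=> t [t0 [K [k [Wk kt a0 ge]]]].
 have E := line_zero kt.
 have neg : side_ k (gp l s) < 0.
  rewrite El ltNge side_gp_ge0 -ltNge.
  by have := t0; rewrite -expR2_lt -(ltr_pM2l a0); lra.
 rewrite -Er in ge; have [u [ub ku nT]] := side_zero sr neg ge.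
 exists u; first by split=> //; apply/crossP; exists K, k.
 by exists K, k; split=> // /(al0_line kt); lra.
apply: bigcup_finite; first exact: finite_cross.
move=> u _; apply: finite_subsingleton => t t' [K [k [Wk ku kt nT]]] [K' [k' [Wk' ku' kt' nT']]].
have E := wall_meet Wk Wk' ku ku'; rewrite -E in kt'.
exact: (line_once kt' kt nT).
Qed.

Lemma al_Sop k h : al ((k * Sop)^-1 * h)%g = - al (k^-1 * h)%g.
Proof. by rewrite !al_side; case: ifP => _; rewrite ?leadN ?qfN ?mulNr ?mulrN. Qed.

Lemma tile_onside X K k z : tile X -> wall K k -> X^° z -> side_ k z < 0 -> X `<=` chpl (k * Sop)%g.
Proof.
move=> tX Wk Xz neg w Xw; have [L EL [_ gL]] := tile_good tX.
have Hw : uhp w by exact: (tile_uhp tX).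
split=> //; rewrite qfN oppr_ge0 leNgt; apply/negP => pos.
rewrite EL in Xz Xw; rewrite interior_poly in Xz.
have [v [Lv kv]] := closure_ipoly Xz Xw (near_open (@open_hpl _ k) (conj Hw pos)).
have [u Lu ku] := seg_cross_in (@hconvex_ipoly _ L) Xz Lv neg (proj2 kv).
have /base_setE[_ /(_ X tX)] := wall_base Wk ku.
by apply; rewrite EL interior_poly.
Qed.

Definition nic h : Prop := exists2 X, tile X & ideal_boundary X (geod h +oo).

(** By [crossed_far] for an interior point of the tile, walls crossed late have the whole tile
    behind them, hence also its ideal boundary, whereas the end of [h] lies strictly in front. *)
Lemma nic_bounded h : nic h -> exists t1, forall t, t1 < t -> ~ cross h t.
Proof.
move=> [X tX iX]; have [z Xz] := tile_int tX.
have Hz : uhp z by apply: (tile_uhp tX); exact: interior_subset Xz.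
have [M HM] := finite_ubound (crossed_far h Hz).
exists (`|M|) => t tM ct; have [K [k [Wk kt a0 _]]] := cross_wall ct.
have neg : side_ k z < 0.
 rewrite ltNge; apply/negP => ge; have : t <= M.
  by apply: HM; split; [have := normr_ge0 M; lra|exists K, k].
 by have := ler_norm M; lra.
have := ideal_chpl (tile_onside tX Wk Xz neg) iX; move/csd_pinf; rewrite al_Sop; lra.
Qed.

Lemma bounded_ray h t0 t1 : cross h t0 -> (forall t, t1 < t -> ~ cross h t) ->
 exists X t2, tile X /\ forall t, t2 < t -> X (gp h t).
Proof.
move=> c0 nc; have fin := finite_cross h t0 t1.
have [s Es] := (finite_seqP _).1 fin.
have inE x : x \in s <-> cross h x /\ t0 <= x <= t1.
 by have : [set` s] x <-> (cross h `&` [set t | t0 <= t <= t1]) x by rewrite Es.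
have t01 : t0 <= t1 by rewrite leNgt; apply/negP => /nc.
have ts : t0 \in s by apply/inE; split=> //; lra.
have [x /inE[cx xb] xmax] := seq_min (fun x : R => - x) ts.
have nx t : x < t -> ~ cross h t.
 move=> xt ct; have [/nc//|tt] := ltP t1 t.
 have : - x <= - t by apply: xmax; apply/inE; split=> //; lra.
 lra.
have [K [k [Wk kx a0 eK]]] := cross_wall cx; have [tX gK _] := Wk.
exists (poly K), x; split=> // t xt; apply: ipoly_sub.
apply: (stay tX gK eK (t1 := t + 1)); last lra.
by move=> r rb; apply: nx; lra.
Qed.

End Crossing.

(** * The action on ideal points and vertical lines *)

Section BoundaryAction.
Implicit Types (g h k : G) (z w v u : C) (x y t e : R).

Lemma mob_real h x : mob h (Some (pt x 0)) = if ec h * x + ed h == 0 then None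
 else Some (pt ((ea h * x + eb h) / (ec h * x + ed h)) 0).
Proof.
have J : jfac h (pt x 0) = pt (ec h * x + ed h) 0.
 by rewrite -[LHS]ptK jfac_re jfac_im re_pt im_pt mulr0.
rewrite /mob J; have -> : (pt (ec h * x + ed h) 0 == 0 :> C) = (ec h * x + ed h == 0).
 by rewrite /pt eq_complex /= eqxx andbT.
case: ifP => // /negbT d0; congr Some; apply: Cext; rewrite ?mobC_re ?mobC_im ?re_pt ?im_pt ?mul0r //.
by rewrite /qf /den re_pt im_pt; field; rewrite ?d0 // mulr0 expr0n addr0 expf_neq0.
Qed.

Lemma mob_geod_pinf h g : mob h (geod g +oo) = geod (h * g)%g +oo.
Proof.
have [s [s2 Ea Eb Ec Ed]] := mul_entries h g; have s0 := sgn_neq0 s2.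
have dt := edet g; rewrite !geod_pinf Ea Ec; case: (eqVneq (ec g) 0) => [c0|c0].
 have a0 : ea g != 0 by nra; rewrite c0 mulr0 mul0r subr0 eq_sym oner_neq0.
 rewrite c0 !mulr0 !addr0 -/(geod h +oo) geod_pinf !mulf_eq0 (negbTE s0) (negbTE a0) orbF /=.
 case: (eqVneq (ec h) 0) => [//|h0]; congr (Some (pt _ _)); field; by rewrite h0 a0 s0.
rewrite mob_real (_ : ec h * (ea g / ec g) + ed h = (ec h * ea g + ed h * ec g) / ec g); last by field.
rewrite !mulf_eq0 invr_eq0 (negbTE c0) (negbTE s0) orbF /=.
case: eqVneq => [//|h0]; congr (Some (pt _ _)); field; by rewrite h0 c0 s0.
Qed.

Lemma mob_geod h g (r : \bar R) : mob h (geod g r) = geod (h * g)%g r.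
Proof.
case: r => [t||].
- rewrite !geod_fin -mobC_gp /mob; case: ifP => // /eqP j0.
 by have := jfac_neq0 h (gp_uhp g t); rewrite j0 eqxx.
- exact: mob_geod_pinf.
by have := mob_geod_pinf h (g * Sop)%g; rewrite mulgA !geod_Sop.
Qed.

Lemma mob_inv_inf h : ec h != 0 -> mob h^-1%g None = Some (pt (ctr h) 0).
Proof.
move=> c0; have := geod_pinf h^-1%g; rewrite ecV0 (negbTE c0) -ctrV ?ecV0 // invgK; exact.
Qed.

Lemma line_vertE x z : line (vert x) z <-> uhp z /\ re z = x.
Proof. by rewrite /line /= side_vert; split=> -[H E]; split=> //; lra. Qed.

Lemma seg_line x : seg (Some (pt x 0)) None = line (vert x).
Proof.
apply/predeqP => z; rewrite line_vertE; split=> [sz|[Hz xz]]; last first.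
 by apply: seg_vert => //; exact: ltW.
have c1 : csd (vert x) (Some (pt x 0)) by apply/csd_vert; rewrite re_pt lexx.
have c2 : csd (vert x) None by apply/csd_vert.
have c3 : csd (vert x * Sop)%g (Some (pt x 0)) by apply/csd_vertS; rewrite re_pt lexx.
have c4 : csd (vert x * Sop)%g None by apply/csd_vertS.
have [Hz h1] := seg_chpl c1 c2 sz; have [_ h2] := seg_chpl c3 c4 sz.
by move: h1 h2; rewrite qfN side_vert => *; split=> //; lra.
Qed.

Lemma mob_vline h : ec h != 0 -> mobC h @` line (vert (ctr h)) = line (vert (ctr h^-1%g)).
Proof.
have sub g : ec g != 0 -> forall z, line (vert (ctr g)) z -> line (vert (ctr g^-1%g)) (mobC g z).
 move=> c0 z /line_vertE[Hz Ez]; apply/line_vertE; split; first exact: mobC_uhp.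
 by rewrite re_mob // Ez subrr mulr0 mul0r subr0.
move=> c0; apply/predeqP => w; split=> [[z kz <-]|kw]; first exact: sub.
have Hw : uhp w by case: kw.
have c0' : ec h^-1%g != 0 by rewrite ecV0.
by exists (mobC h^-1%g w); [have := sub _ c0' _ kw; rewrite invgK|rewrite mobCKV].
Qed.

End BoundaryAction.

(** * Vertical sides of cells, seen from the precells along them *)

Section Columns.
Implicit Types (g h k : G) (z w v u : C) (x y t r e c : R) (A B X : set C) (o : bool).

(* [A] contains the upper end of a one-sided neighbourhood of the vertical line
  over [x]. *)
Definition col A x o : Prop := exists d y0, [/\ 0 < d, 0 < y0 & forall a y,
 (if o then x < a < x + d else x - d < a < x) -> y0 < y -> A^° (pt a y)].

Lemma half_col A c r e : half_of A c r e -> col A c (c < e).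
Proof.
move=> hA; have [r0 ce _ _ _] := half_of_HALF hA.
exists `|e - c|, r; split=> //; first by rewrite normr_gt0 subr_eq0 eq_sym; apply/eqP.
move=> a y ab yr; apply: (half_int hA); first exact: lt_trans yr.
 rewrite re_pt /sbt; case: ltP ab => ec.
  by rewrite gtr0_norm ?subr_gt0 // => ?; apply/orP; left; lra.
 by rewrite ler0_norm ?subr_le0 // => ?; apply/orP; right; lra.
rewrite /nz re_pt im_pt; have := sqr_ge0 (a - c); have : r ^+ 2 < y ^+ 2 by nra.
lra.
Qed.

Lemma CU_col A c r e : CU A c r e -> col A e (e < c).
Proof.
move=> U; have hA : half_of A c r e by constructor 3.
have [r0 /eqP ce _ _ _] := half_of_HALF hA.
exists `|e - c|, r; split=> //; first by rewrite normr_gt0 subr_eq0 eq_sym.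
move=> a y ab yr; apply: (half_int hA); first exact: lt_trans yr.
 rewrite re_pt /sbt; case: (ltgtP e c) ab ce => // ec ab _.
  by rewrite ltr0_norm ?subr_lt0 // in ab *; apply/orP; right; lra.
 by rewrite gtr0_norm ?subr_gt0 // in ab *; apply/orP; left; lra.
rewrite /nz re_pt im_pt; have := sqr_ge0 (a - c); have : r ^+ 2 < y ^+ 2 by nra.
lra.
Qed.

Lemma strip_col A a b : strip_precell Gam A a b -> col A a true /\ col A b false.
Proof.
move=> [ab _ _ EA _]; have int x y : a < x < b -> 0 < y -> A^° (pt x y).
 move=> xb y0; rewrite EA strip_poly interior_poly; split=> // k.
 by rewrite !inE => /orP[]/eqP->; rewrite ?qfN side_vert re_pt; lra.
by split; exists (b - a), 1; split; rewrite ?subr_gt0 // => x y xb y1; apply: int; lra.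
Qed.

Lemma col_pt A A' x o : col A x o -> col A' x o -> exists a y, [/\ A^° (pt a y), A'^° (pt a y), 0 < y &
 if o then x < a else a < x].
Proof.
move=> [d [y0 [d0 y00 H]]] [d' [y0' [d0' y00' H']]]; pose y := y0 + y0'.
have [m [m1 m2 m3]] := ltr_ex2 d0 d0'.
exists (if o then x + m else x - m), y.
by split; [apply: H|apply: H'| |]; rewrite /y; case: (o); lra.
Qed.

Lemma col_vert A x o t : A `<=` uhp -> col A x o -> col (mobC (vert t) @` A) (x + t) o.
Proof.
move=> Au [d [y0 [d0 y00 H]]]; exists d, y0; split=> // a y ab yb.
rewrite interior_mobC //; exists (pt (a - t) y); last by rewrite vert_mob re_pt im_pt subrK.
by apply: H => //; case: (o) ab; lra.
Qed.

Lemma col_fund A A' x o t : AA A -> AA A' -> Gam (vert t) -> col A x o -> col A' (x + t) o ->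
 vert t = 1%g :> G /\ A = A'.
Proof.
move=> AAA AAA' Gt cA cA'.
have Au := precell_uhp (pAA AAA).
have [a [y [h1 h2 y0 _]]] := col_pt (col_vert t Au cA) cA'.
rewrite interior_mobC // in h1; case: h1 => z Az Ez.
by apply: (fund AAA AAA' Gt Az); rewrite Ez; exact: interior_subset h2.
Qed.

Lemma tile_vline X x z w : tile X -> side X (line (vert x)) -> X z -> X w -> re z < x -> x < re w -> False.
Proof.
move=> tX sX Xz Xw zx xw; have [K EK gK] := tile_good tX.
have /(tile_side _ EK gK)[k kK Ek] := sX.
rewrite EK in Xz Xw; have [Hz /(_ k kK) sz] := Xz; have [Hw /(_ k kK) sw] := Xw.
have p1 := gp_line (vert x) 0; have p2 := gp_line (vert x) 1.
have ne : gp (vert x) 0 <> gp (vert x) 1 by move=> /gp_inj /esym/eqP; rewrite oner_eq0.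
have q1 : line k (gp (vert x) 0) by rewrite -Ek.
have q2 : line k (gp (vert x) 1) by rewrite -Ek.
have [a0 b0] := line_two ne q1 q2 p1 p2.
have [[t E]|[t E]] := same_line a0 b0.
 by move: sz; rewrite E side_at // side_vert; lra.
by move: sw; rewrite E side_at // qfN side_vert; lra.
Qed.

(** The points of the arc tend to [e] and belong to the closure of [K]; an isometric sphere centred
    at [e] would eventually enclose them. *)
Lemma end_not_cusp c r e k : HALF c r e -> (e - c) ^+ 2 = r ^+ 2 -> Gam k -> ec k != 0 -> ctr k <> e.
Proof.
move=> H er Gk k0 Ek; have [r0 /eqP ce _ _ _] := H.
have R0 := rad_gt0 k0; have R2 : 0 < rad k ^+ 2 by nra.
have r2 : 0 < r ^+ 2 by nra.
have q0 : 0 < rad k ^+ 2 / (2 * r ^+ 2) by rewrite divr_gt0 // mulr_gt0.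
have [d [d0 d1 d2]] := ltr_ex2 (ltr01 : 0 < 1 :> R) q0.
have sx : sbt c e (e - d * (e - c)).
 by rewrite /sbt; case: (ltgtP c e) ce => // ec _; [apply/orP; left|apply/orP; right]; nra.
have [y [y0 n1 _ cl]] := arc_pt H sx.
have := cl.2 k Gk k0; rewrite den_nz // Ek ler_pdivlMr // mul1r => le.
rewrite ltr_pdivlMr ?mulr_gt0 // in d2.
have : nz e (pt (e - d * (e - c)) y) = 2 * d * r ^+ 2.
 rewrite -er; move: n1; rewrite /nz !re_pt !im_pt -er => n1.
 have -> : y ^+ 2 = (e - c) ^+ 2 - (e - d * (e - c) - c) ^+ 2 by lra.
 ring.
lra.
Qed.

Lemma CU_prV A c r e h A' : AA A -> CU A c r e -> pr c r e h A' ->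
 pr (ctr h^-1%g) r (ctr h^-1%g + c - e) h^-1%g A.
Proof.
move=> AAA U [Gh c0 Ec Er [AAA' hA']]; split; rewrite ?ecV0 ?radV ?invgK //; first exact: GamV.
by split=> //; rewrite Ec (_ : _ - (_ - e) = e); [constructor 3|ring].
Qed.

Lemma CU_pr_ne A c r e h A' : AA A -> CU A c r e -> pr c r e h A' -> A <> A'.
Proof.
move=> AAA U P E; have U' := CU_pr U P; rewrite -E in U'.
have hA : half_of A c r e by constructor 3.
have [z [_ b _ Az]] := half_pt hA.
have [E1 _ E2] := half_mem_CU (half_of_HALF hA) b Az U'.
have [_ ce _ _ _] := half_of_HALF hA; apply: ce; lra.
Qed.

Section Cycle.
Variables (o : bool) (A : set C) (v : C).
Hypotheses (AAA : AA A) (Av : atv A v).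

Lemma cA_ch n m : cA o v A n = cA o v A m ->
 mobC (cg o v A n) v = mobC (cg o v A m) v /\ ch o v A n = ch o v A m.
Proof.
move=> E; have [_ _ a1 s1] := cycP o n AAA Av; have [_ _ a2 s2] := cycP o m AAA Av.
have Ev : mobC (cg o v A n) v = mobC (cg o v A m) v.
 move: a1 a2; rewrite E => -[c1 [r1 [c2 [r2 N]]]] [c1' [r1' [c2' [r2' N']]]].
 by have [] := NC_uniq N N'.
by rewrite E Ev in s1; have [] := stp_uniq s1 s2.
Qed.

Lemma cA_next n m : cA o v A n = cA o v A m -> cA o v A n.+1 = cA o v A m.+1.
Proof.
move=> E; have [Ev _] := cA_ch E.
have [_ _ _ s1] := cycP o n AAA Av; have [_ _ _ s2] := cycP o m AAA Av.
by rewrite E Ev in s1; have [] := stp_uniq s1 s2.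
Qed.

Lemma cA_back n m : cA o v A n.+1 = cA o v A m.+1 -> cA o v A n = cA o v A m.
Proof.
move=> E; have [Ev _] := cA_ch E.
have [a1 _ v1 s1] := cycP o n AAA Av; have [a2 _ v2 s2] := cycP o m AAA Av.
have [_ t1] := stp_V a1 s1; have [_ t2] := stp_V a2 s2.
have Hv := atv_uhp Av.
by move: t1 t2; rewrite -!mobCM // -!cgS E Ev => t1 t2; have [] := stp_uniq t1 t2.
Qed.

Lemma cA_shift n m : cA o v A n = A -> cA o v A (m + n) = cA o v A m.
Proof. by move=> E; elim: m => // m IH; exact: cA_next. Qed.

(** For a non-cuspidal precell this is [cyl]: the sequence of precells has period [l], which may be
    smaller than the length of the cycle. *)
Definition first_return (l : nat) : Prop :=
 [/\ (0 < l)%N, cA o v A l = A & forall j, (0 < j < l)%N -> cA o v A j <> A].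

Lemma fr_inj l i j : first_return l -> (i < l)%N -> (j < l)%N -> cA o v A i = cA o v A j -> i = j.
Proof.
move=> [l0 El Nl]; wlog ij : i j / (i <= j)%N.
 by move=> W il jl E; have [h|/ltnW h] := leqP i j; [exact: W|symmetry; exact: W].
move=> il jl E; apply/eqP; apply: contraT => ne.
have gen n d : cA o v A n = cA o v A (n + d) -> cA o v A d = A.
 by elim: n => [/esym//|n IH]; rewrite addSn => /cA_back.
have : cA o v A (j - i) = A by apply: (gen i); rewrite subnKC.
by move=> h; exfalso; apply: (Nl (j - i)%N _ h); lia.
Qed.

Lemma fr_mod l n : first_return l -> exists2 j, (j < l)%N & cA o v A j = cA o v A n.
Proof.
move=> [l0 El Nl]; elim/ltn_ind: n => n IH; have [nl|ln] := ltnP n l; first by exists n.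
have [|j jl E] := IH (n - l)%N; first by lia.
by exists j => //; rewrite E -(cA_shift (n - l) El) subnK.
Qed.

(** [find] counts in the cycle without its first term; when the precell does not recur it returns
    [k.-1], so the successor is the full length. *)
Lemma cyl_fr (k : nat) : period o v A k ->
 first_return (find (fun p : set C * G => `[< p.1 = A >]) (behead (clist o v A k))).+1.
Proof.
move=> [k0 gk _]; set a := (fun p => _); set s := behead _.
have sz : size s = k.-1 by rewrite size_behead size_mkseq.
have nt j : (j < k.-1)%N -> nth (set0, 1%g) s j = (cA o v A j.+1, ch o v A j.+1).
 by move=> jk; rewrite nth_behead nth_mkseq //; lia.
split=> //.
 have [h|h] := boolP (has a s).
  have := nth_find (set0, 1%g) h; rewrite nt; last by rewrite -sz -has_find.
  by move=> /asboolP.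
 rewrite hasNfind // sz prednK //.
 by have := @cyc_same o v A k 0%N AAA Av; apply; rewrite gk cg0.
move=> [//|j] /= jl E.
have jf : (j < find a s)%N by rewrite -ltnS.
have jk : (j < k.-1)%N by rewrite -sz; exact: leq_trans jf (find_size a s).
by have := jf; move/(before_find (set0, 1%g)); rewrite nt // /a /= E asboolT.
Qed.

End Cycle.

Lemma atv_uniq A v v' : atv A v -> atv A v' -> v = v'.
Proof. by move=> [c1 [r1 [c2 [r2 N]]]] [c1' [r1' [c2' [r2' N']]]]; have [] := NC_uniq N N'. Qed.

Lemma stp_ctr o A v h A' : stp o A v h A' -> ec h != 0.
Proof. by case=> c1 [r1 [c2 [r2 [_ []]]]]. Qed.

Lemma stp_col o A v h A' : stp o A v h A' -> col A (ctr h) o.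
Proof.
case=> c1 [r1 [c2 [r2 [N [_ _ -> _ _]]]]]; have [h1 h2] := NC_halves N; have [_ _ cv _ _] := N.
have [e1 e2] : (c1 < re v) = true /\ (c2 < re v) = false.
 by split; [lra|apply/negbTE; rewrite -leNgt; lra].
by have := half_col h1; have := half_col h2; rewrite e1 e2; case: (o).
Qed.

Lemma stp_ctr_ne A v h h' A1 A2 o : stp o A v h A1 -> stp (~~ o) A v h' A2 -> ctr h <> ctr h'.
Proof.
case=> c1 [r1 [c2 [r2 [N [_ _ E _ _]]]]] [c1' [r1' [c2' [r2' [N' [_ _ E' _ _]]]]]].
have [_ F1 _ F2 _] := NC_uniq N N'; have [_ _ cv _ _] := N.
by rewrite E E' -F1 -F2; case: (o) => /=; lra.
Qed.

Lemma tile_side_mob X b g : Gam g -> tile X -> side X b -> side (mobC g @` X) (mobC g @` b).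
Proof.
move=> Gg tX sX; have [K EK gK] := tile_good tX.
have /(tile_side _ EK gK)[k kK ->] := sX.
apply/(@tile_side (mobC g @` X) [seq (g * k)%g | k <- K]).
- by rewrite EK mob_poly.
- exact: good_mob.
by exists (g * k)%g; [exact: map_f|rewrite line_mobC].
Qed.

Lemma NCtile_tile A v : AA A -> atv A v -> tile (NCtile v).
Proof.
move=> AAA Av; exists 1%g, A, (NCtile v); split=> //; first exact: Gam1.
 exact/(cell_NC _ AAA Av).
apply/predeqP => z; split=> [zN|[w wN <-]]; last by rewrite mobC1.
by exists z => //; rewrite mobC1.
Qed.

Lemma NC_side o A v h A' : AA A -> stp o A v h A' -> side (NCtile v) (line (vert (ctr h))).
Proof.
have main A0 v0 h0 A0' : AA A0 -> stp true A0 v0 h0 A0' -> side (NCtile v0) (line (vert (ctr h0))).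
 move=> AAA st; have [_ Av _ _] := stp_atv AAA st.
 have [N perN] := period_ex true AAA Av.
 have [_ _ _ s0] := cycP true 0 AAA Av.
 rewrite cA0 cg0 mobC1 in s0; have [Eh _] := stp_uniq s0 st.
 rewrite (NCtile_U AAA Av perN) (NCU_poly AAA Av perN).
 have [N0 _ _] := perN.
 have kK : (1^-1 * vert (ctr h0))%g \in NCK A0 v0 N.
  by apply/mapP; exists 0%N; rewrite ?mem_iota //= -Eh.
 rewrite invg1 mul1g in kK.
 apply/tile_side; [by []| |by exists (vert (ctr h0))].
 split; first by exists v0; apply: NCK_v.
 exact: (NCK_lines AAA Av perN).
(* A right vertical side is the left vertical side of the next precell, moved by the pairing. *)
case: o => AAA st; first exact: main AAA st.
have [_ Av _ _] := stp_atv AAA st.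
have [AAA' st'] := stp_V AAA st; have c0 := stp_ctr st.
have [Gh _ _ Av'] := stp_atv AAA st.
have := tile_side_mob (GamV Gh) (NCtile_tile AAA' Av') (main _ _ _ _ AAA' st').
have Hv := atv_uhp Av.
rewrite NCtile_mob // ?mobCK //; [|exact: mobC_uhp|exact: GamV].
by rewrite (@mob_vline h^-1%g) ?ecV0 // invgK.
Qed.

Lemma NC_sides o A v b : AA A -> atv A v -> side (NCtile v) b ->
 exists j, b = mobC (cg o v A j)^-1%g @` line (vert (ctr (ch o v A j))).
Proof.
move=> AAA Av sb; have [N perN] := period_ex true AAA Av.
have E : NCtile v = poly (NCK A v N).
 by rewrite (NCtile_U AAA Av perN) (NCU_poly AAA Av perN).
have gK : good_poly (NCK A v N).
 split; first by exists v; apply: NCK_v.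
 exact: (NCK_lines AAA Av perN).
have /(tile_side _ E gK)[k /mapP[j _ ->] ->] := sb.
case: o; first by exists j; rewrite line_mobC.
have [AAj Gj _ sj] := cycP true j AAA Av.
have [AAj' Gj' vj' _] := cycP true j.+1 AAA Av.
have [n pern] := period_ex false AAA Av.
have [i [_ Eg EA]] := orbit_all AAA Av pern Gj' AAj' vj'.
exists i; have [_ sV] := stp_V AAj sj.
have [_ _ _ si] := cycP false i AAA Av.
have Hv := atv_uhp Av.
rewrite -mobCM // -cgS EA Eg in sV; have [<- _] := stp_uniq sV si.
have c0 := stp_ctr sj.
rewrite -Eg -mob_vline // cgS invgM -mob_img; last first.
 by move=> w [w' kw <-]; apply: mobC_uhp; case: kw.
rewrite -line_mobC; congr (_ @` _); rewrite mob_img; last by move=> w [].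
by rewrite mulVg; apply/predeqP => w; split=> [kw|[w' kw <-]]; [exists w|]; rewrite ?mobC1.
Qed.

Lemma Tri_tile A c r e : AA A -> CU A c r e -> tile (Tri c e).
Proof.
move=> AAA U; exists 1%g, A, (Tri c e); split=> //; first exact: Gam1.
 exact/(cell_CU _ AAA U).
apply/predeqP => z; split=> [zN|[w wN <-]]; last by rewrite mobC1.
by exists z => //; rewrite mobC1.
Qed.

Lemma Tri_sides (a b : R) s : a <> b -> side (Tri a b) s <-> [\/ s = line (vert a), s = line (vert b) |
 s = [set z | uhp z /\ (re z - a) * (re z - b) + im z ^+ 2 = 0]].
Proof.
have lc x y : x < y -> line (circ ((x + y) / 2) ((y - x) / 2)) =
  [set z | uhp z /\ (re z - x) * (re z - y) + im z ^+ 2 = 0].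
 move=> xy; apply/predeqP => z; rewrite line_circ ?divr_gt0 ?subr_gt0 //; split=> -[Hz E]; split=> //;
  move: E; rewrite /nz; move: (re z) (im z) => p q E; lra.
move=> /eqP; wlog ab : a b / a < b.
 move=> W ne; case: (ltgtP a b) (ne) => // lt _; first exact: W.
 rewrite TriC W 1?eq_sym //; split=> -[->|->|->]; [by constructor 2|by constructor 1| |by constructor 2|by constructor 1|];
  constructor 3; apply/predeqP => z; split=> -[Hz E]; split=> //; lra.
move=> _; rewrite (tile_side s (Tri_poly ab) (Tri_good ab)); split.
 by move=> [k]; rewrite !inE => /or3P[]/eqP-> ->; rewrite ?line_Sop ?lc //; [constructor 1|constructor 2|constructor 3].
have [i1 i2 i3] := in3 (vert a) (vert b * Sop)%g (circ ((a + b) / 2) ((b - a) / 2) * Sop)%g.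
case=> ->.
- by exists (vert a); [exact: i1|].
- by exists (vert b * Sop)%g; [exact: i2|rewrite line_Sop].
by exists (circ ((a + b) / 2) ((b - a) / 2) * Sop)%g; [exact: i3|rewrite line_Sop lc].
Qed.

Lemma strip_tile A (a b : R) : AA A -> strip_precell Gam A a b -> tile A.
Proof.
move=> AAA U; exists 1%g, A, A; split=> //; first exact: Gam1.
 exact/(cell_strip A AAA U).
apply/predeqP => z; split=> [zN|[w wN <-]]; last by rewrite mobC1.
by exists z => //; rewrite mobC1.
Qed.

Lemma strip_sides A (a b : R) s : strip_precell Gam A a b -> side A s <-> s = line (vert a) \/ s = line (vert b).
Proof.
move=> [ab _ _ -> _]; rewrite (tile_side s (strip_poly a b) (strip_good ab)); split.
 by move=> [k]; rewrite !inE => /orP[]/eqP-> ->; rewrite ?line_Sop; [left|right].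
by case=> ->; [exists (vert a); rewrite ?inE ?eqxx|exists (vert b * Sop)%g; rewrite ?inE ?eqxx ?orbT ?line_Sop].
Qed.

End Columns.

(** * Every oriented side is represented by exactly one index, up to the group *)

Section Indices.
Implicit Types (g h k : G) (z w v u : C) (x y t r e c : R) (A B X b : set C) (o : bool) (i : CS_index R).
Local Notation is_cell := (is_cell Gam AA).

(* [desc i A1 x B]: the index [i] stands for the side over [x] of the cell [B],
  along which the precell [A1] of [AA] lies. *)
Definition desc i A1 x B : Prop :=
 [\/ exists o v (l j : nat), [/\ AA i.1.1 /\ atv i.1.1 v, i.1.2 = ch o v i.1.1 0,
     first_return o i.1.1 v l, (j < l)%N /\ i.2 = j.+1 &
     [/\ A1 = cA o v i.1.1 j, x = ctr (ch o v i.1.1 j) & B = NCtile (mobC (cg o v i.1.1 j) v)]],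
   exists c r e A', [/\ CU i.1.1 c r e, AA i.1.1, pr c r e i.1.2 A' &
     [\/ [/\ i.2 = 1%N, A1 = i.1.1, x = e & B = Tri c e],
       [/\ i.2 = 2%N, A1 = A', x = ctr i.1.2^-1%g + c - e &
         B = Tri (ctr i.1.2^-1%g) (ctr i.1.2^-1%g + c - e)] |
       [/\ i.2 = 3%N, A1 = i.1.1, x = c & B = Tri c e]]] |
   exists a d : R, [/\ AA i.1.1, strip_precell Gam i.1.1 a d, i.1.2 = 1%g,
     A1 = i.1.1 /\ B = i.1.1 & (i.2 = 1%N /\ x = a) \/ (i.2 = 2%N /\ x = d)]].

Lemma fr_le_period o A v l (k : nat) : AA A -> atv A v -> first_return o A v l -> period o v A k -> (l <= k)%N.
Proof.
move=> AAA Av [l0 _ Nl] [k0 gk _]; rewrite leqNgt; apply/negP => kl.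
apply: (Nl k); first by rewrite k0.
by have := @cyc_same o v A k 0%N AAA Av; apply; rewrite gk cg0.
Qed.

Lemma fr_uniq o A v (l l' : nat) : first_return o A v l -> first_return o A v l' -> l = l'.
Proof.
move=> [l0 El Nl] [l0' El' Nl']; apply/eqP; case: (ltngtP l l') => // h.
 by case: (Nl' l _ El); rewrite l0.
by case: (Nl l' _ El'); rewrite l0'.
Qed.

Lemma ncycle_data o A v o' v' : AA A -> atv A v -> atv A v' -> ch o v A 0 = ch o' v' A 0 -> o = o' /\ v = v'.
Proof.
move=> AAA Av Av' E; have Ev := atv_uniq Av Av'; subst v'; split=> //.
have [_ _ _ s1] := cycP o 0 AAA Av; have [_ _ _ s2] := cycP o' 0 AAA Av.
rewrite !cA0 !cg0 mobC1 in s1 s2; rewrite E in s1.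
by case: o o' s1 s2 {E} => [] [] // s1 s2; [case: (stp_ne s1 s2)|case: (stp_ne s2 s1)].
Qed.

Lemma cyl_NC o A v n : AA A -> atv A v -> is_cyl Gam AA A (ch o v A 0) n -> first_return o A v n.
Proof.
move=> AAA Av [[[x [y [c [_ S _ _]]]] _]|[[p [A' [c [_ [s U _] _]]]] _]|[c cc ->]].
- by case: (NC_stripF Av S).
- by case: (NC_CUF Av U).
have [oo [v' [k [_ Av' per Eh ->]]]] := ncycleP cc.
have [Eo Ev] := ncycle_data AAA Av Av' Eh; subst oo v'.
exact: (cyl_fr AAA Av per).
Qed.

Lemma CU_uniq A c r e c' r' e' : CU A c r e -> CU A c' r' e' -> [/\ c = c', r = r' & e = e'].
Proof.
move=> U U'; have hA : half_of A c r e by constructor 3.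
have [z [_ b _ Az]] := half_pt hA; exact: (half_mem_CU (half_of_HALF hA) b Az U').
Qed.

(** The pairing element maps the ideal vertex of the precell to that of the paired one, so the side
    attached to [m = 2] stands over the reflected abscissa. *)
Lemma CU_mob c r e h A' A : CU A c r e -> pr c r e h A' ->
 mob h (Some (pt e 0)) = Some (pt (ctr h^-1%g + c - e) 0).
Proof.
move=> U [Gh c0 Ec Er _]; have [[r0 ce _ _ _] er _] := U.
have dt := edet h; rewrite mob_real.
have E : ec h * e + ed h = ec h * (e - c) by rewrite -Ec /ctr; field.
have q0 : e - c != 0 by lra; apply/eqP.
rewrite E mulf_eq0 (negbTE c0) (negbTE q0) /=; congr (Some (pt _ _)).
rewrite ctrV //.
have r2 : (e - c) ^+ 2 * ec h ^+ 2 = 1 by rewrite er -Er rad2 mulVf // expf_neq0.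
apply: (mulIf (mulf_neq0 c0 q0)); rewrite divfK ?mulf_neq0 //.
rewrite (_ : ed h = ec h * - c) in dt; last by rewrite -Ec /ctr; field.
have : ec h * (ea h * e + eb h) = ea h * (ec h * (e - c)) - 1.
 by rewrite -dt; ring.
move=> F; apply: (mulfI c0); rewrite F -r2; field; exact: c0.
Qed.

Lemma seg_ctr h : ec h != 0 -> seg (mob h^-1%g None) None = line (vert (ctr h)).
Proof. by move=> c0; rewrite mob_inv_inf // seg_line. Qed.

Lemma seg_CU c r e h A' A : CU A c r e -> pr c r e h A' ->
 seg (mob h (Some (pt e 0))) None = line (vert (ctr h^-1%g + c - e)).
Proof. by move=> U P; rewrite (CU_mob U P) seg_line. Qed.

Lemma desc_side i A1 x B : desc i A1 x B -> index_side Gam AA i B (line (vert x)).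
Proof.
case: i => -[A h] m; rewrite /desc /=; case=> [[oo [v [l [j [[AAA Av] Eh fr [jl Em] [EA Ex EB]]]]]]|
  [c [r [e [A' [U AAA P H]]]]]|[a [d [AAA S Eh [EA EB] H]]]].
- subst h m A1 x B; have [k per] := period_ex oo AAA Av.
 have jk : (j < k)%N by apply: leq_trans jl (fr_le_period AAA Av fr per).
 have [AAj Gj vj sj] := cycP oo j AAA Av.
 constructor 1; exists (clist oo v A k); split; first exact: ncycle_ex.
  by rewrite clist_term //=; exact/(cell_NC _ AAj vj).
 by rewrite clist_term //; exact: (esym (seg_ctr (stp_ctr sj))).
- have P' := P; have [Gh c0 Ec Er [AAA' _]] := P'.
 constructor 2; exists (Some (pt e 0)), A', [:: (A, h); (A', h^-1%g)].
 split; first exact/(cuspidal_cycleP _ _ _ _ U).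
 case: H => -[-> _ -> ->].
 + by constructor 1; split; rewrite -?seg_line //; exact/(cell_CU _ AAA U).
 + constructor 2; split=> //; last exact: (esym (seg_CU U P)).
  exact/(cell_CU _ AAA' (CU_pr U P)).
 + constructor 3; split=> //; last by rewrite -Ec; exact: (esym (seg_ctr c0)).
  exact/(cell_CU _ AAA U).
subst h A1 B; constructor 3; exists a, d, [:: (A, 1%g)]; split; first by split.
by split=> //; case: H => -[-> ->]; [left|right]; rewrite -seg_line.
Qed.

Lemma side_desc i B b n : is_cyl Gam AA i.1.1 i.1.2 n -> (1 <= i.2 <= n)%N -> index_side Gam AA i B b ->
 exists A1 x, desc i A1 x B /\ b = line (vert x).
Proof.
case: i => -[A h] m /= cyl mn [[cc [nc cB ->]]|[p [A' [cc [cu H]]]]|[a [d [cc [[AAA S h1 _] [-> H]]]]]].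
- have [oo [v [k [AAA Av per Eh Ecc]]]] := ncycleP nc; subst h cc.
 have fr := cyl_NC AAA Av cyl; have nk := fr_le_period AAA Av fr per.
 have mk : (m.-1 < k)%N by lia.
 rewrite clist_term //= in cB; rewrite clist_term //; have [AAj Gj vj sj] := cycP oo m.-1 AAA Av.
 exists (cA oo v A m.-1), (ctr (ch oo v A m.-1)); split; last exact: (seg_ctr (stp_ctr sj)).
 constructor 1; exists oo, v, n, m.-1; split=> //; first by split=> /=; lia.
 by split=> //; exact/(cell_NC _ AAj vj).
- have [AAA [s U0 _] _] := cu; have [c [r [e [U _ _]]]] := cuspidal_CU U0.
 have /(cuspidal_cycleP _ _ _ _ U)[_ P Ep _] := cu; have [Gh c0 Ec Er [AAA' _]] := P.
 case: H => -[-> cB ->].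
 + exists A, e; rewrite Ep seg_line; split=> //; constructor 2; exists c, r, e, A'; split=> //.
  by constructor 1; split=> //; exact/(cell_CU _ AAA U).
 + exists A', (ctr h^-1%g + c - e); rewrite Ep; split; last exact: (seg_CU U P).
  constructor 2; exists c, r, e, A'; split=> //.
  by constructor 2; split=> //; exact/(cell_CU _ AAA' (CU_pr U P)).
 + exists A, c; split; last by rewrite -Ec; exact: (seg_ctr c0).
  constructor 2; exists c, r, e, A'; split=> //.
  by constructor 3; split=> //; exact/(cell_CU _ AAA U).
by case: H => -[-> ->]; [exists A, a|exists A, d]; split; rewrite ?seg_line //; constructor 3; exists a, d;
 split=> //; [left|right].
Qed.

Lemma desc_facts i A1 x B : desc i A1 x B -> [/\ AA A1, is_cell A1 B, tile B, side B (line (vert x)) &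
 (exists o, col A1 x o) /\ exists2 c, cycle_of Gam AA i.1.1 i.1.2 c & A1 \in map fst c].
Proof.
case: i => -[A h] m; rewrite /desc /=; case=> [[oo [v [l [j [[AAA Av] Eh fr [jl Em] [EA Ex EB]]]]]]|
  [c [r [e [A' [U AAA P H]]]]]|[a [d [AAA S Eh [EA EB] H]]]].
- subst h m A1 x B; have [k per] := period_ex oo AAA Av.
 have jk : (j < k)%N by apply: leq_trans jl (fr_le_period AAA Av fr per).
 have [AAj Gj vj sj] := cycP oo j AAA Av.
 split=> //; [exact/(cell_NC _ AAj vj)|exact: (NCtile_tile AAj vj)|exact: (NC_side AAj sj)|].
 split; first by exists oo; exact: stp_col sj.
 exists (clist oo v A k); first by constructor 3; exact: ncycle_ex.
 by apply/mapP; exists (cA oo v A j, ch oo v A j) => //; apply/mapP; exists j; rewrite ?mem_iota.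
- have P' := P; have [Gh c0 Ec Er [AAA' hA']] := P'; have U' := CU_pr U P.
 have [[_ ce _ _ _] _ _] := U; have [[_ ce' _ _ _] _ _] := U'.
 have cc : cycle_of Gam AA A h [:: (A, h); (A', h^-1%g)].
  by constructor 2; exists (Some (pt e 0)), A'; exact/(cuspidal_cycleP _ _ _ _ U).
 case: H => -[_ -> -> ->].
 + split=> //; [exact/(cell_CU _ AAA U)|exact: (Tri_tile AAA U)|by apply/Tri_sides => //; constructor 2|].
  split; first by exists (e < c); exact: CU_col U.
  by exists [:: (A, h); (A', h^-1%g)]; rewrite ?inE ?eqxx.
 + split=> //; [exact/(cell_CU _ AAA' U')|exact: (Tri_tile AAA' U')|by apply/Tri_sides => //; constructor 2|].
  split; first by exists (ctr h^-1%g + c - e < ctr h^-1%g); exact: CU_col U'.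
  by exists [:: (A, h); (A', h^-1%g)]; rewrite ?inE ?eqxx ?orbT.
 + split=> //; [exact/(cell_CU _ AAA U)|exact: (Tri_tile AAA U)|by apply/Tri_sides => //; constructor 1|].
  split; first by exists (c < e); apply: half_col; constructor 3; exact: U.
  by exists [:: (A, h); (A', h^-1%g)]; rewrite ?inE ?eqxx.
subst h A1 B; have [c1 c2] := strip_col S.
split=> //; [exact/(cell_strip A AAA S)|exact: (strip_tile AAA S)| |].
 by apply/(strip_sides (line (vert x)) S); case: H => -[_ ->]; [left|right].
split; first by case: H => -[_ ->]; [exists true|exists false].
by exists [:: (A, 1%g)]; [constructor 1; exists a, d|rewrite inE].
Qed.

Lemma strip_uniq A (a d a2 d2 : R) : strip_precell Gam A a d -> strip_precell Gam A a2 d2 -> a = a2 /\ d = d2.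
Proof.
move=> [ad _ _ EA1 _] [ad2 _ _ EA2 _].
have m1 (p : R) : a <= p <= d <-> a2 <= p <= d2.
 have q : A (pt p 1) <-> a <= p <= d by rewrite EA1 /=; split=> [[]|] //; split=> //; exact: ltr01.
 have q2 : A (pt p 1) <-> a2 <= p <= d2 by rewrite EA2 /=; split=> [[]|] //; split=> //; exact: ltr01.
 by rewrite -q q2.
have h1 : a2 <= a <= d2 by apply/m1; lra.
have h2 : a2 <= d <= d2 by apply/m1; lra.
have h3 : a <= a2 <= d by apply/m1; lra.
have h4 : a <= d2 <= d by apply/m1; lra.
by split; lra.
Qed.

(** Within one choice, precell and abscissa recover [m]: before the first return the precells of a
    cycle are distinct, in the cuspidal case [A <> A'] and [c <> e], and the two ends of a strip
    differ. *)
Lemma desc_det i i' A1 A1' x x' B B' : desc i A1 x B -> desc i' A1' x' B' -> i.1 = i'.1 ->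
 (i = i' -> x = x' /\ B = B') /\ (A1 = A1' -> x = x' -> i = i').
Proof.
case: i i' => -[A h] m [[A2 h2] m2] D D' /= [? ?]; subst A2 h2.
have I : m = m2 -> (A, h, m) = (A, h, m2) by move=> ->.
move: D D'; rewrite /desc /=.
case=> [[oo [v [l [j [[AAA Av] Eh fr [jl Ej] [EA Ex EB]]]]]]|[c [r [e [A' [U AAA P H]]]]]|[a [d [AAA S Eh [EA EB] H]]]].
- case=> [[uu [v2 [l2 [j2 [[_ Av2] Eh2 fr2 [jl2 Ej2] [EA2 Ex2 EB2]]]]]]|[c [r [e [A' [U _ _ _]]]]]|[a [d [_ S _ _ _]]]].
 + rewrite Eh in Eh2; have [Eo Ev] := ncycle_data AAA Av Av2 Eh2; subst uu v2.
  have El := fr_uniq fr fr2; subst l2; split=> [[Em]|E1 _]; last first.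
   by apply: I; rewrite Ej Ej2; congr S; apply: (fr_inj AAA Av fr jl jl2); rewrite -EA -EA2.
  by move: Ej2; rewrite -Em Ej => -[Ej2]; rewrite Ex Ex2 EB EB2 Ej2.
 + by case: Av => c1 [r1 [c2 [r2 N]]]; case: (CU_NC U N).
 + by case: (NC_stripF Av S).
- case=> [[uu [v2 [l2 [j2 [[_ Av2] _ _ _ _]]]]]|[c2 [r2 [e2 [A2 [U2 _ P2 H2]]]]]|[a [d [_ S _ _ _]]]].
 + by case: Av2 => c1 [r1 [c2 [r2 N]]]; case: (CU_NC U N).
 + have [? ? ?] := CU_uniq U U2; subst c2 r2 e2.
  have [[_ ce _ _ _] _ _] := U.
  have [_ ?] := pr_uniq (half_of_HALF (Or33 _ _ U)) P P2; subst A2.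
  have ne := CU_pr_ne AAA U P.
  split=> [[Em]|E1 E2].
   by move: H2; rewrite -Em; case: H => -[-> F1 -> ->] [[// G1 F2 -> ->]|[// G1 F2 -> ->]|[// G1 F2 -> ->]].
  apply: I; move: H2; rewrite -E1 -E2; case: H => -[-> -> -> _] [[-> // F1 F2 _]|[-> // F1 F2 _]|[-> // F1 F2 _]];
   by [case: ne|case: ce].
 + by case: (CU_stripF U S).
case=> [[uu [v2 [l2 [j2 [[_ Av2] _ _ _ _]]]]]|[c2 [r2 [e2 [A2 [U2 _ _ _]]]]]|[a2 [d2 [_ S2 _ [_ EB2] H2]]]].
- by case: (NC_stripF Av2 S).
- by case: (CU_stripF U2 S).
have [ad _ _ _ _] := S; have [? ?] := strip_uniq S S2; subst a2 d2; split=> [[Em]|_ Ex].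
 by move: H2; rewrite -Em EB EB2; case: H => -[-> ->] [[// _ ->]|[// _ ->]].
by apply: I; move: H2; rewrite -Ex; case: H => -[-> ->] [[-> // E]|[-> // E]]; move: ad; rewrite E ltxx.
Qed.

(** Below the summit the same side of the same cell runs along the pulled back precell [A2]. From
    there it is a vertical side of [A2] that no index of this choice selects. A side over an ideal
    vertex has no such second description, as its foot is not the centre of an isometric sphere. *)
Lemma desc_nbr i A1 x B : desc i A1 x B -> (forall k, Gam k -> ec k != 0 -> ctr k <> x) \/
 exists h A2, [/\ Gam h, ec h != 0 /\ ctr h = x, AA A2 /\ is_cell A2 (mobC h @` B),
  (exists o, col A2 (ctr h^-1%g) o) /\ (exists2 c, cycle_of Gam AA i.1.1 i.1.2 c & A2 \in map fst c) &
  forall i' B', i'.1 = i.1 -> ~ desc i' A2 (ctr h^-1%g) B'].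
Proof.
case: i => -[A h] m; rewrite {1}/desc /=.
case=> [[oo [v [l [j [[AAA Av] Eh fr [jl Em] [EA Ex EB]]]]]]|[c [r [e [A' [U AAA P H]]]]]|[a [d [AAA S Eh [EA EB] H]]]].
- right; subst h A1 x B; have [k per] := period_ex oo AAA Av.
 have [AAj Gj vj sj] := cycP oo j AAA Av.
 have [AAj1 Gj1 vj1 sj1] := cycP oo j.+1 AAA Av.
 have [_ sV] := stp_V AAj sj; have [Gh _ _ _] := stp_atv AAj sj.
 have Hv := atv_uhp Av.
 exists (ch oo v A j), (cA oo v A j.+1); split=> //.
 + by split=> //; exact: stp_ctr sj.
 + split=> //; apply/(cell_NC _ AAj1 vj1).
  by rewrite NCtile_mob //; [rewrite -mobCM // -cgS|exact: mobC_uhp].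
 + split; first by exists (~~ oo); exact: stp_col sV.
  exists (clist oo v A k); first by constructor 3; exact: ncycle_ex.
  have [j' j'l Ej'] := fr_mod AAA Av j.+1 fr.
  have j'k : (j' < k)%N := leq_trans j'l (fr_le_period AAA Av fr per).
  apply/mapP; exists (cA oo v A j', ch oo v A j'); last by rewrite /= Ej'.
  by apply/mapP; exists j'; rewrite ?mem_iota.
 case=> -[A2 h2] m' B' /= [? ?]; subst A2 h2; rewrite /desc /=.
 case=> [[uu [v2 [l2 [j2 [[_ Av2] Eh2 fr2 [jl2 Em2] [EA2 Ex2 EB2]]]]]]|[c [r [e [A' [U _ _ _]]]]]|[a [d [_ S _ _ _]]]].
 + have [Eo Ev] := ncycle_data AAA Av Av2 Eh2; subst uu v2.
  have [E1 E2] := cA_ch AAA Av EA2.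
  rewrite -mobCM // -cgS in sV; rewrite -E2 in Ex2.
  exact: (stp_ctr_ne sj1 sV).
 + by case: Av => c1 [r1 [c2 [r2 N]]]; case: (CU_NC U N).
 + by case: (NC_stripF Av S).
- have P' := P; have [Gh c0 Ec Er [AAA' hA']] := P'; have U' := CU_pr U P.
 have [Hh er _] := U; have [Hh' er' _] := U'; have [_ ce _ _ _] := Hh.
 case: H => -[Em EA Ex EB]; subst m A1 x B.
 + by left=> k Gk k0; exact: (end_not_cusp Hh er).
 + by left=> k Gk k0; exact: (end_not_cusp Hh' er').
 right; exists h, A'; split=> //.
 + split=> //; rewrite (Tri_image AAA U P); exact/(cell_CU _ AAA' U').
 + split; first by exists (ctr h^-1%g < ctr h^-1%g + c - e); apply: half_col; exact: hA'.
  exists [:: (A, h); (A', h^-1%g)]; last by rewrite !inE eqxx orbT.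
  by constructor 2; exists (Some (pt e 0)), A'; exact/(cuspidal_cycleP _ _ _ _ U).
 case=> -[A2 h2] m' B' /= [? ?]; subst A2 h2; rewrite /desc /=.
 have ne := CU_pr_ne AAA U P.
 case=> [[uu [v2 [l2 [j2 [[_ Av2] _ _ _ _]]]]]|[c2 [r2 [e2 [A2 [U2 _ P2 H2]]]]]|[a [d [_ S _ _ _]]]].
 + by case: Av2 => c1 [r1 [c2 [r2 N]]]; case: (CU_NC U N).
 + have [? ? ?] := CU_uniq U U2; subst c2 r2 e2.
  by case: H2 => -[_ E1 E2 _]; [case: ne|move: E2 ce; lra|case: ne].
 + by case: (CU_stripF U S).
left=> k Gk k0; have [c [r [c' [r' [H1 H2 E1 E2 _]]]]] := strip_end S.
by case: H => -[_ ->]; [exact: (end_not_cusp H1 E1)|exact: (end_not_cusp H2 E2)].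
Qed.

Lemma vline_image g x y : ec g != 0 -> mobC g @` line (vert x) = line (vert y) -> ctr g = x /\ ctr g^-1%g = y.
Proof.
move=> c0 E; have im t : 0 < t -> re (mobC g (pt x t)) = y.
 move=> t0; have : line (vert y) (mobC g (pt x t)).
  by rewrite -E; exists (pt x t) => //; apply/line_vertE.
 by case/line_vertE.
have r0 := rad_gt0 c0; have r2 : 0 < rad g ^+ 2 by nra.
have u1 : uhp (pt x 1 : C) by exact: ltr01.
have u2 : uhp (pt x 2 : C) by exact: ltr0Sn.
have E1 := im 1 ltr01; have E2 := im 2 (ltr0Sn R 1).
rewrite re_mob // /nz re_pt im_pt in E1; rewrite re_mob // /nz re_pt im_pt in E2.
have q0 : x = ctr g.
 apply/eqP; rewrite -subr_eq0; apply: contraT => ne.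
 have : rad g ^+ 2 * (x - ctr g) / ((x - ctr g) ^+ 2 + 1 ^+ 2) = rad g ^+ 2 * (x - ctr g) / ((x - ctr g) ^+ 2 + 2 ^+ 2) by lra.
 have m0 : rad g ^+ 2 * (x - ctr g) != 0 by rewrite mulf_neq0 // gt_eqF.
 move=> /(mulfI m0) /invr_inj; lra.
nra.
Qed.

Section Choices.
Variable S : set (set C * G).
Hypothesis HS : set_of_choices Gam AA S.

Lemma choice_uniq i i' A1 (c c' : seq (set C * G)) : S i.1 -> S i'.1 -> cycle_of Gam AA i.1.1 i.1.2 c -> A1 \in map fst c ->
 cycle_of Gam AA i'.1.1 i'.1.2 c' -> A1 \in map fst c' -> i.1 = i'.1.
Proof.
move=> Si Si' cc mc cc' mc'; have [p [_ U]] := HS.2 _ _ _ cc.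
rewrite -(U i.1) ?(U i'.1) //; split=> //; [exists c'|exists c] => //; by exists A1.
Qed.

(** If [g] fixes infinity, comparing columns at the side identifies the precells and makes [g]
    trivial. Otherwise [g] exchanges the roles of top and foot; followed by the element of
    [desc_nbr] it fixes infinity and leads to a side that no index selects. *)
Lemma desc_uniq i i' A1 A1' x x' B B' g : S i.1 -> S i'.1 -> desc i A1 x B -> desc i' A1' x' B' ->
 Gam g -> mobC g @` B' = B -> mobC g @` line (vert x') = line (vert x) -> i = i' /\ g = 1%g.
Proof.
move=> Si Si' D D' Gg EB El.
have [AA1 cB tB sB [[oo co] [c cc mc]]] := desc_facts D.
have [AA1' cB' tB' sB' [[oo' co'] [c' cc' mc']]] := desc_facts D'.
have same k A2 X y o2 : tile X -> side X (line (vert y)) -> AA A2 -> A2 `<=` X -> col A2 y o2 ->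
  ec k = 0 -> Gam k -> mobC k @` B' = X -> mobC k @` line (vert x') = line (vert y) ->
  k = 1%g /\ A2 = A1' /\ x' = y.
 move=> tX sX AA2 sub c2 k0 Gk EX Ey.
 have [t Ek] : exists t, k = vert t by apply: translation_stab; apply/stab_infP.
 rewrite Ek in Gk EX Ey *.
 have Exy : y = x' + t.
  have : line (vert y) (mobC (vert t) (pt x' 1)).
   by rewrite -Ey; exists (pt x' 1) => //; apply/line_vertE; split=> //; exact: ltr01.
  by case/line_vertE; rewrite vert_mob re_pt.
 have Au := precell_uhp (pAA AA1').
 have c1 := col_vert t Au co'; rewrite -Exy in c1.
 have sub1 : mobC (vert t) @` A1' `<=` X.
  by move=> _ [w Aw <-]; rewrite -EX; exists w => //; exact: (cell_sub AA1' cB').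
 (* Both columns are in the tile [X], which lies on one side of the line because the line is a side
    of it. *)
 have Eo : oo' = o2.
  have [d [y0 [d0 y00 H]]] := c1; have [d' [y0' [d0' y00' H']]] := c2.
  have pts (a b : R) : (if oo' then y < a < y + d else y - d < a < y) ->
    (if o2 then y < b < y + d' else y - d' < b < y) -> X (pt a (y0 + y0')) /\ X (pt b (y0 + y0')).
   move=> ha hb; split; [apply: sub1; apply: interior_subset; apply: H => //; lra|
    apply: sub; apply: interior_subset; apply: H' => //; lra].
  case: oo' o2 pts {c1 c2 H H' co'} => -[] // pts; exfalso.
   have [|| p1 p2] := pts (y + d / 2) (y - d' / 2); [lra|lra|].
   by apply: (tile_vline tX sX p2 p1); rewrite re_pt; lra.
  have [|| p1 p2] := pts (y - d / 2) (y + d' / 2); [lra|lra|].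
  by apply: (tile_vline tX sX p1 p2); rewrite re_pt; lra.
 rewrite -Eo Exy in c2; have [Et EA] := col_fund AA1' AA2 Gk co' c2.
 by rewrite Et; split=> //; split=> //; rewrite Exy (vert_inj (etrans Et (esym vert0))) addr0.
have [g0|g0] := eqVneq (ec g) 0.
 have subB := cell_sub AA1 cB.
 have [-> [E Ex]] := same g A1 B x oo tB sB AA1 subB co g0 Gg EB El; split=> //.
 subst A1' x'; by case: (desc_det D D' (choice_uniq Si Si' cc mc cc' mc')) => _; apply.
exfalso; have [E1 E2] := vline_image g0 El.
case: (desc_nbr D) => [nc|[h [A2 [Gh [h0 Eh] [AA2 cB2] [[oo2 co2] [c2 cc2 mc2]] no]]]].
 by apply: (nc g^-1%g) => //; [exact: GamV|rewrite ecV0].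
have k0 : ec (h * g)%g = 0.
 have [s [_ _ _ Ec _]] := mul_entries h g; rewrite Ec.
 have ed1 : ed h = - (ec h * x) by rewrite -Eh /ctr; field.
 have ea1 : ea g = ec g * x by rewrite -E2 ctrV //; field.
 by rewrite ed1 ea1; ring.
have Gk : Gam (h * g)%g by exact: GamM.
have Bu := tile_uhp tB'.
have tX := tile_mob Gh tB.
have sX := tile_side_mob Gh tB sB.
rewrite -Eh mob_vline // in sX.
have EX : mobC (h * g)%g @` B' = mobC h @` B by rewrite -EB mob_img.
have Ey : mobC (h * g)%g @` line (vert x') = line (vert (ctr h^-1%g)).
 by rewrite -mob_vline // Eh -El mob_img // => w [].
have sub2 := cell_sub AA2 cB2.
have [_ [E3 Ex]] := same (h * g)%g A2 _ _ oo2 tX sX AA2 sub2 co2 k0 Gk EX Ey.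
rewrite -E3 Ex in D'; rewrite -E3 in mc'; apply: (no i' B' _ D').
exact: (choice_uniq Si' Si cc' mc' cc2 mc2).
Qed.

(** The non-vertical side of the ideal triangle becomes vertical after the pairing, standing over
    the ideal vertex of the paired triangle; this is the side with [m = 2]. *)
Lemma tri_circ_image A c r e h A' : CU A c r e -> pr c r e h A' ->
 [set z | uhp z /\ (re z - c) * (re z - e) + im z ^+ 2 = 0] =
 mobC h^-1%g @` line (vert (ctr h^-1%g + c - e)).
Proof.
move=> [[r0 ce _ _ _] er _] [Gh c0 Ec Er _].
have iff z : uhp z -> (re z - c) * (re z - e) + im z ^+ 2 = 0 <-> re (mobC h z) = ctr h^-1%g + c - e.
 move=> Hz; rewrite re_mob // Ec Er -er; have n0 := nz_gt0 c Hz.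
 have q0 : e - c != 0 by lra; apply/eqP.
 have -> : (re z - c) * (re z - e) + im z ^+ 2 = nz c z - (e - c) * (re z - c) by rewrite /nz; ring.
 move: (nz c z) n0 => N n0; split=> E.
  have -> : N = (e - c) * (re z - c) by lra.
  have z0 : re z - c != 0.
   nra.
  by field; rewrite z0.
 have F : (e - c) ^+ 2 * (re z - c) / N = e - c by lra.
 have : (e - c) ^+ 2 * (re z - c) = (e - c) * N by rewrite -{2}F divfK // gt_eqF.
 nra.
apply/predeqP => z; split=> [[Hz E]|[w /line_vertE[Hw Ew] <-]].
 exists (mobC h z); last by rewrite mobCK.
 by apply/line_vertE; split; [exact: mobC_uhp|exact/(iff z Hz)].
have Hz := mobC_uhp h^-1%g Hw; split=> //; apply/(iff _ Hz); rewrite mobCKV //.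
Qed.

Lemma img1 X : mobC (1%g : G) @` X = X.
Proof. by apply/predeqP => z; split=> [[w wB <-]|zB]; [|exists z]; rewrite ?mobC1. Qed.

Lemma side_uhp X b : tile X -> side X b -> b `<=` uhp.
Proof.
move=> tX sb; have [K EK gK] := tile_good tX.
by have /(tile_side _ EK gK)[k kK ->] := sb => w [].
Qed.

Lemma cycle_mem A h (c : seq (set C * G)) A2 : cycle_of Gam AA A h c -> A2 \in map fst c ->
 [\/ exists x y, [/\ strip_precell Gam A2 x y, A2 = A, h = 1%g & AA A],
   exists d q e A', [/\ CU A d q e, AA A, pr d q e h A' & A2 = A \/ A2 = A'] |
   exists o v (k j : nat), [/\ AA A, atv A v, period o v A k, h = ch o v A 0 & A2 = cA o v A j]].
Proof.
case=> [[x [y [AAA St Eh ->]]]|[p [A' cu]]|nc] m.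
- by constructor 1; exists x, y; move: m; rewrite inE => /eqP ->.
- constructor 2; have [AAA [s U _] Ec] := cu; have [d [q [e [U1 _ _]]]] := cuspidal_CU U.
 have /(cuspidal_cycleP _ _ _ _ U1)[_ P _ _] := cu.
 by exists d, q, e, A'; split=> //; move: m; rewrite Ec !inE => /orP[/eqP|/eqP]; [left|right].
constructor 3; have [oo [v [k [AAA Av per Eh Ec]]]] := ncycleP nc.
by move: m; rewrite Ec => /mapP[q' /mapP[j jk ->] /= EA]; exists oo, v, k, j.
Qed.

Lemma choice_ex A h (c : seq (set C * G)) : cycle_of Gam AA A h c -> exists A1 h1 (c1 : seq (set C * G)) A2,
 [/\ S (A1, h1), cycle_of Gam AA A1 h1 c1, A2 \in map fst c & A2 \in map fst c1].
Proof. by move=> cc; have [[A1 h1] [[Sp [c' cc' [A2 [m m']]]] _]] := HS.2 _ _ _ cc; exists A1, h1, c', A2. Qed.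

(** The chosen cycle shares a precell with the given one, so their vertices are in one orbit and the
    tiles are translates. The position of the side in the chosen cycle is reduced below [cyl] by
    periodicity. *)
Lemma desc_ex_NC A0 v0 s : AA A0 -> atv A0 v0 -> side (NCtile v0) s -> exists i A1 x B g,
 [/\ index_set Gam AA S i, desc i A1 x B, Gam g, NCtile v0 = mobC g @` B & s = mobC g @` line (vert x)].
Proof.
move=> AA0 Av0 ss; have [k0 per0] := period_ex true AA0 Av0.
have cc0 : cycle_of Gam AA A0 (ch true v0 A0 0) (clist true v0 A0 k0) by constructor 3; exact: ncycle_ex.
have [A [h [c [A2 [Sp cc m0 m1]]]]] := choice_ex cc0.
have /mapP[q /mapP[j0 j0k ->] /= EA2] := m0.
have [AA2 G2 v2 _] := cycP true j0 AA0 Av0; rewrite -EA2 in v2 AA2.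
case: (cycle_mem cc m1) => [[x [y [St _ _ _]]]|[d [q1 [e [A' [U _ P EA]]]]]|[oo [v [k [j [AAA Av per Eh EA]]]]]].
- by case: (NC_stripF v2 St).
- have U2 : exists d q e, CU A2 d q e by case: EA => ->; [exists d, q1, e|exists (ctr h^-1%g), q1, (ctr h^-1%g + d - e); exact: (CU_pr U P)].
 have [d2 [q2 [e2 U3]]] := U2; have [c1 [r1 [c2 [r2 N]]]] := v2; by case: (CU_NC U3 N).
have [AAj Gj vj _] := cycP oo j AAA Av; rewrite -EA in vj AAj.
have Ev := atv_uniq v2 vj; subst h.
have Hv := atv_uhp Av; have Hv0 := atv_uhp Av0.
pose g1 := ((cg true v0 A0 j0)^-1 * cg oo v A j)%g.
have Gg1 : Gam g1 by apply: GamM => //; exact: GamV.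
have Ev0 : v0 = mobC g1 v by rewrite /g1 mobCM // -Ev mobCK.
have EN : NCtile v0 = mobC g1 @` NCtile v by rewrite NCtile_mob // Ev0.
have tN := NCtile_tile AAA Av; have Nu := tile_uhp tN.
have tN0 := NCtile_tile AA0 Av0.
have := tile_side_mob (GamV Gg1) tN0 ss.
rewrite EN mob_img // mulVg img1 => /(NC_sides oo AAA Av)[n En].
have fr := cyl_fr AAA Av per; set l := (find _ _).+1 in fr.
have [n' n'l En'] := fr_mod AAA Av n fr.
have [Evn Ehn] := cA_ch AAA Av En'.
have [AAn Gn vn sn] := cycP oo n AAA Av.
exists (A, ch oo v A 0, n'.+1), (cA oo v A n'), (ctr (ch oo v A n')), (NCtile (mobC (cg oo v A n') v)),
 (g1 * (cg oo v A n)^-1)%g; split.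
- split=> //; exists l; last by [].
 by constructor 3; exists (clist oo v A k) => //; exact: ncycle_ex.
- by constructor 1; exists oo, v, l, n'.
- by apply: GamM => //; exact: GamV.
- rewrite -EN Evn NCtile_mob //; [|exact: mobC_uhp|by apply: GamM => //; exact: GamV].
 by rewrite -mobCM // mulgVK -Ev0.
rewrite Ehn -mob_img; last by move=> w [].
by rewrite -En mob_img ?mulgV ?img1 //; exact: side_uhp tN0 ss.
Qed.

Lemma desc_ex_CU A0 c0 r0 e0 s : AA A0 -> CU A0 c0 r0 e0 -> side (Tri c0 e0) s -> exists i A1 x B g,
 [/\ index_set Gam AA S i, desc i A1 x B, Gam g, Tri c0 e0 = mobC g @` B & s = mobC g @` line (vert x)].
Proof.
move=> AA0 U0 ss; have [h0 [A0' P0]] := pr_ex (half_of_HALF (Or33 _ _ U0)).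
have cc0 : cycle_of Gam AA A0 h0 [:: (A0, h0); (A0', h0^-1%g)].
 by constructor 2; exists (Some (pt e0 0)), A0'; exact/(cuspidal_cycleP _ _ _ _ U0).
have U0' := CU_pr U0 P0.
have [A [h [c [A2 [Sp cc m0 m1]]]]] := choice_ex cc0.
have EA2 : A2 = A0 \/ A2 = A0' by move: m0; rewrite !inE => /orP[/eqP|/eqP]; [left|right].
have U2 : exists d q e, CU A2 d q e by case: EA2 => ->; [exists c0, r0, e0|exists (ctr h0^-1%g), r0, (ctr h0^-1%g + c0 - e0); exact: U0'].
have [d2 [q2 [e2 U3]]] := U2.
case: (cycle_mem cc m1) => [[x [y [St _ _ _]]]|[d [q [e [A' [U AAA P EA]]]]]|[oo [v [k [j [AAA Av per Eh EA]]]]]]; first 1 last.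
- have U' := CU_pr U P; have [Gh h0' Ec Er [AAA' _]] := P; have [[_ ce _ _ _] _ _] := U.
 have P0V := CU_prV AA0 U0 P0; have PV := CU_prV AAA U P.
 have EA0 : A0 = A \/ A0 = A'.
  case: EA2 EA => -> [E|E]; [by left|by right| |].
   right; rewrite E in U0'; have [E1 E2 E3] := CU_uniq U0' U; rewrite E3 E1 E2 in P0V.
   by have [_ ->] := pr_uniq (half_of_HALF (Or33 _ _ U)) P0V P.
  left; rewrite E in U0'; have [E1 E2 E3] := CU_uniq U0' U'; rewrite E3 E1 E2 in P0V.
  by have [_ ->] := pr_uniq (half_of_HALF (Or33 _ _ U')) P0V PV.
 have [g [Gg ET]] : exists g, Gam g /\ Tri c0 e0 = mobC g @` Tri d e.
  case: EA0 => E.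
   exists 1%g; split; first exact: Gam1.
   by rewrite img1; rewrite E in U0; have [-> _ ->] := CU_uniq U0 U.
  exists h; split=> //; rewrite (Tri_image AAA U P); rewrite E in U0.
  by have [-> _ ->] := CU_uniq U0 U'.
 have tT := Tri_tile AAA U; have Tu := tile_uhp tT.
 have tT0 := Tri_tile AA0 U0; have su := side_uhp tT0 ss.
 have := tile_side_mob (GamV Gg) tT0 ss; rewrite ET mob_img // mulVg img1.
 have Es (t : set C) : mobC g^-1%g @` s = t -> s = mobC g @` t by move=> <-; rewrite mob_img // mulgV img1.
 have cyl : is_cyl Gam AA A h 3%N.
  constructor 2; split=> //; exists (Some (pt e 0)), A', [:: (A, h); (A', h^-1%g)].
  exact/(cuspidal_cycleP _ _ _ _ U).
 move/(Tri_sides _ ce) => -[/Es Es0|/Es Es0|/Es Es0].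
 + exists (A, h, 3%N), A, d, (Tri d e), g; split=> //; first by split=> //; exists 3%N.
  by constructor 2; exists d, q, e, A'; split=> //; constructor 3.
 + exists (A, h, 1%N), A, e, (Tri d e), g; split=> //; first by split=> //; exists 3%N.
  by constructor 2; exists d, q, e, A'; split=> //; constructor 1.
 exists (A, h, 2%N), A', (ctr h^-1%g + d - e), (Tri (ctr h^-1%g) (ctr h^-1%g + d - e)), (g * h^-1)%g; split=> //.
 + by split=> //; exists 3%N.
 + by constructor 2; exists d, q, e, A'; split=> //; constructor 2.
 + by apply: GamM => //; exact: GamV.
 + by rewrite -(Tri_image AAA U P) mob_img // mulgVK.
 by rewrite Es0 (tri_circ_image U P) mob_img // => w [].
- have [AAj Gj vj _] := cycP oo j AAA Av; rewrite -EA in vj AAj.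
 by have [c1 [r1 [c2 [r2 N]]]] := vj; case: (CU_NC U3 N).
by case: (CU_stripF U3 St).
Qed.

Lemma desc_ex_strip A0 (a d : R) s : AA A0 -> strip_precell Gam A0 a d -> side A0 s -> exists i A1 x B g,
 [/\ index_set Gam AA S i, desc i A1 x B, Gam g, A0 = mobC g @` B & s = mobC g @` line (vert x)].
Proof.
move=> AA0 St ss; have cc0 : cycle_of Gam AA A0 1%g [:: (A0, 1%g)] by constructor 1; exists a, d.
have [A [h [c [A2 [Sp cc m0 m1]]]]] := choice_ex cc0.
have EA2 : A2 = A0 by move: m0; rewrite inE => /eqP.
subst A2; case: (cycle_mem cc m1) => [[x [y [_ EA Eh _]]]|[d1 [q [e [A' [U _ P EA]]]]]|[oo [v [k [j [AAA Av per Eh EA]]]]]].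
- subst A h; have cyl : is_cyl Gam AA A0 1%g 2%N by constructor 1; split=> //; exists a, d, [:: (A0, 1%g)].
 case/(strip_sides _ St): ss => ->.
  exists (A0, 1%g, 1%N), A0, a, A0, 1%g; rewrite !img1; split=> //; [by split=> //; exists 2%N| |exact: Gam1].
  by constructor 3; exists a, d; split=> //; left.
 exists (A0, 1%g, 2%N), A0, d, A0, 1%g; rewrite !img1; split=> //; [by split=> //; exists 2%N| |exact: Gam1].
 by constructor 3; exists a, d; split=> //; right.
- by case: EA St => -> St; [case: (CU_stripF U St)|case: (CU_stripF (CU_pr U P) St)].
have [AAj Gj vj _] := cycP oo j AAA Av; rewrite -EA in vj.
by case: (NC_stripF vj St).
Qed.

Lemma desc_ex X b : tile X -> side X b -> exists i A1 x B g, [/\ index_set Gam AA S i, desc i A1 x B, Gam g,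
 X = mobC g @` B & b = mobC g @` line (vert x)].
Proof.
move=> tX sb; have [g0 [A0 [B0 [Gg0 AA0 cB0 EX]]]] := tX.
have tB0 : tile B0 by exists 1%g, A0, B0; rewrite img1; split=> //; exact: Gam1.
have B0u := tile_uhp tB0; have bu := side_uhp tX sb.
have := tile_side_mob (GamV Gg0) tX sb; rewrite EX mob_img // mulVg img1 => ss.
suff [i [A1 [x [B [g [Si D Gg EB0 Es0]]]]]] : exists i A1 x B g, [/\ index_set Gam AA S i, desc i A1 x B, Gam g,
  B0 = mobC g @` B & mobC g0^-1%g @` b = mobC g @` line (vert x)].
 have [_ _ tB _ _] := desc_facts D; have Bu := tile_uhp tB.
 exists i, A1, x, B, (g0 * g)%g; split=> //; first exact: GamM.
  by rewrite EB0 mob_img.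
 rewrite -mob_img; last by move=> w [].
 by rewrite -Es0 mob_img // mulgV img1.
case: (precell_cases (pAA AA0)) => [[v0 [c1 [r1 [c2 [r2 N]]]]]|[c [r [e U]]]|[a [d St]]].
- have Av0 : atv A0 v0 by exists c1, r1, c2, r2.
 have E0 := (cell_NC _ AA0 Av0).1 cB0; subst B0; exact: (desc_ex_NC AA0 Av0 ss).
- have E0 := (cell_CU _ AA0 U).1 cB0; subst B0; exact: (desc_ex_CU AA0 U ss).
have E0 := (cell_strip _ AA0 St).1 cB0; subst B0; exact: (desc_ex_strip AA0 St ss).
Qed.

End Choices.

End Indices.

(** * Crossing sequences, labels and the symbolic dynamics *)

Section Coding.
Variable S : set (set (Cplx R) * PSL2 R).
Variable T : CS_index R -> PSL2 R.
Hypothesis HS : set_of_choices Gam AA S.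
Hypothesis HT : shift_map Gam AA S T.
Implicit Types (g h k l : G) (z w : C) (s t x e : R) (X B b : set C) (i : CS_index R) (m n : int).
Local Notation piece := (section_piece Gam AA T).

(** The vector at time [t] lies in the translate by [g] of the piece of index [i]. For consecutive
    hits with elements [g] and [g1] the label is formed with [g^-1 * g1]. *)
Definition hit h t i g : Prop :=
 [/\ index_set Gam AA S i, Gam g & (mobT g @` piece i) (velocity h t)].

Lemma T_Gam i : index_set Gam AA S i -> Gam (T i).
Proof. by move=> /HT[]. Qed.

Lemma hitE h t i g : hit h t i g <-> [/\ index_set Gam AA S i, Gam g & exists A1 x B,
 [/\ desc i A1 x B, (mobC (g * T i)%g @` line (vert x)) (gp h t) &
   exists2 e, 0 < e & forall s, t < s < t + e -> (mobC (g * T i)%g @` B)^° (gp h s)]].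
Proof.
have imu X g0 : X `<=` uhp -> mobC g0 @` X `<=` uhp by move=> Xu _ [z /Xu Hz <-]; exact: mobC_uhp.
split=> [[Ii Gg [w [SHw [B [b [ib bw [g0 [E0 pt]]]]]] Ew]]|[Ii Gg [A1 [x [B [D bh [e e0 He]]]]]]]; split=> //.
 have [Si [n cyl mn]] := Ii; have [A1 [x [D Eb]]] := side_desc cyl mn ib.
 have [_ _ tB _ _] := desc_facts D; have Bu := tile_uhp tB.
 have Eh : (h * at_ t = g * g0)%g.
  by apply: velocity_inj; rewrite velocity_at0 -Ew -E0 mobT_velocity.
 have gpE s : gp h (s + t) = mobC g (gp g0 s) by rewrite mobC_gp -Eh gp_at.
 exists A1, x, B; split=> //.
  have -> : gp h t = mobC g w.1 by rewrite -[t]add0r gpE -E0.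
  rewrite -mob_img; last by move=> u [].
  by exists w.1 => //; rewrite -Eb.
 have /nbhs_ballP[e /= e0 He] := pt; exists e => // s st.
 rewrite -mob_img // interior_mobC; last exact: imu.
 exists (gp g0 (s - t)); last by rewrite -gpE subrK.
 apply: He; last by lra.
 by rewrite /ball /= sub0r normrN ger0_norm; lra.
have [_ _ tB _ _] := desc_facts D; have Bu := tile_uhp tB.
exists (velocity (g^-1 * (h * at_ t))%g 0); last by rewrite mobT_velocity mulVKg velocity_at0.
have gpE s : gp (g^-1 * (h * at_ t))%g s = mobC g^-1%g (gp h (s + t)) by rewrite -mobC_gp gp_at.
split; first exact: SH_velocity.
exists B, (line (vert x)); split; first exact: (desc_side D).
 have -> : (velocity (g^-1 * (h * at_ t))%g 0).1 = mobC g^-1%g (gp h t).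
  by rewrite -{2}[t]add0r -gpE.
 case: bh => u ku <-; exists u => //; have Hu : uhp u by case: ku.
 by rewrite mobCM // mobCK //; exact: mobC_uhp.
exists (g^-1 * (h * at_ t))%g; split=> //.
apply/nbhs_ballP; exists e => // s /=; rewrite /ball /= sub0r normrN => se s0.
rewrite gtr0_norm // in se; change ((mobC (T i) @` B)^° (gp (g^-1 * (h * at_ t))%g s)); rewrite gpE.
have : (mobC (g * T i)%g @` B)^° (gp h (s + t)) by apply: He; lra.
rewrite -mob_img // interior_mobC; last exact: imu.
by case=> u Xu <-; rewrite mobCK //; have := interior_subset Xu; exact: imu.
Qed.

Lemma hit_wall h t i g : hit h t i g -> exists A1 x B K k, [/\ desc i A1 x B, wall K k,
 poly K = mobC (g * T i)%g @` B /\ line k = mobC (g * T i)%g @` line (vert x),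
 line k (gp h t) & exists2 e, 0 < e & forall s, t < s < t + e -> ipoly K (gp h s)].
Proof.
move=> /hitE[Ii Gg [A1 [x [B [D bh He]]]]].
have [_ _ tB sB _] := desc_facts D.
have GT : Gam (g * T i)%g by apply: GamM => //; exact: T_Gam.
have tX := tile_mob GT tB; have sX := tile_side_mob GT tB sB.
have [K EK gK] := tile_good tX; have /(tile_side _ EK gK)[k kK Ek] := sX.
exists A1, x, B, K, k; rewrite -Ek -EK; split=> //; first by split=> //; rewrite -EK.
by case: He => e e0 He; exists e => // s /He; rewrite EK interior_poly.
Qed.

Lemma hit_al h t i g K k : hit h t i g -> wall K k -> line k (gp h t) ->
 (exists2 e, 0 < e & forall s, t < s < t + e -> ipoly K (gp h s)) -> 0 < al (k^-1 * h)%g.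
Proof.
move=> _ [_ _ kK] kt [e e0 He]; have [_ /(_ k kK) p] : ipoly K (gp h (t + e / 2)) by apply: He; lra.
rewrite (al_pos kt p); lra.
Qed.

Lemma hit_ex h t : cross h t -> exists i g, hit h t i g.
Proof.
move=> /cross_wall[K [k [[tX gK kK] kt a0 [e e0 He]]]].
have sX : side (poly K) (line k) by apply/(tile_side (K := K)) => //; exists k.
have [i [A1 [x [B [g [Ii D Gg EX Ek]]]]]] := desc_ex HS tX sX.
have GT := T_Gam Ii; exists i, (g * (T i)^-1)%g; apply/hitE; split=> //.
 by apply: GamM => //; exact: GamV.
exists A1, x, B; rewrite mulgVK -EX -Ek; split=> //.
by exists e => // s /He; rewrite interior_poly.
Qed.

(** The geodesic determines the tile it enters and the wall it crosses; [desc_uniq] recovers index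
    and group element from these. *)
Lemma hit_uniq h t i g i' g' : hit h t i g -> hit h t i' g' -> i = i' /\ g = g'.
Proof.
move=> H H'; have [[Si _] Gg _] := H; have [[Si' _] Gg' _] := H'.
have [A1 [x [B [K [k [D Wk [EB El] kt [e e0 He]]]]]]] := hit_wall H.
have [A1' [x' [B' [K' [k' [D' Wk' [EB' El'] kt' [e' e0' He']]]]]]] := hit_wall H'.
have [m [m1 m2 m3]] := ltr_ex2 e0 e0'.
have h1 : ipoly K (gp h (t + m)) by apply: He; lra.
have h2 : ipoly K' (gp h (t + m)) by apply: He'; lra.
have [tX [[z0 z0K] gK] kK] := Wk; have [tX' gK' kK'] := Wk'.
have E : poly K = poly K'.
 by apply: (tile_eq tX tX' (z := gp h (t + m))); [rewrite interior_poly|exact: ipoly_sub].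
have Ekk := wall_meet Wk Wk' kt kt'.
have GT : Gam (g * T i)%g by apply: GamM => //; case: H => /T_Gam.
have GT' : Gam (g' * T i')%g by apply: GamM => //; case: H' => /T_Gam.
have [_ _ tB _ _] := desc_facts D; have Bu := tile_uhp tB.
have [_ _ tB' _ _] := desc_facts D'; have Bu' := tile_uhp tB'.
have lu y : line (vert y) `<=` uhp by move=> u [].
have Gs : Gam ((g * T i)^-1 * (g' * T i'))%g by apply: GamM => //; exact: GamV.
have [] := desc_uniq HS Si Si' D D' Gs.
- by rewrite -mob_img // -EB' -E EB mob_img // mulVg img1.
- by rewrite -mob_img // -El' -Ekk El mob_img // mulVg img1.
move=> Ei E1; split=> //; subst i'; apply: (mulIg (T i)).
by rewrite -[RHS]mul1g -(mulgV (g * T i)%g) -mulgA E1 mulg1.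
Qed.

Lemma hit_mob c h t i g : Gam c -> hit h t i g -> hit (c * h)%g t i (c * g)%g.
Proof.
move=> Gc [Ii Gg [w pw Ew]]; split=> //; first exact: GamM.
exists w => //; rewrite -mobT_velocity -Ew mobTM //; by case: pw => -[].
Qed.

Lemma hit_at h s t i g : hit (h * at_ s)%g t i g <-> hit h (t + s) i g.
Proof. by rewrite /hit velocity_at. Qed.

Lemma hit_rep h t i : hit h t i 1%g <-> index_set Gam AA S i /\ piece i (velocity h t).
Proof.
split=> [[Ii _ [w pw <-]]|[Ii pw]]; first by rewrite mobT1.
by split=> //; [exact: Gam1|exists (velocity h t); rewrite ?mobT1].
Qed.

Lemma velocityYE h h' t t' : velocityY Gam h t = velocityY Gam h' t' <->
 exists2 c, Gam c & (h' * at_ t' = c * (h * at_ t))%g.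
Proof.
split=> [E|[c Gc E]].
 have : velocityY Gam h' t' (velocity h' t').
  by exists 1%g; [exact: Gam1|rewrite mobT1].
 rewrite -E => -[c Gc Ec]; exists c => //; apply: velocity_inj.
 by rewrite velocity_at0 -Ec -mobT_velocity velocity_at0.
apply/predeqP => w; split=> -[d Gd <-].
 exists (d * c^-1)%g; first by apply: GamM => //; exact: GamV.
 by rewrite -(velocity_at0 h' t') -(velocity_at0 h t) E !mobT_velocity mulgA mulgVK.
by exists (d * c)%g => /=; [exact: GamM|rewrite -(velocity_at0 h' t') -(velocity_at0 h t) E !mobT_velocity -mulgA].
Qed.

Lemma CSY_cross h t : CSY Gam AA (velocityY Gam h t) <-> cross h t.
Proof.
split=> [[v cv Ev]|ch]; last by exists (velocity h t).
have [h' Eh'] := SH_exists (let: And3 a _ _ := cv in a); rewrite -Eh' in cv Ev.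
have /velocityYE[c Gc E] : velocityY Gam h' 0 = velocityY Gam h t by exact: Ev.
have c0 : cross (h' * at_ 0)%g 0 by apply/cross_at; rewrite add0r.
have : cross (h * at_ t)%g 0 by rewrite E; apply/cross_mob.
by move/cross_at; rewrite add0r.
Qed.

(** An orbit has only one vector in the set of representatives, by [hit_uniq]. The label can
    therefore be read off on any lift, relative to the group element of its hit. *)
Lemma labelY_hit h t i g (l : label R) : hit h t i g -> has_labelY Gam AA S T (velocityY Gam h t) l <->
 match l with None => ~ exists s, first_time [set s | cross h (t + s)] s
 | Some (i1, g1) => exists2 s, first_time [set s | cross h (t + s)] s & hit h (t + s) i1 (g * g1)%g end.
Proof.
move=> H; have [Ii Gg _] := H.
pose h0 := (g^-1 * (h * at_ t))%g.
have GV := GamV Gg.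
have ct s : cross h0 s <-> cross h (t + s).
 by rewrite /h0 cross_mob // cross_at addrC.
have hh s i1 g1 : hit h0 s i1 g1 <-> hit h (t + s) i1 (g * g1)%g.
 split=> [/(hit_mob Gg)|]; first by rewrite mulVKg hit_at addrC.
 by rewrite addrC -hit_at => /(hit_mob GV); rewrite mulKg.
have H0 : hit h0 0 i 1%g by apply/hh; rewrite addr0 mulg1.
have E0 q : (q * at_ (0 : R) = q :> G)%g by apply: velocity_inj; rewrite velocity_at0.
have Ev : velocityY Gam h0 0 = velocityY Gam h t.
 by apply/velocityYE; exists g; rewrite // E0 mulVKg.
have rep h1 : section_reps Gam AA S T (velocity h1 0) -> piT Gam (velocity h1 0) = velocityY Gam h t -> h1 = h0.
 case=> i1 Ii1 p1 E1; have H1 : hit h1 0 i1 1%g by apply/hit_rep.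
 have /velocityYE[c Gc E] : velocityY Gam h0 0 = velocityY Gam h1 0 by rewrite Ev.
 rewrite !E0 in E; have := hit_mob Gc H0; rewrite -E mulg1 => H2.
 by have [_ Ec] := hit_uniq H1 H2; rewrite E -Ec mul1g.
have ft s : first_time [set s | cross_section Gam AA (velocity h0 s)] s <-> first_time [set s | cross h (t + s)] s.
 by split=> -[s0 cs no]; split=> //; try exact/ct; move=> r rb /ct; exact: no.
split.
 move=> [u [su Eu [h1 E1]]]; rewrite -E1 in su Eu; have Eh := rep h1 su Eu; subst h1.
 case: l => [[i1 g1]|]; last by move=> no [s /ft fs]; apply: no; exists s.
 by move=> [Ii1 Gg1 [s /ft fs hs]]; exists s => //; apply/hh.
have [_ p0] := (hit_rep _ _ _).1 H0.
move=> Hl; exists (velocity h0 0); split=> //; first by exists i.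
exists h0 => //; case: l Hl => [[i1 g1]|].
 by move=> [s /ft fs /hh[Ii1 Gg1 hs]]; split=> //; exists s.
by move=> no [s /ft fs]; apply: no; exists s.
Qed.

Definition endless h : Prop := forall x, (exists2 t, x < t & cross h t) /\ (exists2 t, t < x & cross h t).

(** All crossing times in increasing order. Every crossing occurs, since by [finite_cross]
    infinitely many times cannot stay in a bounded interval. *)
Definition enum h (tau : int -> R) : Prop := [/\ tau 0 = 0, forall n, cross h (tau n),
 forall n, tau n < tau (n + 1) & forall n s, tau n < s < tau (n + 1) -> ~ cross h s].

Lemma int_pm (P : int -> Prop) : P 0 -> (forall n, P n <-> P (n + 1)) -> forall n, P n.
Proof.
move=> P0 H; elim/int_ind => // n Pn; first by rewrite -addn1 PoszD; apply: (H _).1.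
by apply: (H _).2; rewrite -addn1 PoszD opprD subrK.
Qed.

Lemma prev_cross h t0 t : t < t0 -> cross h t -> exists t1, [/\ t1 < t0, cross h t1 &
 forall s, t1 < s < t0 -> ~ cross h s].
Proof.
move=> lt ct; have lt' : - t0 < - t by lra.
have ct' : cross (h * Sop)%g (- t) by apply/cross_Sop; rewrite opprK.
have [t1 [b /cross_Sop c1 no]] := next_cross lt' ct'.
exists (- t1); split=> //; first lra.
by move=> s sb cs; apply: (no (- s)); [lra|apply/cross_Sop; rewrite opprK].
Qed.

Lemma enum_ex h : cross h 0 -> endless h -> exists tau, enum h tau.
Proof.
move=> c0 en.
have up t : exists t1, cross h t -> [/\ t < t1, cross h t1 & forall s, t < s < t1 -> ~ cross h s].
 have [[t1 lt ct] _] := en t; have [t2 [b c2 no]] := next_cross lt ct.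
 by exists t2 => _; split=> //; lra.
have dn t : exists t1, cross h t -> [/\ t1 < t, cross h t1 & forall s, t1 < s < t -> ~ cross h s].
 by have [_ [t1 lt ct]] := en t; have [t2 H] := prev_cross lt ct; exists t2.
have [f Hf] := choice up; have [p Hp] := choice dn.
have cf (n : nat) : cross h (iter n f 0) by elim: n => //= n IH; have [] := Hf _ IH.
have cp (n : nat) : cross h (iter n p 0) by elim: n => //= n IH; have [] := Hp _ IH.
(* [Negz m] stands for [- (m + 1)], so the number of backward steps is the absolute value of [n]. *)
pose tau (n : int) := if n is Posz m then iter m f 0 else iter `|n|%N p 0.
exists tau; have step n : [/\ cross h (tau n), tau n < tau (n + 1) & forall s, tau n < s < tau (n + 1) -> ~ cross h s].
 case: n => [m|m].
  have -> : Posz m + 1 = Posz m.+1 :> int by rewrite -addn1 PoszD.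
  by rewrite /tau /=; have [] := Hf _ (cf m); split.
 have -> : tau (Negz m + 1) = iter m p 0.
  by rewrite NegzE -addn1 PoszD opprD subrK; case: m.
 by rewrite /tau /=; have [] := Hp _ (cp m); split=> //; exact: (cp m.+1).
by split=> // n; have [] := step n.
Qed.

Lemma enum_mono h tau m n : enum h tau -> m < n -> tau m < tau n.
Proof.
move=> [_ _ st _] mn; have [d -> d0] : exists2 d : nat, n = m + d%:Z & (0 < d)%N by exists `|n - m|%N; lia.
elim: d d0 {mn} => // -[_ _|d IH _]; first exact: st.
by apply: lt_trans (IH isT) _; rewrite -[d.+2]addn1 PoszD addrA; exact: st.
Qed.

Lemma enum_unbounded h tau x : enum h tau -> (exists n, x < tau n) /\ (exists n, tau n < x).
Proof.
move=> E; have [t0 ct _ _] := E; have tinj : injective tau.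
 move=> m n Emn; apply/eqP; case: (ltgtP m n) => // h1; have := enum_mono E h1; rewrite Emn ltxx //.
split; apply: contrapT => N.
 have fin := finite_cross h 0 `|x|.
 have : finite_set [set: nat].
  have : finite_set ((tau \o Posz) @^-1` (cross h `&` [set t | 0 <= t <= `|x|])).
   by apply: finite_preimage => // a b _ _ /tinj[].
  apply: sub_finite_set => a _; split; first exact: ct.
  have : tau a <= x by rewrite leNgt; apply/negP => h1; apply: N; exists a.
  have : 0 <= tau a by case: a => [|a]; [rewrite t0|rewrite ltW // -t0; apply: (enum_mono E)].
  by have := ler_norm x; rewrite /=; lra.
 exact: infinite_nat.
have fin := finite_cross h (- `|x|) 0.
have : finite_set [set: nat].
 have : finite_set ((fun a : nat => tau (- a%:Z)) @^-1` (cross h `&` [set t | - `|x| <= t <= 0])).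
  by apply: finite_preimage => // a b _ _ /tinj /oppr_inj[].
 apply: sub_finite_set => a _; split; first exact: ct.
 have : x <= tau (- a%:Z) by rewrite leNgt; apply/negP => h1; apply: N; exists (- a%:Z).
 have : tau (- a%:Z) <= 0 by case: a => [|a]; [rewrite oppr0 t0|rewrite ltW // -t0; apply: (enum_mono E)].
 have := ler_norm (- x); rewrite normrN /=; lra.
exact: infinite_nat.
Qed.

Lemma enum_endless h tau : enum h tau -> endless h.
Proof. by move=> E x; have [[n h1] [m h2]] := enum_unbounded x E; have [_ c _ _] := E; split; [exists (tau n)|exists (tau m)]. Qed.

Lemma enum_surj h tau s : enum h tau -> cross h s -> exists n, tau n = s.
Proof.
move=> E cs; have [t0 ct st no] := E; have [[n hn] [m hm]] := enum_unbounded s E.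
have mn : m < n.
 rewrite ltNge; apply/negP; rewrite le_eqVlt => /orP[/eqP h1|h1]; first by move: hn hm; rewrite h1; lra.
 by have := enum_mono E h1; lra.
have [d Ed] : exists d : nat, n = m + d%:Z by exists `|n - m|%N; lia.
rewrite Ed in hn; elim: d hn {Ed mn n} => [|d IH] hn; first by move: hn; rewrite addr0; lra.
have [h1|h1] := ltP s (tau (m + d%:Z)); first exact: IH.
exists (m + d%:Z); apply/eqP; rewrite eq_le h1 /= leNgt; apply/negP => h2.
by apply: (no (m + d%:Z) s) => //; rewrite h2 -addrA; move: hn; rewrite -addn1 PoszD.
Qed.

Lemma enum_first h tau n s : enum h tau -> first_time [set s | cross h (tau n + s)] s <-> s = tau (n + 1) - tau n.
Proof.
move=> [_ ct st no]; split=> [[s0 cs min]|->].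
 have := st n; case: (ltgtP s (tau (n + 1) - tau n)) => // h1 h2.
  by case: (no n (tau n + s)) => //; lra.
 by case: (min (tau (n + 1) - tau n)); [lra|rewrite /= subrKC; exact: ct].
split; [by rewrite subr_gt0|by rewrite /= subrKC; exact: ct|move=> r /andP[r0 r1]; apply: (no n); lra].
Qed.

Lemma enum_uniq h tau tau' : enum h tau -> enum h tau' -> tau = tau'.
Proof.
move=> E E'; apply/funext; have [t0 ct st no] := E; have [t0' ct' st' no'] := E'.
apply: int_pm => [|n]; first by rewrite t0.
split=> En.
 have h1 := enum_first n (tau (n + 1) - tau n) E; have h2 := enum_first n (tau (n + 1) - tau n) E'.
 by have := h2.1; rewrite -En => /(_ (h1.2 erefl)) => /subIr.
apply/eqP; case: (ltgtP (tau n) (tau' n)) => // h1.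
 by case: (no n (tau' n)) => //; rewrite h1 En; exact: st'.
by case: (no' n (tau n)) => //; rewrite h1 -En; exact: st.
Qed.

Lemma enum_shift h tau m : enum h tau -> enum (h * at_ (tau m))%g (fun n => tau (n + m) - tau m).
Proof.
move=> [t0 ct st no]; split=> [|n|n|n s sb]; first by rewrite add0r subrr.
- by apply/cross_at; rewrite subrK; exact: ct.
- by rewrite ltrD2r addrAC; exact: st.
by move=> /cross_at; apply: (no (n + m)); rewrite addrAC in sb; lra.
Qed.

Lemma enum_label h tau n i g (l : label R) : enum h tau -> hit h (tau n) i g ->
 has_labelY Gam AA S T (velocityY Gam h (tau n)) l <-> exists i1 g1, l = Some (i1, g1) /\ hit h (tau (n + 1)) i1 (g * g1)%g.
Proof.
move=> E H; rewrite (labelY_hit _ H); case: l => [[i1 g1]|].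
 split=> [[s /(enum_first n s E) -> hs]|[i2 [g2 [[<- <-] hs]]]]; first by exists i1, g1; rewrite subrKC in hs.
 by exists (tau (n + 1) - tau n); [apply/(enum_first n _ E)|rewrite subrKC].
split=> [[]|[i1 [g1 []]] //]; exists (tau (n + 1) - tau n); exact/(enum_first n _ E).
Qed.

Definition codes h tau (a : int -> label R) : Prop :=
 enum h tau /\ forall n, has_labelY Gam AA S T (velocityY Gam h (tau n)) (a n).

Lemma codes_ex h tau : enum h tau -> exists a, codes h tau a.
Proof.
move=> E; have [_ ct _ _] := E.
have [a Ha] : exists a : int -> label R, forall n, has_labelY Gam AA S T (velocityY Gam h (tau n)) (a n).
 suff: forall n : int, exists l : label R, has_labelY Gam AA S T (velocityY Gam h (tau n)) l by move=> /choice[a Ha]; exists a.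
 move=> n; have [i [g H]] := hit_ex (ct n); have [i1 [g1 H1]] := hit_ex (ct (n + 1)).
 by exists (Some (i1, (g^-1 * g1)%g)); apply/(enum_label _ E H); exists i1, (g^-1 * g1)%g; rewrite mulVKg.
by exists a.
Qed.

Lemma label_uniq h tau n (l l' : label R) : enum h tau -> has_labelY Gam AA S T (velocityY Gam h (tau n)) l ->
 has_labelY Gam AA S T (velocityY Gam h (tau n)) l' -> l = l'.
Proof.
move=> E; have [_ ct _ _] := E; have [i [g H]] := hit_ex (ct n).
move=> /(enum_label _ E H)[i1 [g1 [-> h1]]] /(enum_label _ E H)[i2 [g2 [-> h2]]].
by have [-> /mulgI ->] := hit_uniq h1 h2.
Qed.

Lemma codingE v a : geometric_coding Gam AA S T v setT a <-> exists h tau, v = velocityY Gam h 0 /\ codes h tau a.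
Proof.
split=> [[_ _ [c [tau [Ec t0 mono Et lab]]]]|[h [tau [-> [E lab]]]]].
 have [h _ Eh] : range (velocityY Gam) (val c) by apply/set_mem; exact: (valP c).
 exists h, tau; rewrite -Ec -Eh; split=> //; split; last by move=> n; rewrite Eh; exact: lab.
 have ct n : cross h (tau n).
  by apply/CSY_cross; rewrite Eh; have : [set s | CSY Gam AA (val c s)] (tau n) by rewrite -Et; exists n.
 split=> // [n|n s sb cs]; first by apply: mono => //; lia.
 have [m _ Em] : (tau @` setT) s by rewrite Et /= -Eh; apply/CSY_cross.
 have mn p q : tau p < tau q -> p < q.
  move=> pq; rewrite ltNge; apply/negP; rewrite le_eqVlt => /orP[/eqP e1|e1]; first by move: pq; rewrite e1 ltxx.
  by have := mono q p I I e1; lra.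
 have h1 : n < m by apply: mn; lra.
 have h2 : m < n + 1 by apply: mn; lra.
 lia.
have [t0 ct st no] := E; split=> //.
have cP : velocityY Gam h \in range (velocityY Gam) by apply/mem_set; exists h.
exists (exist _ (velocityY Gam h) cP), tau; split=> //.
- by move=> m n _ _; exact: enum_mono.
 apply/predeqP => s; split=> [[n _ <-]|/CSY_cross cs]; first exact/CSY_cross.
 by have [n <-] := enum_surj E cs; exists n.
by move=> n _; exact: lab.
Qed.

Lemma codes_shift h tau a m : codes h tau a -> codes (h * at_ (tau m))%g (fun n => tau (n + m) - tau m) (fun n => a (n + m)).
Proof.
move=> [E lab]; split; first exact: enum_shift.
by move=> n; rewrite /velocityY velocity_at subrK; exact: lab.
Qed.

Lemma codes_mob c h tau a : Gam c -> codes h tau a -> codes (c * h)%g tau a.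
Proof.
move=> Gc [[t0 ct st no] lab]; split; last first.
 move=> n; rewrite (_ : velocityY Gam (c * h)%g (tau n) = velocityY Gam h (tau n)) //.
 by apply/velocityYE; exists c^-1%g; [exact: GamV|rewrite -mulgA mulKg].
by split=> // [n|n s sb]; rewrite cross_mob //; exact: (no n).
Qed.

(** Both geodesics cross one wall in the same direction, at times [t] and [t']. Nothing more of
    equal labels is used to compare their ends. *)
Definition common h t h' t' : Prop := exists K k,
 [/\ wall K k, line k (gp h t) /\ line k (gp h' t'), 0 < al (k^-1 * h)%g & 0 < al (k^-1 * h')%g].

Lemma hit_common h t h' t' i g : hit h t i g -> hit h' t' i g -> common h t h' t'.
Proof.
move=> H H'; have [A1 [x [B [K [k [D Wk [EB El] kt He]]]]]] := hit_wall H.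
have [A1' [x' [B' [K' [k' [D' _ [EB' El'] kt' [e' e0' He']]]]]]] := hit_wall H'.
have [Ex EBB] : x' = x /\ B' = B.
 by have [-> ->] := (desc_det D D' erefl).1 erefl.
move: EB' El' kt'; rewrite Ex EBB -EB -El => EB' -> kt'.
exists K, k; split=> //; first exact: (hit_al H Wk kt He).
apply: (hit_al H' Wk kt'); exists e' => // s /He'.
by rewrite -!interior_poly EB'.
Qed.

(** After reversing both geodesics the tile on the other side of the wall takes over; backward ends
    are thus reduced to forward ends. *)
Lemma common_Sop h t h' t' : common h t h' t' -> common (h * Sop)%g (- t) (h' * Sop)%g (- t').
Proof.
move=> [K [k [Wk [kt kt'] a a']]]; have [K' [k' [Wk' El Eh]]] := wall_other Wk kt.
have flip q s : line k (gp q s) -> 0 < al (k^-1 * q)%g -> line k' (gp (q * Sop)%g (- s)) /\ 0 < al (k'^-1 * (q * Sop))%g.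
 move=> ks b; have ks' : line k' (gp (q * Sop)%g (- s)) by rewrite gp_Sop opprK El.
 split=> //; suff p : 0 < side_ k' (gp (q * Sop)%g (- s + 1)) by rewrite (al_pos ks' p); lra.
 suff [] : hpl k' (gp (q * Sop)%g (- s + 1)) by [].
 rewrite Eh gp_Sop; split; first exact: gp_uhp.
 rewrite side_Sop ?oppr_gt0; last exact: gp_uhp.
 rewrite ltNge side_gp_ge0 -ltNge; have := line_zero ks.
 have : expR (- (- s + 1)) ^+ 2 < expR s ^+ 2 :> R by rewrite expR2_lt; lra.
 nra.
by have [p1 p2] := flip _ _ kt a; have [p3 p4] := flip _ _ kt' a'; exists K', k'.
Qed.

Lemma alE k h : al (k * h)%g = (ea k * ea h + eb k * ec h) * (ec k * ea h + ed k * ec h).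
Proof.
by have [s [s2 Ea _ Ec _]] := mul_entries k h; rewrite /al Ea Ec mulrACA s2 mul1r.
Qed.

Lemma beE k h : be (k * h)%g = (ea k * eb h + eb k * ed h) * (ec k * eb h + ed k * ed h).
Proof.
by have [s [s2 _ Eb _ Ed]] := mul_entries k h; rewrite /be Eb Ed mulrACA s2 mul1r.
Qed.

(** [D] vanishes exactly when the forward ends agree. Otherwise [l] joins the forward end of [h] to
    that of [h']; a common wall has both of them on its positive side, hence all of [l], and
    [crossed_far] for [gp l 0] allows only finitely many such walls. *)
Lemma ends_eq h h' : (forall M, exists t t', M < t /\ common h t h' t') -> ea h' * ec h = ea h * ec h'.
Proof.
move=> Hc; apply/eqP; rewrite -subr_eq0; set D := _ - _; apply/negP => /negP D0.
pose l := mk4 (ea h' / D) (ea h) (ec h' / D) (ec h).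
have [s [s2 Ea Eb Ec Ed]] : eqs (ea l) (eb l) (ec l) (ed l) (ea h' / D) (ea h) (ec h' / D) (ec h).
 by apply: mk4E; rewrite mulrAC [ea h * _]mulrA -mulrBl divff.
have [M HM] := finite_ubound (crossed_far h (gp_uhp l 0)).
have [t [t' [Mt [K [k [Wk [kt kt'] a a']]]]]] := Hc (Num.max M 0).
move: Mt; rewrite gt_max => /andP[Mt t0].
suff : t <= M by lra.
apply: HM; split=> //; exists K, k; split=> //.
rewrite side_gp_ge0 expR0 expr1n mulr1 alE beE Ea Eb Ec Ed.
move: a a'; rewrite !alE; set p := ea k^-1%g; set q := eb k^-1%g; set r := ec k^-1%g; set u := ed k^-1%g => a a'.
have -> : (p * (s * (ea h' / D)) + q * (s * (ec h' / D))) * (r * (s * (ea h' / D)) + u * (s * (ec h' / D))) =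
 s * s * ((p * ea h' + q * ec h') * (r * ea h' + u * ec h')) / D ^+ 2 by field.
have -> : (p * (s * ea h) + q * (s * ec h)) * (r * (s * ea h) + u * (s * ec h)) =
 s * s * ((p * ea h + q * ec h) * (r * ea h + u * ec h)) by ring.
by rewrite s2 !mul1r addr_ge0 ?(ltW a) // divr_ge0 ?(ltW a') ?sqr_ge0.
Qed.

(** With both ends equal, the geodesics differ by the flow. A common wall, which is crossed only
    once, fixes the time shift. *)
Lemma same_ends h h' t t' : (forall M, exists s s', M < s /\ common h s h' s') ->
 (forall M, exists s s', s < M /\ common h s h' s') -> common h t h' t' -> (h * at_ t = h' * at_ t')%g.
Proof.
move=> /ends_eq E1 Hn Ht.
have E2 : eb h' * ed h = eb h * ed h'.
 have := @ends_eq (h * Sop)%g (h' * Sop)%g.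
 have [s [s2 Ea _ Ec _]] := mul_entries h Sop; have [s' [s2' Ea' _ Ec' _]] := mul_entries h' Sop.
 have [r [r2 Fa _ Fc _]] := Sop_entries R.
 rewrite Ea Ec Ea' Ec' Fa Fc !mulr0 !add0r !mulr1 => H.
 have N x : x * x = 1 -> x != 0 by nra; apply: contra_eq_neq Ex => ->; rewrite mulr0 eq_sym oner_neq0.
 apply: (mulRI (mulf_neq0 (mulf_neq0 (N _ s2) (N _ s2')) (mulf_neq0 (N _ r2) (N _ r2)))).
 apply: etrans (etrans (H _) _); [ring| |ring] => M.
 by have [x [x' [xM cx]]] := Hn (- M); exists (- x), (- x'); split; [lra|exact: common_Sop].
pose m := (h^-1 * h')%g.
have [s [s2 Ea Eb Ec Ed]] := mul_entries h^-1%g h'; have [r [r2 Fa Fb Fc Fd]] := inv_entries h.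
have c0 : ec m = 0.
 rewrite Ec Fc Fd; transitivity (s * r * (ea h * ec h' - ea h' * ec h)); first ring.
 by rewrite E1 subrr mulr0.
have b0 : eb m = 0.
 rewrite Eb Fa Fb; transitivity (s * r * (eb h' * ed h - eb h * ed h')); first ring.
 by rewrite E2 subrr mulr0.
have [x Em] : exists x, m = at_ x.
 have a00 : al m = 0 by rewrite /al c0 mulr0.
 have b00 : be m = 0 by rewrite /be b0 mul0r.
 case: (diag_or_anti a00 b00) => // -[x Em].
 have [y [y2 _ _ Gc _]] := mul_entries Sop (at_ x); have [z [z2 _ _ Sc Sd]] := Sop_entries R.
 have [u [u2 Aa _ Ac _]] := at_entries x.
 have e0 := expR_gt0 (x / 2); move: c0; rewrite Em Gc Sc Sd Aa Ac => F.
 have F' : (y * z * u) * expR (x / 2) = 0 by rewrite -F; ring.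
 exfalso; have : (y * z * u) * (y * z * u) = 1 by transitivity (y * y * (z * z) * (u * u)); [ring|rewrite y2 z2 u2 !mulr1].
 move/eqP: F'; rewrite mulf_eq0 (gt_eqF e0) orbF => /eqP ->; rewrite mulr0 => /esym/eqP; rewrite oner_eq0 //.
have Eh : h' = (h * at_ x)%g by rewrite -Em mulVKg.
have [K [k [Wk [kt kt'] a a']]] := Ht.
move: kt'; rewrite Eh gp_at => kx.
have -> : t = t' + x.
 apply: (line_once kx kt) => /(al0_line kt) z; by move: a; rewrite z ltxx.
by apply: velocity_inj; rewrite (velocity_at0 h (t' + x)) (velocity_at0 (h * at_ x)%g t') velocity_at.
Qed.

(** Labels determine the indices and the quotients of consecutive group elements, so the two
    sequences of hits differ by one left factor [c], propagated in both directions. *)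
Lemma codes_common h tau h' tau' a : codes h tau a -> codes h' tau' a ->
 exists2 c, Gam c & forall n, common h (tau n) (c * h')%g (tau' n).
Proof.
move=> [E lab] [E' lab']; have [_ ct _ _] := E; have [_ ct' _ _] := E'.
have ex n : exists p : CS_index R * G, hit h (tau n) p.1 p.2.
 by have [i [g H]] := hit_ex (ct n); exists (i, g).
have ex' n : exists p : CS_index R * G, hit h' (tau' n) p.1 p.2.
 by have [i [g H]] := hit_ex (ct' n); exists (i, g).
have [f Hf] := choice ex; have [f' Hf'] := choice ex'.
have st n : (f (n + 1)).1 = (f' (n + 1)).1 /\ ((f n).2^-1 * (f (n + 1)).2 = (f' n).2^-1 * (f' (n + 1)).2)%g.
 have [i [g [Ea H]]] := (enum_label _ E (Hf n)).1 (lab n).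
 have [i' [g' [Ea' H']]] := (enum_label _ E' (Hf' n)).1 (lab' n).
 have [<- Eg] := hit_uniq H (Hf (n + 1)); have [<- Eg'] := hit_uniq H' (Hf' (n + 1)).
 by rewrite -Eg -Eg' !mulKg; move: Ea; rewrite Ea' => -[-> ->].
pose c := ((f 0).2 * (f' 0).2^-1)%g.
have Ec n : (f n).2 = (c * (f' n).2)%g.
 move: n; apply: int_pm => [|n]; first by rewrite /c mulgVK.
 have [_ Es] := st n; split=> En.
  by rewrite -[LHS](mulVKg (f n).2) Es En -!mulgA mulVKg.
 have : ((f n).2^-1 * (c * (f' (n + 1)).2) = (f' n).2^-1 * (f' (n + 1)).2)%g by rewrite -En.
 by rewrite mulgA => /mulIg Eq; apply: (mulgI (f n).2^-1%g); rewrite mulVg mulgA Eq mulVg.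
have Gc : Gam c by apply: GamM; [case: (Hf 0)|apply: GamV; case: (Hf' 0)].
exists c => // n; apply: (hit_common (Hf n)); rewrite Ec.
have -> : (f n).1 = (f' n).1 by have [] := st (n - 1); rewrite subrK.
exact: hit_mob.
Qed.

Lemma codes_inj h tau h' tau' a : codes h tau a -> codes h' tau' a -> velocityY Gam h 0 = velocityY Gam h' 0.
Proof.
move=> H H'; have [c Gc Hc] := codes_common H H'; have [E _] := H; have [t0 _ _ _] := E.
have [[t0' _ _ _] _] := H'.
have := Hc 0; rewrite t0 t0' => H0.
have Eh : (h * at_ 0 = c * h' * at_ 0)%g.
 apply: same_ends H0 => M; have [[n hn] [m hm]] := enum_unbounded M E.
  by exists (tau n), (tau' n).
 by exists (tau m), (tau' m).
by apply/velocityYE; exists c^-1%g; [exact: GamV|rewrite Eh -!mulgA mulKg].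
Qed.

Lemma geod_ex (p : sphere R) : bdry_pt p -> exists l (r : \bar R), p = geod l r.
Proof.
case=> [->|[x ->]]; first by exists (vert 0), +oo%E; rewrite geod_vert.
by exists (vert x), -oo%E; rewrite geod_vert.
Qed.

Local Notation iend p := ((piS Gam @` ideal_cells Gam AA) (piS Gam p)).

Lemma end_nic g : iend (geod g +oo) -> exists2 d, Gam d & nic (d * g)%g.
Proof.
case=> q [g1 [A [B [G1 AAA cB [q0 q0B Eq]]]]] Es.
have : piS Gam (geod g +oo) (geod g +oo) by exists 1%g; [exact: Gam1|case: (geod_ex (bdry_geod g)) => l [r ->]; rewrite mob_geod mul1g].
rewrite -Es -Eq => -[g2 G2]; have [l [r E0]] := geod_ex (proj2 q0B).
rewrite E0 !mob_geod => E1; exists (g2 * g1)^-1%g; first by apply: GamV; apply: GamM.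
exists B; last by rewrite -mob_geod -E1 mob_geod [(g2 * (g1 * l))%g]mulgA mulKg -E0.
by exists 1%g, A, B; rewrite img1; split=> //; exact: Gam1.
Qed.

Lemma ray_end h X x : tile X -> (forall t, x < t -> X (gp h t)) -> iend (geod h +oo).
Proof.
move=> [g [A [B [Gg AAA cB ->]]]] HX; exists (geod h +oo) => //.
have Bu := cell_uhp AAA cB.
exists g, A, B; split=> //; exists (geod (g^-1 * h)%g +oo); last by rewrite mob_geod mulVKg.
apply: (ray_ideal (t0 := x)) => t /HX[z Bz Ez].
by rewrite -mobC_gp -Ez mobCK //; exact: Bu.
Qed.

(** [NIC] asks for some lift. Lifts with the same velocity curve differ by an element of [Gam],
    under which the condition on the ends is invariant, so any lift may be used. *)
Lemma NIC_ends (c : geodY Gam) h : val c = velocityY Gam h ->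
 NIC Gam AA c <-> iend (geod h +oo) \/ iend (geod (h * Sop)%g +oo).
Proof.
move=> Ec; rewrite [geod (h * _)%g _]geod_Sop /=; split=> [[g [Eg H]]|H]; last by exists h.
have : velocityY Gam h 0 = velocityY Gam g 0 by rewrite -Ec Eg.
move=> /velocityYE[d Gd E].
have -> : h = (d^-1 * g)%g.
 by apply: (mulIg (at_ 0)); rewrite -mulgA E mulKg.
have V r : iend (geod g r) -> iend (geod (d^-1 * g)%g r).
 case=> q iq Eq; exists q => //; rewrite Eq -mob_geod; apply/predeqP => p; split=> -[k Gk <-].
  exists (k * d)%g; first exact: GamM.
  by rewrite !mob_geod mulgA mulgK.
 exists (k * d^-1)%g; first by apply: GamM => //; exact: GamV.
 by rewrite !mob_geod mulgA.
by case: H => /V H; [left|right].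
Qed.

Lemma end_bounded h : iend (geod h +oo) -> exists x, forall t, x < t -> ~ cross h t.
Proof.
move=> /end_nic[d Gd /nic_bounded[x Hx]].
by exists x => t /Hx H ct; apply: H; apply/cross_mob.
Qed.

(** A ray with a last crossing stays in one tile and ends in its ideal boundary; conversely
    [nic_bounded] forbids unbounded crossing times. Backward ends are treated by reversal. *)
Lemma NIC_endless (c : geodY Gam) h : val c = velocityY Gam h -> (exists t, cross h t) ->
 ~ NIC Gam AA c <-> endless h.
Proof.
move=> Ec [t0 ct0]; rewrite (NIC_ends Ec); split=> [N|en].
 have cs t : cross (h * Sop)%g t <-> cross h (- t) by apply: cross_Sop.
 move=> x; split; apply: contrapT => H; apply: N; [left|right].
  have [|X [t2 [tX HX]]] := bounded_ray (t1 := x) ct0; last exact: ray_end tX HX.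
  by move=> t xt ct; apply: H; exists t.
 have ct0' : cross (h * Sop)%g (- t0) by apply/cs; rewrite opprK.
 have [|X [t2 [tX HX]]] := bounded_ray (t1 := - x) ct0'; last exact: ray_end tX HX.
 by move=> t xt /cs ct; apply: H; exists (- t) => //; lra.
case=> /end_bounded[x Hx]; first by have [[t xt ct] _] := en x; apply: (Hx t).
have [_ [t xt ct]] := en (- x); apply: (Hx (- t)); first lra.
by apply/cross_Sop; rewrite opprK.
Qed.

(** Such a geodesic runs inside a wall or stays in one open tile. It belongs to [NIC], as the almost
    everywhere statement requires. *)
Lemma no_cross_end h : (forall t, ~ cross h t) -> iend (geod h +oo).
Proof.
move=> N; have [/base_wall[K [k [Wk k0]]]|nB] := pselect (base_set Gam AA (gp h 0)).
 have all : forall s, line k (gp h s).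
  by apply: contrapT => H; apply: (N 0); apply/crossP; exists K, k.
 have [tX [_ gK] kK] := Wk.
 by apply: (ray_end (x := 0) tX) => t _; apply: (gK k kK); exact: all.
have [X tX X0] : exists2 X, tile X & X^° (gp h 0).
 apply: contrapT => H; apply: nB; apply/base_setE; split; first exact: gp_uhp.
 by move=> X tX iX; apply: H; exists X.
have [K EK gK] := tile_good tX; rewrite EK interior_poly in X0.
have /cts_gp /nbhs_ballP[e /= e0 He] : nbhs (gp h 0) (ipoly K).
 by apply: open_nbhs_nbhs; split; [exact: open_ipoly|].
rewrite EK in tX.
apply: (ray_end (x := 0) tX) => t t0; apply: ipoly_sub.
apply: (stay (t0 := 0) (t1 := t + 1) tX gK) => //; last by lra.
by exists e => // s sb; apply: He; rewrite /ball /= sub0r normrN gtr0_norm; lra.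
Qed.

Lemma endless_at h s : endless h -> endless (h * at_ s)%g.
Proof.
move=> en x; have [[t h1 c1] [t' h2 c2]] := en (x + s).
by split; [exists (t - s)|exists (t' - s)]; rewrite ?(cross_at, subrK) //; try lra; apply/cross_at; rewrite subrK.
Qed.

Lemma endless_mob c h : Gam c -> endless h -> endless (c * h)%g.
Proof.
by move=> Gc en x; have [[t h1 c1] [t' h2 c2]] := en x; split; [exists t|exists t'] => //; apply/cross_mob.
Qed.

Lemma geodY_ex h : exists c : geodY Gam, val c = velocityY Gam h.
Proof.
have cP : velocityY Gam h \in range (velocityY Gam) by apply/mem_set; exists h.
by exists (exist (fun x : R -> set (C * C) => x \in range (velocityY Gam)) _ cP).
Qed.

Lemma CSst_velocity h t : CSst Gam AA (velocityY Gam h t) <-> cross h t /\ endless h.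
Proof.
split=> [[/CSY_cross ct N]|[ct en]].
 have [c Ec] := geodY_ex h; split=> //; apply/(NIC_endless Ec); first by exists t.
 by move=> Nc; apply: N; exists c => //; exists t; rewrite Ec.
split; first exact/CSY_cross.
move=> [c Nc [s Es]]; have [h' _ Eh'] : range (velocityY Gam) (val c) by apply/set_mem; exact: (valP c).
have ct' : cross h' s by apply/CSY_cross; rewrite Eh' Es; apply/CSY_cross.
move: Nc; apply/(NIC_endless (esym Eh')); first by exists s.
have /velocityYE[d Gd E] : velocityY Gam h t = velocityY Gam h' s by rewrite Eh'.
have -> : h' = ((d * (h * at_ t)) * at_ (- s))%g.
 by apply: velocity_inj; rewrite -E velocity_at0 velocity_at addNr.
by apply: endless_at; apply: endless_mob => //; exact: endless_at.
Qed.

Lemma CSstP v : CSst Gam AA v <-> exists h tau, v = velocityY Gam h 0 /\ enum h tau.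
Proof.
split=> [Cv|[h [tau [-> E]]]].
 have [[u cu Eu] _] := Cv; have [h Eh] := SH_exists (let: And3 a _ _ := cu in a).
 have Ev : v = velocityY Gam h 0 by rewrite -Eu -Eh.
 move: Cv; rewrite Ev => /CSst_velocity[c0 en]; have [tau E] := enum_ex c0 en.
 by exists h, tau.
apply/CSst_velocity; split; last exact: enum_endless E.
by case: E => <- ct _ _; exact: ct.
Qed.

Lemma enum_CSst h tau s : enum h tau -> CSst Gam AA (velocityY Gam h s) <-> cross h s.
Proof. by move=> E; rewrite CSst_velocity; split=> [[]|] //; split=> //; exact: enum_endless E. Qed.

(** Uniqueness of the value has to be shown too, as the return map is defined by [xget]: every
    geodesic of the quotient through the vector has the same lift up to [Gam]. *)
Lemma return_enum h tau n : enum h tau ->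
 first_return_map Gam (CSst Gam AA) (velocityY Gam h (tau n)) = velocityY Gam h (tau (n + 1)).
Proof.
move=> E; have [c0 Ec0] := geodY_ex (h * at_ (tau n))%g.
have vE s : velocityY Gam (h * at_ (tau n))%g s = velocityY Gam h (tau n + s).
 by rewrite /velocityY velocity_at addrC.
have fE s : first_time [set s | CSst Gam AA (velocityY Gam h (tau n + s))] s <-> s = tau (n + 1) - tau n.
 rewrite -(enum_first n s E); split=> -[s0 cs no]; split=> //; try exact/(enum_CSst _ E); move=> r rb /(enum_CSst _ E); exact: no.
apply: xget_unique.
 exists c0, (tau (n + 1) - tau n); split; rewrite ?Ec0 ?vE ?addr0 ?subrKC //.
 have [s0 cs no] := (fE _).2 erefl; split=> //=; first by rewrite vE.
 by move=> r rb; rewrite vE; exact: no.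
move=> w [c [t [Ev ft <-]]].
have [h' _ Eh'] : range (velocityY Gam) (val c) by apply/set_mem; exact: (valP c).
have /velocityYE[d Gd Ed] : velocityY Gam (h * at_ (tau n))%g 0 = velocityY Gam h' 0 by rewrite Eh' Ev vE addr0.
have Ec s : val c s = velocityY Gam h (tau n + s).
 rewrite -Eh' -vE; apply/esym/velocityYE; exists d => //; apply: velocity_inj.
 have E1 (q : G) : (q * at_ 0)%g = q by apply: velocity_inj; rewrite velocity_at0.
 by rewrite !E1 in Ed; rewrite Ed -mulgA.
have -> : t = tau (n + 1) - tau n.
 apply/fE; case: ft => s0 cs no; split=> //=; first by rewrite -Ec.
 by move=> r rb; rewrite -Ec; exact: no.
by rewrite Ec subrKC.
Qed.

Lemma codes_uniq h tau a h' tau' a' : codes h tau a -> codes h' tau' a' ->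
 velocityY Gam h 0 = velocityY Gam h' 0 -> a = a' /\ forall n, velocityY Gam h (tau n) = velocityY Gam h' (tau' n).
Proof.
move=> H [E' lab'] /velocityYE[d Gd Ed].
have Eh : h' = (d * h)%g by apply: (mulIg (at_ 0)); rewrite Ed mulgA.
have vE n : velocityY Gam h (tau n) = velocityY Gam (d * h)%g (tau n) by apply/velocityYE; exists d; rewrite // mulgA.
have [E lab] := codes_mob Gd H; move: E' lab'; rewrite Eh => E' lab'.
have Et := enum_uniq E E'; subst tau'; split=> //; apply/funext => n.
exact: (label_uniq E (lab n) (lab' n)).
Qed.

Lemma LstP a : Lst Gam AA S T a <-> exists h tau, codes h tau a.
Proof.
split=> [[v _ /codingE[h [tau [_ H]]]]|[h [tau H]]]; first by exists h, tau.
exists (velocityY Gam h 0); last by apply/codingE; exists h, tau.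
by apply/CSY_cross; case: H => -[<- ct _ _] _; exact: ct.
Qed.

Lemma coding_mapE h tau a : codes h tau a -> coding_map Gam AA S T (velocityY Gam h 0) = a.
Proof.
move=> H; apply: xget_unique; first by apply/codingE; exists h, tau.
by move=> a' /codingE[h' [tau' [Ev H']]]; have [-> _] := codes_uniq H H' Ev.
Qed.

Lemma coding_inj : {in CSst Gam AA &, injective (coding_map Gam AA S T)}.
Proof.
move=> v w /set_mem/CSstP[h [tau [-> E]]] /set_mem/CSstP[h' [tau' [-> E']]].
have [a H] := codes_ex E; have [a' H'] := codes_ex E'.
rewrite (coding_mapE H) (coding_mapE H') => Ea; subst a'; exact: codes_inj H H'.
Qed.

Lemma codes_CSst h tau a : codes h tau a -> CSst Gam AA (velocityY Gam h 0).
Proof. by move=> [E _]; apply/CSstP; exists h, tau. Qed.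

Lemma CodE h tau a : codes h tau a -> Cod Gam AA S T a = velocityY Gam h 0.
Proof.
move=> H; rewrite -{1}(coding_mapE H) /Cod pinvKV //; first exact: coding_inj.
by apply/mem_set; exact: codes_CSst H.
Qed.

Lemma coding_bij : set_bij (CSst Gam AA) (Lst Gam AA S T) (coding_map Gam AA S T).
Proof.
split=> [v /CSstP[h [tau [-> E]]]| |a /LstP[h [tau H]]]; last 2 first.
- exact: coding_inj.
- by exists (velocityY Gam h 0); [exact: codes_CSst H|exact: coding_mapE H].
by have [a H] := codes_ex E; rewrite (coding_mapE H); apply/LstP; exists h, tau.
Qed.

Lemma codes_left_shift h tau a : codes h tau a ->
 codes (h * at_ (tau 1)%R)%g (fun n => tau (n + 1) - tau 1) (left_shift a).
Proof. by move=> H; exact: (codes_shift 1 H). Qed.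

Lemma return_Cod a : Lst Gam AA S T a ->
 first_return_map Gam (CSst Gam AA) (Cod Gam AA S T a) = Cod Gam AA S T (left_shift a).
Proof.
move=> /LstP[h [tau H]]; have [E _] := H; have [t0 _ _ _] := E.
rewrite (CodE H) (CodE (codes_left_shift H)) -{1}t0 (return_enum _ E) add0r.
by rewrite /velocityY velocity_at add0r.
Qed.

Lemma left_shift_Lst : (@left_shift _) @` Lst Gam AA S T = Lst Gam AA S T.
Proof.
apply/predeqP => a; split=> [[b /LstP[h [tau H]] <-]|/LstP[h [tau H]]].
 by apply/LstP; do 2 eexists; exact: codes_left_shift H.
exists (fun n => a (n - 1)); last by apply/funext => n; rewrite /left_shift addrK.
by apply/LstP; do 2 eexists; exact: (codes_shift (-1) H).
Qed.

(** A countable union of the finite sets of elements with bounded entries. *)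
Lemma countable_Gam : countable Gam.
Proof.
pose F (n : nat) := [set g | [/\ Gam g, `|ea g| <= n%:R, `|eb g| <= n%:R, `|ec g| <= n%:R & `|ed g| <= n%:R]].
apply: (@sub_countable _ _ _ (\bigcup_n F n)); last first.
 by apply: bigcup_countable => // n _; apply: finite_set_countable; exact: finite_bounded.
apply: subset_card_le => g Gg; pose M := `|ea g| + `|eb g| + `|ec g| + `|ed g|.
exists (Num.bound M) => //; have := archi_boundP (_ : 0 <= M); rewrite /M => H.
have h0 : 0 <= `|ea g| + `|eb g| + `|ec g| + `|ed g| by rewrite !addr_ge0.
have := H h0; have := normr_ge0 (ea g); have := normr_ge0 (eb g); have := normr_ge0 (ec g); have := normr_ge0 (ed g).
by move=> *; split=> //; lra.
Qed.

Lemma cycle_AA A h (c : seq (set C * G)) : cycle_of Gam AA A h c -> AA A /\ Gam h.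
Proof.
case=> [[x [y [AAA _ -> _]]]|[v [A' [AAA [s _ [[Gh _] _ _ _]] _]]]|[[AAA [b [A' [_ [[Gh _] _ _ _]]]]] _ _ _ _]] //.
by split=> //; exact: Gam1.
Qed.

Lemma countable_alphabet : countable (alphabet Gam AA S T).
Proof.
pose X := (((AA `*` Gam) `*` [set: nat]) `*` Gam) : set (CS_index R * G).
have cX : countable X.
 apply: countableX; last exact: countable_Gam.
 apply: countableX => //; apply: countableX; last exact: countable_Gam.
 exact/finite_set_countable/finite_AA.
apply: (@sub_countable _ _ _ ([set None] `|` Some @` X)).
 apply: subset_card_le => -[[i g]|] [v _ [h _ H]]; last by left.
 case: H => -[Si _] Gg _; right; exists (i, g) => //; split=> //; split=> //.
 have [HS1 _] := HS; have [c cy] := HS1 _ Si; exact: cycle_AA cy.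
rewrite -bigcup2E; apply: bigcup_countable => // -[|[|n]] _ /=; first exact: countable1.
 exact: sub_countable (card_image_le _ _) cX.
exact: countable0.
Qed.

Lemma piece_uniq v (l l' : label R) : CSst_piece Gam AA S T l v -> CSst_piece Gam AA S T l' v -> l = l'.
Proof.
move=> [/CSstP[h [tau [-> E]]] H] [_ H']; have [t0 _ _ _] := E.
by apply: (label_uniq (n := 0) E); rewrite t0.
Qed.

Lemma piece_alphabet v (l : label R) : CSst_piece Gam AA S T l v -> alphabet Gam AA S T l.
Proof. by move=> [_ [u [su _ hu]]]; exists u. Qed.

Lemma piece_cover : trivIset (alphabet Gam AA S T) (CSst_piece Gam AA S T) /\
 \bigcup_(l in alphabet Gam AA S T) CSst_piece Gam AA S T l = CSst Gam AA.
Proof.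
split=> [l l' _ _ [v [p p']]|]; first exact: piece_uniq p p'.
apply/predeqP => v; split=> [[l _ []] //|Cv].
have [h [tau [Ev E]]] := (CSstP v).1 Cv; have [a [_ lab]] := codes_ex E; have [t0 _ _ _] := E.
have p : CSst_piece Gam AA S T (a 0) v by split=> //; rewrite Ev -[X in velocityY Gam h X]t0.
by exists (a 0) => //; exact: piece_alphabet p.
Qed.

(** The return map prescribes [w] forward only; the values at negative indices have to be recovered
    from their being in the cross section. *)
Lemma return_codingE h tau a : enum h tau ->
 return_coding Gam (CSst Gam AA) (alphabet Gam AA S T) (CSst_piece Gam AA S T) (velocityY Gam h 0) a <->
 codes h tau a.
Proof.
move=> E; have [t0 ct _ _] := E.
have Cn n : CSst Gam AA (velocityY Gam h (tau n)) by apply/(enum_CSst _ E).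
split=> [[w [w0 Dw Rw lab]]|[_ lab]]; last first.
 exists (fun n => velocityY Gam h (tau n)); split=> // [|n|n]; first by rewrite t0.
  by rewrite (return_enum _ E).
 have p : CSst_piece Gam AA S T (a n) (velocityY Gam h (tau n)) by split.
 split=> [|l _]; first exact: piece_alphabet p.
 by split=> [<- //|p']; exact: piece_uniq p p'.
split=> // n; have [Sn /(_ _ Sn)[/(_ erefl) [_ p] _]] := lab n; move: p.
suff -> : w n = velocityY Gam h (tau n) by [].
move: n {Sn}; apply: int_pm => [|n]; first by rewrite w0 t0.
split=> En; first by rewrite Rw En (return_enum _ E).
(* [w n] has its own enumeration of crossings, which after one step agrees with that of [h] up to
   [Gam]. Uniqueness of enumerations then identifies the preceding crossing. *)
have [h1 [tau1 [E1 F]]] := (CSstP _).1 (Dw n); have [s0 _ _ _] := F.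
have : velocityY Gam h1 (tau1 1) = velocityY Gam h (tau (n + 1)).
 by rewrite -En Rw E1; have := return_enum 0 F; rewrite s0 add0r => ->.
move=> /velocityYE[d Gd Ed].
have [a1 H1] := codes_ex F; have [a2 H2] := codes_ex E.
have [F1 _] := codes_mob Gd (codes_shift 1 H1); have [F2 _] := codes_shift (n + 1) H2.
rewrite -Ed in F1; have /(congr1 (fun f => f (-1))) := enum_uniq F1 F2.
rewrite (_ : -1 + (n + 1) = n) ?addNr ?s0 ?sub0r => [Et|]; last by lia.
have -> : tau n = tau (n + 1) - tau1 1 by rewrite Et subrKC.
rewrite E1; apply/velocityYE; exists d => //; apply: velocity_inj.
set y := tau1 1; have -> : (h1 * at_ 0)%g = (h1 * at_ y * at_ (- y))%g.
 by apply: velocity_inj; rewrite !velocity_at0 velocity_at addNr.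
by rewrite mulgA -Ed !velocity_at0 velocity_at addrC.
Qed.

(** A geodesic outside [NIC] crosses [BS] by [no_cross_end], and then infinitely often in both
    directions by [NIC_endless]; so the exceptional set is negligible. *)
Lemma strong_section (X : set (set (geodY Gam))) (mu : {measure set (g_sigma_algebraType X) -> \bar R}) :
 mu.-negligible (NIC Gam AA) -> strong_cross_section mu (CSst Gam AA).
Proof.
move=> HN.
have rep (c : geodY Gam) : exists h, val c = velocityY Gam h.
 by have [h _ <-] : range (velocityY Gam) (val c) by [apply/set_mem; exact: (valP c)]; exists h.
have inf (c : geodY Gam) h : val c = velocityY Gam h -> endless h -> infinitely_often (CSst Gam AA) c.
 move=> Ec en x; have [[t xt ct] [t' xt' ct']] := en x.
 by split; [exists t|exists t'] => //; rewrite Ec; apply/CSst_velocity.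
split.
- by move=> v /CSstP[h [tau [-> _]]]; exists (velocity h 0) => //; exact: SH_velocity.
- apply: negligibleS HN => c /= H; have [h Eh] := rep c; apply: contrapT => N; apply: H.
 apply: (inf _ _ Eh); have [ex|nex] := pselect (exists t, cross h t); first exact/(NIC_endless Eh ex).
 exfalso; apply: N; apply/(NIC_ends Eh); left; apply: no_cross_end => t ct; apply: nex; by exists t.
- move=> c t; have [h Eh] := rep c; rewrite Eh => /CSst_velocity[ct _].
 have [e e0 He] := cross_isolated ct; exists e => // s se st /CSst_velocity[[_ bs _] _].
 exact: (He s).
move=> c [t]; have [h Eh] := rep c; rewrite Eh => /CSst_velocity[_ en]; exact: inf Eh en.
Qed.

Lemma symbolic (X : set (set (geodY Gam))) (mu : {measure set (g_sigma_algebraType X) -> \bar R}) :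
 mu.-negligible (NIC Gam AA) ->
 symbolic_dynamics mu (CSst Gam AA) (alphabet Gam AA S T) (CSst_piece Gam AA S T) (Lst Gam AA S T).
Proof.
move=> HN; split; [exact: strong_section|exact: countable_alphabet|exact: piece_cover| |split; last exact: left_shift_Lst].
 move=> v w a /CSstP[h [tau [-> E]]] /CSstP[h' [tau' [-> E']]].
 by move=> /(return_codingE _ E) H /(return_codingE _ E') H'; exact: codes_inj H H'.
apply/predeqP => a; split=> [/LstP[h [tau H]]|[v /CSstP[h [tau [-> E]]] /(return_codingE _ E) H]].
 by exists (velocityY Gam h 0); [exact: codes_CSst H|apply/(return_codingE (tau := tau)) => //; case: H].
by apply/LstP; exists h, tau.
Qed.

End Coding.

End Fuchsian.

Theorem corollary8p31 (R : realType) (Gam : set (PSL2 R))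
    (AA : set (set (Cplx R))) (S : set (set (Cplx R) * PSL2 R))
    (T : CS_index R -> PSL2 R) :
  fuchsian Gam -> geometrically_finite Gam -> cuspidal_at_infinity Gam ->
  Gam <> stab_inf Gam -> condition_A Gam ->
  basal_family Gam AA -> set_of_choices Gam AA S -> shift_map Gam AA S T ->
  [/\ set_bij (CSst Gam AA) (Lst Gam AA S T) (coding_map Gam AA S T),
      forall a, Lst Gam AA S T a ->
        first_return_map Gam (CSst Gam AA) (Cod Gam AA S T a) =
        Cod Gam AA S T (left_shift a) &
      forall (G : set (set (geodY Gam)))
        (mu : {measure set (g_sigma_algebraType G) -> \bar R}),
        mu.-negligible (NIC Gam AA) ->
        symbolic_dynamics mu (CSst Gam AA) (alphabet Gam AA S T)
          (CSst_piece Gam AA S T) (Lst Gam AA S T)].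
Proof.
move=> HF HG HC _ HA HB HS HT; split.
- exact: coding_bij.
- by move=> a; exact: return_Cod.
by move=> G mu; exact: symbolic.
Qed.
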